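(* Let $L>0$, $m\in\mathbb N$, and let $f:\mathbb R^m\to\mathbb R^{m\times m}$ and $g:\mathbb R^m\to\mathbb R^m$ be of class $C_0^\infty$. Let $S(t)$ be the solution semigroup in $\Phi=[H^1(0,L)]^m$ of the problem $$\partial_tu+f(u)\partial_xu+g(u)=\partial_x^2u-u,\quad x\in(0,L),\qquad \partial_xu|_{x=0}=\partial_xu|_{x=L}=0,$$ for $u=(u_1,\dots,u_m)$. Then this problem (i.e. $S(t)$) possesses a (generalized) inertial manifold, and this manifold is $C^{1+\varepsilon}$-smooth for some $\varepsilon>0$.
   Context: A semigroup on a Banach space is dissipative if it has a bounded absorbing set, i.e. a bounded set $\mathcal B$ such that for every bounded set $B$ there is $T$ with the image of $B$ at time $t$ contained in $\mathcal B$ for all $t\ge T$. Inertial manifold of a semigroup $\bar S(t)$ on $\Psi$: here $\Psi$ is a Banach space of vector-valued functions on $(0,L)$ (continuously embedded in $[L^2(0,L)]^N$), each component being associated with either Dirichlet or Neumann boundary conditions; $P_n$ denotes the $L^2$-orthoprojector onto the span of all eigenvectors corresponding to the first $n$ (distinct) eigenvalues of the vector Laplacian $-\partial_x^2$ with these boundary conditions (this span being contained in $\Psi$), and $Q_n=\mathrm{Id}-P_n$. A finite-dimensional submanifold $\mathcal M\subset\Psi$ is an inertial manifold if (1) $\bar S(t)\mathcal M=\mathcal M$ for all $t\ge0$; (2) $\mathcal M$ is the graph of a Lipschitz continuous function $M:P_n\Psi\to Q_n\Psi$ for some $n\in\mathbb N$; (3) (exponential tracking) there are positive $C,\theta$ such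 that for every trajectory $v(t)=\bar S(t)v(0)$, $t\ge0$, there is a trajectory $\tilde v(t)$ lying in $\mathcal M$ with $\|v(t)-\tilde v(t)\|_\Psi\le C\|v(0)-\tilde v(0)\|_\Psi e^{-\theta t}$ for all $t\ge0$. (Generalized) inertial manifold for a semigroup $S(t):\Phi\to\Phi$ possessing a bounded absorbing set $\mathcal B\subset\Phi$ with $S(t)\mathcal B\subset\mathcal B$ for all $t\ge0$: assume that there are (i) a Banach space $\Psi$ and a dissipative semigroup $\bar S(t)$ on $\Psi$; (ii) a bi-Lipschitz embedding $E:\mathcal B\to\Psi$ (bi-Lipschitz onto its image) such that $\bar S(t)=E\circ S(t)\circ E^{-1}$ on $E(\mathcal B)$ for all $t\ge0$; (iii) an inertial manifold $\mathcal M\subset\Psi$ of $\bar S(t)$ in the sense above. Then $\mathcal M$ is called a (generalized) inertial manifold for $S(t)$. It is $C^{1+\varepsilon}$-smooth if both $\mathcal M$ (i.e. the function $M$) and $E$ (i.e. $E$ is the restriction to $\mathcal B$ of a $C^{1+\varepsilon}$ map defined on an open neighbourhood of $\mathcal B$) are $C^{1+\varepsilon}$, meaning continuously Fréchet differentiable with locally $\varepsilon$-Hölder derivative. *)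

(* Defs.v *)
From HB Require Import structures.
From mathcomp Require Import all_boot all_order all_algebra.
From mathcomp Require Import all_classical all_reals all_analysis.
From mathcomp Require Import measurable_realfun.
From mathcomp Require Import ring lra.

Set Implicit Arguments.
Unset Strict Implicit.
Unset Printing Implicit Defensive.
Import Order.TTheory GRing.Theory Num.Theory.
Import numFieldNormedType.Exports.
Local Open Scope classical_set_scope.
Local Open Scope ring_scope.

Section L2.
Context {R : realType} (L : {posnum R}).
Local Notation mu := (@lebesgue_measure R).
Local Notation I := `[0, L%:num]%classic.
Implicit Types (f g h : R -> R) (a x : R).

(* Square integrable on (0, L); values outside [0, L] are ignored. *)
Definition L2fun f := (f \_ I) \in Lfun mu 2%:E.

Let mI : measurable I. Proof. exact: measurable_itv. Qed.

Let p1 : (1 <= 2%:E :> \bar R)%E. Proof. by rewrite lee_fin ler1n. Qed.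

Let intI f : mu.-integrable I (EFin \o f) <->
  mu.-integrable setT (EFin \o f \_ I).
Proof.
rewrite -restrict_EFin -[X in integrable _ X]setTI.
exact: integrable_restrict.
Qed.

Let restrictE f x : (f \_ I) x = if x \in I then f x else 0.
Proof. by []. Qed.

Lemma L2fun_intM f g : L2fun f -> L2fun g ->
  mu.-integrable I (EFin \o (fun x => f x * g x)).
Proof.
move=> hf hg; have /Lfun1_integrable H := Lfun2_mul_Lfun1 hf hg.
apply/intI; congr (integrable _ _ (EFin \o _)) : H.
apply/funext => x; rewrite /= !restrictE.
by case: ifPn => // _; rewrite mul0r.
Qed.

Lemma L2funP f : measurable_fun I f ->
  mu.-integrable I (EFin \o (fun x => f x ^+ 2)) -> L2fun f.
Proof.
move=> mf /intI fi; rewrite /L2fun inE; apply/andP; split; rewrite inE /=.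
  by apply/(measurable_restrict _ mI measurableT); rewrite setTI.
rewrite /finite_norm; apply: (@lty_poweRy _ _ 2) => //.
rewrite poweR_Lnorm//; case/integrableP: fi => _; apply: le_lt_trans.
rewrite le_eqVlt; apply/orP; left; apply/eqP; apply: eq_integral => x _ /=.
rewrite !restrictE; case: ifPn => _; last by rewrite !normr0 powR0.
by rewrite powR_mulrn// normrX.
Qed.

Lemma L2fun_meas f : L2fun f -> measurable_fun I f.
Proof.
rewrite /L2fun inE => /andP[+ _]; rewrite inE /= => mf.
by have := (measurable_restrict f mI measurableT).2 mf; rewrite setTI.
Qed.

Lemma L2fun_cont f : {within I, continuous f} -> L2fun f.
Proof.
move=> cf; apply: L2funP.
  exact: subspace_continuous_measurable_fun.
apply: continuous_compact_integrable; first exact: segment_compact.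
have -> : (fun x => f x ^+ 2) = (fun x => f x * f x).
  by apply/funext => x; rewrite expr2.
by move=> x; apply: (@cvgM _ _ (nbhs (x : subspace I))); exact: cf.
Qed.

Lemma L2fun_lin a f g : L2fun f -> L2fun g -> L2fun (fun x => a * f x + g x).
Proof.
move=> hf hg; rewrite /L2fun.
have -> : (fun x => a * f x + g x) \_ I = a *: (f \_ I) + (g \_ I).
  apply/funext => x; rewrite !fctE !restrictE.
  by case: ifPn => // _; rewrite scaler0 addr0.
by apply: (Lfun_submod_closed mu p1).2.
Qed.

Lemma L2fun_int f : L2fun f -> mu.-integrable I (EFin \o f).
Proof.
move=> hf; have h1 : L2fun (cst 1) by apply: L2fun_cont => x; exact: cvg_cst.
have := L2fun_intM hf h1; apply: eq_integrable => // x _.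
by rewrite /= mulr1.
Qed.


(* f is absolutely continuous on [0, L] with derivative g in L^2: in one
   dimension this describes the continuous representatives of the elements of
   H^1(0, L) and their weak derivatives. *)
Definition has_L2deriv f g :=
  L2fun g /\ forall x, I x -> f x = f 0 + \int[mu]_(t in `[0, x]) g t.

Let I0 : I 0. Proof. by rewrite /= in_itv /= lexx ltW. Qed.

Lemma itv0_sub x : I x -> `[0, x] `<=` I.
Proof.
rewrite /= in_itv /= => /andP[_ xL] t /=; rewrite !in_itv /= => /andP[-> tx].
exact: le_trans tx xL.
Qed.

Let int0x g x : L2fun g -> I x -> mu.-integrable `[0, x] (EFin \o g).
Proof.
move=> hg Ix; by apply: integrableS (L2fun_int hg) => //; exact: itv0_sub.
Qed.

Lemma has_L2deriv0 : has_L2deriv (cst 0) (cst 0).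
Proof.
split; first by apply: L2fun_cont => x; exact: cvg_cst.
by move=> x _; rewrite /= Rintegral_cst// mul0r addr0.
Qed.

Lemma has_L2deriv_lin a f1 f2 g1 g2 : has_L2deriv f1 g1 -> has_L2deriv f2 g2 ->
  has_L2deriv (fun x => a * f1 x + f2 x) (fun x => a * g1 x + g2 x).
Proof.
move=> [h1 e1] [h2 e2]; split; first exact: L2fun_lin.
move=> x Ix; rewrite e1// e2//.
have i1 := int0x h1 Ix; have i2 := int0x h2 Ix.
rewrite RintegralD//; last first.
  by apply: eq_integrable (integrableZl _ a i1).
rewrite RintegralZl//.
by rewrite mulrDr addrACA.
Qed.

Lemma has_L2deriv_L2 f g : has_L2deriv f g -> L2fun f.
Proof.
move=> [hg e]; apply: L2fun_cont.
have c := @parameterized_integral_continuous R 0 L%:num g (ltW (gt0 L))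
  (L2fun_int hg).
apply: (@subspace_eq_continuous _ I _ (fun x => f 0 + \int[mu]_(t in `[0, x]) g t)).
  by move=> x xI; rewrite /= -e//; exact/set_mem.
by move=> x; apply: cvgD; [exact: cvg_cst|exact: c].
Qed.

Let L2fun_prim_eq0 h : L2fun h ->
  (forall x, I x -> \int[mu]_(t in `[0, x]) h t = 0) ->
  h = cst 0 %[ae mu in I].
Proof.
move=> hh e0; have ih := L2fun_int hh.
have lp : {ae mu, forall x, lebesgue_pt (h \_ I) x} :=
  lebesgue_differentiation (integrable_locally_restrict mI ih).
have ae2 : {ae mu, forall x : R, x <> 0 /\ x <> L%:num}.
  exists [set 0; L%:num]; split.
  - by apply: measurableU; exact: measurable_set1.
  - apply: countable_lebesgue_measure0; apply: finite_set_countable.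
    exact: finite_set2.
  - by move=> x /= /not_andP[/contrapT ->|/contrapT ->]; [left|right].
have aeF : Filter (nbhs (almost_everywhere mu)) := ae_filter_ringOfSetsType mu.
apply: filterS2 ae2 lp => x [x0 xL] lx Ix.
have /andP[x0' xL'] : 0 < x < L%:num.
  move: Ix; rewrite /= in_itv /= => /andP[? ?].
  by rewrite !lt_neqAle; apply/andP; split; apply/andP; split => //;
    apply/eqP => // /esym.
have hE (y : R) : 0 < y < L%:num -> \int[mu]_(t in `[0, y]) (h \_ I) t = 0.
  move=> /andP[y0 yL]; have Iy : I y by rewrite /= in_itv/= !ltW.
  rewrite -[RHS](e0 y Iy); apply: eq_Rintegral => t /set_mem /(itv0_sub Iy) It.
  by rewrite /= restrictE mem_set.
have ihI : mu.-integrable [set` Interval (BLeft 0) (BRight L%:num)]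
    (EFin \o (h \_ I)).
  by apply: eq_integrable ih => // t tI; rewrite /= restrictE tI.
have b0x : (BLeft (0%R : R) < BRight x)%E by rewrite /= lte_fin.
have [_] := FTC1_lebesgue_pt xL' ihI b0x lx.
rewrite restrictE (mem_set Ix) => <-.
rewrite derive1E (near_eq_derive _ _ (g := cst 0)) ?derive_cst//.
near=> y; apply: hE; apply/andP; split; near: y.
  exact: lt_nbhsr.
exact: lt_nbhsl.
Unshelve. all: by end_near. Qed.

Lemma has_L2deriv_unique f g1 g2 : has_L2deriv f g1 -> has_L2deriv f g2 ->
  g1 = g2 %[ae mu in I].
Proof.
move=> h1 h2; have := has_L2deriv_lin (-1) h1 h2 => -[hg e].
have h0 := L2fun_prim_eq0 hg _.
have aeF : Filter (nbhs (almost_everywhere mu)) := ae_filter_ringOfSetsType mu.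
apply: filterS (h0 _) => [x hx Ix|x Ix].
  by have := hx Ix; rewrite mulN1r /= => /eqP; rewrite addrC subr_eq0 => /eqP.
by have := e x Ix; rewrite !mulN1r !addNr add0r => <-.
Qed.

Definition ipL2 n (u v : R -> 'cV[R]_n) : R :=
  \sum_(i < n) \int[mu]_(x in I) (u x i 0 * v x i 0).

Definition L2vec n (u : R -> 'cV[R]_n) := forall i, L2fun (fun x => u x i 0).

Lemma ipL2C n (u v : R -> 'cV[R]_n) : ipL2 u v = ipL2 v u.
Proof.
apply: eq_bigr => i _; apply: eq_Rintegral => x _; exact: mulrC.
Qed.

Lemma ipL2_lin n a (u1 u2 v : R -> 'cV[R]_n) :
  L2vec u1 -> L2vec u2 -> L2vec v ->
  ipL2 (fun x => a *: u1 x + u2 x) v = a * ipL2 u1 v + ipL2 u2 v.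
Proof.
move=> h1 h2 hv; rewrite /ipL2 mulr_sumr -big_split; apply: eq_bigr => i _ /=.
have i1 := L2fun_intM (h1 i) (hv i); have i2 := L2fun_intM (h2 i) (hv i).
rewrite -RintegralZl// -RintegralD//; last first.
  by apply: eq_integrable (integrableZl _ a i1).
by apply: eq_Rintegral => x _; rewrite !mxE mulrDl mulrA.
Qed.

Lemma ipL2_ae n (u1 u2 v : R -> 'cV[R]_n) :
  L2vec u1 -> L2vec u2 -> L2vec v ->
  (forall i, (fun x => u1 x i 0) = (fun x => u2 x i 0) %[ae mu in I]) ->
  ipL2 u1 v = ipL2 u2 v.
Proof.
move=> h1 h2 hv e; apply: eq_bigr => i _; congr fine.
have aeF : Filter (nbhs (almost_everywhere mu)) := ae_filter_ringOfSetsType mu.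
apply: ae_eq_integral => //.
- exact: measurable_int (L2fun_intM (h1 i) (hv i)).
- exact: measurable_int (L2fun_intM (h2 i) (hv i)).
- by apply: filterS (e i) => x /[apply] ->.
Qed.

Lemma ipL2_ge0 n (u : R -> 'cV[R]_n) : 0 <= ipL2 u u.
Proof. by apply: sumr_ge0 => i _; apply: Rintegral_ge0 => x _; rewrite -expr2 sqr_ge0. Qed.

Lemma ipL2_eq0 n (u : R -> 'cV[R]_n) : L2vec u -> ipL2 u u = 0 ->
  forall i, (fun x => u x i 0) = cst 0 %[ae mu in I].
Proof.
move=> hu /eqP; rewrite psumr_eq0; last first.
  by move=> i _; apply: Rintegral_ge0 => x _; rewrite -expr2 sqr_ge0.
move=> /allP h i; have /h/= /eqP e : i \in index_enum 'I_n by rewrite mem_index_enum.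
have ii := L2fun_intM (hu i) (hu i).
have := (ae_eq_integral_abs mu mI (measurable_int _ ii)).1.
have aeF : Filter (nbhs (almost_everywhere mu)) := ae_filter_ringOfSetsType mu.
move=> H; apply: filterS (H _) => [x hx Ix|].
  by have /= [/eqP] := hx Ix; rewrite mulf_eq0 orbb => /eqP.
have -> : (\int[mu]_(x in I) `|(EFin \o (fun x => (u x i 0 * u x i 0)%R)) x| =
  \int[mu]_(x in I) (u x i 0 * u x i 0)%:E)%E.
  by apply: eq_integral => x _; rewrite /= -expr2 ger0_norm// sqr_ge0.
by rewrite -(fineK (integrable_fin_num _ ii))// -[fine _]/(\int[mu]_(x in I) (u x i 0 * u x i 0)) e.
Qed.

Definition weak_deriv n (u w : R -> 'cV[R]_n) :=
  forall i, has_L2deriv (fun x => u x i 0) (fun x => w x i 0).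

(* The weak derivative is unique a.e. on [0, L] (has_L2deriv_unique), so the
   choice made by get is immaterial under integrals. *)
Definition grad n (u : R -> 'cV[R]_n) : R -> 'cV[R]_n :=
  get [set w | weak_deriv u w].

Definition H1set n : {pred R -> 'cV[R]_n} :=
  mem [set u : R -> 'cV[R]_n |
    (exists w, weak_deriv u w) /\ forall x, ~ I x -> u x = 0].

Lemma H1set_submod n : submod_closed (@H1set n).
Proof.
split.
  rewrite inE; split => //; exists 0 => i.
  by have := has_L2deriv0; congr has_L2deriv; apply/funext => x; rewrite mxE.
move=> a u v; rewrite !inE => -[[w1 h1] z1] [[w2 h2] z2]; split.
  exists (fun x => a *: w1 x + w2 x) => i.
  have := has_L2deriv_lin a (h1 i) (h2 i).
  by congr has_L2deriv; apply/funext => x; rewrite !mxE.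
by move=> x Ix; rewrite !fctE z1// z2// scaler0 addr0.
Qed.

End L2.

(* [H^1(0, L)]^n: an element is stored as its continuous representative on
   [0, L], extended by 0 outside so that equality is plain equality. *)
Record H1 (R : realType) (L : {posnum R}) (n : nat) := MkH1 {
  H1val :> R -> 'cV[R]_n;
  H1valP : H1val \in @H1set R L n }.

Section H1_lmod.
Context (R : realType) (L : {posnum R}) (n : nat).
Local Notation mu := (@lebesgue_measure R).
Local Notation I := `[0, L%:num]%classic.

HB.instance Definition _ := [isSub for @H1val R L n].
HB.instance Definition _ := [Choice of H1 L n by <:].
HB.instance Definition _ := GRing.isSubmodClosed.Build R (R -> 'cV[R]_n)
  (@H1set R L n) (@H1set_submod R L n).
HB.instance Definition _ := [SubChoice_isSubLmodule of H1 L n by <:].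

Definition dx (u : H1 L n) : R -> 'cV[R]_n := grad L u.

Lemma dxP (u : H1 L n) : weak_deriv L u (dx u).
Proof.
have := H1valP u; rewrite inE => -[[w hw] _].
by rewrite /dx /grad; exact: (@getI _ [set w | weak_deriv L u w] w).
Qed.

Lemma H1_L2 (u : H1 L n) : L2vec L u.
Proof. by move=> i; exact: has_L2deriv_L2 (dxP u i). Qed.

Lemma dx_L2 (u : H1 L n) : L2vec L (dx u).
Proof. by move=> i; case: (dxP u i). Qed.

Definition ipH1 (u v : H1 L n) : R := ipL2 L u v + ipL2 L (dx u) (dx v).
Definition H1norm (u : H1 L n) : R := Num.sqrt (ipH1 u u).

Let ipC u v : ipH1 u v = ipH1 v u.
Proof. by rewrite /ipH1 ipL2C [X in _ + X]ipL2C. Qed.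

Let ipD a u1 u2 v : ipH1 (a *: u1 + u2) v = a * ipH1 u1 v + ipH1 u2 v.
Proof.
rewrite /ipH1 [X in _ + X](@ipL2_ae _ _ _ _ (fun x => a *: dx u1 x + dx u2 x)).
- rewrite !ipL2_lin//; try exact: H1_L2; try exact: dx_L2.
  by rewrite mulrDr addrACA.
- exact: dx_L2.
- move=> i; have := L2fun_lin a (dx_L2 u1 i) (dx_L2 u2 i).
  by congr L2fun; apply/funext => x; rewrite !mxE.
- exact: dx_L2.
- move=> i; apply: (has_L2deriv_unique (dxP _ i)).
  have := has_L2deriv_lin a (dxP u1 i) (dxP u2 i).
  by congr has_L2deriv; apply/funext => x; rewrite !mxE.
Qed.

Let ip_ge0 u : 0 <= ipH1 u u.
Proof. by rewrite addr_ge0 ?ipL2_ge0. Qed.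

Let normZ a u : H1norm (a *: u) = `|a| * H1norm u.
Proof.
have Z b v w : ipH1 (b *: v) w = b * ipH1 v w.
  have z : ipH1 0 w = 0.
    by have := ipD (-1) w w w; rewrite scaleN1r addNr mulN1r addNr.
  by rewrite -[b *: v]addr0 ipD z addr0.
by rewrite /H1norm Z ipC Z mulrA -expr2 sqrtrM ?sqr_ge0// sqrtr_sqr.
Qed.

Let ipM u v : ipH1 u v ^+ 2 <= ipH1 u u * ipH1 v v.
Proof.
have q t : 0 <= t ^+ 2 * ipH1 u u + 2 * t * ipH1 u v + ipH1 v v.
  have := ip_ge0 (t *: u + v); rewrite ipD ipC ipD [ipH1 v (_ + _)]ipC ipD.
  by rewrite [ipH1 v u]ipC => /le_trans; apply; rewrite le_eqVlt; apply/orP; left; apply/eqP; ring.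
have [A0|A0] := eqVneq (ipH1 u u) 0.
  have [->|B0] := eqVneq (ipH1 u v) 0; first by rewrite A0 mul0r expr0n.
  have := q (- (ipH1 v v + 1) / (2 * ipH1 u v)); rewrite A0 mulr0 add0r.
  have -> : 2 * (- (ipH1 v v + 1) / (2 * ipH1 u v)) * ipH1 u v + ipH1 v v = -1.
    by field.
  by rewrite oppr_ge0 ler10.
have Ap : 0 < ipH1 u u by rewrite lt0r A0 ip_ge0.
have := q (- ipH1 u v / ipH1 u u).
have -> : (- ipH1 u v / ipH1 u u) ^+ 2 * ipH1 u u +
    2 * (- ipH1 u v / ipH1 u u) * ipH1 u v + ipH1 v v =
    ipH1 v v - ipH1 u v ^+ 2 / ipH1 u u by field.
by rewrite subr_ge0 ler_pdivrMr// mulrC.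
Qed.

Let normD u v : H1norm (u + v) <= H1norm u + H1norm v.
Proof.
rewrite -(ler_pXn2r (ltn0Sn 1)) ?nnegrE ?addr_ge0 ?sqrtr_ge0//.
rewrite sqrrD /H1norm !sqr_sqrtr//.
have D a b c : ipH1 (a + b) c = ipH1 a c + ipH1 b c.
  by rewrite -[a in LHS]scale1r ipD mul1r.
rewrite !D ![ipH1 _ (u + v)]ipC !D [ipH1 v u]ipC.
suff h : ipH1 u v <= Num.sqrt (ipH1 u u) * Num.sqrt (ipH1 v v).
  by rewrite mulr2n; lra.
rewrite -sqrtrM// (le_trans (ler_norm _))// -sqrtr_sqr ler_wsqrtr//.
Qed.

Let norm0 u : H1norm u = 0 -> u = 0.
Proof.
move/eqP; rewrite sqrtr_eq0 => h.
have /eqP : ipH1 u u = 0 by apply/eqP; rewrite eq_le h ip_ge0.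
rewrite paddr_eq0 ?ipL2_ge0// => /andP[/eqP h0 /eqP h1].
have d0 := ipL2_eq0 (dx_L2 u) h1.
have cu i x : I x -> u x i 0 = u 0 i 0.
  move=> Ix; have [dL2 ->//] := dxP u i.
  rewrite (_ : \int[mu]_(t in _) _ = 0) ?addr0//.
  transitivity (\int[mu]_(t in `[0, x]) (cst 0 t : R)); last first.
    by rewrite Rintegral_cst// mul0r.
  congr fine; apply: (ae_eq_integral (EFin \o cst 0)) => //.
    by apply: measurable_funS (measurable_int _ (L2fun_int dL2)) => //; exact: itv0_sub.
    exact: (@measurable_cst _ _ _ _ _ 0%E).
  have aeF : Filter (nbhs (almost_everywhere mu)) := ae_filter_ringOfSetsType mu.
  apply: filterS (d0 i) => y hy xy; rewrite /= hy//; exact: itv0_sub xy.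
apply/val_inj/funext => x; apply/matrixP => i j; rewrite ord1 [RHS]mxE.
have u00 : u 0 i 0 = 0.
  move/eqP: h0; rewrite psumr_eq0; last first.
    by move=> k _; apply: Rintegral_ge0 => t _; rewrite -expr2 sqr_ge0.
  move=> /allP /(_ i (mem_index_enum i)) /= /eqP.
  rewrite (_ : \int[mu]_(t in _) _ = \int[mu]_(t in I) (u 0 i 0 * u 0 i 0)); last first.
    by apply: eq_Rintegral => t /set_mem It; rewrite cu.
  rewrite Rintegral_cst// (_ : fine _ = L%:num); last first.
    by rewrite [X in fine X](lebesgue_measure_itv `[0, L%:num]) /= lte_fin gt0 oppr0 adde0.
  by move/eqP; rewrite !mulf_eq0 orbb (gt_eqF (gt0 L)) orbF => /eqP.
have [Ix|Ix] := pselect (I x); first by rewrite /= cu.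
have := H1valP u; rewrite inE => -[_ /(_ x Ix) /= ->].
by rewrite mxE.
Qed.

HB.instance Definition _ :=
  @Lmodule_isNormed.Build R (H1 L n) H1norm normD normZ norm0.

End H1_lmod.

Section Smoothness.
Context {R : realType} {V W : normedModType R}.
Implicit Types (f : V -> W) (A : set V).

(* Class C^k through iterated directional derivatives; used for V of finite
   dimension only. *)
Fixpoint Ck (k : nat) f : Prop :=
  match k with
  | 0%N => continuous f
  | k'.+1 => (forall x, differentiable f x) /\
             forall v, Ck k' (fun x => 'd f x v)
  end.

Definition Cinfty0 f :=
  (forall k, Ck k f) /\ compact (closure [set x | f x != 0]).

(* For an open set A. The last inequality bounds the operator norm of
   'd f y - 'd f z by C |y - z|^eps. *)
Definition C1holder (eps : R) A f :=
  (forall x, A x -> differentiable f x) /\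
  forall x, A x -> exists C : R, \forall y \near x & z \near x,
    forall h, `|'d f y h - 'd f z h| <= C * `|y - z| `^ eps * `|h|.

End Smoothness.

Section Semigroups.
Context {R : realType} {V : normedModType R}.
Implicit Types (S : R -> V -> V) (B : set V).

(* Only the times t >= 0 matter; a semigroup is understood to be strongly
   continuous, with continuous evolution maps. *)
Definition semigroup S :=
  [/\ S 0 = id,
      forall s t, 0 <= s -> 0 <= t -> S (s + t) = S s \o S t,
      forall t, 0 <= t -> continuous (S t)
    & forall v, {within `[0, +oo[, continuous (S ^~ v)}].

Definition bounded_absorbing S B :=
  bounded_set B /\
  forall A, bounded_set A ->
    exists T : R, forall t, 0 <= t -> T <= t -> S t @` A `<=` B.

Definition dissipative S := exists B, bounded_absorbing S B.

Definition lin_span B : set V :=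
  [set v | exists (k : nat) (c : 'I_k -> R) (e : 'I_k -> V),
    (forall i, B (e i)) /\ v = \sum_i c i *: e i].

End Semigroups.

Section Equation.
Context {R : realType} {L : {posnum R}} {m : nat}.
Variables (f : 'cV[R]_m -> 'M[R]_m) (g : 'cV[R]_m -> 'cV[R]_m).

(* u is a solution in C([0, oo); H^1) of the variational form of
     u_t + f(u) u_x + g(u) = u_xx - u,
   where u_xx is integrated by parts; since phi ranges over all of H^1 (no
   condition at 0 and L), the Neumann conditions u_x = 0 at 0 and L are
   the natural boundary conditions of this form. *)
Definition is_solution (u : R -> H1 L m) :=
  {within `[0, +oo[, continuous u} /\
  forall (phi : H1 L m) (t : R), 0 < t ->
    is_derive t 1 (fun s => ipL2 L (u s) phi)
      (- ipL2 L (dx (u t)) (dx phi)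
       - ipL2 L (fun x => f (u t x) *m dx (u t) x + g (u t x) + u t x) phi).

Definition solution_semigroup (S : R -> H1 L m -> H1 L m) :=
  semigroup S /\ forall u0, is_solution (S ^~ u0).

End Equation.

Inductive boundary_condition := Dirichlet | Neumann.

Section VectorLaplacian.
Context {R : realType} (L : {posnum R}) {N : nat}.
Variable bc : 'I_N -> boundary_condition.

(* w is a nonzero solution of - w'' = lam w on (0, L) with the boundary
   conditions bc. Solutions of this linear equation extend uniquely to the
   whole line, hence two-sided derivatives at 0 and L. *)
Definition eigenfunction (lam : R) (w : R -> 'cV[R]_N) :=
  (forall i, let wi := fun x => w x i 0 in
    (forall x, [/\ derivable wi x 1, derivable (derive1 wi) x 1
                 & - derive1 (derive1 wi) x = lam * wi x]) /\
    match bc i with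
    | Dirichlet => wi 0 = 0 /\ wi L%:num = 0
    | Neumann => derive1 wi 0 = 0 /\ derive1 wi L%:num = 0
    end) /\
  exists x, x \in `[0, L%:num] /\ w x != 0.

Definition eigenvalue_lap (lam : R) := exists w, eigenfunction lam w.

(* lam is one of the n smallest distinct eigenvalues *)
Definition first_eigenvalue (n : nat) (lam : R) :=
  eigenvalue_lap lam /\
  exists2 k, (k < n)%N &
    ([set nu | eigenvalue_lap nu /\ nu < lam] #= `I_k)%card.

(* A Banach space of (classes of) functions (0, L) -> R^N, continuously
   embedded in L^2 and containing the eigenfunctions. fs_fun picks a
   representative of each class, so it is linear and injective up to a.e.
   equality only. *)
Record function_space := FunctionSpace {
  fs_sort :> completeNormedModType R;
  fs_fun : fs_sort -> R -> 'cV[R]_N;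
  fs_L2 : forall v, L2vec L (fs_fun v);
  fs_linear : forall (a : R) (u v : fs_sort),
    fs_fun (a *: u + v) = (fun x => a *: fs_fun u x + fs_fun v x)
      %[ae (@lebesgue_measure R) in `[0, L%:num]%classic];
  fs_inj : forall v : fs_sort,
    fs_fun v = cst 0 %[ae (@lebesgue_measure R) in `[0, L%:num]%classic] -> v = 0;
  fs_cont : exists C : R, forall v : fs_sort,
    Num.sqrt (ipL2 L (fs_fun v) (fs_fun v)) <= C * `|v|;
  fs_eigen : forall lam w, eigenfunction lam w -> exists v : fs_sort,
    fs_fun v = w %[ae (@lebesgue_measure R) in `[0, L%:num]%classic] }.

Variable Psi : function_space.

Definition low_modes (n : nat) : set Psi :=
  lin_span [set v | exists lam w,
    [/\ first_eigenvalue n lam, eigenfunction lam w &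
        fs_fun v = w %[ae (@lebesgue_measure R) in `[0, L%:num]%classic]]].

(* The L^2-orthoprojector onto low_modes n *)
Definition Pn (n : nat) (v : Psi) : Psi :=
  get [set p | low_modes n p /\
    forall e, low_modes n e -> ipL2 L (fs_fun (v - p)) (fs_fun e) = 0].

Definition Qn (n : nat) (v : Psi) : Psi := v - Pn n v.

Definition exponential_tracking (S : R -> Psi -> Psi) (X : set Psi) :=
  exists C theta : R, [/\ 0 < C, 0 < theta &
    forall v0 : Psi, exists w0 : Psi,
      (forall t, 0 <= t -> X (S t w0)) /\
      forall t, 0 <= t ->
        `|S t v0 - S t w0| <= C * `|v0 - w0| * expR (- theta * t)].

(* X is an inertial manifold, namely the graph of M over P_n Psi; the values
   of M outside P_n Psi are irrelevant. *)
Definition inertial_manifold (S : R -> Psi -> Psi) (n : nat)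
    (M : Psi -> Psi) (X : set Psi) :=
  [/\ forall t, 0 <= t -> S t @` X = X,
      forall p, range (Pn n) p -> range (Qn n) (M p),
      [lipschitz M p | p in range (Pn n)],
      X = [set p + M p | p in range (Pn n)]
    & exponential_tracking S X].

End VectorLaplacian.

Definition bilipschitz_on (R : realType) (V W : normedModType R) (B : set V)
    (E : V -> W) :=
  exists c C : R, [/\ 0 < c, 0 < C & forall x y, B x -> B y ->
    c * `|x - y| <= `|E x - E y| <= C * `|x - y|].

(* The values of gim_E outside gim_B are irrelevant for this record. *)
Record gen_inertial_manifold (R : realType) (L : {posnum R}) (m : nat)
    (S : R -> H1 L m -> H1 L m) := GenInertialManifold {
  gim_B : set (H1 L m);
  gim_B_absorbing : bounded_absorbing S gim_B;
  gim_B_invariant : forall t, 0 <= t -> S t @` gim_B `<=` gim_B;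
  gim_N : nat;
  gim_N_gt0 : (0 < gim_N)%N;
  gim_bc : 'I_gim_N -> boundary_condition;
  gim_Psi : function_space L gim_bc;
  gim_S : R -> gim_Psi -> gim_Psi;
  gim_S_semigroup : semigroup gim_S;
  gim_S_dissipative : dissipative gim_S;
  gim_E : H1 L m -> gim_Psi;
  gim_E_bilipschitz : bilipschitz_on gim_B gim_E;
  gim_E_conj : forall t u, 0 <= t -> gim_B u ->
    gim_S t (gim_E u) = gim_E (S t u);
  gim_n : nat;
  gim_n_gt0 : (0 < gim_n)%N;
  gim_M : gim_Psi -> gim_Psi;
  gim_manifold : set gim_Psi;
  gim_inertial : inertial_manifold gim_S gim_n gim_M gim_manifold }.

(* M is defined on the finite-dimensional subspace P_n Psi; it is of class
   C^(1+eps) there iff its composite with the bounded projector P_n is so on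
   Psi. *)
Definition C1holder_gim (R : realType) (L : {posnum R}) (m : nat)
    (S : R -> H1 L m -> H1 L m) (G : gen_inertial_manifold S) (eps : R) :=
  C1holder eps setT (@gim_M _ _ _ _ G \o Pn (gim_n G)) /\
  exists U, [/\ open U, gim_B G `<=` U & C1holder eps U (@gim_E _ _ _ _ G)].

(* Main.v *)
(* Let be' = - be f(u) / 2, be(0) = 1, with inverse al, and W = be u_x. This change of
   variable removes the leading part of the drift: in the coordinates <u, cn_k>, weighted by
   ow_k = (k + 1)^(3/4) so that u is recovered by a uniformly convergent series, and <W, sn_k>, the
   equation reads y_k' = - (om_k^2 + 1) y_k + F_k(y) on l2, where after a cut-off F_k is bounded and
   Lipschitz with constant O(ow_k). The gaps of om_k^2 grow like k, hence the sum of
   (ow_k / |om_k^2 + 1 - th|)^2 is small for th in the middle of a remote gap, and Perron's method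
   gives an inertial manifold. Smoothness is obtained without differentiating: the graph map and
   the embedding satisfy |G a + G b - 2 G((a + b) / 2)| <= C |a - b|^(1 + eps), and such a map is of
   class C^(1 + eps). The absorbing set is a sublevel set of |u_x|^2 + c |u|^2. *)
From HB Require Import structures.
Require Import Defs.
From mathcomp Require Import all_boot all_order all_algebra.
From mathcomp Require Import all_classical all_reals all_analysis.
From mathcomp Require Import measurable_realfun.
From mathcomp Require Import ring lra.
Set Implicit Arguments.
Unset Strict Implicit.
Unset Printing Implicit Defensive.
Import Order.TTheory GRing.Theory Num.Theory.
Import numFieldNormedType.Exports.
Local Open Scope classical_set_scope.
Local Open Scope ring_scope.

(* A function together with all its iterated partial derivatives, indexed by the directions. *)
Local Notation jet R m := (seq 'I_m -> 'cV[R]_m -> R).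

(** In the equation for u the drift costs one derivative: on mode k its Lipschitz constant is of the
    order of om_k, just like the gaps, so that their quotient stays bounded without becoming small.
    In the equation for W no first-order term remains; the price is the variation of [be] along the
    flow, an integral over (0, x) of u_t and hence of u_xx. Tested against sn_k and integrated by
    parts, it leaves only products of L2 functions, so the field is bounded uniformly in k and W is
    never differentiated. Since u_x vanishes at both ends, sines are the natural modes of W.

    Solutions are only known to be continuous in H^1. Every derivative in time is therefore read off
    the weak form, and a nonlinear functional of u is compared with its linearization, with an error
    quadratic in the L2 norm of the increment.

    The exponent 1 + eps is the ratio r of two rates inside one gap: the second difference of orbits
    growing like exp (th t) is driven by a source growing like exp (r th t), and r th must still lie
    in the gap. *)

Lemma eqle d (T : porderType d) (x y : T) : x = y -> (x <= y)%O.
Proof. by move=> ->. Qed.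

(** * Square-summable sequences of column vectors *)

Section SquareSummable.
Context (R : realType) (N : nat).
Implicit Types (u v : nat -> 'cV[R]_N) (n j : nat) (i : 'I_N).

(** Partial sums only: estimates on [l2] are proved for finite sums, uniformly in [n], and pass to
    the norm as a supremum, so that no series has to be summed. *)
Definition sqs n u : R := \sum_(j < n) \sum_(i < N) u j i 0 ^+ 2.

Lemma sqs_ge0 n u : 0 <= sqs n u.
Proof. by apply: sumr_ge0 => j _; apply: sumr_ge0 => i _; exact: sqr_ge0. Qed.

Lemma sqsS n u : sqs n.+1 u = sqs n u + \sum_(i < N) u n i 0 ^+ 2.
Proof. by rewrite /sqs big_ord_recr. Qed.

Lemma sqs_homo u : {homo sqs ^~ u : n p / (n <= p)%N >-> n <= p}.
Proof.
move=> n p /subnKC <-; elim: (p - n)%N => [|k IH]; first by rewrite addn0.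
rewrite addnS sqsS (le_trans IH)// lerDl.
by apply: sumr_ge0 => i _; exact: sqr_ge0.
Qed.

Lemma sqs_entry n u j i : (j < n)%N -> u j i 0 ^+ 2 <= sqs n u.
Proof.
move=> jn; apply: le_trans (sqs_homo u jn); rewrite sqsS.
rewrite (bigD1 i)//= addrCA lerDl addr_ge0// ?sqs_ge0//.
by apply: sumr_ge0 => k _; exact: sqr_ge0.
Qed.

Lemma sqsZ n a u : sqs n (a *: u) = a ^+ 2 * sqs n u.
Proof.
rewrite /sqs mulr_sumr; apply: eq_bigr => j _; rewrite mulr_sumr.
by apply: eq_bigr => i _; rewrite !fctE !mxE exprMn.
Qed.

(* Minkowski: expand with 2ab <= (s/r) a^2 + (r/s) b^2. *)
Lemma sqsD n u v (r s : R) : 0 <= r -> 0 <= s ->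
  sqs n u <= r ^+ 2 -> sqs n v <= s ^+ 2 -> sqs n (u + v) <= (r + s) ^+ 2.
Proof.
rewrite le_eqVlt => /predU1P[<- s0|r0].
  rewrite expr0n /= add0r => u0 hv; rewrite (_ : sqs n (u + v) = sqs n v)//.
  apply: eq_bigr => j _; apply: eq_bigr => i _; rewrite !fctE !mxE.
  suff -> : u j i 0 = 0 by rewrite add0r.
  apply/eqP; rewrite -sqrf_eq0 eq_le sqr_ge0 andbT (le_trans _ u0)//.
  by apply: sqs_entry.
rewrite le_eqVlt => /predU1P[<- + |s0].
  rewrite [0 ^+ 2]expr0n /= addr0 => hu v0; rewrite (_ : sqs n (u + v) = sqs n u)//.
  apply: eq_bigr => j _; apply: eq_bigr => i _; rewrite !fctE !mxE.
  suff -> : v j i 0 = 0 by rewrite addr0.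
  apply/eqP; rewrite -sqrf_eq0 eq_le sqr_ge0 andbT (le_trans _ v0)//.
  by apply: sqs_entry.
move=> hu hv.
have : sqs n (u + v) <= (1 + s / r) * sqs n u + (1 + r / s) * sqs n v.
  rewrite /sqs !mulr_sumr -big_split /=; apply: ler_sum => j _.
  rewrite !mulr_sumr -big_split /=; apply: ler_sum => i _; rewrite !fctE !mxE.
  set a := u j i 0; set b := v j i 0; rewrite -subr_ge0.
  have -> : (1 + s / r) * a ^+ 2 + (1 + r / s) * b ^+ 2 - (a + b) ^+ 2
    = (s * a - r * b) ^+ 2 / (r * s) by field; rewrite !gt_eqF.
  by rewrite divr_ge0 ?sqr_ge0// mulr_ge0// ltW.
move=> /le_trans; apply.
have -> : (r + s) ^+ 2 = (1 + s / r) * r ^+ 2 + (1 + r / s) * s ^+ 2.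
  by field; rewrite !gt_eqF.
by apply: lerD; apply: ler_wpM2l => //; rewrite addr_ge0// divr_ge0// ltW.
Qed.

Definition l2set : {pred nat -> 'cV[R]_N} :=
  mem [set u | exists M, forall n, sqs n u <= M ^+ 2].

Lemma l2setP u : reflect (exists2 M, 0 <= M & forall n, sqs n u <= M ^+ 2)
  (u \in l2set).
Proof.
apply: (iffP idP); rewrite inE => -[M h]; last by exists M.
by exists `|M| => // n; rewrite real_normK// num_real.
Qed.

Lemma l2set_submod : submod_closed l2set.
Proof.
split.
  apply/l2setP; exists 0 => // n; rewrite expr0n/= /sqs big1// => j _.
  by rewrite big1// => i _; rewrite mxE expr0n.
move=> a u v /l2setP[r r0 hr] /l2setP[s s0 hs]; apply/l2setP.
exists (`|a| * r + s); first by rewrite addr_ge0// mulr_ge0.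
move=> n; apply: sqsD => //; first by rewrite mulr_ge0.
rewrite sqsZ exprMn real_normK ?num_real// ler_wpM2l ?sqr_ge0//.
Qed.

End SquareSummable.

(** The phase space of the reduced equation, used with [N = m + m]: the upper half of entry k holds
    the weighted cosine coefficients of u, the lower half the sine coefficients of W. *)
Record l2 (R : realType) (N : nat) := MkL2 {
  l2val :> nat -> 'cV[R]_N;
  l2valP : l2val \in @l2set R N }.

Section L2Space.
Context (R : realType) (N : nat).

HB.instance Definition _ := [isSub for @l2val R N].
HB.instance Definition _ := [Choice of l2 R N by <:].
HB.instance Definition _ := GRing.isSubmodClosed.Build R (nat -> 'cV[R]_N)
  (@l2set R N) (@l2set_submod R N).
HB.instance Definition _ := [SubChoice_isSubLmodule of l2 R N by <:].

Implicit Types (u v : l2 R N) (n j : nat) (i : 'I_N).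

Definition l2norm u : R := sup (range (fun n => Num.sqrt (sqs n u))).

Let l2_has_sup u : has_sup (range (fun n => Num.sqrt (sqs n u))).
Proof.
split; first by exists (Num.sqrt (sqs 0 u)); exists 0%N.
have /l2setP[M M0 h] := l2valP u; exists M => _ [n _ <-].
by rewrite -(ger0_norm M0) -sqrtr_sqr ler_wsqrtr.
Qed.

Let sqs_le_norm n u : Num.sqrt (sqs n u) <= l2norm u.
Proof. by apply: sup_ubound; [case: (l2_has_sup u)|exists n]. Qed.

Let l2norm_ge0 u : 0 <= l2norm u.
Proof. exact: le_trans (sqrtr_ge0 _) (sqs_le_norm 0 u). Qed.

Let sqs_norm n u : sqs n u <= l2norm u ^+ 2.
Proof.
rewrite -[sqs n u]sqr_sqrtr ?sqs_ge0//.
by rewrite ler_pXn2r ?nnegrE ?sqrtr_ge0.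
Qed.

Let l2norm_le u M : 0 <= M -> (forall n, sqs n u <= M ^+ 2) -> l2norm u <= M.
Proof.
move=> M0 h; apply: ge_sup; first by case: (l2_has_sup u).
by move=> _ [n _ <-]; rewrite -(ger0_norm M0) -sqrtr_sqr ler_wsqrtr.
Qed.

Let normD u v : l2norm (u + v) <= l2norm u + l2norm v.
Proof.
apply: l2norm_le; first exact: addr_ge0.
by move=> n; apply: (@sqsD _ _ n (l2val u) (l2val v)).
Qed.

Let normZ a u : l2norm (a *: u) = `|a| * l2norm u.
Proof.
have le b (w : l2 R N) : l2norm (b *: w) <= `|b| * l2norm w.
  apply: l2norm_le; first exact: mulr_ge0.
  move=> n; rewrite sqsZ exprMn real_normK ?num_real//.
  by apply: ler_wpM2l; [exact: sqr_ge0|exact: (sqs_norm n w)].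
apply/eqP; rewrite eq_le le /=; have [->|a0] := eqVneq a 0.
  by rewrite normr0 mul0r.
rewrite mulrC -ler_pdivlMr ?normr_gt0// mulrC -normfV.
by have := le a^-1 (a *: u); rewrite scalerA mulVf// scale1r.
Qed.

Let norm0 u : l2norm u = 0 -> u = 0.
Proof.
move=> u0; apply/val_inj/funext => j; apply/matrixP => i k.
rewrite ord1 mxE; apply/eqP; rewrite -sqrf_eq0 eq_le sqr_ge0 andbT.
have := sqs_norm j.+1 u; rewrite u0 expr0n; apply: le_trans.
by apply: sqs_entry.
Qed.

HB.instance Definition _ :=
  @Lmodule_isNormed.Build R (l2 R N) l2norm normD normZ norm0.

Lemma sqs_le n u : sqs n u <= `|u| ^+ 2.
Proof. exact: sqs_norm. Qed.

Lemma l2_norm_le u M : 0 <= M -> (forall n, sqs n u <= M ^+ 2) -> `|u| <= M.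
Proof. exact: l2norm_le. Qed.

Lemma l2_entry u j i : `|u j i 0| <= `|u|.
Proof.
rewrite -(ler_pXn2r (ltn0Sn 1)) ?nnegrE// real_normK ?num_real//.
by apply: le_trans (sqs_le j.+1 u); exact: sqs_entry.
Qed.

Lemma l2E a u v j i : (a *: u + v) j i 0 = a * u j i 0 + v j i 0.
Proof. by rewrite -[l2val (a *: u + v)]/(a *: l2val u + l2val v) !fctE !mxE. Qed.

Lemma l2ZE a u j i : (a *: u) j i 0 = a * u j i 0.
Proof. by rewrite -[l2val (a *: u)]/(a *: l2val u) !fctE !mxE. Qed.

Lemma l2DE u v j i : (u + v) j i 0 = u j i 0 + v j i 0.
Proof. by rewrite -[l2val (u + v)]/(l2val u + l2val v) !fctE !mxE. Qed.

Lemma l2BE u v j i : (u - v) j i 0 = u j i 0 - v j i 0.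
Proof. by rewrite -[l2val (u - v)]/(l2val u - l2val v) !fctE !mxE. Qed.

Lemma l2P u v : (forall j i, u j i 0 = v j i 0) -> u = v.
Proof.
by move=> h; apply/val_inj/funext => j; apply/matrixP => i k; rewrite ord1 h.
Qed.

Lemma l2_exist (u : nat -> 'cV[R]_N) M : 0 <= M ->
  (forall n, sqs n u <= M ^+ 2) -> exists2 v : l2 R N, l2val v = u & `|v| <= M.
Proof.
move=> M0 h; have hu : u \in @l2set R N by apply/l2setP; exists M.
by exists (MkL2 hu) => //; exact: l2_norm_le.
Qed.

End L2Space.

(** * Completeness of the sequence space *)

Section L2Complete.
Context (R : realType) (N : nat).
Implicit Types (u v : l2 R N) (n j : nat) (i : 'I_N).

Lemma l2_continuous_entry j i : continuous (fun u : l2 R N => u j i 0).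
Proof.
move=> u; apply/(@cvgrPdist_le _ _ _ (nbhs u)) => e e0.
have := @cvgr_dist_le _ _ _ (nbhs u) (nbhs_filter u) id u (@cvg_id _ (nbhs u)) e e0.
by apply: filterS => v uv; rewrite -l2BE (le_trans (l2_entry _ _ _)).
Qed.

(** Entries are 1-Lipschitz, so they converge along the filter. For the sequence [l] of their
    limits, [key] fixes a point x close to the filter and lets the partial sums of x - y, which
    involve finitely many entries, pass to the limit in y. *)
Let l2_complete (F : set_system (l2 R N)) : ProperFilter F -> cauchy F -> cvg F.
Proof.
move=> FF Fc.
have cF e : 0 < e -> exists2 x, True & \forall y \near F, `|x - y| <= e.
  move=> e0; have /cauchyP/(_ e e0)[x hx] := Fc.
  exists x => //; apply: filterS hx => y; rewrite -ball_normE /=; exact: ltW.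
have ce j i : cvg ((fun u : l2 R N => u j i 0) @ F).
  apply: cauchy_cvg; apply/cauchyP => e e0.
  have [x _ hx] := cF (e / 2) (divr_gt0 e0 (ltr0Sn _ _)).
  exists (x j i 0) => /=; rewrite -ball_normE /=; apply: filterS hx => y xy.
  rewrite /= -l2BE (le_lt_trans (l2_entry _ _ _))// (le_lt_trans xy)//; lra.
pose l : nat -> 'cV[R]_N := fun j => \col_i lim ((fun u : l2 R N => u j i 0) @ F).
have key e : 0 < e -> exists x : l2 R N, (\forall y \near F, `|x - y| <= e) /\
    forall n, sqs n ((x : nat -> 'cV[R]_N) - l) <= e ^+ 2.
  move=> e0; have [x _ hx] := cF e e0; exists x; split => // n.
  have c : (fun y : l2 R N => sqs n ((x : nat -> 'cV[R]_N) - l2val y)) @ F -->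
      sqs n ((x : nat -> 'cV[R]_N) - l).
    rewrite /sqs; apply: (cvg_big (op := +%R)) => [|j _]; first exact: add_continuous.
    apply: (cvg_big (op := +%R)) => [|i _]; first exact: add_continuous.
    rewrite !fctE !mxE; under eq_fun do rewrite !fctE !mxE expr2.
    by rewrite expr2; apply: cvgM; apply: cvgB; [exact: cvg_cst|exact: ce|
      exact: cvg_cst|exact: ce].
  apply: (closed_cvg (fun r : R => r <= e ^+ 2)) c; first exact: closed_le.
  apply: filterS hx => y xy; apply: le_trans (sqs_le n (x - y)) _.
  by rewrite ler_pXn2r ?nnegrE// ltW.
have [x0 [_ h0]] := key 1 ltr01.
have hl : l \in @l2set R N.
  apply/l2setP; exists (`|x0| + 1); first by rewrite addr_ge0.
  move=> n; have -> : l = (x0 : nat -> 'cV[R]_N) + (-1 : R) *: ((x0 : nat -> 'cV[R]_N) - l).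
    by apply/funext => j; rewrite !fctE scaleN1r opprB addrCA subrr addr0.
  apply: sqsD => //; first exact: sqs_le.
  by rewrite sqsZ sqrrN expr1n mul1r; have := h0 n; rewrite expr1n.
pose l' : l2 R N := MkL2 hl.
apply/cvg_ex; exists l'; apply/cvgrPdist_le => e e0.
have [x [h1 h2]] := key (e / 2) (divr_gt0 e0 (ltr0Sn _ _)).
apply: filterS h1 => y xy.
have -> : l' - y = (x - y) - (x - l') by rewrite opprB [RHS]addrC subrKA.
rewrite [e]splitr (le_trans (ler_normB _ _))// lerD//.
by apply: l2_norm_le => //; rewrite ltW// divr_gt0.
Qed.

HB.instance Definition _ := Uniform_isComplete.Build (l2 R N) l2_complete.

End L2Complete.

(** * Calculus in one variable *)

Section RealDerivatives.
Context {R : realType}.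
Implicit Types (f g h x : R -> R) (a b t : R).

Lemma is_derive_add f g t a b : is_derive t 1 f a -> is_derive t 1 g b ->
  is_derive t 1 (fun s => f s + g s) (a + b).
Proof. exact: is_deriveD. Qed.

Lemma is_derive_sub f g t a b : is_derive t 1 f a -> is_derive t 1 g b ->
  is_derive t 1 (fun s => f s - g s) (a - b).
Proof. exact: is_deriveB. Qed.

Lemma is_derive_mul f g t a b : is_derive t 1 f a -> is_derive t 1 g b ->
  is_derive t 1 (fun s => f s * g s) (f t * b + g t * a).
Proof. exact: is_deriveM. Qed.

Lemma is_derive_scale (c : R) f t a : is_derive t 1 f a ->
  is_derive t 1 (fun s => c * f s) (c * a).
Proof. exact: is_deriveZ. Qed.

Lemma is_derive_const (c t : R) : is_derive t 1 (fun _ : R => c) (0 : R).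
Proof. exact: is_derive_cst. Qed.

Lemma is_derive_sumR (T : Type) (r : seq T) (F : T -> R -> R) (dF : T -> R) t :
  (forall i, is_derive t 1 (F i) (dF i)) ->
  is_derive t 1 (fun s => \sum_(i <- r) F i s) (\sum_(i <- r) dF i).
Proof.
move=> h; elim: r => [|i r IH].
  rewrite big_nil (_ : (fun _ => _) = cst 0); first exact: is_derive_cst.
  by apply/funext => s; rewrite big_nil.
rewrite big_cons (_ : (fun _ => _) = (fun s => F i s + \sum_(j <- r) F j s)).
  exact: is_derive_add.
by apply/funext => s; rewrite big_cons.
Qed.

Lemma is_derive_expM (c : R) t :
  is_derive t 1 (fun s => expR (c * s)) (c * expR (c * t)).
Proof.
have h : is_derive t 1 (fun s => c * s) c.
  by rewrite -[X in is_derive _ _ _ X]mulr1; exact: is_derive_scale.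
by rewrite mulrC; exact: (@is_derive1_comp _ expR _ t _ _ (is_derive_expR _) h).
Qed.

Lemma is_derive_near f g t a : (\forall s \near t, g s = f s) ->
  is_derive t 1 f a -> is_derive t 1 g a.
Proof.
move=> gf [d e]; apply: DeriveDef.
  apply: (near_eq_derivable _ d); by apply: filterS gf => s ->.
by rewrite -e; exact: near_eq_derive.
Qed.

Lemma is_derive_continuous f t a : is_derive t 1 f a -> {for t, continuous f}.
Proof. by move=> [d _]; apply: differentiable_continuous; exact/derivable1_diffP. Qed.

Lemma derive_ge0_le f df a b : a <= b -> {within `[a, b], continuous f} ->
  (forall t, a < t < b -> is_derive t 1 f (df t)) ->
  (forall t, a < t < b -> 0 <= df t) -> f a <= f b.
Proof.
rewrite le_eqVlt => /predU1P[-> //|ab] cf d d0.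
have dI t : t \in `]a, b[ -> is_derive t 1 f (df t) by rewrite in_itv /= => /d.
have [c cI e] := MVT ab dI cf.
rewrite -subr_ge0 e; apply: mulr_ge0; last by rewrite subr_ge0 ltW.
by apply: d0; move: cI; rewrite in_itv.
Qed.

Lemma primitive_exist h : continuous h -> exists H, H 0 = 0 /\
  forall t, 0 <= t -> is_derive t 1 H (h t).
Proof.
(* The integral starts at -1, which makes 0 an interior point and the derivative there two-sided. *)
move=> ch; pose G t := \int[lebesgue_measure]_(s in [set` Interval (BLeft (-1)) (BRight t)]) h s.
exists (fun t => G t - G 0); split => [|t t0]; first by rewrite subrr.
suff d : is_derive t 1 G (h t).
  by have := is_derive_sub d (is_derive_const (G 0) t); rewrite subr0.
have t1 : t < t + 1 by rewrite ltrDl.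
have ih : lebesgue_measure.-integrable [set` Interval (BLeft (-1)) (BRight (t + 1))]
    (EFin \o h).
  apply: continuous_compact_integrable; first exact: segment_compact.
  exact: continuous_subspaceT.
have lt : (BLeft ((-1)%R : R) < BRight t)%E by rewrite /= lte_fin; lra.
have [d e] := continuous_FTC1 t1 ih lt (ch t).
by apply: DeriveDef; [exact: d|rewrite -derive1E; exact: e].
Qed.

(** Only times t >= 0 matter; composition with [Num.max 0] freezes a curve at its initial value, so
    that all curves are continuous on the whole line. *)
Lemma continuous_pos f : (forall t, 0 <= t -> {for t, continuous f}) ->
  continuous (fun t => f (Num.max 0 t)).
Proof.
move=> cf t; apply: (@continuous_comp _ _ _ (fun t => Num.max 0 t) f).
  by apply: (@continuous_max _ _ (cst 0) id); [exact: cst_continuous|move=> ?].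
by apply: cf; rewrite le_max lexx.
Qed.

Lemma is_derive_pos f t a : 0 < t -> is_derive t 1 f a ->
  is_derive t 1 (fun s => f (Num.max 0 s)) a.
Proof.
move=> t0; apply: is_derive_near; near=> s.
rewrite max_r// ltW//; near: s; exact: lt_nbhsr.
Unshelve. all: by end_near. Qed.

End RealDerivatives.

(** * Scalar linear equations with exponentially bounded source *)

Section ScalarOde.
Context {R : realType}.
Implicit Types (h x : R -> R) (nu rho H K c T t : R).

(* The derivative is not required at the time T, so that two solutions can be
   glued there. *)
Definition solves T nu h x := continuous x /\
  forall t, 0 < t -> t != T -> is_derive t 1 x (nu * x t + h t).

Lemma solvesN T nu h x : solves T nu h x -> solves T nu (fun t => - h t) (fun t => - x t).
Proof.
move=> [cx d]; split; first by move=> t; apply: cvgN; exact: cx.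
move=> t t0 tT; rewrite mulrN -opprD; apply: is_deriveN; exact: d.
Qed.

Lemma solvesB T nu h1 h2 x1 x2 : solves T nu h1 x1 -> solves T nu h2 x2 ->
  solves T nu (fun t => h1 t - h2 t) (fun t => x1 t - x2 t).
Proof.
move=> [c1 d1] [c2 d2]; split; first by move=> t; apply: cvgB; [exact: c1|exact: c2].
move=> t t0 tT; have := is_derive_sub (d1 t t0 tT) (d2 t t0 tT).
by rewrite mulrBr opprD addrACA.
Qed.

(** The derivative of the expression is [expR (- nu * r) * (h r + c * (rho - nu) * expR (rho * r))],
    nonnegative under the bound on h. The interval is cut at T, where differentiability is not
    granted. *)
Lemma solves_mono T nu rho h x c s t : solves T nu h x -> 0 <= s <= t ->
  (forall r, 0 <= r <= t -> `|h r| <= c * (rho - nu) * expR (rho * r)) ->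
  expR (- nu * s) * x s + c * expR ((rho - nu) * s) <=
  expR (- nu * t) * x t + c * expR ((rho - nu) * t).
Proof.
move=> [cx dx] /andP[s0 st] hh.
pose f := fun r => expR (- nu * r) * x r + c * expR ((rho - nu) * r).
pose df := fun r => expR (- nu * r) * (h r + c * (rho - nu) * expR (rho * r)).
have dc (a r : R) : {for r, continuous (fun r => expR (a * r))}.
  exact: is_derive_continuous (is_derive_expM _ _).
have cf : continuous f.
  move=> r; apply: cvgD; apply: cvgM; [exact: dc|exact: cx|exact: cvg_cst|exact: dc].
have df0 r : 0 <= r <= t -> 0 <= df r.
  move=> /hh; rewrite ler_norml => /andP[h1 _].
  by rewrite mulr_ge0 ?expR_ge0// -lerBlDr sub0r.
have d r : 0 < r -> r != T -> is_derive r 1 f (df r).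
  move=> r0 rT; have := is_derive_add
    (is_derive_mul (is_derive_expM (- nu) r) (dx r r0 rT))
    (is_derive_scale c (is_derive_expM (rho - nu) r)).
  move=> /is_derive_eq; apply; rewrite /df.
  have -> : expR ((rho - nu) * r) = expR (- nu * r) * expR (rho * r).
    by rewrite -expRD; congr expR; ring.
  ring.
have piece a b : 0 <= a -> a <= b -> b <= t -> ~~ (a < T < b) -> f a <= f b.
  move=> a0 ab bt Tab; apply: (derive_ge0_le (df := df)) => //.
  - exact: continuous_subspaceT.
  - move=> r /andP[ar rb]; apply: d; first exact: le_lt_trans ar.
    by apply: contraNneq Tab => <-; rewrite ar rb.
  - move=> r /andP[ar rb]; apply: df0; rewrite (le_trans a0 (ltW ar)) /=.
    exact: le_trans (ltW rb) bt.
have [/andP[sT Tt]|] := boolP (s < T < t); last by move=> ?; exact: piece.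
apply: (@le_trans _ _ (f T)); apply: piece => //.
- exact: ltW.
- exact: ltW.
- by rewrite ltxx andbF.
- exact: le_trans s0 (ltW sT).
- exact: ltW.
- by rewrite ltxx.
Qed.

(** For a rate below that of the weight, [solves_mono] with [c = H / (rho - nu)], applied to x and
    to - x, compares the solution with its initial value. *)
Lemma solves_low T nu rho h x H t : nu < rho -> solves T nu h x -> 0 <= t ->
  (forall r, 0 <= r <= t -> `|h r| <= H * expR (rho * r)) ->
  `|x t| <= (`|x 0| + H / (rho - nu)) * expR (rho * t).
Proof.
move=> nr sx t0 hh; have r0 : 0 < rho - nu by rewrite subr_gt0.
have H0 : 0 <= H.
  have := le_trans (normr_ge0 _) (hh 0 _); rewrite lexx t0 mulr0 expR0 mulr1.
  by move=> ->.
suff up y g : solves T nu g y -> `|y 0| = `|x 0| ->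
    (forall r, 0 <= r <= t -> `|g r| <= H * expR (rho * r)) ->
    - y t <= (`|x 0| + H / (rho - nu)) * expR (rho * t).
  rewrite ler_norml; apply/andP; split.
    by rewrite lerNl; exact: (up x h).
  rewrite -[x t]opprK; apply: (up (fun t => - x t) _ (solvesN sx)).
    by rewrite normrN.
  by move=> r /hh; rewrite normrN.
move=> sy y0 gh; have := @solves_mono T nu rho g y (H / (rho - nu)) 0 t sy.
rewrite lexx t0 => /(_ isT); rewrite !mulr0 expR0 !(mulr1, mul1r) => mono.
have {}mono := mono _; rewrite divfK ?gt_eqF// in mono; have {gh}mono := mono gh.
have e1 : expR (rho * t) = expR (nu * t) * expR ((rho - nu) * t).
  by rewrite -expRD; congr expR; ring.
have e2 : expR (nu * t) * expR (- nu * t) = 1.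
  by rewrite -expRD mulNr subrr expR0.
have p := expR_gt0 (nu * t).
have h1 : - y t <= expR (nu * t) * (- y 0) + H / (rho - nu) * (expR (rho * t) - expR (nu * t)).
  rewrite e1; move: mono; rewrite -(ler_pM2l p) !mulrDr [_ * (expR (- nu * t) * _)]mulrA e2 mul1r; lra.
have ny : - y 0 <= `|x 0| by rewrite -y0 -normrN ler_norm.
have le : expR (nu * t) <= expR (rho * t).
  by rewrite ler_expR ler_wpM2r// ltW.
have q0 : 0 <= H / (rho - nu) by rewrite divr_ge0// ltW.
apply: le_trans h1 _; rewrite mulrDl; apply: lerD.
  apply: (@le_trans _ _ (expR (nu * t) * `|x 0|)); first by rewrite ler_pM2l.
  by rewrite mulrC ler_wpM2l.
by rewrite ler_wpM2l// gerBl ltW.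
Qed.

Lemma expR_decay (a e : R) : a < 0 -> 0 < e -> exists2 s0 : R, 0 <= s0 &
  forall s, s0 <= s -> expR (a * s) <= e.
Proof.
move=> a0 e0; exists (`|ln e / a|) => // s hs.
rewrite -[leRHS]lnK ?posrE// ler_expR -ler_ndivrMl//.
by rewrite mulrC (le_trans _ hs)// ler_norm.
Qed.

(** For a rate above that of the weight the initial value is not free. In the variable
    [expR (- nu * t) * x t] an excess over the bound would persist at all later times, whereas the
    growth bound K forces that variable to 0. The size of K disappears from the conclusion. *)
Lemma solves_high T nu rho h x H K t : rho < nu -> solves T nu h x -> 0 <= t ->
  (forall r, 0 <= r -> `|h r| <= H * expR (rho * r)) ->
  (forall r, 0 <= r -> `|x r| <= K * expR (rho * r)) ->
  `|x t| <= H / (nu - rho) * expR (rho * t).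
Proof.
move=> rn sx t0 hh xK; have r0 : 0 < nu - rho by rewrite subr_gt0.
have H0 : 0 <= H.
  have := le_trans (normr_ge0 _) (hh 0 _); rewrite mulr0 expR0 mulr1.
  by apply.
have K0 : 0 <= K.
  have := le_trans (normr_ge0 _) (xK 0 _); rewrite mulr0 expR0 mulr1.
  by apply.
suff up y g : solves T nu g y ->
    (forall r, 0 <= r -> `|y r| <= K * expR (rho * r)) ->
    (forall r, 0 <= r -> `|g r| <= H * expR (rho * r)) ->
    y t <= H / (nu - rho) * expR (rho * t).
  rewrite ler_norml; apply/andP; split; last exact: (up x h).
  rewrite lerNl; apply: (up (fun t => - x t) _ (solvesN sx)).
    by move=> r /xK; rewrite normrN.
  by move=> r /hh; rewrite normrN.
move=> sy yK gH; have p := expR_gt0 (nu * t).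
have e1 : expR (rho * t) = expR (nu * t) * expR ((rho - nu) * t).
  by rewrite -expRD; congr expR; ring.
have e2 : expR (nu * t) * expR (- nu * t) = 1.
  by rewrite -expRD mulNr subrr expR0.
suff : expR (- nu * t) * y t + - (H / (nu - rho)) * expR ((rho - nu) * t) <= 0.
  by rewrite -(ler_pM2l p) mulr0 e1 mulrDr [_ * (expR (- nu * t) * _)]mulrA e2 mul1r; lra.
rewrite leNgt; apply/negP => e0; set e := (X in 0 < X) in e0.
have K1 : 0 < K + 1 by rewrite ltr_wpDl.
have rn0 : rho - nu < 0 by rewrite subr_lt0.
have ek : 0 < e / 2 / (K + 1) by rewrite !divr_gt0.
have [s0 s00 hs0] := expR_decay rn0 ek; pose s := Num.max s0 t.
have hs : expR ((rho - nu) * s) <= e / 2 / (K + 1).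
  by apply: hs0; rewrite le_max lexx.
have st : t <= s by rewrite le_max lexx orbT.
have s1 : 0 <= s by exact: le_trans st.
have := @solves_mono T nu rho g y (- (H / (nu - rho))) t s sy.
rewrite t0 st => /(_ isT) mono.
have {}mono := mono _; rewrite -/e in mono.
have {}mono : e <= expR (- nu * s) * y s + - (H / (nu - rho)) * expR ((rho - nu) * s).
  apply: mono => r /andP[r1 _]; rewrite mulNr -mulrN opprB divfK ?gt_eqF//.
  exact: gH.
have : expR (- nu * s) * y s <= K * expR ((rho - nu) * s).
  have -> : expR ((rho - nu) * s) = expR (- nu * s) * expR (rho * s).
    by rewrite -expRD; congr expR; ring.
  rewrite mulrCA ler_wpM2l ?expR_ge0//.
  exact: le_trans (ler_norm _) (yK s s1).
have : K * expR ((rho - nu) * s) <= e / 2.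
  apply: (@le_trans _ _ ((K + 1) * expR ((rho - nu) * s))).
    by rewrite ler_wpM2r ?expR_ge0// lerDl.
  by rewrite mulrC -ler_pdivlMr.
have : 0 <= H / (nu - rho) * expR ((rho - nu) * s).
  by rewrite mulr_ge0 ?expR_ge0// divr_ge0// ltW.
move: mono e0; rewrite mulNr; clearbody e; lra.
Qed.

Lemma solves_exp_primitive T nu h P c : (forall t, 0 <= t ->
    is_derive t 1 P (expR (- nu * t) * h t)) ->
  solves T nu h (fun t => expR (nu * Num.max 0 t) * (P (Num.max 0 t) - c)).
Proof.
move=> dP; pose X t := expR (nu * t) * (P t - c).
have dX t : 0 <= t -> is_derive t 1 X (nu * X t + h t).
  move=> t0; have := is_derive_mul (is_derive_expM nu t)
    (is_derive_sub (dP t t0) (is_derive_const c t)).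
  move=> /is_derive_eq; apply; rewrite subr0 mulrA -expRD mulNr subrr expR0 /X /=.
  ring.
split; first by apply: (continuous_pos (f := X)) => t /dX /is_derive_continuous.
move=> t t0 _; rewrite -/(X (Num.max 0 t)) max_r ?ltW//.
by apply: (is_derive_pos (f := X)) => //; exact: dX (ltW t0).
Qed.

Let primE nu h : continuous h -> exists P : R -> R, P 0 = 0 /\
  forall t, 0 <= t -> is_derive t 1 P (expR (- nu * t) * h t).
Proof.
move=> ch; apply: (@primitive_exist _ (fun t => expR (- nu * t) * h t)) => t.
apply: cvgM; last exact: ch.
exact: is_derive_continuous (is_derive_expM _ _).
Qed.

Lemma solves_low_exist nu h (x0 : R) : continuous h ->
  exists2 x, (forall T, solves T nu h x) & x 0 = x0 /\ forall t, t <= 0 -> x t = x0.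
Proof.
move=> /(primE nu)[P [P0 dP]].
exists (fun t => expR (nu * Num.max 0 t) * (P (Num.max 0 t) - (- x0))).
  by move=> T; exact: solves_exp_primitive.
have e t : t <= 0 -> expR (nu * Num.max 0 t) * (P (Num.max 0 t) - - x0) = x0.
  by move=> t0; rewrite max_l// mulr0 expR0 P0 mul1r opprK add0r.
by split; first exact: e.
Qed.

Lemma solves_high_exist nu rho h H : rho < nu -> continuous h ->
  (forall r, 0 <= r -> `|h r| <= H * expR (rho * r)) ->
  exists2 x, (forall T, solves T nu h x) &
    (forall t, `|x t| <= H / (nu - rho) * expR (rho * Num.max 0 t)) /\
    forall t, t <= 0 -> x t = x 0.
Proof.
move=> rn ch hH; have [P [P0 dP]] := primE nu ch.
have r0 : 0 < nu - rho by rewrite subr_gt0.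
pose c0 := H / (nu - rho).
have sP T : solves T 0 (fun t => expR (- nu * Num.max 0 t) * h (Num.max 0 t))
    (fun t => P (Num.max 0 t)).
  split; first by apply: continuous_pos => t /dP /is_derive_continuous.
  move=> t t0 _; rewrite mul0r add0r max_r ?ltW//.
  by apply: is_derive_pos => //; exact: dP (ltW t0).
have gH r : 0 <= r -> `|expR (- nu * Num.max 0 r) * h (Num.max 0 r)| <=
    - c0 * (rho - nu - 0) * expR ((rho - nu) * r).
  move=> r1; rewrite max_r// normrM ger0_norm ?expR_ge0//.
  rewrite subr0 [- c0 * _]mulNr -mulrN opprB divfK ?gt_eqF//.
  have -> : expR ((rho - nu) * r) = expR (- nu * r) * expR (rho * r).
    by rewrite -expRD; congr expR; ring.
  by rewrite [leRHS]mulrCA ler_wpM2l ?expR_ge0// hH.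
have E t : expR (- 0 * t) = 1 :> R by rewrite oppr0 mul0r expR0.
have A s t : 0 <= s <= t -> P s - c0 * expR ((rho - nu) * s) <=
    P t - c0 * expR ((rho - nu) * t).
  move=> st; have /andP[s1 s2] := st.
  have := solves_mono (sP 0) st (c := - c0) (rho := rho - nu).
  rewrite !E !mul1r !subr0 !max_r ?(le_trans s1 s2)// ![- c0 * _]mulNr; apply => r /andP[r1 _].
  by have := gH r r1; rewrite subr0 [- c0 * _]mulNr.
have B s t : 0 <= s <= t -> P t + c0 * expR ((rho - nu) * t) <=
    P s + c0 * expR ((rho - nu) * s).
  move=> st; have /andP[s1 s2] := st.
  have := solves_mono (solvesN (sP 0)) st (c := - c0) (rho := rho - nu).
  rewrite !E !mul1r !subr0 !max_r ?(le_trans s1 s2)// !mulNr -!opprD lerN2.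
  apply => r /andP[r1 _].
  by have := gH r r1; rewrite subr0 [- c0 * _]mulNr normrN.
have c00 : 0 <= c0.
  have := le_trans (normr_ge0 _) (hH 0 (lexx _)); rewrite mulr0 expR0 mulr1 => H0.
  by rewrite divr_ge0// ltW.
have AB s t : 0 <= s -> 0 <= t -> P s - c0 * expR ((rho - nu) * s) <=
    P t + c0 * expR ((rho - nu) * t).
  move=> s1 t1; have m1 : s <= Num.max s t by rewrite le_max lexx.
  have m2 : t <= Num.max s t by rewrite le_max lexx orbT.
  apply: le_trans (A s (Num.max s t) _) _; first by rewrite s1.
  apply: le_trans (B t (Num.max s t) _); last by rewrite t1.
  by rewrite lerD2l -subr_ge0 opprK -mulr2n mulrn_wge0// mulr_ge0 ?expR_ge0.
(* By [A] and [B] the intervals of centre [P t] and radius [c0 * expR ((rho - nu) * t)] are nested,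
   and they shrink to the value of P at infinity. That value, [sup S], is the constant of
   integration that cancels the growing exponential. *)
pose S := [set P s - c0 * expR ((rho - nu) * s) | s in [set s | 0 <= s]].
have hS : has_sup S.
  split; first by exists (P 0 - c0 * expR ((rho - nu) * 0)); exists 0 => //=.
  exists (P 0 + c0 * expR ((rho - nu) * 0)) => _ [s /= s1 <-]; exact: AB.
have hc t : 0 <= t -> `|P t - sup S| <= c0 * expR ((rho - nu) * t).
  move=> t1; rewrite ler_distl; apply/andP; split.
    by rewrite lerBlDr; apply: ge_sup; [case: hS|move=> _ [s /= s1 <-]; exact: AB].
  by rewrite -lerBlDr; apply: sup_ubound; [case: hS|exists t].
exists (fun t => expR (nu * Num.max 0 t) * (P (Num.max 0 t) - sup S)).
  by move=> T; exact: solves_exp_primitive.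
split => [t|t t1]; last by rewrite max_l// max_l.
have m0 : 0 <= Num.max 0 t by rewrite le_max lexx.
rewrite normrM ger0_norm ?expR_ge0//.
have -> : expR (rho * Num.max 0 t) = expR (nu * Num.max 0 t) * expR ((rho - nu) * Num.max 0 t).
  by rewrite -expRD; congr expR; ring.
by rewrite mulrCA ler_wpM2l ?expR_ge0// hc.
Qed.

End ScalarOde.

(** * Geometric convergence and fixed points of curves *)

Section Contraction.
Context {R : realType}.
Implicit Types (q C e : R) (n k : nat).

Lemma geometric_small q C e : 0 <= q < 1 -> 0 < e -> exists n, C * q ^+ n <= e.
Proof.
move=> /andP[q0 q1] e0.
have c : geometric C q @ \oo --> (0 : R) by apply: cvg_geometric; rewrite ger0_norm.
have /cvgrPdist_le/(_ e e0)[n _ /(_ n (leqnn _))] := c.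
by rewrite sub0r normrN => h; exists n; apply: le_trans h; exact: ler_norm.
Qed.

(** Stands in for passages to the limit: the compared quantities are fixed and the error is
    geometric in n. *)
Lemma le_geometric (a b C q : R) : 0 <= q < 1 -> (forall n, a <= b + C * q ^+ n) -> a <= b.
Proof.
move=> q01 h; apply/ler_addgt0Pr => e e0.
have [n hn] := geometric_small C q01 e0.
by apply: le_trans (h n) _; rewrite lerD2l.
Qed.

Lemma cvg_geometric_dist (V : completeNormedModType R) (x : nat -> V) C q :
  0 <= q < 1 -> (forall n, `|x n.+1 - x n| <= C * q ^+ n) ->
  exists l, forall n, `|l - x n| <= C / (1 - q) * q ^+ n.
Proof.
move=> q01 hx; have /andP[q0 q1] := q01.
have p : 0 < 1 - q by rewrite subr_gt0.
have C0 : 0 <= C.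
  by have := le_trans (normr_ge0 _) (hx 0%N); rewrite expr0 mulr1.
pose D := C / (1 - q); have D0 : 0 <= D by rewrite divr_ge0// ltW.
have dist n k : `|x (n + k)%N - x n| <= D * q ^+ n.
  suff : `|x (n + k)%N - x n| <= D * (q ^+ n - q ^+ (n + k)).
    move=> /le_trans; apply; rewrite ler_wpM2l// gerBl exprn_ge0//.
  elim: k => [|k IH]; first by rewrite addn0 !subrr normr0 mulr0.
  rewrite -(subrKA (x (n + k)%N)) (le_trans (ler_normD _ _))// addnS.
  apply: le_trans (lerD (hx _) IH) _.
  apply: eqle; rewrite /D exprS.
  by field; rewrite gt_eqF.
have cx : cvg (x @ \oo).
  apply/cauchy_cvgP/cauchyP => e e0.
  have e2 : 0 < e / 2 by rewrite divr_gt0.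
  have [n hn] := geometric_small D q01 e2.
  exists (x n); exists n => // k /= nk.
  rewrite -ball_normE /= distrC -(subnKC nk).
  apply: le_lt_trans (dist _ _) _; apply: le_lt_trans hn _.
  by rewrite ltr_pdivrMr// ltr_pMr// ltr1n.
exists (lim (x @ \oo)) => n.
have c : (fun k => `|x k - x n|) @ \oo --> `|lim (x @ \oo) - x n|.
  by apply: cvg_norm; apply: cvgB => //; exact: cvg_cst.
apply: (closed_cvg (fun r : R => r <= D * q ^+ n)) c; first exact: closed_le.
by exists n => // k /= nk; rewrite -(subnKC nk).
Qed.

Definition cgrow (V : normedModType R) (w : R -> R) (x : R -> V) :=
  continuous x /\ exists K, forall t, `|x t| <= K * w t.

Lemma cgrowB (V : normedModType R) (w : R -> R) (x y : R -> V) :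
  cgrow w x -> cgrow w y -> cgrow w (fun t => x t - y t).
Proof.
move=> [cx [K hK]] [cy [J hJ]]; split.
  by move=> t; apply: cvgB; [exact: cx|exact: cy].
exists (K + J) => t; rewrite (le_trans (ler_normB _ _))// mulrDl lerD//.
Qed.

(** Banach's theorem without building the weighted function space: the iterates of 0 converge
    pointwise, at a geometric rate relative to w. As w is locally bounded the convergence is locally
    uniform, hence the limit is continuous. *)
Lemma fixed_curve (V : completeNormedModType R) (w : R -> R) q (T : (R -> V) -> R -> V) :
  (forall t, 0 < w t) -> continuous w -> 0 <= q < 1 ->
  (forall x, cgrow w x -> cgrow w (T x)) ->
  (forall x y K, cgrow w x -> cgrow w y -> (forall t, `|x t - y t| <= K * w t) ->
     forall t, `|T x t - T y t| <= q * K * w t) ->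
  exists2 x, cgrow w x & T x = x.
Proof.
move=> w0 cw q01 Tg Tc; have /andP[q0 q1] := q01.
pose x n := iter n T (fun=> 0).
have gx n : cgrow w (x n).
  elim: n => [|n IH]; last by rewrite /x iterS; exact: Tg.
  split; first exact: cst_continuous.
  by exists 0 => t; rewrite normr0 mul0r.
have [_ [K0 hK0]] := gx 1%N.
have dx n t : `|x n.+1 t - x n t| <= K0 * q ^+ n * w t.
  elim: n t => [|n IH] t; first by rewrite expr0 mulr1 /x /= subr0 hK0.
  rewrite exprS mulrCA; exact: (Tc (x n.+1) (x n) _ (gx _) (gx _) IH t).
have lx t : exists l, forall n, `|l - x n t| <= K0 * w t / (1 - q) * q ^+ n.
  by apply: cvg_geometric_dist => // n; rewrite mulrAC.
have [y hy] := choice lx.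
have yx n t : `|y t - x n t| <= K0 / (1 - q) * q ^+ n * w t.
  rewrite (_ : _ * w t = K0 * w t / (1 - q) * q ^+ n) ?hy//; ring.
have gy : cgrow w y.
  split; last first.
    exists (K0 / (1 - q)) => t; have := yx 0%N t.
    by rewrite expr0 mulr1 /x /= subr0.
  move=> t; apply/(@cvgrPdist_le _ _ _ (nbhs t)) => e e0.
  have e3 : 0 < e / 3 by rewrite divr_gt0.
  (* [w t + 1] dominates w near t, so that a single index n serves for all s near t. *)
  have [n hn] := geometric_small (K0 / (1 - q) * (w t + 1)) q01 e3.
  have {}hn s : w s <= w t + 1 -> `|y s - x n s| <= e / 3.
    move=> ws; apply: le_trans (yx n s) _; apply: le_trans hn.
    rewrite mulrAC ler_wpM2r ?exprn_ge0// ler_wpM2l//.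
    have := le_trans (normr_ge0 _) (yx 0%N t); rewrite expr0 mulr1.
    by rewrite pmulr_lge0.
  near=> s.
  have -> : y t - y s = (y t - x n t) + (x n t - x n s) - (y s - x n s).
    by rewrite subrKA opprB subrKA.
  have h1 : `|y t - x n t| <= e / 3 by apply: hn; rewrite lerDl.
  have h2 : `|x n t - x n s| <= e / 3.
    by near: s; apply: (@cvgr_dist_le _ _ _ (nbhs t)) => //; case: (gx n) => c _; exact: c.
  have h3 : `|y s - x n s| <= e / 3.
    apply: hn; rewrite -lerBlDl (le_trans (ler_norm _))// distrC.
    by near: s; apply: (@cvgr_dist_le _ _ _ (nbhs t)) => //; exact: cw.
  apply: (le_trans (ler_normB _ _)); apply: (le_trans (lerD (ler_normD _ _) (lexx _))).
  by lra.
exists y => //; apply/funext => t; apply/eqP; rewrite -subr_eq0 -normr_le0.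
apply: (@le_geometric _ _ (2 * (K0 / (1 - q) * w t)) q q01) => n; rewrite add0r.
have h1 : `|T y t - x n.+1 t| <= q * (K0 / (1 - q) * q ^+ n) * w t.
  exact: (Tc y (x n) _ gy (gx n) (yx n) t).
have h2 := yx n.+1 t.
have -> : T y t - y t = (T y t - x n.+1 t) - (y t - x n.+1 t) by rewrite opprB subrKA.
apply: (le_trans (ler_normB _ _)); apply: (le_trans (lerD h1 h2)).
have K00 : 0 <= K0 / (1 - q) * w t.
  by have := le_trans (normr_ge0 _) (yx 0%N t); rewrite expr0 mulr1.
have -> : q * (K0 / (1 - q) * q ^+ n) * w t + K0 / (1 - q) * q ^+ n.+1 * w t
  = 2 * (K0 / (1 - q) * w t) * q ^+ n * q by rewrite exprS; ring.
by rewrite ler_piMr ?(ltW q1)// mulr_ge0 ?exprn_ge0// mulr_ge0.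
Unshelve. all: by end_near. Qed.

End Contraction.

(** * Lyapunov-Perron estimates for diagonal systems *)

Section Modes.
Context {R : realType} {N : nat}.
Local Notation V := (l2 R N).
Implicit Types (nu l a : nat -> R) (x y z : R -> V) (h : R -> nat -> 'I_N -> R).
Implicit Types (p : V) (n j : nat) (i : 'I_N) (A K kappa rho T t : R).

(** Square-summability of the gains, each of the [N] components of mode j having gain [a j]. With
    [a j] equal to [l j] divided by the distance from [nu j] to the rate, a small [kappa] is the
    spectral gap condition. *)
Definition wsum a kappa := forall n, \sum_(j < n) N%:R * a j ^+ 2 <= kappa ^+ 2.

Lemma sqs_dom n (u v : nat -> 'cV[R]_N) :
  (forall j i, `|u j i 0| <= `|v j i 0|) -> sqs n u <= sqs n v.
Proof.
move=> h; apply: ler_sum => j _; apply: ler_sum => i _.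
by rewrite -[u _ _ _ ^+ 2]real_normK ?num_real// -[v _ _ _ ^+ 2]real_normK ?num_real// ler_pXn2r ?nnegrE.
Qed.

Lemma sqs_cst n a (c : R) : sqs n (fun j => \col_(i < N) (a j * c)) =
  c ^+ 2 * \sum_(j < n) N%:R * a j ^+ 2.
Proof.
rewrite /sqs mulr_sumr; apply: eq_bigr => j _.
under eq_bigr do rewrite mxE.
by rewrite sumr_const card_ord exprMn -mulr_natl; ring.
Qed.

Lemma l2_dominated (u : nat -> 'cV[R]_N) p a kappa (c : R) : 0 <= kappa -> 0 <= c ->
  wsum a kappa -> (forall j i, `|u j i 0| <= `|p j i 0| + a j * c) ->
  exists2 v : V, l2val v = u & `|v| <= `|p| + kappa * c.
Proof.
move=> k0 c0 ak h; apply: l2_exist; first by rewrite addr_ge0// mulr_ge0.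
move=> n; pose b : nat -> 'cV[R]_N := fun j => \col_i `|p j i 0|.
apply: (@le_trans _ _ (sqs n (b + (fun j => \col_(i < N) (a j * c))))).
  apply: sqs_dom => j i; rewrite !fctE !mxE (le_trans (h _ _))//.
  exact: ler_norm.
apply: sqsD => //; first by rewrite mulr_ge0.
  apply: le_trans (sqs_le n p); apply: sqs_dom => j i.
  by rewrite mxE normr_id.
by rewrite sqs_cst mulrC exprMn ler_wpM2r ?sqr_ge0.
Qed.

Lemma l2_norm_dom (v p : V) a kappa (c : R) : 0 <= kappa -> 0 <= c ->
  wsum a kappa -> (forall j i, `|v j i 0| <= `|p j i 0| + a j * c) ->
  `|v| <= `|p| + kappa * c.
Proof.
by move=> k0 c0 ak /(l2_dominated k0 c0 ak)[v' /val_inj ->].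
Qed.

Lemma l2_norm_dom0 (v : V) a kappa (c : R) : 0 <= kappa -> 0 <= c ->
  wsum a kappa -> (forall j i, `|v j i 0| <= a j * c) -> `|v| <= kappa * c.
Proof.
move=> k0 c0 ak h; rewrite -[leRHS]add0r -(@normr0 _ V).
apply: (l2_norm_dom k0 c0 ak) => j i; rewrite (le_trans (h j i))// lerDr//.
Qed.

Lemma l2_norm_mono (v p : V) : (forall j i, `|v j i 0| <= `|p j i 0|) -> `|v| <= `|p|.
Proof.
by move=> h; apply: l2_norm_le => // n; apply: le_trans (sqs_le n p); exact: sqs_dom.
Qed.

Lemma l2_tail p (d : R) : 0 < d -> exists n, forall m, (n <= m)%N ->
  sqs m p <= sqs n p + d.
Proof.
move=> d0; pose S := range (fun n => sqs n p).
have hS : has_sup S.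
  split; first by exists (sqs 0 p); exists 0%N.
  by exists (`|p| ^+ 2) => _ [n _ <-]; exact: sqs_le.
have [_ [n _ <-] hn] := sup_adherent d0 hS.
exists n => m _; rewrite -lerBlDr; apply: le_trans (ltW hn).
by rewrite lerD2r; apply: sup_ubound; [case: hS|exists m].
Qed.

(** Dominated convergence: finitely many entries are continuous, and the tail of [y t - y s] is
    controlled by the tail of p, uniformly for s near t because w is locally bounded. *)
Lemma curve_continuous y p (w : R -> R) : (forall j i, continuous (fun t => y t j i 0)) ->
  continuous w -> (forall t, 0 <= w t) ->
  (forall t j i, `|y t j i 0| <= `|p j i 0| * w t) -> continuous y.
Proof.
move=> cy cw w0 hy t; apply/(@cvgrPdist_le _ _ _ (nbhs t)) => e e0.
pose C := w t + 1; have C0 : 0 < C by rewrite ltr_wpDl.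
pose d := (e ^+ 2 / 2) / (2 * C) ^+ 2.
have C2 : 0 < (2 * C) ^+ 2 by rewrite exprn_gt0// mulr_gt0.
have d0 : 0 < d by rewrite divr_gt0// divr_gt0// exprn_gt0.
have [n hn] := l2_tail p d0.
have cn : (fun s => sqs n (y t - y s)) @ t --> sqs n (y t - y t).
  rewrite /sqs; apply: (cvg_big (op := +%R)) => [|j _]; first exact: add_continuous.
  apply: (cvg_big (op := +%R)) => [|i _]; first exact: add_continuous.
  under eq_fun do rewrite l2BE expr2; rewrite l2BE expr2.
  by apply: cvgM; apply: cvgB; [exact: cvg_cst|exact: cy|exact: cvg_cst|exact: cy].
have s0 : sqs n (y t - y t) = 0.
  rewrite /sqs big1// => j _; rewrite big1// => i _.
  by rewrite l2BE subrr expr0n.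
rewrite s0 in cn; near=> s.
have h1 : sqs n (y t - y s) <= e ^+ 2 / 2.
  apply: le_trans (ler_norm _) _; rewrite -normrN -sub0r.
  by near: s; apply: (@cvgr_dist_le _ _ _ (nbhs t)) => //; rewrite divr_gt0// exprn_gt0.
have h2 : w s <= C.
  rewrite -lerBlDl (le_trans (ler_norm _))// distrC.
  by near: s; apply: (@cvgr_dist_le _ _ _ (nbhs t)) => //; exact: cw.
apply: l2_norm_le; first exact: ltW.
move=> m; have [mn|nm] := leqP m n.
  apply: le_trans (sqs_homo _ mn) _; apply: le_trans h1 _.
  by rewrite ler_pdivrMr// ler_peMr ?sqr_ge0// ler1n.
have hd j i : (y t - y s) j i 0 ^+ 2 <= (2 * C) ^+ 2 * p j i 0 ^+ 2.
  rewrite -exprMn -[leLHS]real_normK ?num_real// -[leRHS]real_normK ?num_real//.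
  rewrite ler_pXn2r ?nnegrE// l2BE normrM [`|2 * C|]gtr0_norm ?mulr_gt0//.
  apply: (le_trans (ler_normB _ _)).
  apply: (@le_trans _ _ (`|p j i 0| * C + `|p j i 0| * C)); last by lra.
  rewrite lerD//; apply: (le_trans (hy _ _ _)); rewrite ler_wpM2l//.
  by rewrite lerDl.
have : sqs m (y t - y s) - sqs n (y t - y s) <= (2 * C) ^+ 2 * (sqs m p - sqs n p).
  elim: m nm => // m IH; rewrite ltnS leq_eqVlt => /predU1P[<-|/IH {}IH].
    rewrite !sqsS !(addrC (sqs n _)) !addrK mulr_sumr.
    by apply: ler_sum => i _; exact: hd.
  rewrite !sqsS.
  have : \sum_(i < N) (y t - y s) m i 0 ^+ 2 <= (2 * C) ^+ 2 * \sum_(i < N) p m i 0 ^+ 2.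
    by rewrite mulr_sumr; apply: ler_sum => i _; exact: hd.
  by rewrite !mulrBr !mulrDr in IH *; lra.
have : (2 * C) ^+ 2 * (sqs m p - sqs n p) <= e ^+ 2 / 2.
  apply: (@le_trans _ _ ((2 * C) ^+ 2 * d)).
    by rewrite ler_wpM2l ?(ltW C2)// lerBlDl hn// ltnW.
  by rewrite /d mulrC divfK ?gt_eqF.
lra.
Unshelve. all: by end_near. Qed.

Definition msolves T nu h x := forall j i,
  solves T (nu j) (fun t => h t j i) (fun t => x t j i 0).

Lemma msolvesB T nu h1 h2 x1 x2 : msolves T nu h1 x1 -> msolves T nu h2 x2 ->
  msolves T nu (fun t j i => h1 t j i - h2 t j i) (fun t => x1 t - x2 t).
Proof.
move=> s1 s2 j i; have := solvesB (s1 j i) (s2 j i).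
by congr solves; apply/funext => t; rewrite l2BE.
Qed.

Section Bound.
Variables (nu l : nat -> R) (rho kappa : R).
Hypotheses (nu_rho : forall j, nu j != rho) (kappa0 : 0 <= kappa).
Hypothesis (hk : wsum (fun j => l j / `|nu j - rho|) kappa).

Lemma modes_bound T h x p A : 0 <= A -> msolves T nu h x ->
  (forall j i, rho < nu j -> exists K, forall t, 0 <= t -> `|x t j i 0| <= K * expR (rho * t)) ->
  (forall t j i, 0 <= t -> `|h t j i| <= l j * A * expR (rho * t)) ->
  (forall j i, nu j < rho -> `|x 0 j i 0| <= `|p j i 0|) ->
  forall t, 0 <= t -> `|x t| <= (`|p| + kappa * A) * expR (rho * t).
Proof.
move=> A0 sx gx hh x0 t t0; have e0 := expR_gt0 (rho * t).
have -> : (`|p| + kappa * A) * expR (rho * t) = `|expR (rho * t) *: p| + kappa * (A * expR (rho * t)).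
  by rewrite normrZ gtr0_norm// mulrDl mulrA [`|p| * _]mulrC.
apply: (l2_norm_dom kappa0 _ hk); first by rewrite mulr_ge0 ?(ltW e0).
move=> j i; rewrite l2ZE normrM gtr0_norm//.
have [nr|nr|e] := ltgtP (nu j) rho; last by have := nu_rho j; rewrite e eqxx.
  apply: le_trans (solves_low nr (sx j i) t0 (H := l j * A) _) _.
    by move=> r /andP[r0 _]; exact: hh.
  rewrite mulrDl [expR _ * _]mulrC; apply: lerD; first by rewrite ler_wpM2r ?(ltW e0)// x0.
  by apply: eqle; rewrite ltr0_norm ?subr_lt0// opprB; ring.
have [K hK] := gx j i nr.
apply: le_trans (solves_high nr (sx j i) t0 (H := l j * A) (K := K) _ hK) _.
  by move=> r r0; exact: hh.
rewrite [`|nu j - rho|]gtr0_norm ?subr_gt0// -[leLHS]add0r lerD ?mulr_ge0 ?(ltW e0)//.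
by apply: eqle; ring.
Qed.

(* Iterating [modes_bound] improves any growth bound on x. *)
Lemma modes_apriori T h x p A K0 : 0 <= A -> kappa < 1 -> msolves T nu h x ->
  (forall t, 0 <= t -> `|x t| <= K0 * expR (rho * t)) ->
  (forall t j i, 0 <= t -> `|h t j i| <= l j * (A * expR (rho * t) + `|x t|)) ->
  (forall j, 0 <= l j) ->
  (forall j i, nu j < rho -> `|x 0 j i 0| <= `|p j i 0|) ->
  forall t, 0 <= t -> `|x t| <= (`|p| + kappa * A) / (1 - kappa) * expR (rho * t).
Proof.
move=> A0 k1 sx gx hh l0 x0 t t0.
have p1 : 0 < 1 - kappa by rewrite subr_gt0.
pose B := (`|p| + kappa * A) / (1 - kappa).
have B0 : 0 <= B by rewrite divr_ge0 ?(ltW p1)// addr_ge0// mulr_ge0.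
have K00 : 0 <= K0.
  by have := le_trans (normr_ge0 _) (gx 0 (lexx _)); rewrite mulr0 expR0 mulr1.
have it n : forall s, 0 <= s -> `|x s| <= (B + K0 * kappa ^+ n) * expR (rho * s).
  elim: n => [|n IH] s s0.
    rewrite expr0 mulr1 (le_trans (gx s s0))// ler_wpM2r ?expR_ge0// lerDr//.
  have A1 : 0 <= A + (B + K0 * kappa ^+ n).
    by rewrite !addr_ge0// mulr_ge0// exprn_ge0.
  apply: le_trans (modes_bound (p := p) A1 sx _ _ x0 s0) _.
  - move=> j i _; exists K0 => r /gx; apply: le_trans; exact: l2_entry.
  - move=> r j i r0; apply: le_trans (hh r j i r0) _; rewrite -mulrA ler_wpM2l//.
    by rewrite mulrDl lerD2l IH.
  rewrite ler_wpM2r ?expR_ge0// exprS; apply: eqle.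
  by rewrite /B; field; rewrite gt_eqF.
apply: (@le_geometric _ _ _ (K0 * expR (rho * t)) kappa); first by rewrite kappa0.
by move=> n; apply: le_trans (it n t t0) _; rewrite mulrDl lerD2l mulrAC.
Qed.

(** Low modes are integrated from 0 starting at p, each high mode takes its solution of admissible
    growth. The vector of the bounds found entry by entry lies in [l2] and dominates the whole
    curve, which gives both membership and continuity. *)
Lemma modes_linear h p A : 0 <= A -> (forall j i, continuous (fun t => h t j i)) ->
  (forall t j i, 0 <= t -> `|h t j i| <= l j * A * expR (rho * t)) ->
  exists y, [/\ cgrow (fun t => expR (rho * Num.max 0 t)) y,
    forall T, msolves T nu h y, forall t, t <= 0 -> y t = y 0 &
    forall j i, nu j < rho -> y 0 j i 0 = p j i 0].
Proof.
move=> A0 ch hh.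
have ex (ji : nat * 'I_N) : exists y : R -> R,
    [/\ forall T, solves T (nu ji.1) (fun t => h t ji.1 ji.2) y,
    forall t, `|y t| <= (`|p ji.1 ji.2 0| + l ji.1 / `|nu ji.1 - rho| * A) * expR (rho * Num.max 0 t),
    forall t, t <= 0 -> y t = y 0 &
    nu ji.1 < rho -> y 0 = p ji.1 ji.2 0].
  case: ji => j i /=.
  have [nr|nr|e] := ltgtP (nu j) rho; last by have := nu_rho j; rewrite e eqxx.
    have [y sy [y0 yn]] := solves_low_exist (nu j) (p j i 0) (ch j i).
    exists y; split => // [t|t t0]; last by rewrite y0 yn.
    have b t1 : 0 <= t1 -> `|y t1| <= (`|p j i 0| + l j / `|nu j - rho| * A) * expR (rho * t1).
      move=> t10; apply: le_trans (solves_low nr (sy 0) t10 (H := l j * A) _) _.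
        by move=> r /andP[r0 _]; exact: hh.
      rewrite y0 ler_wpM2r ?expR_ge0// lerD2l ltr0_norm ?subr_lt0// opprB.
      by rewrite mulrAC.
    have [t0|t0] := leP 0 t; first exact: b.
    by have := b 0 (lexx _); rewrite y0 (yn t (ltW t0)).
  have [y sy [yb yn]] := solves_high_exist nr (ch j i) (fun r r0 => hh r j i r0).
  exists y; split => // t; apply: le_trans (yb t) _.
  rewrite ler_wpM2r ?expR_ge0// [`|nu j - rho|]gtr0_norm ?subr_gt0// mulrAC lerDr//.
have [f hf] := choice ex.
have exy t : exists v : V, forall j i, v j i 0 = f (j, i) t.
  have [|j i|v e _] := @l2_dominated (fun j => \col_i f (j, i) t)
      (expR (rho * Num.max 0 t) *: p) _ kappa (A * expR (rho * Num.max 0 t)) kappa0 _ hk.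
  - by rewrite mulr_ge0 ?expR_ge0.
  - rewrite mxE l2ZE normrM [`|expR _|]gtr0_norm ?expR_gt0//.
    have -> (e b c : R) : e * b + c * (A * e) = (b + c * A) * e by ring.
    by have [_ /(_ t)] := hf (j, i).
  by exists v => j i; rewrite e mxE.
have [y hy] := choice exy.
have yE j i : (fun t => y t j i 0) = f (j, i) by apply/funext => t; rewrite hy.
exists y; split.
- have [j i|b eb nb] := @l2_dominated (fun j => \col_i (`|p j i 0| + l j / `|nu j - rho| * A))
      p _ kappa A kappa0 A0 hk.
  + rewrite mxE ger0_norm//.
    have [_ /(_ 0)] := hf (j, i); rewrite max_l// mulr0 expR0 mulr1 => h0 _ _.
    exact: le_trans (normr_ge0 _) h0.
  have cw : continuous (fun t : R => expR (rho * Num.max 0 t)).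
    apply: (continuous_pos (f := fun t => expR (rho * t))) => t _.
    exact: is_derive_continuous (is_derive_expM _ _).
  have dom t j i : `|y t j i 0| <= `|b j i 0| * expR (rho * Num.max 0 t).
    rewrite hy eb mxE; have [_ /(_ t) h0 _ _] := hf (j, i).
    by apply: le_trans h0 _; rewrite ler_wpM2r ?expR_ge0// ler_norm.
  split.
    apply: (curve_continuous (p := b) _ cw _ dom); last by move=> t; exact: expR_ge0.
    by move=> j i; rewrite yE; have [/(_ 0)[]] := hf (j, i).
  exists `|b| => t; have -> : `|b| * expR (rho * Num.max 0 t) = `|expR (rho * Num.max 0 t) *: b|.
    by rewrite normrZ ger0_norm ?expR_ge0// mulrC.
  apply: l2_norm_mono => j i; rewrite l2ZE normrM [`|expR _|]ger0_norm ?expR_ge0// mulrC.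
  exact: dom.
- by move=> T j i; rewrite yE; have [/(_ T)] := hf (j, i).
- by move=> t t0; apply: l2P => j i; rewrite !hy; have [_ _ /(_ t t0)] := hf (j, i).
- by move=> j i nr; rewrite hy; have [_ _ _ /(_ nr)] := hf (j, i).
Qed.

(** The Lyapunov-Perron construction. The low modes start at [eta (x 0)]: a constant [eta]
    prescribes them, a Lipschitz one lets them depend on the unknown, as the tracking argument
    requires. The contraction constant is [q] from the initial data plus [kappa] from the
    nonlinearity. *)
Lemma modes_exist (H : R -> V -> nat -> 'I_N -> R) (eta : V -> V) A q : 0 <= A -> 0 <= q ->
  (forall x, continuous x -> forall j i, continuous (fun t => H t (x t) j i)) ->
  (forall t j i, 0 <= t -> `|H t 0 j i| <= l j * A * expR (rho * t)) ->
  (forall t j i u v, `|H t u j i - H t v j i| <= l j * `|u - v|) ->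
  (forall j, 0 <= l j) ->
  (forall u v, `|eta u - eta v| <= q * `|u - v|) -> q + kappa < 1 ->
  exists x, [/\ cgrow (fun t => expR (rho * Num.max 0 t)) x,
    forall T, msolves T nu (fun t => H t (x t)) x &
    forall j i, nu j < rho -> x 0 j i 0 = eta (x 0) j i 0].
Proof.
move=> A0 q0 cH H0 lipH l0 lipe qk; pose w (t : R) := expR (rho * Num.max 0 t).
(* Stated for every curve so that [choice] returns a total operator; nothing is asked of it outside
   the growth class. *)
have ex x : exists y, cgrow w x -> [/\ cgrow w y,
    forall T, msolves T nu (fun t => H t (x t)) y, forall t, t <= 0 -> y t = y 0 &
    forall j i, nu j < rho -> y 0 j i 0 = eta (x 0) j i 0].
  have [[cx [K hK]]|nx] := pselect (cgrow w x); last by exists x => /nx.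
  have K0 : 0 <= K.
    by have := le_trans (normr_ge0 _) (hK 0); rewrite /w max_l// mulr0 expR0 mulr1.
  have [||t j i t0|y hy] := @modes_linear (fun t => H t (x t)) (eta (x 0)) (A + K).
  - exact: addr_ge0.
  - exact: cH.
  - rewrite -[H t (x t) j i](subrK (H t 0 j i)) (le_trans (ler_normD _ _))//.
    rewrite mulrDr mulrDl addrC lerD ?H0// (le_trans (lipH _ _ _ _ _))// subr0 -mulrA.
    by rewrite ler_wpM2l//; have := hK t; rewrite /w max_r.
  by exists y.
have [S hS] := choice ex.
have [x gx Sx] : exists2 x, cgrow w x & S x = x.
  apply: (fixed_curve (w := w) (q := q + kappa)).
  - by move=> t; exact: expR_gt0.
  - apply: (continuous_pos (f := fun t => expR (rho * t))) => t _.
    exact: is_derive_continuous (is_derive_expM _ _).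
  - by rewrite addr_ge0.
  - by move=> x /hS[].
  - move=> x y K gx gy xy t.
    have [_ sx nx ix] := hS x gx; have [_ sy ny iy] := hS y gy.
    have gB : cgrow w (fun t => S x t - S y t).
      by apply: cgrowB; [have [] := hS x gx|have [] := hS y gy].
    have K0 : 0 <= K.
      by have := le_trans (normr_ge0 _) (xy 0); rewrite /w max_l// mulr0 expR0 mulr1.
    have b t1 : 0 <= t1 -> `|S x t1 - S y t1| <= (q + kappa) * K * expR (rho * t1).
      move=> t10; apply: le_trans (modes_bound (p := eta (x 0) - eta (y 0)) (A := K) K0
        (msolvesB (sx 0) (sy 0)) _ _ _ t10) _.
      + move=> j i _; have [_ [K1 h1]] := gB; exists K1 => r r0.
        by apply: le_trans (l2_entry _ _ _) _; have := h1 r; rewrite /w max_r.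
      + move=> r j i r0; apply: le_trans (lipH _ _ _ _ _) _; rewrite -mulrA ler_wpM2l//.
        by have := xy r; rewrite /w max_r.
      + by move=> j i nr; rewrite !l2BE ix// iy.
      rewrite ler_wpM2r ?expR_ge0// mulrDl lerD2r (le_trans (lipe _ _))// ler_wpM2l//.
      by have := xy 0; rewrite /w max_l// mulr0 expR0 mulr1.
    have [t0|t0] := leP 0 t; first by have := b t t0; rewrite /w max_r.
    rewrite nx ?(ltW t0)// ny ?(ltW t0)//; have := b 0 (lexx _).
    by rewrite /w max_l ?(ltW t0).
exists x; have [_ sx _ ix] := hS x gx; rewrite Sx in sx ix; split => //.
Qed.

End Bound.
End Modes.

Arguments wsum {R} N a kappa.

(** * Gluing solutions in time *)

Section Gluing.
Context {R : realType}.
Implicit Types (h x : R -> R) (nu T t s : R).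

Lemma solves_derive nu h x t : (forall T, solves T nu h x) -> 0 < t ->
  is_derive t 1 x (nu * x t + h t).
Proof. by move=> /(_ 0)[_ d] t0; apply: d; rewrite ?gt_eqF. Qed.

Lemma solves_shift T nu h x s : 0 <= s -> (forall T, solves T nu h x) ->
  solves T nu (fun t => h (Num.max 0 t + s)) (fun t => x (Num.max 0 t + s)).
Proof.
move=> s0 sx; have [cx _] := sx 0; split.
  apply: (continuous_pos (f := fun t => x (t + s))) => t _.
  apply: (@continuous_comp _ _ _ (fun t : R => t + s) x); last exact: cx.
  by apply: cvgD; [exact: cvg_id|exact: cvg_cst].
move=> t t0 _; rewrite max_r ?(ltW t0)//.
apply: (is_derive_pos (f := fun t => x (t + s))) => //.
have ts : 0 < t + s by rewrite ltr_wpDr.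
have d1 : is_derive t 1 (fun r : R => r + s) 1.
  by rewrite -[X in is_derive _ _ _ X]addr0; apply: is_derive_add; exact: is_derive_const.
have := @is_derive1_comp _ x (fun r => r + s) t _ _ (solves_derive sx ts) d1.
by rewrite mulr1.
Qed.

(** The sum avoids a case distinction in the curve: on either side of T one of the two terms is
    frozen at the common value, which is subtracted. xA is run in reversed time, which explains the
    signs of its rate and its source. *)
Lemma solves_glue T nu hA hB xA xB : 0 <= T ->
  (forall T, solves T (- nu) hA xA) -> (forall T, solves T nu hB xB) -> xA 0 = xB 0 ->
  solves T nu (fun t => if t < T then - hA (T - t) else hB (t - T))
    (fun t => xA (Num.max 0 (T - t)) + xB (Num.max 0 (t - T)) - xB 0).
Proof.
move=> T0 sA sB AB; have [cA _] := sA 0; have [cB _] := sB 0.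
have cmx (f : R -> R) : continuous f -> continuous (fun t => Num.max 0 (f t)).
  by move=> cf t; apply: (@continuous_max _ _ (cst 0) f); [exact: cst_continuous|exact: cf].
have c1 : continuous (fun t : R => T - t).
  by move=> t; apply: cvgB; [exact: cvg_cst|exact: cvg_id].
have c2 : continuous (fun t : R => t - T).
  by move=> t; apply: cvgB; [exact: cvg_id|exact: cvg_cst].
split.
  move=> t; apply: cvgB; last exact: cvg_cst.
  apply: cvgD.
    apply: (@continuous_comp _ _ _ (fun t : R => Num.max 0 (T - t)) xA); last exact: cA.
    exact: cmx.
  apply: (@continuous_comp _ _ _ (fun t : R => Num.max 0 (t - T)) xB); last exact: cB.
  exact: cmx.
move=> t t0 tT; have [lt|gt|e] := ltgtP t T; last by rewrite e eqxx in tT.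
  have Tt : 0 < T - t by rewrite subr_gt0.
  rewrite max_r ?(ltW Tt)// max_l ?subr_le0 ?(ltW lt)// addrK.
  apply: (@is_derive_near _ (fun s => xA (T - s))).
    near=> s; have sT : s <= T by apply: ltW; near: s; exact: lt_nbhsl.
    by rewrite max_r ?subr_ge0// max_l ?subr_le0// addrK.
  have d1 : is_derive t 1 (fun r : R => T - r) (-1).
    rewrite -[X in is_derive _ _ _ X]add0r; apply: is_derive_sub; exact: is_derive_const.
  have := @is_derive1_comp _ xA (fun r => T - r) t _ _ (solves_derive sA Tt) d1.
  by rewrite mulrN1 opprD mulNr opprK.
have Tt : 0 < t - T by rewrite subr_gt0.
rewrite max_l ?subr_le0 ?(ltW gt)// max_r ?(ltW Tt)// AB addrAC subrr add0r.
apply: (@is_derive_near _ (fun s => xB (s - T))).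
  near=> s; have sT : T <= s by apply: ltW; near: s; exact: lt_nbhsr.
  by rewrite max_l ?subr_le0// max_r ?subr_ge0// AB addrAC subrr add0r.
have d1 : is_derive t 1 (fun r : R => r - T) 1.
  rewrite -[X in is_derive _ _ _ X]subr0; apply: is_derive_sub; exact: is_derive_const.
have := @is_derive1_comp _ xB (fun r => r - T) t _ _ (solves_derive sB Tt) d1.
by rewrite mulr1.
Unshelve. all: by end_near. Qed.

Lemma solves_exp T nu (c : R) : solves T nu (fun=> 0) (fun t => expR (nu * t) * c).
Proof.
have d t : is_derive t 1 (fun t => expR (nu * t) * c) (nu * (expR (nu * t) * c)).
  have := is_derive_mul (is_derive_expM nu t) (is_derive_const c t).
  by move=> /is_derive_eq; apply; ring.
split; first by move=> t; exact: is_derive_continuous (d t).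
by move=> t _ _; rewrite addr0.
Qed.

End Gluing.

(** * Truncation to the first modes *)

Section Truncation.
Context {R : realType} {N : nat}.
Local Notation V := (l2 R N).
Implicit Types (u v : V) (n j : nat) (i : 'I_N).

Lemma l20E j i : (0 : V) j i 0 = 0.
Proof. by rewrite -(scale0r (0 : V)) l2ZE mul0r. Qed.

Lemma trunc_subproof n v : (fun j => if (j < n)%N then v j else 0) \in @l2set R N.
Proof.
apply/l2setP; exists `|v| => // k; apply: le_trans (sqs_le k v).
apply: sqs_dom => j i; case: ifP => // _.
by rewrite mxE normr0.
Qed.

Definition trunc n v : V := MkL2 (trunc_subproof n v).

Lemma truncE n v j i : trunc n v j i 0 = if (j < n)%N then v j i 0 else 0.
Proof. by rewrite /trunc /=; case: ifP => // _; rewrite mxE. Qed.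

Lemma truncK n v : trunc n (trunc n v) = trunc n v.
Proof. by apply: l2P => j i; rewrite !truncE; case: (j < n)%N. Qed.

Lemma truncB n u v : trunc n (u - v) = trunc n u - trunc n v.
Proof. by apply: l2P => j i; rewrite !(truncE, l2BE); case: ifP; rewrite ?subr0. Qed.

End Truncation.

(** * Inertial manifold of a diagonal system with bounded Lipschitz coupling *)

Section InertialManifold.
Context {R : realType} {N : nat}.
Local Notation V := (l2 R N).
Variables (mu l : nat -> R) (F : V -> nat -> 'I_N -> R).
Implicit Types (x y : R -> V) (u v p q : V) (j : nat) (i : 'I_N) (t T K : R).

Hypotheses (mu1 : forall j, 1 <= mu j) (l0 : forall j, 0 <= l j).
Hypothesis F_bd : forall v j i, `|F v j i| <= l j.
Hypothesis F_lip : forall u v j i, `|F u j i - F v j i| <= l j * `|u - v|.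

Lemma F_continuous x : continuous x -> forall j i, continuous (fun t => F (x t) j i).
Proof.
move=> cx j i t; apply/(@cvgrPdist_le _ _ _ (nbhs t)) => e e0.
have p : 0 < e / (l j + 1) by rewrite divr_gt0// ltr_wpDl.
have := @cvgr_dist_le _ _ _ (nbhs t) (nbhs_filter t) x (x t) (cx t) _ p.
apply: filterS => s ts; apply: le_trans (F_lip _ _ _ _) _.
apply: (@le_trans _ _ ((l j + 1) * (e / (l j + 1)))).
  by apply: ler_pM => //; rewrite lerDl.
by rewrite mulrC divfK// gt_eqF// ltr_wpDl.
Qed.

Definition fwd T x := msolves T (fun j => - mu j) (fun t => F (x t)) x.
(** The equation in reversed time. The manifold consists of the starting points of those backward
    orbits that grow at most like [expR (th * t)]. *)
Definition bwd T x := msolves T mu (fun t j i => - F (x t) j i) x.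

Lemma shift_fwd T x (s : R) : 0 <= s -> (forall T, fwd T x) ->
  fwd T (fun t => x (Num.max 0 t + s)).
Proof. by move=> s0 fx j i; apply: (solves_shift _ s0 (fun T => fx T j i)). Qed.

Lemma shift_bwd T x (s : R) : 0 <= s -> (forall T, bwd T x) ->
  bwd T (fun t => x (Num.max 0 t + s)).
Proof. by move=> s0 fx j i; apply: (solves_shift _ s0 (fun T => fx T j i)). Qed.

(** [c = 1] makes a forward orbit from a reversed backward one followed by a forward one; [c = -1]
    makes a backward orbit from a reversed forward one followed by a backward one. *)
Lemma glue (nu : nat -> R) (c : R) T xA xB : 0 <= T ->
  (forall T, msolves T (fun j => - nu j) (fun t j i => - (c * F (xA t) j i)) xA) ->
  (forall T, msolves T nu (fun t j i => c * F (xB t) j i) xB) ->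
  xA 0 = xB 0 ->
  exists y, [/\ msolves T nu (fun t j i => c * F (y t) j i) y,
    forall t, t <= T -> y t = xA (T - t) & forall t, T <= t -> y t = xB (t - T)].
Proof.
move=> T0 sA sB AB.
pose y t := xA (Num.max 0 (T - t)) + xB (Num.max 0 (t - T)) - xB 0.
have y1 t : t <= T -> y t = xA (T - t).
  by move=> tT; rewrite /y max_r ?subr_ge0// max_l ?subr_le0// addrK.
have y2 t : T <= t -> y t = xB (t - T).
  move=> tT; rewrite /y max_l ?subr_le0// max_r ?subr_ge0// AB.
  by rewrite addrAC subrr add0r.
exists y; split => // j i.
have ABj : xA 0 j i 0 = xB 0 j i 0 by rewrite AB.
have := solves_glue T0 (fun T => sA T j i) (fun T => sB T j i) ABj.
congr solves; apply/funext => t; last by rewrite l2BE l2DE.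
by case: ltP => tT; [rewrite opprK y1// ltW|rewrite y2].
Qed.

Section Forward.
Variables (rho0 : R) (rho0_gt0 : 0 < rho0).
Hypothesis hk0 : wsum N (fun j => l j / `|- mu j - rho0|) (2^-1).

Let nmu_rho j : - mu j < rho0.
Proof. by rewrite (@le_lt_trans _ _ 0)// oppr_le0 (le_trans ler01). Qed.

Let nmu_neq j : - mu j != rho0. Proof. by rewrite lt_eqF. Qed.

Let h0 : 0 <= 2^-1 :> R. Proof. by rewrite invr_ge0. Qed.

Let e1 t : 0 <= t -> 1 <= expR (rho0 * t).
Proof. by move=> t0; rewrite -expR0 ler_expR mulr_ge0// ltW. Qed.

(** In forward time every rate [- mu j] is below [rho0]: all modes count as low, and the estimates
    for diagonal systems become estimates of an initial value problem. *)
Lemma fwd_bound T x t : fwd T x -> 0 <= t -> `|x t| <= (`|x 0| + 2^-1) * expR (rho0 * t).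
Proof.
move=> fx t0; rewrite -[2^-1](mulr1).
apply: (modes_bound nmu_neq h0 hk0 (p := x 0) ler01 fx) => //.
- by move=> j i /lt_trans /(_ (nmu_rho j)); rewrite ltxx.
- move=> s j i s0; rewrite mulr1 (le_trans (F_bd _ _ _))// ler_peMr ?e1//.
Qed.

Lemma fwd_dist T x y t : fwd T x -> fwd T y -> 0 <= t ->
  `|x t - y t| <= 2 * `|x 0 - y 0| * expR (rho0 * t).
Proof.
move=> fx fy t0; pose K0 := (`|x 0| + 2^-1) + (`|y 0| + 2^-1).
have -> : 2 * `|x 0 - y 0| = (`|x 0 - y 0| + 2^-1 * 0) / (1 - 2^-1).
  by rewrite mulr0 addr0; field.
apply: (modes_apriori nmu_neq h0 hk0 (K0 := K0) (lexx _) _ (msolvesB fx fy)) => //.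
- by rewrite invf_lt1 ?ltr1n.
- move=> s s0; apply: le_trans (ler_normB _ _) _; rewrite mulrDl.
  by apply: lerD; [exact: fwd_bound fx s0|exact: fwd_bound fy s0].
- by move=> s j i s0; rewrite mul0r add0r F_lip.
Qed.

Lemma fwd_unique T x y t : fwd T x -> fwd T y -> x 0 = y 0 -> 0 <= t -> x t = y t.
Proof.
move=> fx fy xy t0; apply/eqP; rewrite -subr_eq0 -normr_le0.
by apply: le_trans (fwd_dist fx fy t0) _; rewrite xy subrr normr0 mulr0 mul0r.
Qed.

(** All modes being low, the constant map [eta = cst v] prescribes the entire initial value, and
    [q = 0]. *)
Lemma flow_exist : exists S : R -> V -> V,
  [/\ forall v, continuous (S ^~ v), forall v, S 0 v = v & forall v T, fwd T (S ^~ v)].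
Proof.
have ex v : exists x, [/\ continuous x, x 0 = v & forall T, fwd T x].
  have [||||||x [[cx _] sx ix]] := @modes_exist _ _ (fun j => - mu j) l rho0 2^-1 nmu_neq h0 hk0
    (fun _ u => F u) (cst v) 1 0 ler01 (lexx _).
  - by move=> x cx; exact: F_continuous.
  - by move=> t j i t0; rewrite mulr1 (le_trans (F_bd _ _ _))// ler_peMr ?e1.
  - by move=> _ u w j i; exact: F_lip.
  - exact: l0.
  - by move=> u w; rewrite subrr normr0 mul0r.
  - by rewrite add0r invf_lt1 ?ltr1n.
  exists x; split => //; apply: l2P => j i; exact: ix.
have [S hS] := choice ex.
by exists (fun t v => S v t); split => v; have [] := hS v.
Qed.

Variable S : R -> V -> V.
Hypotheses (S_cont : forall v, continuous (S ^~ v)) (S0 : forall v, S 0 v = v).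
Hypothesis S_fwd : forall v T, fwd T (S ^~ v).

Lemma flow_unique T x t : fwd T x -> 0 <= t -> x t = S t (x 0).
Proof. by move=> fx t0; apply: (fwd_unique fx (S_fwd _ _)) => //; rewrite S0. Qed.

Lemma flowD (s t : R) v : 0 <= s -> 0 <= t -> S (s + t) v = S s (S t v).
Proof.
move=> s0 t0; have := flow_unique (shift_fwd 0 t0 (S_fwd v)) s0.
by rewrite max_r// maxxx add0r.
Qed.

Lemma flow_semigroup : semigroup S.
Proof.
split.
- by apply/funext => v; rewrite S0.
- by move=> s t s0 t0; apply/funext => v; exact: flowD.
- move=> t t0 v; apply/(@cvgrPdist_le _ _ _ (nbhs v)) => e e0.
  have p : 0 < e / (2 * expR (rho0 * t)) by rewrite divr_gt0// mulr_gt0// expR_gt0.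
  have := @cvgr_dist_le _ _ _ (nbhs v) (nbhs_filter v) id v (@cvg_id _ (nbhs v)) _ p.
  apply: filterS => u vu; apply: le_trans (fwd_dist (S_fwd v 0) (S_fwd u 0) t0) _.
  by rewrite !S0 mulrAC mulrC -ler_pdivlMr// mulr_gt0// expR_gt0.
- by move=> v; apply: continuous_subspaceT; exact: S_cont.
Qed.

Lemma flow_dissipative (D : R) : 0 <= D -> wsum N (fun j => l j / mu j) D -> dissipative S.
Proof.
move=> D0 hD; have mu0 j : 0 < mu j by apply: lt_le_trans (mu1 j).
have bd v t : 0 <= t -> `|S t v| <= expR (- t) * `|v| + D.
  move=> t0; have -> : expR (- t) * `|v| + D = `|expR (- t) *: v| + D * 1.
    by rewrite normrZ ger0_norm ?expR_ge0// mulr1.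
  apply: (l2_norm_dom D0 ler01 hD) => j i.
  (* Subtracting the free evolution leaves a solution that starts at 0, bounded by [l j / mu j]
     since F is bounded. *)
  have sB := solvesB (S_fwd v 0 j i) (solves_exp 0 (- mu j) (v j i 0)).
  have := solves_low (rho := 0) _ sB t0 (H := l j).
  rewrite mul0r expR0 mulr1 S0 !mulr0 expR0 mul1r subrr normr0 add0r sub0r opprK.
  rewrite oppr_lt0 => /(_ (mu0 j)) h1.
  rewrite l2ZE mulr1 -[S t v j i 0](subrK (expR (- mu j * t) * v j i 0)).
  rewrite (le_trans (ler_normD _ _))// addrC lerD//.
    rewrite !normrM ![`|expR _|]ger0_norm ?expR_ge0// ler_wpM2r// ler_expR mulNr lerN2.
    by rewrite ler_peMl.
  by apply: h1 => r _; rewrite subr0 mul0r expR0 mulr1.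
exists [set v | `|v| <= 1 + D]; split.
  exists (1 + D); split; first exact: num_real.
  by move=> K hK v /= hv; rewrite (le_trans hv)// ltW.
move=> A [K [_ hA]]; have hA1 v : A v -> `|v| <= `|K| + 1.
  by apply: hA; rewrite ltr_pwDr// ler_norm.
have K1 : 0 < `|K| + 1 by rewrite ltr_wpDl.
have [s0 s00 hs] := expR_decay (ltrN10 R) (divr_gt0 ltr01 K1).
exists s0 => t t0 st _ [v Av <-] /=; apply: le_trans (bd v t t0) _.
rewrite lerD2r -[leRHS](divfK (lt0r_neq0 K1)); apply: ler_pM => //.
- by have := hs t st; rewrite mulN1r.
- exact: hA1.
Qed.

(** * Backward orbits of slow growth in a spectral gap *)

Section Gap.
Variables (n : nat) (th th' kappa : R).
Hypotheses (th_gt0 : 0 < th) (th_le : th <= th').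
Hypotheses (lo : forall j, (j < n)%N -> mu j < th) (hi : forall j, (n <= j)%N -> th' < mu j).
Hypotheses (kappa0 : 0 <= kappa) (kappa8 : kappa <= 8^-1).
Hypotheses (hk : wsum N (fun j => l j / `|mu j - th|) kappa)
  (hk' : wsum N (fun j => l j / `|mu j - th'|) kappa).

Let mu_th j : mu j != th.
Proof.
have [jn|nj] := ltnP j n; first by rewrite lt_eqF// lo.
by rewrite gt_eqF// (le_lt_trans th_le)// hi.
Qed.

Let mu_th' j : mu j != th'.
Proof.
have [jn|nj] := ltnP j n; first by rewrite lt_eqF// (lt_le_trans _ th_le)// lo.
by rewrite gt_eqF// hi.
Qed.

Let k1 : kappa < 1.
Proof. by rewrite (le_lt_trans kappa8)// invf_lt1// ltr1n. Qed.

Let low_lt j : mu j < th -> (j < n)%N.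
Proof.
by move=> h; rewrite ltnNge; apply/negP => /hi h1; have := lt_le_trans (lt_trans h1 h) th_le; rewrite ltxx.
Qed.

Let low_lt' j : mu j < th' -> (j < n)%N.
Proof.
by move=> h; rewrite ltnNge; apply/negP => /hi h1; have := lt_trans h1 h; rewrite ltxx.
Qed.

Definition bgrow x := exists K, forall t, 0 <= t -> `|x t| <= K * expR (th * t).

Lemma bwd_dist T x y q t : bwd T x -> bwd T y -> bgrow x -> bgrow y ->
  (forall j i, (j < n)%N -> `|x 0 j i 0 - y 0 j i 0| <= `|q j i 0|) -> 0 <= t ->
  `|x t - y t| <= `|q| / (1 - kappa) * expR (th * t).
Proof.
move=> bx bY [K hK] [J hJ] xy t0; rewrite -[`|q|]addr0 -(mulr0 kappa).
apply: (modes_apriori mu_th kappa0 hk (K0 := K + J) (lexx _) k1 (msolvesB bx bY)) => //.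
- move=> s s0; apply: le_trans (ler_normB _ _) _; rewrite mulrDl.
  by apply: lerD; [exact: hK|exact: hJ].
- by move=> s j i s0; rewrite mul0r add0r -opprD normrN F_lip.
- by move=> j i /low_lt jn; rewrite l2BE xy.
Qed.

Lemma bwd_unique T x y t : bwd T x -> bwd T y -> bgrow x -> bgrow y ->
  (forall j i, (j < n)%N -> x 0 j i 0 = y 0 j i 0) -> 0 <= t -> x t = y t.
Proof.
move=> bx bY gx gy xy t0; apply/eqP; rewrite -subr_eq0 -normr_le0.
apply: le_trans (bwd_dist (q := 0) bx bY gx gy _ t0) _; last first.
  by rewrite normr0 !mul0r.
by move=> j i /xy ->; rewrite subrr normr0.
Qed.

Lemma bwd_exist p : exists x, [/\ bgrow x, forall T, bwd T x &
  forall j i, (j < n)%N -> x 0 j i 0 = p j i 0].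
Proof.
have [||||||x [[cx [K hK]] sx ix]] := @modes_exist _ _ mu l th kappa mu_th kappa0 hk
    (fun _ u j i => - F u j i) (cst p) 1 0 ler01 (lexx _).
- by move=> x cx j i t; apply: cvgN; exact: F_continuous.
- move=> t j i t0; rewrite normrN mulr1 (le_trans (F_bd _ _ _))// ler_peMr//.
  by rewrite -expR0 ler_expR mulr_ge0// ltW.
- by move=> t j i u v; rewrite -opprD normrN F_lip.
- exact: l0.
- by move=> u v; rewrite subrr normr0 mul0r.
- by rewrite add0r.
exists x; split => //; last by move=> j i /lo; exact: ix.
by exists K => t t0; have := hK t; rewrite max_r.
Qed.

(** Defined by orbits rather than as a graph, so that invariance reduces to gluing; [bsetE] recovers
    the graph. *)
Definition bset := [set v | exists2 x, bgrow x /\ (forall T, bwd T x) & x 0 = v].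

Section Graph.
Variable X : V -> R -> V.
Hypotheses (X_grow : forall p, bgrow (X p)) (X_bwd : forall p T, bwd T (X p)).
Hypothesis X_low : forall p j i, (j < n)%N -> X p 0 j i 0 = p j i 0.

Definition graph_map p := X p 0 - trunc n p.

Lemma trunc_X p : trunc n (X p 0) = trunc n p.
Proof. by apply: l2P => j i; rewrite !truncE; case: ifP => // jn; rewrite X_low. Qed.

Lemma graph_map_low p : trunc n (graph_map p) = 0.
Proof. by rewrite /graph_map truncB truncK trunc_X subrr. Qed.

Lemma X_trunc p : X (trunc n p) 0 = X p 0.
Proof.
apply: (bwd_unique (T := 0)) => // j i jn.
by rewrite !X_low// truncE jn.
Qed.

Lemma graph_map_trunc p : graph_map (trunc n p) = graph_map p.
Proof. by rewrite /graph_map X_trunc truncK. Qed.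

Lemma bsetE : bset = [set p + graph_map p | p in range (trunc n)].
Proof.
apply/seteqP; split => [v [x [gx bx] <-]|_ [_ [p _ <-] <-]].
  exists (trunc n (x 0)); first by exists (x 0).
  rewrite graph_map_trunc /graph_map addrC subrK.
  by apply: (bwd_unique (T := 0)) => // j i jn; rewrite X_low.
exists (X p) => //; rewrite graph_map_trunc /graph_map addrC subrK//.
Qed.

Lemma X_dist p q t : 0 <= t -> `|X p t - X q t| <= `|p - q| / (1 - kappa) * expR (th * t).
Proof.
apply: (bwd_dist (T := 0)) => // j i jn.
by rewrite !X_low// l2BE.
Qed.

Let p1 : 0 < 1 - kappa. Proof. by rewrite subr_gt0. Qed.

(** Only high modes differ, and at time 0 they are bounded by the gain [kappa] times the distance of
    the two orbits, whence the constant [kappa / (1 - kappa)]. With [kappa] at most 1/8 it is below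
    1/4, small enough for the contraction in [bset_tracking]. *)
Lemma graph_map_lip p q : `|graph_map p - graph_map q| <= 4^-1 * `|p - q|.
Proof.
have c0 : 0 <= `|p - q| / (1 - kappa) by rewrite divr_ge0// ltW.
apply: (@le_trans _ _ (kappa * (`|p - q| / (1 - kappa)))); last first.
  rewrite mulrCA [leRHS]mulrC ler_wpM2l// ler_pdivrMr// mulrBr mulr1 lerBrDl.
  have k4 : 4^-1 * kappa <= 8^-1 by move: kappa8; lra.
  by move: kappa8; lra.
apply: (l2_norm_dom0 kappa0 c0 hk) => j i.
have [jn|nj] := ltnP j n.
  have e r : graph_map r j i 0 = 0.
    have : trunc n (graph_map r) j i 0 = 0 by rewrite graph_map_low l20E.
    by rewrite truncE jn.
  by rewrite l2BE !e subrr normr0 mulr_ge0// divr_ge0.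
have nr : th < mu j by apply: le_lt_trans th_le (hi nj).
have sB := msolvesB (X_bwd p 0) (X_bwd q 0).
have := solves_high nr (sB j i) (lexx 0) (H := l j * (`|p - q| / (1 - kappa)))
  (K := `|p - q| / (1 - kappa)).
rewrite mulr0 expR0 mulr1 !l2BE !truncE ltnNge nj /= !subr0 [`|mu j - th|]gtr0_norm ?subr_gt0//.
move=> h; apply: le_trans (h _ _) _.
- move=> r r0; rewrite -opprD normrN (le_trans (F_lip _ _ _ _))// -mulrA ler_wpM2l//.
  exact: X_dist.
- move=> r r0; have := l2_entry (X p r - X q r) j i; move=> /le_trans; apply.
  exact: X_dist.
- by rewrite mulrAC.
Qed.

(** For one inclusion, the reversed forward orbit of v followed by the backward orbit of v is a
    backward orbit from [S t v]; its growth is admissible, as the added piece is bounded. For the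
    other, v is reached from the point [x t] of its own backward orbit, by uniqueness of the forward
    flow. *)
Lemma bset_flow t : 0 <= t -> S t @` bset = bset.
Proof.
move=> t0; apply/seteqP; split => [_ [v [x [[K hK] bx] xv] <-]|v [x [gx bx] xv]].
  have [|||y [sy y1 y2]] := @glue mu (-1) t (S ^~ v) x t0.
  - move=> T j i; have := S_fwd v T j i; congr solves; apply/funext => s; ring.
  - move=> T j i; have := bx T j i; congr solves; apply/funext => s; ring.
  - by rewrite S0.
  have bY : bwd t y by move=> j i; have := sy j i; congr solves; apply/funext => s; ring.
  have gy : bgrow y.
    pose C := (`|v| + 2^-1) * expR (rho0 * t) + `|K|.
    exists C => s s0; have es : 1 <= expR (th * s) by rewrite -expR0 ler_expR mulr_ge0// ltW.
    have C1 : 0 <= (`|v| + 2^-1) * expR (rho0 * t).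
      by rewrite mulr_ge0 ?expR_ge0// addr_ge0// invr_ge0.
    have [st|ts] := leP s t.
      rewrite y1// (@le_trans _ _ C)//; last by rewrite ler_peMr// addr_ge0.
      have st0 : 0 <= t - s by rewrite subr_ge0.
      apply: le_trans (fwd_bound (S_fwd v 0) st0) _; rewrite S0.
      rewrite (@le_trans _ _ ((`|v| + 2^-1) * expR (rho0 * t))) ?lerDl//.
      rewrite ler_wpM2l ?addr_ge0 ?invr_ge0// ler_expR ler_wpM2l ?(ltW rho0_gt0)//.
      by rewrite lerBlDr lerDl.
    have ts0 : 0 <= s - t by rewrite subr_ge0 ltW.
    rewrite y2 ?(ltW ts)// (le_trans (hK _ ts0))//.
    apply: (@le_trans _ _ (`|K| * expR (th * s))); last first.
      by rewrite ler_wpM2r ?expR_ge0// lerDr.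
    apply: ler_pM; rewrite ?expR_ge0 ?ler_norm//; last first.
      by rewrite ler_expR ler_wpM2l ?(ltW th_gt0)// lerBlDr lerDl.
    by have := le_trans (normr_ge0 _) (hK 0 (lexx _)); rewrite mulr0 expR0 mulr1.
  exists (X (y 0)) => //.
  transitivity (y 0); last by rewrite y1// subr0.
  by apply: (bwd_unique (T := t)) => // j i jn; rewrite X_low.
exists (x t).
  exists (fun s => x (Num.max 0 s + t)); last by rewrite maxxx add0r.
  split; last by move=> T; exact: shift_bwd.
  have [K hK] := gx; exists (K * expR (th * t)) => s s0; rewrite max_r//.
  by rewrite (le_trans (hK _ _)) ?addr_ge0// mulrDr expRD mulrAC mulrA.
have [|||y [sy y1 y2]] := @glue (fun j => - mu j) 1 t x (S ^~ v) t0.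
- move=> T j i; have := bx T j i; rewrite opprK; congr solves; apply/funext => s; ring.
- move=> T j i; have := S_fwd v T j i; congr solves; apply/funext => s; ring.
- by rewrite S0.
have fy : fwd t y by move=> j i; have := sy j i; congr solves; apply/funext => s; ring.
have := flow_unique fy t0; rewrite y1// subrr y1// subr0 => <-; exact: xv.
Qed.

(** The tracking orbit is sought as [S t v + z t] with z decaying like [expR (- th * t)]. This is
    again a Lyapunov-Perron problem, now at rate [- th]: its low modes are those with [mu j > th],
    and they are fixed at time 0 by requiring that [v + z 0] lie on the graph. The constant 2 bounds
    [1 / (1 - kappa)]. *)
Lemma bset_tracking v : exists w, bset w /\
  forall t, 0 <= t -> `|S t v - S t w| <= 2 * `|v - w| * expR (- th * t).
Proof.
have nth j : - mu j != - th by rewrite eqr_opp.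
have hkN : wsum N (fun j => l j / `|- mu j - - th|) kappa.
  by move=> m; under eq_bigr do rewrite -opprD normrN; exact: hk.
have q4 : 0 <= 4^-1 :> R by rewrite invr_ge0.
have [||||||z [[cz [K hK]] sz iz]] := @modes_exist _ _ (fun j => - mu j) l (- th) kappa nth
    kappa0 hkN (fun t u j i => F (S t v + u) j i - F (S t v) j i)
    (fun u => graph_map (v + u) - v) 0 4^-1 (lexx _) q4.
- move=> x cx j i t; apply: cvgB; last exact: F_continuous.
  apply: (F_continuous (x := fun t => S t v + x t)) => s.
  by apply: cvgD; [exact: S_cont|exact: cx].
- by move=> t j i t0; rewrite addr0 subrr normr0 mulr0 mul0r.
- move=> t j i u w; rewrite opprB addrA subrK (le_trans (F_lip _ _ _ _))//.
  by rewrite opprD addrACA subrr add0r.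
- exact: l0.
- move=> u w; rewrite opprB addrA subrK (le_trans (graph_map_lip _ _))//.
  by rewrite opprD addrACA subrr add0r.
- by move: kappa8; lra.
have hK1 t : 0 <= t -> `|z t| <= K * expR (- th * t) by move=> t0; have := hK t; rewrite max_r.
have fz T : fwd T (fun t => S t v + z t).
  move=> j i; have [c1 d1] := S_fwd v T j i; have [c2 d2] := sz T j i; split.
    move=> t; have -> : (fun t => (S t v + z t) j i 0) = (fun t => S t v j i 0 + z t j i 0).
      by apply/funext => s; rewrite l2DE.
    by apply: cvgD; [exact: c1|exact: c2].
  move=> t t0 tT; have := is_derive_add (d1 t t0 tT) (d2 t t0 tT).
  have -> : (fun t => (S t v + z t) j i 0) = (fun t => S t v j i 0 + z t j i 0).
    by apply/funext => s; rewrite l2DE.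
  by move=> /is_derive_eq; apply; rewrite l2DE; ring.
have Sw t : 0 <= t -> S t (v + z 0) = S t v + z t.
  by move=> t0; have := flow_unique (fz 0) t0; rewrite S0.
exists (v + z 0); split.
  exists (X (v + z 0)) => //; apply: l2P => j i.
  have [jn|nj] := ltnP j n; first by rewrite X_low.
  have : - mu j < - th by rewrite ltrN2 (le_lt_trans th_le)// hi.
  move=> /(iz j i); rewrite l2BE [graph_map _ j i 0]l2BE truncE ltnNge nj /= subr0.
  by move=> e; rewrite l2DE e [RHS]addrC subrK.
move=> t t0; rewrite Sw// opprD addrA subrr add0r normrN opprD addrA subrr add0r normrN.
have := modes_apriori nth kappa0 hkN (K0 := K) (p := z 0) (lexx 0) k1 (sz 0) hK1.
move=> h; apply: le_trans (h _ _ _ t t0) _ => //.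
  by move=> s j i s0; rewrite mul0r add0r (le_trans (F_lip _ _ _ _))// [X in `|X|]addrC addKr.
rewrite mulr0 addr0 ler_wpM2r ?expR_ge0// mulrC ler_wpM2r//.
rewrite -[leRHS]invrK lef_pV2 ?posrE ?invr_gt0//; move: kappa8; lra.
Qed.

Section Smooth.
Variable r : R.
Hypotheses (r0 : 0 <= r) (th_r : r * th = th').
Hypothesis F_mid : forall u v j i,
  `|F u j i + F v j i - 2 * F (2^-1 *: (u + v)) j i| <= l j * `|u - v| `^ r.

(** The second difference z of the orbits from u, v and their midpoint solves a linear equation
    whose source, by [F_mid] and [X_dist], grows like [expR (r * th * t)]. Since [th' = r * th] lies
    in the same gap, the a priori estimate applies at rate [th']; the low modes of [z 0] vanish, the
    low part of [X p 0] being linear in p. *)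
Lemma graph_map_mid u v :
  `|graph_map u + graph_map v - 2 *: graph_map (2^-1 *: (u + v))| <=
  (1 - kappa)^-1 `^ r * `|u - v| `^ r.
Proof.
set m := 2^-1 *: (u + v); pose z t := X u t - X m t - (X m t - X v t).
have sz : msolves 0 mu (fun t j i => - F (X u t) j i - - F (X m t) j i
    - (- F (X m t) j i - - F (X v t) j i)) z.
  by apply: msolvesB; apply: msolvesB; exact: X_bwd.
pose A := (`|u - v| / (1 - kappa)) `^ r.
have A0 : 0 <= A by exact: powR_ge0.
have [K hK] : exists K, forall t, 0 <= t -> `|z t| <= K * expR (th' * t).
  exists (`|u - m| / (1 - kappa) + `|m - v| / (1 - kappa)) => t t0.
  apply: (@le_trans _ _ ((`|u - m| / (1 - kappa) + `|m - v| / (1 - kappa)) * expR (th * t))).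
    by rewrite mulrDl (le_trans (ler_normB _ _))// lerD// X_dist.
  by rewrite ler_wpM2l ?addr_ge0 ?divr_ge0 ?(ltW p1)// ler_expR ler_wpM2r.
have z0 : graph_map u + graph_map v - 2 *: graph_map m = z 0.
  apply: l2P => j i; rewrite /z /graph_map !(l2BE, l2DE, l2ZE, truncE).
  by case: ifP => _; field.
have := modes_apriori mu_th' kappa0 hk' (K0 := K) (p := 0) A0 k1 sz hK _ l0.
rewrite normr0 add0r z0 => h; apply: le_trans (h _ _ 0 (lexx _)) _.
- move=> t j i t0.
  (* Second difference of F at the two orbits, plus a correction between their mean and the middle
     orbit. The mean differs from the middle orbit by z / 2, so the correction costs exactly
     [l j * |z t|]. *)
  have -> : - F (X u t) j i - - F (X m t) j i - (- F (X m t) j i - - F (X v t) j i) =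
     - (F (X u t) j i + F (X v t) j i - 2 * F (2^-1 *: (X u t + X v t)) j i)
     - 2 * (F (2^-1 *: (X u t + X v t)) j i - F (X m t) j i) by ring.
  rewrite (le_trans (ler_normB _ _))// normrN [leRHS]mulrDr lerD//.
    rewrite (le_trans (F_mid _ _ _ _))// ler_wpM2l//.
    have -> : A * expR (th' * t) = (`|u - v| / (1 - kappa) * expR (th * t)) `^ r.
      rewrite powRM ?expR_ge0 ?divr_ge0 ?(ltW p1)//; congr (_ * _).
      by rewrite -expRM -th_r; congr expR; ring.
    apply: ge0_ler_powR => //; last exact: X_dist.
    - by rewrite nnegrE.
    - by rewrite nnegrE mulr_ge0 ?expR_ge0// divr_ge0// ltW.
  rewrite normrM ger0_norm// mulrC -ler_pdivlMr// (le_trans (F_lip _ _ _ _))// -mulrA ler_wpM2l//.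
  have -> : 2^-1 *: (X u t + X v t) - X m t = 2^-1 *: z t.
    by apply: l2P => j' i'; rewrite /z !(l2BE, l2DE, l2ZE); field.
  by rewrite normrZ ger0_norm ?invr_ge0// mulrC.
- move=> j i /low_lt' jn; rewrite l20E normr0 normr_le0 -z0.
  have e s : graph_map s j i 0 = 0.
    have : trunc n (graph_map s) j i 0 = 0 by rewrite graph_map_low l20E.
    by rewrite truncE jn.
  by rewrite l2BE l2DE l2ZE !e addr0 mulr0 subr0.
rewrite mulr0 expR0 mulr1 /A powRM ?invr_ge0 ?(ltW p1)// mulrC.
rewrite [`|u - v| `^ r * _]mulrC mulrA ler_piMl ?mulr_ge0 ?powR_ge0//.
by rewrite mulrC ler_pdivrMr// mul1r; move: kappa8; lra.
Qed.

End Smooth.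
End Graph.
End Gap.
End Forward.
End InertialManifold.

(** * Reflexive proofs of linear identities *)

Section LinearCombinations.
Context (R : comPzRingType) (V : lmodType R).

Inductive lexp := LAtom of nat | LAdd of lexp & lexp | LOpp of lexp
  | LScale of R & lexp | LZero.

Fixpoint lexp_eval (s : seq V) e : V := match e with
  | LAtom n => nth 0 s n
  | LAdd a b => lexp_eval s a + lexp_eval s b
  | LOpp a => - lexp_eval s a
  | LScale c a => c *: lexp_eval s a
  | LZero => 0
  end.

Fixpoint lexp_coef e (n : nat) : R := match e with
  | LAtom m => if eqn m n then 1 else 0
  | LAdd a b => lexp_coef a n + lexp_coef b n
  | LOpp a => - lexp_coef a n
  | LScale c a => c * lexp_coef a n
  | LZero => 0
  end.

(** A conjunction that unfolds by computation and leaves one coefficient identity per atom. *)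
Fixpoint all_below (n : nat) (P : nat -> Prop) : Prop :=
  if n is n'.+1 then P n' /\ all_below n' P else True.

Lemma lexp_evalE s e :
  lexp_eval s e = \sum_(i < size s) lexp_coef e i *: nth 0 s i.
Proof.
elim: e => [m|a ha b hb|a ha|c a ha|] /=; rewrite ?ha ?hb.
- have [ms|sm] := ltnP m (size s); last first.
    rewrite nth_default// big1// => i _; case: eqnP => [e|_]; last by rewrite scale0r.
    by move: (ltn_ord i); rewrite -e ltnNge sm.
  rewrite (bigD1 (Ordinal ms))//= -[eqn m m]/(m == m) eqxx scale1r big1 ?addr0//.
  move=> i /eqP im; case: eqnP => [e|_]; last by rewrite scale0r.
  by case: im; apply: val_inj.
- by rewrite -big_split; apply: eq_bigr => i _; rewrite scalerDl.
- by rewrite -sumrN; apply: eq_bigr => i _; rewrite scaleNr.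
- by rewrite scaler_sumr; apply: eq_bigr => i _; rewrite scalerA.
- by rewrite big1// => i _; rewrite scale0r.
Qed.

Lemma lexp_eq s e1 e2 : all_below (size s) (fun n => lexp_coef e1 n = lexp_coef e2 n) ->
  lexp_eval s e1 = lexp_eval s e2.
Proof.
move=> h; rewrite !lexp_evalE; apply: eq_bigr => i _; congr (_ *: _).
elim: (size s) i h => [[]//|n IH] i /= [h0 h].
have [e|ni] := eqVneq (i : nat) n; first by rewrite e.
have lt : (i < n)%N by rewrite ltn_neqAle ni -ltnS ltn_ord.
exact: (IH (Ordinal lt)).
Qed.

End LinearCombinations.

Ltac lmod_atoms s t := match t with
  | Algebra.add ?a ?b => let s1 := lmod_atoms s a in lmod_atoms s1 b
  | Algebra.opp ?a => lmod_atoms s a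
  | GRing.scale _ ?a => lmod_atoms s a
  | Algebra.zero => s
  | _ => match s with
    | context [t :: _] => s
    | _ => constr:(t :: s)
    end
  end.

Ltac lmod_index s t := match s with
  | t :: _ => constr:(0%N)
  | _ :: ?r => let n := lmod_index r t in constr:(S n)
  end.

Ltac lmod_reify R s t := match t with
  | Algebra.add ?a ?b => let x := lmod_reify R s a in let y := lmod_reify R s b in
     constr:(LAdd x y)
  | Algebra.opp ?a => let x := lmod_reify R s a in constr:(LOpp x)
  | GRing.scale ?c ?a => let x := lmod_reify R s a in constr:(@LScale R c x)
  | Algebra.zero => constr:(@LZero R)
  | _ => let n := lmod_index s t in constr:(@LAtom R n)
  end.

(* Proves an equality between linear combinations over R, up to field identities
   between the coefficients. *)
Ltac lmod R := match goal with |- @eq ?T ?a ?b =>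
  let s0 := lmod_atoms (@nil T) a in let s := lmod_atoms s0 b in
  let x := lmod_reify R s a in let y := lmod_reify R s b in
  refine (@lexp_eq R _ s x y _); cbn [all_below size lexp_coef eqn nth]; repeat split; field
  end.

(** * Small second differences imply Hölder differentiability *)

Section Zygmund.
Context {R : realType} {V : normedModType R} {W : completeNormedModType R}.
Variables (G : V -> W) (p : R) (C : R -> R).
Hypotheses (p1 : 1 < p) (p2 : p <= 2).
Hypothesis C0 : forall r, 0 <= C r.
Hypothesis C_mono : {homo C : x y / x <= y}.
Hypothesis G_lip : forall r a b, `|a| <= r -> `|b| <= r -> `|G a - G b| <= C r * `|a - b|.
Hypothesis G_mid : forall r a b, `|a| <= r -> `|b| <= r ->
  `|G a + G b - 2 *: G (2^-1 *: (a + b))| <= C r * `|a - b| `^ p.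
Implicit Types (a h k : V) (n : nat).

(** Halving an increment h multiplies [|h| ^ p / |h|] by q, and q < 1 because p > 1. *)
Let q : R := 2^-1 `^ (p - 1).

Let half_gt0 : 0 < 2^-1 :> R. Proof. by rewrite invr_gt0. Qed.

Let q01 : 0 <= q < 1.
Proof.
rewrite powR_ge0 /=.
rewrite /q /powR gt_eqF// -[ltRHS](@expR0 R) ltr_expR.
by rewrite pmulr_rlt0 ?subr_gt0// ln_lt0// half_gt0 invf_lt1 ?ltr1n.
Qed.

Let powS (x : R) : 0 < x -> x `^ p = x `^ (p - 1) * x.
Proof.
move=> x0; rewrite -[X in _ * X](powRr1 (ltW x0)) -powRD ?subrK//.
by apply/implyP => _; rewrite gt_eqF.
Qed.

Let pw n : (2^-1 ^+ n) `^ p = q ^+ n * 2^-1 ^+ n :> R.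
Proof.
rewrite powS ?exprn_gt0//; congr (_ * _).
by rewrite -(powR_mulrn _ (ltW half_gt0)) powRAC powR_mulrn// powR_ge0.
Qed.

Let D a h n := 2 ^+ n *: (G (a + 2^-1 ^+ n *: h) - G a).

Let two_n n : (2 : R) ^+ n * 2^-1 ^+ n = 1.
Proof. by rewrite -exprMn divff// expr1n. Qed.

Let half_le1 n : 2^-1 ^+ n <= 1 :> R.
Proof. by rewrite exprn_ile1// ?ltW// invf_lt1 ?ltr1n. Qed.

Let shift_norm a h n : `|a + 2^-1 ^+ n *: h| <= `|a| + `|h|.
Proof.
rewrite (le_trans (ler_normD _ _))// lerD2l normrZ ger0_norm ?exprn_ge0 ?(ltW half_gt0)//.
by rewrite ler_piMl.
Qed.

(** Two consecutive dyadic difference quotients differ by a rescaled second difference, the point of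
    the later one being the midpoint of a and the point of the earlier one. *)
Let D_step a h n : `|D a h n.+1 - D a h n| <= C (`|a| + `|h|) * `|h| `^ p * q ^+ n.
Proof.
have -> : D a h n.+1 - D a h n = - (2 ^+ n *: (G a + G (a + 2^-1 ^+ n *: h)
   - 2 *: G (2^-1 *: (a + (a + 2^-1 ^+ n *: h))))).
  have -> : 2^-1 *: (a + (a + 2^-1 ^+ n *: h)) = a + 2^-1 ^+ n.+1 *: h.
    by rewrite exprS; lmod R.
  by rewrite /D exprS; lmod R.
rewrite normrN normrZ ger0_norm ?exprn_ge0//.
have -> : C (`|a| + `|h|) * `|h| `^ p * q ^+ n =
   2 ^+ n * (C (`|a| + `|h|) * `|a - (a + 2^-1 ^+ n *: h)| `^ p).
  rewrite opprD addNKr normrN normrZ powRM// ger0_norm ?exprn_ge0 ?(ltW half_gt0)// pw.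
  have -> (x y z t u : R) : x * (y * (z * t * u)) = x * t * (y * u * z) by ring.
  by rewrite two_n mul1r.
rewrite ler_wpM2l ?exprn_ge0//; apply: G_mid; last exact: shift_norm.
by rewrite lerDl.
Qed.

Let T_ex a h : exists l, forall n, `|l - D a h n| <= C (`|a| + `|h|) * `|h| `^ p / (1 - q) * q ^+ n.
Proof. exact: cvg_geometric_dist (D_step a h). Qed.

Let T a h := sval (cid (T_ex a h)).

Let TP a h n : `|T a h - D a h n| <= C (`|a| + `|h|) * `|h| `^ p / (1 - q) * q ^+ n.
Proof. exact: (svalP (cid (T_ex a h))). Qed.

Let T_taylor a h : `|G (a + h) - G a - T a h| <= C (`|a| + `|h|) / (1 - q) * `|h| `^ p.
Proof.
have := TP a h 0; rewrite /D !expr0 scale1r scale1r mulr1 distrC.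
by rewrite mulrAC.
Qed.

Let err a h := C (`|a| + `|h|) * `|h| `^ p / (1 - q).

Let err_ge0 a h : 0 <= err a h.
Proof.
have /andP[_ q1] := q01.
by rewrite !mulr_ge0 ?powR_ge0// invr_ge0 subr_ge0 ltW.
Qed.

Let qS n (k : nat) : q ^+ (n + k) <= q ^+ n.
Proof.
have /andP[q0 q1] := q01.
by rewrite exprD ler_piMr ?exprn_ge0// exprn_ile1// ltW.
Qed.

Let TPs a h n (k : nat) : `|T a h - D a h (n + k)| <= err a h * q ^+ n.
Proof. exact: le_trans (TP _ _ _) (ler_wpM2l (err_ge0 _ _) (qS _ _)). Qed.

(** The midpoint of [a + 2^-1 ^+ n.+1 *: h] and [a + 2^-1 ^+ n.+1 *: k] is the point of the quotient
    of order n + 2 in the direction h + k, so additivity holds up to one second difference. *)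
Let T_add a h k : T a (h + k) = T a h + T a k.
Proof.
pose r := `|a| + (`|h| + `|k|).
apply/esym/eqP; rewrite -subr_eq0 -normr_le0.
apply: (@le_geometric _ _ _ (err a h + err a k + C r * `|h - k| `^ p + err a (h + k)) q q01) => n.
pose x := a + 2^-1 ^+ n.+1 *: h; pose y := a + 2^-1 ^+ n.+1 *: k.
have m : 2^-1 *: (x + y) = a + 2^-1 ^+ n.+2 *: (h + k).
  by rewrite /x /y [2^-1 ^+ n.+2]exprS; lmod R.
have -> : T a h + T a k - T a (h + k) = (T a h - D a h n.+1) + (T a k - D a k n.+1)
   + 2 ^+ n.+1 *: (G x + G y - 2 *: G (2^-1 *: (x + y))) - (T a (h + k) - D a (h + k) n.+2).
  by rewrite /D -/x -/y m [2 ^+ n.+2]exprS; lmod R.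
rewrite add0r !mulrDl.
apply: (le_trans (ler_normB _ _)); apply: lerD; last first.
  by rewrite -addn2; exact: TPs.
apply: (le_trans (ler_normD _ _)); apply: lerD.
  apply: (le_trans (ler_normD _ _)); apply: lerD.
    by rewrite -addn1; exact: TPs.
  by rewrite -addn1; exact: TPs.
rewrite normrZ ger0_norm ?exprn_ge0//.
have xr : `|x| <= r by rewrite (le_trans (shift_norm _ _ _))// lerD2l lerDl.
have yr : `|y| <= r by rewrite (le_trans (shift_norm _ _ _))// lerD2l lerDr.
apply: (@le_trans _ _ (2 ^+ n.+1 * (C r * `|x - y| `^ p))).
  by rewrite ler_wpM2l ?exprn_ge0// G_mid.
have -> : x - y = 2^-1 ^+ n.+1 *: (h - k) by rewrite /x /y; lmod R.
rewrite normrZ powRM// ger0_norm ?exprn_ge0 ?(ltW half_gt0)// pw.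
have -> (b c d e f : R) : b * (c * (d * e * f)) = b * e * (c * f * d) by ring.
by rewrite two_n mul1r ler_wpM2l ?mulr_ge0 ?powR_ge0// -addn1 qS.
Qed.

Let T_bound a h : `|T a h| <= C (`|a| + 1) * `|h|.
Proof.
have h01 : 0 <= (2^-1 : R) < 1 by rewrite ltW//= invf_lt1 ?ltr1n.
(* After [n0] halvings the increment has norm at most 1, so that the Lipschitz constant at radius
   [|a| + 1] serves for every h and the bound is linear in h. *)
have [n0 hn0] := geometric_small `|h| h01 ltr01.
apply: (@le_geometric _ _ _ (err a h) q q01) => n.
rewrite -[T a h](subrK (D a h (n0 + n))) (le_trans (ler_normD _ _))// addrC lerD//; last first.
  by rewrite addnC; exact: TPs.
set k := (n0 + n)%N; have hk : 2^-1 ^+ k * `|h| <= 1.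
  by apply: le_trans hn0; rewrite mulrC ler_wpM2l// /k exprD ler_piMr// exprn_ge0// ltW.
rewrite /D normrZ ger0_norm ?exprn_ge0//.
apply: (@le_trans _ _ (2 ^+ k * (C (`|a| + 1) * `|a + 2^-1 ^+ k *: h - a|))).
  rewrite ler_wpM2l ?exprn_ge0// G_lip ?lerDl//.
  rewrite (le_trans (ler_normD _ _))// lerD2l normrZ ger0_norm ?exprn_ge0 ?(ltW half_gt0)//.
rewrite addrAC subrr add0r normrZ ger0_norm ?exprn_ge0 ?(ltW half_gt0)//.
have -> (b c d e : R) : b * (c * (d * e)) = b * d * (c * e) by ring.
by rewrite two_n mul1r.
Qed.

(** Cauchy's functional equation: f vanishes on the integers, so it is periodic and bounded
    everywhere, and [f (2 ^ n x) = 2 ^ n f x] forces it to be 0. *)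
Let additive_bounded (f : R -> W) (K : R) : (forall x y, f (x + y) = f x + f y) ->
  (forall x, 0 <= x <= 1 -> `|f x| <= K) -> f 1 = 0 -> forall x, f x = 0.
Proof.
move=> fD fK f1; have f0 : f 0 = 0 by apply: (addrI (f 0)); rewrite -fD !addr0.
have fN x : f (- x) = - f x by apply/eqP; rewrite -subr_eq0 opprK -fD addNr f0.
have fn (n : nat) x : f (n%:R * x) = n%:R *: f x.
  elim: n => [|n IH]; first by rewrite mul0r f0 scale0r.
  by rewrite -natr1 mulrDl mul1r fD IH scalerDl scale1r.
have fz (z : int) : f z%:~R = 0.
  case: z => n; first by rewrite -[_%:~R]mulr1 fn f1 scaler0.
  by rewrite NegzE mulrNz fN -[_%:~R]mulr1 fn f1 scaler0 oppr0.
move=> x; apply/eqP; rewrite -normr_le0.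
have h01 : 0 <= (2^-1 : R) < 1 by rewrite ltW//= invf_lt1 ?ltr1n.
apply: (@le_geometric _ _ _ K 2^-1 h01) => n; rewrite add0r.
have e : (2 ^+ n)%:R * x = ((2 ^+ n)%:R * x - (Num.floor ((2 ^+ n)%:R * x))%:~R) +
   (Num.floor ((2 ^+ n)%:R * x))%:~R by rewrite subrK.
have : f ((2 ^+ n)%:R * x) = f ((2 ^+ n)%:R * x - (Num.floor ((2 ^+ n)%:R * x))%:~R).
  by rewrite {1}e fD fz addr0.
rewrite fn natrX => e2.
have : `|2 ^+ n *: f x| <= K.
  rewrite e2; apply: fK; rewrite subr_ge0 floor_le_tmp /= lerBlDr addrC.
  by have /ltW := floorD1_gt (2 ^+ n * x); rewrite intrD.
rewrite normrZ ger0_norm ?exprn_ge0// mulrC -ler_pdivlMr ?exprn_gt0//.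
by rewrite exprVn.
Qed.

Let T_scale a c h : T a (c *: h) = c *: T a h.
Proof.
apply/eqP; rewrite -subr_eq0; apply/eqP.
apply: (@additive_bounded (fun c => T a (c *: h) - c *: T a h)
  (C (`|a| + 1) * `|h| + `|T a h|)).
- by move=> x y; rewrite scalerDl T_add; lmod R.
- move=> x /andP[x0 x1]; apply: (le_trans (ler_normB _ _)); apply: lerD.
    apply: (le_trans (T_bound _ _)); rewrite normrZ ger0_norm// ler_wpM2l//.
    by rewrite ler_piMl.
  by rewrite normrZ ger0_norm// ler_piMl.
- by rewrite !scale1r subrr.
Qed.

Let T_linear a : linear (T a).
Proof. by move=> c x y; rewrite T_add T_scale. Qed.

Let Tl a : {linear V -> W} := HB.pack (T a) (GRing.isLinear.Build R V W *:%R (T a) (T_linear a)).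

Let T_continuous a : continuous (Tl a).
Proof.
move=> x; apply/(@cvgrPdist_le _ _ _ (nbhs x)) => e e0.
have c1 : 0 < C (`|a| + 1) + 1 by rewrite ltr_wpDl.
have := @cvgr_dist_le _ _ _ (nbhs x) (nbhs_filter x) id x (@cvg_id _ (nbhs x)) _ (divr_gt0 e0 c1).
apply: filterS => y xy; rewrite -raddfB /=.
apply: (le_trans (T_bound _ _)); apply: (@le_trans _ _ ((C (`|a| + 1) + 1) * `|x - y|)).
  by rewrite ler_wpM2r// lerDl.
by rewrite mulrC -ler_pdivlMr.
Qed.

Let p0 : 0 < p. Proof. exact: lt_trans p1. Qed.

Let powR_small (K e : R) : 0 <= K -> 0 < e ->
  exists2 d : R, 0 < d & forall x, 0 <= x <= d -> K * x `^ p <= e * x.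
Proof.
move=> K0 e0; have K1 : 0 < K + 1 by rewrite ltr_wpDl.
have pp : 0 < p - 1 by rewrite subr_gt0.
exists ((e / (K + 1)) `^ (p - 1)^-1); first by rewrite powR_gt0// divr_gt0.
move=> x /andP[]; rewrite le_eqVlt => /predU1P[<- _|x0 xd].
  by rewrite powR0 ?gt_eqF// !mulr0.
rewrite powS// mulrA ler_wpM2r ?(ltW x0)//.
apply: (@le_trans _ _ ((K + 1) * x `^ (p - 1))).
  by rewrite ler_wpM2r ?powR_ge0// lerDl.
rewrite mulrC -ler_pdivlMr//.
have : x `^ (p - 1) <= ((e / (K + 1)) `^ (p - 1)^-1) `^ (p - 1).
  by apply: ge0_ler_powR; rewrite ?nnegrE ?powR_ge0 ?(ltW pp) ?(ltW x0).
by rewrite -powRrM mulVf ?gt_eqF// powRr1// divr_ge0// ltW.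
Qed.

Let G_littleo a : G \o shift a = cst (G a) + Tl a +o_ (0 : V) id.
Proof.
apply/eqaddoP => e e0.
have [||d d0 hd] := @powR_small (C (`|a| + 1) / (1 - q)) e.
- by rewrite divr_ge0// subr_ge0 ltW//; case/andP: q01.
- exact: e0.
have dm : 0 < Num.min d 1 by rewrite lt_min d0 ltr01.
have := @cvgr_dist_le _ _ _ (nbhs (0 : V)) (nbhs_filter (0 : V)) id 0 (@cvg_id _ (nbhs (0 : V))) _ dm.
apply: filterS => h; rewrite sub0r normrN le_min => /andP[hd1 h1] /=.
rewrite -[X in `|X|]/(G (h + a) - (G a + T a h)) [h + a]addrC opprD addrA.
apply: (le_trans (T_taylor _ _)).
apply: (@le_trans _ _ (C (`|a| + 1) / (1 - q) * `|h| `^ p)).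
  rewrite ler_wpM2r ?powR_ge0// ler_wpM2r ?invr_ge0 ?subr_ge0//.
    by rewrite ltW//; case/andP: q01.
  by apply: C_mono; rewrite lerD2l.
by apply: hd; rewrite normr_ge0.
Qed.

Let diff_G a : 'd G a = Tl a :> (V -> W).
Proof. exact: diff_unique (@T_continuous a) (G_littleo a). Qed.

(** When [|h| = |a - b|] the difference [T a h - T b h] is made of two Taylor remainders and of the
    second differences of the pairs (a + h, b) and (b + h, a), whose midpoints coincide. Homogeneity
    later removes the condition on h. *)
Let T_holder r a b h : `|a| <= r -> `|b| <= r -> h != 0 ->  `|h| = `|a - b| ->
  `|T a h - T b h| <= (8 + 2 / (1 - q)) * C (3 * r) * `|a - b| `^ p.
Proof.
move=> ar br h0 hab; have r0 : 0 <= r := le_trans (normr_ge0 _) ar.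
have hr : `|h| <= 2 * r by rewrite hab (le_trans (ler_normB _ _))//; lra.
have ah : `|a + h| <= 3 * r by rewrite (le_trans (ler_normD _ _))//; lra.
have bh : `|b + h| <= 3 * r by rewrite (le_trans (ler_normD _ _))//; lra.
have a3 : `|a| <= 3 * r by lra.
have b3 : `|b| <= 3 * r by lra.
have i1 : 0 <= (1 - q)^-1 by rewrite invr_ge0 subr_ge0 ltW//; case/andP: q01.
have ta c : `|c| <= r -> `|G (c + h) - G c - T c h| <= C (3 * r) / (1 - q) * `|a - b| `^ p.
  move=> cr; apply: (le_trans (T_taylor _ _)); rewrite hab ler_wpM2r ?powR_ge0// ler_wpM2r//.
  by apply: C_mono; rewrite -hab; lra.
have mid x y : `|x| <= 3 * r -> `|y| <= 3 * r -> `|x - y| <= 2 * `|a - b| ->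
    `|G x + G y - 2 *: G (2^-1 *: (x + y))| <= 4 * C (3 * r) * `|a - b| `^ p.
  move=> x3 y3 xy; apply: (le_trans (G_mid x3 y3)); rewrite [4 * _]mulrC -mulrA ler_wpM2l//.
  apply: (@le_trans _ _ ((2 * `|a - b|) `^ p)).
    by apply: ge0_ler_powR; rewrite ?nnegrE ?mulr_ge0 ?(ltW p0).
  rewrite powRM// ler_wpM2r ?powR_ge0//.
  have -> : 4 = 2 `^ 2 :> R by rewrite powR_mulrn// -natrX.
  by rewrite ler_powR// ler1n.
have m1 := mid (a + h) b ah b3 _.
have m2 := mid (b + h) a bh a3 _.
have {}m1 : `|G (a + h) + G b - 2 *: G (2^-1 *: (a + h + b))| <= 4 * C (3 * r) * `|a - b| `^ p.
  by apply: m1; rewrite addrAC (le_trans (ler_normD _ _))// hab; lra.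
have {}m2 : `|G (b + h) + G a - 2 *: G (2^-1 *: (b + h + a))| <= 4 * C (3 * r) * `|a - b| `^ p.
  by apply: m2; rewrite addrAC (le_trans (ler_normD _ _))// hab [`|b - a|]distrC; lra.
have -> : T a h - T b h = (G (b + h) - G b - T b h) - (G (a + h) - G a - T a h)
   + (G (a + h) + G b - 2 *: G (2^-1 *: (a + h + b)))
   - (G (b + h) + G a - 2 *: G (2^-1 *: (b + h + a))).
  have -> : 2^-1 *: (b + h + a) = 2^-1 *: (a + h + b) by lmod R.
  by lmod R.
apply: (le_trans (ler_normB _ _)); apply: (le_trans (lerD (ler_normD _ _) m2)).
apply: (le_trans (lerD (lerD (ler_normB _ _) m1) (lexx _))).
apply: (le_trans (lerD (lerD (lerD (ta b br) (ta a ar)) (lexx _)) (lexx _))).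
by apply: eqle; ring.
Qed.

Theorem zygmund_C1holder (A : set V) : C1holder (p - 1) A G.
Proof.
split=> [a _|a _].
  by apply/diff_locallyP; rewrite diff_G; split; [exact: T_continuous|exact: G_littleo].
pose r := `|a| + 1; pose K := (8 + 2 / (1 - q)) * C (3 * r).
exists K; near=> y z => h; rewrite !diff_G /=.
have nr (x : V) : `|a - x| <= 1 -> `|x| <= r.
  by move=> ax; rewrite -[x](subKr a) (le_trans (ler_normB _ _))// /r lerD2l.
have yr : `|y| <= r.
  by apply: nr; near: y; apply: (@cvgr_dist_le _ _ _ (nbhs a)).
have zr : `|z| <= r.
  by apply: nr; near: z; apply: (@cvgr_dist_le _ _ _ (nbhs a)).
have [->|h0] := eqVneq h 0.
  have T0 c : T c 0 = 0 by rewrite -(scale0r (0 : V)) T_scale scale0r.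
  by rewrite !T0 subrr !normr0 mulr0.
have K0 : 0 <= K.
  by rewrite mulr_ge0// addr_ge0// divr_ge0// subr_ge0 ltW//; case/andP: q01.
have [->|yz] := eqVneq y z.
  by rewrite subrr normr0 mulr_ge0// mulr_ge0// powR_ge0.
have d0 : 0 < `|y - z| by rewrite normr_gt0 subr_eq0.
have hp : 0 < `|h| by rewrite normr_gt0.
pose c := `|y - z| / `|h|; have c0 : 0 < c by rewrite divr_gt0.
have ch : `|c *: h| = `|y - z| by rewrite normrZ gtr0_norm// divfK// gt_eqF.
have ch0 : c *: h != 0 by rewrite -normr_gt0 ch.
have := T_holder yr zr ch0 ch; rewrite !T_scale -scalerBr normrZ gtr0_norm// powS// mulrA.
rewrite mulrC -ler_pdivlMr// /c => /le_trans; apply.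
rewrite -/K; apply: eqle; clearbody K; field.
by rewrite !gt_eqF.
Unshelve. all: by end_near. Qed.

End Zygmund.

(** * Integrals of real functions *)

#[local] Instance ae_filter (R : realType) : Filter (nbhs (almost_everywhere (@lebesgue_measure R))) :=
  ae_filter_ringOfSetsType _.

Local Notation mu := (@lebesgue_measure _).

Section RealIntegral.
Context {R : realType}.
Implicit Types (f g : R -> R) (D : set (measurableTypeR R)) (a x y : R).

Definition intg D f := mu.-integrable D (EFin \o f).

Lemma intg_eq D f g : measurable D -> (forall x, D x -> f x = g x) -> intg D f -> intg D g.
Proof. by move=> mD e; apply: eq_integrable => // x /set_mem /e /= ->. Qed.

Lemma intgD D f g : measurable D -> intg D f -> intg D g -> intg D (fun x => f x + g x).
Proof. by move=> mD hf hg; have := integrableD mD hf hg; apply: eq_integrable. Qed.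

Lemma intgZ D a f : measurable D -> intg D f -> intg D (fun x => a * f x).
Proof. by move=> mD hf; have := integrableZl mD a hf; apply: eq_integrable. Qed.

Lemma intgN D f : measurable D -> intg D f -> intg D (fun x => - f x).
Proof.
move=> mD hf; apply: intg_eq (intgZ (-1) mD hf) => // x _; exact: mulN1r.
Qed.

Lemma intgB D f g : measurable D -> intg D f -> intg D g -> intg D (fun x => f x - g x).
Proof. by move=> mD hf hg; apply: intgD => //; exact: intgN. Qed.

Lemma intg_abs D f : measurable D -> intg D f -> intg D (fun x => `|f x|).
Proof. by move=> mD hf; have := integrable_norm hf; apply: eq_integrable. Qed.

Lemma intg_sum D (T : Type) (r : seq T) (F : T -> R -> R) : measurable D ->
  (forall i, intg D (F i)) -> intg D (fun x => \sum_(i <- r) F i x).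
Proof.
move=> mD h; elim: r => [|i r IH].
  apply: (@intg_eq _ (cst 0)) => // [x _|]; first by rewrite big_nil.
  by apply: eq_integrable (integrable0 mu D).
apply: intg_eq (intgD mD (h i) IH) => // x _; by rewrite big_cons.
Qed.

Lemma int_add D f g : measurable D -> intg D f -> intg D g ->
  \int[mu]_(x in D) (f x + g x) = \int[mu]_(x in D) f x + \int[mu]_(x in D) g x.
Proof. by move=> mD hf hg; rewrite RintegralD. Qed.

Lemma int_scale D a f : measurable D -> intg D f ->
  \int[mu]_(x in D) (a * f x) = a * \int[mu]_(x in D) f x.
Proof. by move=> mD hf; rewrite RintegralZl. Qed.

Lemma int_sub D f g : measurable D -> intg D f -> intg D g ->
  \int[mu]_(x in D) (f x - g x) = \int[mu]_(x in D) f x - \int[mu]_(x in D) g x.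
Proof. by move=> mD hf hg; rewrite RintegralB. Qed.

Lemma int_sum D (T : Type) (r : seq T) (F : T -> R -> R) : measurable D ->
  (forall i, intg D (F i)) ->
  \int[mu]_(x in D) (\sum_(i <- r) F i x) = \sum_(i <- r) \int[mu]_(x in D) F i x.
Proof.
move=> mD h; elim: r => [|i r IH].
  by under eq_Rintegral do rewrite big_nil; rewrite big_nil Rintegral_cst// mul0r.
under eq_Rintegral do rewrite big_cons.
by rewrite int_add ?big_cons ?IH//; exact: intg_sum.
Qed.

Lemma int_le D f g : measurable D -> intg D f -> intg D g ->
  (forall x, D x -> f x <= g x) -> \int[mu]_(x in D) f x <= \int[mu]_(x in D) g x.
Proof. by move=> mD hf hg fg; apply: le_Rintegral. Qed.

Lemma int_abs D f g : measurable D -> intg D f -> intg D g ->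
  (forall x, D x -> `|f x| <= g x) -> `|\int[mu]_(x in D) f x| <= \int[mu]_(x in D) g x.
Proof.
move=> mD hf hg fg; apply: (@le_trans _ _ (\int[mu]_(x in D) `|f x|)).
  exact: le_normr_Rintegral.
by apply: int_le => //; exact: intg_abs.
Qed.

Lemma int_eq D f g : (forall x, D x -> f x = g x) ->
  \int[mu]_(x in D) f x = \int[mu]_(x in D) g x.
Proof. by move=> e; apply: eq_Rintegral => x /set_mem /e. Qed.

Lemma int_itv_split x y z f : x <= y -> y <= z -> intg `[x, z] f ->
  \int[mu]_(t in `[x, z]) f t = \int[mu]_(t in `[x, y]) f t + \int[mu]_(t in `[y, z]) f t.
Proof.
move=> xy yz hf.
have := @Rintegral_itvB _ f (BLeft x) (BRight z) y hf; rewrite !bnd_simp => /(_ xy yz).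
rewrite (@Rintegral_itv_obnd_cbnd _ y (BRight z) f).
  by move=> <-; rewrite addrC subrK.
apply: integrableS hf => // t; rewrite /= !in_itv /= => /andP[yt ->].
by rewrite andbT (le_trans xy)// ltW.
Qed.

(* Minimise the nonnegative quadratic polynomial t |-> int (t f + g)^2. *)
Lemma int_CS D f g : measurable D -> intg D (fun x => f x ^+ 2) -> intg D (fun x => g x ^+ 2) ->
  intg D (fun x => f x * g x) ->
  (\int[mu]_(x in D) (f x * g x)) ^+ 2 <=
  \int[mu]_(x in D) (f x ^+ 2) * \int[mu]_(x in D) (g x ^+ 2).
Proof.
move=> mD hf hg hfg.
set a := \int[mu]_(x in D) (f x ^+ 2); set b := \int[mu]_(x in D) (g x ^+ 2).
set c := \int[mu]_(x in D) (f x * g x).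
have q t : 0 <= t ^+ 2 * a + 2 * t * c + b.
  have -> : t ^+ 2 * a + 2 * t * c + b = \int[mu]_(x in D) ((t * f x + g x) ^+ 2).
    rewrite /a /b /c -!int_scale// -!int_add//; last 3 first.
    - by apply: intgD => //; exact: intgZ.
    - exact: intgZ.
    - exact: intgZ.
    by apply: int_eq => x _; ring.
  by apply: Rintegral_ge0 => x _; exact: sqr_ge0.
have a0 : 0 <= a by apply: Rintegral_ge0 => x _; exact: sqr_ge0.
have [az|an] := eqVneq a 0.
  have [->|c0] := eqVneq c 0; first by rewrite expr0n az mul0r.
  have := q (- (b + 1) / (2 * c)); rewrite az mulr0 add0r.
  have -> : 2 * (- (b + 1) / (2 * c)) * c + b = -1 by field.
  by rewrite oppr_ge0 ler10.
have := q (- c / a).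
have -> : (- c / a) ^+ 2 * a + 2 * (- c / a) * c + b = b - c ^+ 2 / a by field.
by rewrite subr_ge0 ler_pdivrMr ?lt0r ?an// mulrC.
Qed.

End RealIntegral.

(** * Continuous and square-integrable functions on [0, L] *)

Section OnInterval.
Context {R : realType} {L : {posnum R}}.
Local Notation I := `[0, L%:num]%classic.
Implicit Types (f g u v A : R -> R) (a x y : R).

Lemma mI : measurable (I : set (measurableTypeR R)). Proof. exact: measurable_itv. Qed.
Hint Resolve mI : core.

Lemma I0 : I 0. Proof. by rewrite /= in_itv /= lexx ltW. Qed.
Lemma IL : I L%:num. Proof. by rewrite /= in_itv /= lexx andbT ltW. Qed.
Hint Resolve I0 IL : core.

Definition cts f := {within I, continuous f}.

Lemma cts_cst a : cts (fun=> a).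
Proof. by move=> x; exact: cvg_cst. Qed.

Lemma cts_add f g : cts f -> cts g -> cts (fun x => f x + g x).
Proof. by move=> cf cg x; apply: (@cvgD _ _ _ (nbhs (x : subspace I))); [exact: cf|exact: cg]. Qed.

Lemma cts_mul f g : cts f -> cts g -> cts (fun x => f x * g x).
Proof. by move=> cf cg x; apply: (@cvgM _ _ (nbhs (x : subspace I))); [exact: cf|exact: cg]. Qed.

Lemma cts_scale a f : cts f -> cts (fun x => a * f x).
Proof. by move=> cf; apply: cts_mul => //; exact: cts_cst. Qed.

Lemma cts_opp f : cts f -> cts (fun x => - f x).
Proof. by move=> cf x; apply: (@cvgN _ _ _ (nbhs (x : subspace I))); exact: cf. Qed.

Lemma cts_sub f g : cts f -> cts g -> cts (fun x => f x - g x).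
Proof. by move=> cf cg; apply: cts_add => //; exact: cts_opp. Qed.

Lemma cts_sum (T : Type) (r : seq T) (F : T -> R -> R) :
  (forall i, cts (F i)) -> cts (fun x => \sum_(i <- r) F i x).
Proof.
move=> h; elim: r => [|i r IH].
  rewrite (_ : (fun _ => _) = fun=> 0); first exact: cts_cst.
  by apply/funext => x; rewrite big_nil.
rewrite (_ : (fun _ => _) = fun x => F i x + \sum_(j <- r) F j x); first exact: cts_add.
by apply/funext => x; rewrite big_cons.
Qed.

Lemma cts_eq f g : (forall x, I x -> f x = g x) -> cts f -> cts g.
Proof. by move=> e; apply: subspace_eq_continuous => x /set_mem /e. Qed.

Lemma cts_continuous f : continuous f -> cts f.
Proof. exact: continuous_subspaceT. Qed.

Lemma cts_abs f : cts f -> cts (fun x => `|f x|).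
Proof. by move=> cf x; apply: (@cvg_norm _ _ _ (nbhs (x : subspace I))); exact: cf. Qed.

Lemma cts_bounded f : cts f -> exists2 M, 0 <= M & forall x, I x -> `|f x| <= M.
Proof.
move=> cf; have [c cI hc] := EVT_max (ltW (gt0 L)) (cts_abs cf).
by exists `|f c| => // x Ix; exact: hc.
Qed.

Lemma cts_intg f : cts f -> intg I f.
Proof. by move=> cf; apply: continuous_compact_integrable => //; exact: segment_compact. Qed.

Lemma L2_eq f g : (forall x, I x -> f x = g x) -> L2fun L f -> L2fun L g.
Proof.
move=> e; rewrite /L2fun; have -> // : f \_ I = g \_ I.
by apply/funext => x; rewrite /patch; case: ifPn => // /set_mem /e.
Qed.

Lemma L2_add f g : L2fun L f -> L2fun L g -> L2fun L (fun x => f x + g x).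
Proof.
by move=> hf hg; apply: L2_eq (L2fun_lin 1 hf hg) => x _; rewrite mul1r.
Qed.

Lemma L2_scale a f : L2fun L f -> L2fun L (fun x => a * f x).
Proof.
move=> hf; have h0 : L2fun L (cst 0) by apply: L2fun_cont; exact: cts_cst.
by apply: L2_eq (L2fun_lin a hf h0) => x _; rewrite addr0.
Qed.

Lemma L2_opp f : L2fun L f -> L2fun L (fun x => - f x).
Proof. by move=> hf; apply: L2_eq (L2_scale (-1) hf) => x _; rewrite mulN1r. Qed.

Lemma L2_sub f g : L2fun L f -> L2fun L g -> L2fun L (fun x => f x - g x).
Proof. by move=> hf hg; apply: L2_add => //; exact: L2_opp. Qed.

Lemma L2_cts f : cts f -> L2fun L f. Proof. exact: L2fun_cont. Qed.

Lemma L2_sum (T : Type) (r : seq T) (F : T -> R -> R) :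
  (forall i, L2fun L (F i)) -> L2fun L (fun x => \sum_(i <- r) F i x).
Proof.
move=> h; elim: r => [|i r IH].
  by apply: L2_eq (L2_cts (@cts_cst 0)) => x _; rewrite big_nil.
by apply: L2_eq (L2_add (h i) IH) => x _; rewrite big_cons.
Qed.

Lemma L2_intg f g : L2fun L f -> L2fun L g -> intg I (fun x => f x * g x).
Proof. exact: L2fun_intM. Qed.

Lemma L2_intg1 f : L2fun L f -> intg I f. Proof. exact: L2fun_int. Qed.

Lemma L2_sqr f : L2fun L f -> intg I (fun x => f x ^+ 2).
Proof. by move=> hf; apply: intg_eq (L2_intg hf hf) => // x _; rewrite expr2. Qed.

Lemma L2_mul_bounded A f M : measurable_fun I A -> (forall x, I x -> `|A x| <= M) ->
  L2fun L f -> L2fun L (fun x => A x * f x).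
Proof.
move=> mA AM hf; have mf := L2fun_meas hf.
have mAf : measurable_fun I (fun x => A x * f x) by exact: measurable_funM.
apply: L2funP => //; have := intgZ (M ^+ 2) mI (L2_sqr hf); apply: (le_integrable mI).
  by apply/measurable_EFinP; exact: measurable_funX.
move=> x Ix /=; have p : 0 <= M ^+ 2 * f x ^+ 2 by apply: mulr_ge0; exact: sqr_ge0.
rewrite lee_fin ger0_norm ?sqr_ge0// (ger0_norm p).
rewrite exprMn ler_wpM2r ?sqr_ge0//.
have h := AM x Ix; have h1 : `|A x| ^+ 2 <= M ^+ 2.
  by rewrite ler_pXn2r ?nnegrE// (le_trans _ h).
by move: h1; rewrite real_normK ?num_real.
Qed.

Lemma L2_mul A f : cts A -> L2fun L f -> L2fun L (fun x => A x * f x).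
Proof.
move=> cA hf; have [M M0 AM] := cts_bounded cA.
by apply: (L2_mul_bounded _ AM) => //; exact: subspace_continuous_measurable_fun.
Qed.

(** Functions are not identified: [nrm] is only a seminorm, and a vanishing [nrm] of a difference
    plays the role of equality of classes. *)
Definition ip f g := \int[mu]_(x in I) (f x * g x).
Definition nrm f := Num.sqrt (ip f f).

Lemma ipC f g : ip f g = ip g f.
Proof. by apply: eq_Rintegral => x _; exact: mulrC. Qed.

Lemma ip_eq f g u v : (forall x, I x -> f x * g x = u x * v x) -> ip f g = ip u v.
Proof. exact: int_eq. Qed.

Lemma ip_addl f g h : L2fun L f -> L2fun L g -> L2fun L h ->
  ip (fun x => f x + g x) h = ip f h + ip g h.
Proof.
move=> hf hg hh; rewrite /ip -int_add//; try exact: L2_intg.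
by apply: int_eq => x _; rewrite mulrDl.
Qed.

Lemma ip_scalel a f h : L2fun L f -> L2fun L h -> ip (fun x => a * f x) h = a * ip f h.
Proof.
move=> hf hh; rewrite /ip -int_scale//; last exact: L2_intg.
by apply: int_eq => x _; rewrite mulrA.
Qed.

Lemma ip_subl f g h : L2fun L f -> L2fun L g -> L2fun L h ->
  ip (fun x => f x - g x) h = ip f h - ip g h.
Proof.
move=> hf hg hh; rewrite /ip -int_sub//; try exact: L2_intg.
by apply: int_eq => x _; rewrite mulrBl.
Qed.

Lemma ip_suml (T : Type) (r : seq T) (F : T -> R -> R) h : (forall i, L2fun L (F i)) ->
  L2fun L h -> ip (fun x => \sum_(i <- r) F i x) h = \sum_(i <- r) ip (F i) h.
Proof.
move=> hF hh; rewrite /ip -int_sum//; last by move=> i; exact: L2_intg.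
by apply: int_eq => x _; rewrite mulr_suml.
Qed.

Lemma ip_ge0 f : 0 <= ip f f.
Proof. by apply: Rintegral_ge0 => x _; rewrite -expr2 sqr_ge0. Qed.

Lemma nrm_ge0 f : 0 <= nrm f. Proof. exact: sqrtr_ge0. Qed.
Hint Resolve nrm_ge0 : core.

Lemma sqr_nrm f : nrm f ^+ 2 = ip f f. Proof. by rewrite sqr_sqrtr// ip_ge0. Qed.

Lemma ipE2 f : ip f f = \int[mu]_(x in I) (f x ^+ 2).
Proof. by apply: int_eq => x _; rewrite expr2. Qed.

Lemma le_ip f g : L2fun L f -> L2fun L g -> `|ip f g| <= nrm f * nrm g.
Proof.
move=> hf hg; have := int_CS mI (L2_sqr hf) (L2_sqr hg) (L2_intg hf hg).
rewrite -!ipE2 -!sqr_nrm -exprMn -[X in X <= _]real_normK ?num_real//.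
by rewrite ler_pXn2r ?nnegrE ?mulr_ge0.
Qed.

Lemma nrm_le f M : 0 <= M -> ip f f <= M ^+ 2 -> nrm f <= M.
Proof. by move=> M0 h; rewrite -(ler_pXn2r (ltn0Sn 1)) ?nnegrE// sqr_nrm. Qed.

Lemma nrmD f g : L2fun L f -> L2fun L g -> nrm (fun x => f x + g x) <= nrm f + nrm g.
Proof.
move=> hf hg; apply: nrm_le; first by rewrite addr_ge0.
rewrite ip_addl//; last exact: L2_add.
rewrite ipC [ip g _]ipC !ip_addl// sqrrD !sqr_nrm [ip g f]ipC.
by have := le_trans (ler_norm _) (le_ip hf hg); lra.
Qed.

Lemma nrmZ a f : L2fun L f -> nrm (fun x => a * f x) = `|a| * nrm f.
Proof.
move=> hf; rewrite /nrm ip_scalel//; last exact: L2_scale.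
by rewrite ipC ip_scalel// mulrA -expr2 sqrtrM ?sqr_ge0// sqrtr_sqr.
Qed.

Lemma nrmB f g : L2fun L f -> L2fun L g -> nrm (fun x => f x - g x) <= nrm f + nrm g.
Proof.
move=> hf hg; apply: le_trans (nrmD hf (L2_opp hg)) _; rewrite lerD2l.
have -> : (fun x => - g x) = (fun x => -1 * g x) by apply/funext => x; rewrite mulN1r.
by rewrite nrmZ// normrN normr1 mul1r.
Qed.

Lemma nrm_eq f g : (forall x, I x -> f x = g x) -> nrm f = nrm g.
Proof. by move=> e; congr Num.sqrt; apply: ip_eq => x /e ->. Qed.

Lemma nrm_sum (T : Type) (r : seq T) (F : T -> R -> R) : (forall i, L2fun L (F i)) ->
  nrm (fun x => \sum_(i <- r) F i x) <= \sum_(i <- r) nrm (F i).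
Proof.
move=> h; elim: r => [|i r IH].
  rewrite big_nil nrm_le// expr0n /= /ip (int_eq (g := cst 0)) ?Rintegral_cst ?mul0r//.
  by move=> x _; rewrite big_nil mul0r.
rewrite big_cons (@nrm_eq _ (fun x => F i x + \sum_(j <- r) F j x)).
  by apply: le_trans (nrmD (h i) (L2_sum _ h)) _; rewrite lerD2l.
by move=> x _; rewrite big_cons.
Qed.

Lemma nrm_dom f g M : 0 <= M -> L2fun L f -> L2fun L g ->
  (forall x, I x -> `|f x| <= M * `|g x|) -> nrm f <= M * nrm g.
Proof.
move=> M0 hf hg fg; apply: nrm_le; first by rewrite mulr_ge0.
rewrite exprMn sqr_nrm !ipE2 -int_scale//; last exact: L2_sqr.
apply: int_le => //; [exact: L2_sqr|by apply: intgZ => //; exact: L2_sqr|].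
move=> x Ix; have h := fg x Ix.
rewrite -[f x ^+ 2]real_normK ?num_real// -[g x ^+ 2]real_normK ?num_real//.
by rewrite -exprMn ler_pXn2r ?nnegrE ?mulr_ge0.
Qed.

Lemma muI : fine (mu I) = L%:num.
Proof. by rewrite [X in fine X](lebesgue_measure_itv `[0, L%:num]) /= lte_fin gt0 oppr0 adde0. Qed.

Lemma nrm_bounded f M : L2fun L f -> 0 <= M -> (forall x, I x -> `|f x| <= M) ->
  nrm f <= M * Num.sqrt L%:num.
Proof.
move=> hf M0 fM; have h1 := L2_cts (@cts_cst 1).
apply: le_trans (nrm_dom M0 hf h1 _) _ => [x Ix|]; first by rewrite normr1 mulr1 fM.
rewrite ler_wpM2l// nrm_le ?sqrtr_ge0// sqr_sqrtr// /ip Rintegral_cst// muI.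
by rewrite mulr1 mul1r.
Qed.

Lemma int_le_nrm f : L2fun L f -> `|\int[mu]_(x in I) f x| <= Num.sqrt L%:num * nrm f.
Proof.
move=> hf; have h1 := L2_cts (@cts_cst 1).
have -> : \int[mu]_(x in I) f x = ip (cst 1) f by apply: int_eq => x _; rewrite mul1r.
apply: le_trans (le_ip h1 hf) _; rewrite ler_wpM2r//.
by rewrite -[leRHS]mul1r nrm_bounded// => x _; rewrite normr1.
Qed.

End OnInterval.
Arguments cts_cst {R L} a.
#[global] Hint Resolve mI I0 IL nrm_ge0 : core.

(** * Calculus of weak derivatives *)

Section WeakDerivatives.
Context {R : realType} {L : {posnum R}}.
Local Notation I := `[0, L%:num]%classic.
Local Notation hd := (has_L2deriv L).
Implicit Types (f g u v w : R -> R) (a x y : R).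

Lemma subI x y : I x -> I y -> `[x, y] `<=` I.
Proof.
rewrite /= !in_itv /= => /andP[x0 _] /andP[_ yL] t /=; rewrite !in_itv /= => /andP[xt ty].
by rewrite (le_trans x0 xt) (le_trans ty yL).
Qed.

Lemma mitv x y : measurable (`[x, y]%classic : set (measurableTypeR R)).
Proof. exact: measurable_itv. Qed.
Hint Resolve mitv : core.

Lemma intg_sub f x y : I x -> I y -> intg I f -> intg `[x, y] f.
Proof. by move=> Ix Iy hf; apply: integrableS hf => //; exact: subI. Qed.

Lemma hd_diff f g x y : hd f g -> I x -> I y -> x <= y ->
  f y - f x = \int[mu]_(t in `[x, y]) g t.
Proof.
move=> [hg e] Ix Iy xy; rewrite (e y)// (e x)// opprD addrACA subrr add0r.
have x0 : 0 <= x by move: Ix; rewrite /= in_itv /= => /andP[].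
have ig : intg `[0, y] g by apply: intg_sub => //; exact: L2_intg1.
by rewrite (int_itv_split x0 xy ig) addrC addKr.
Qed.

Lemma hd_cts f g : hd f g -> cts (L := L) f.
Proof.
move=> [hg e].
have L0 : 0 <= L%:num by [].
have c := parameterized_integral_continuous L0 (L2fun_int hg).
apply: (@cts_eq _ _ (fun x => f 0 + \int[mu]_(t in `[0, x]) g t)) => [x Ix|].
  by rewrite -e.
by apply: cts_add; [exact: cts_cst|exact: c].
Qed.

Lemma hd_eq f f' g g' : (forall x, I x -> f x = f' x) -> (forall x, I x -> g x = g' x) ->
  hd f g -> hd f' g'.
Proof.
move=> ef eg [hg e]; split; first exact: L2_eq hg.
move=> x Ix; rewrite -ef// -ef// e//; congr (_ + _); apply: int_eq => t tx.
by apply: eg; apply: (subI (I0 (L := L)) Ix).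
Qed.

Lemma hd_cst a : hd (fun=> a) (fun=> 0).
Proof.
split; first by apply: L2_cts; exact: cts_cst.
by move=> x _; rewrite Rintegral_cst// mul0r addr0.
Qed.

Lemma hd_scale a f g : hd f g -> hd (fun x => a * f x) (fun x => a * g x).
Proof.
move=> hf; have := has_L2deriv_lin a hf (hd_cst 0).
by apply: hd_eq => x _; rewrite addr0.
Qed.

Lemma hd_add f g u v : hd f u -> hd g v -> hd (fun x => f x + g x) (fun x => u x + v x).
Proof.
move=> hf hg; have := has_L2deriv_lin 1 hf hg.
by apply: hd_eq => x _; rewrite mul1r.
Qed.

Lemma hd_opp f g : hd f g -> hd (fun x => - f x) (fun x => - g x).
Proof. by move=> /(hd_scale (-1)); apply: hd_eq => x _; rewrite mulN1r. Qed.

Lemma hd_sub f g u v : hd f u -> hd g v -> hd (fun x => f x - g x) (fun x => u x - v x).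
Proof. by move=> hf hg; apply: hd_add => //; exact: hd_opp. Qed.

Lemma hd_sum (T : Type) (r : seq T) (F dF : T -> R -> R) : (forall i, hd (F i) (dF i)) ->
  hd (fun x => \sum_(i <- r) F i x) (fun x => \sum_(i <- r) dF i x).
Proof.
move=> h; elim: r => [|i r IH].
  by apply: hd_eq (hd_cst 0) => x _; rewrite big_nil.
by apply: hd_eq (hd_add (h i) IH) => x _; rewrite big_cons.
Qed.

Lemma hd_prim g : L2fun L g -> hd (fun x => \int[mu]_(t in `[0, x]) g t) g.
Proof.
by move=> hg; split => // x _; rewrite set_itv1 Rintegral_set1 add0r.
Qed.

Lemma hd_int f g : hd f g -> \int[mu]_(x in I) g x = f L%:num - f 0.
Proof. by move=> h; rewrite (hd_diff h)//; exact: I0. Qed.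

Lemma hd_C1 f df : (forall x, is_derive x 1 f (df x)) -> continuous df -> hd f df.
Proof.
move=> d cdf; have cf : continuous f by move=> x; exact: is_derive_continuous (d x).
split; first by apply: L2_cts; exact: cts_continuous.
move=> x; rewrite /= in_itv /= => /andP[+ _]; rewrite le_eqVlt => /predU1P[<-|x0].
  by rewrite set_itv1 Rintegral_set1 addr0.
rewrite /Rintegral (continuous_FTC2 (F := f) x0) /=; first by rewrite [RHS]addrC subrK.
- exact: continuous_subspaceT.
- split; first by move=> t _; case: (d t).
  + by apply: cvg_at_right_filter; exact: cf.
  + by apply: cvg_at_left_filter; exact: cf.
- by move=> t _; rewrite derive1E; case: (d t).
Qed.

(* Subdivide [0, x] into 2 ^ k equal parts: the bound telescopes to O(2 ^- k). *)
Lemma superadditive_const (D W : R -> R) (K : R) : (forall x y, I x -> I y -> x <= y ->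
    `|D y - D x| <= K * (y - x) * (W y - W x)) -> forall x, I x -> D x = D 0.
Proof.
move=> h x Ix; have := Ix; rewrite /= in_itv /= => /andP[x0 xL].
apply/eqP; rewrite -subr_eq0 -normr_le0.
have h01 : 0 <= (2^-1 : R) < 1 by rewrite invr_ge0 ler0n /= invf_lt1 ?ltr1n.
apply: (@le_geometric _ _ _ (K * x * (W x - W 0)) 2^-1 h01) => k; rewrite add0r.
pose n := (2 ^ k)%N; pose p i : R := x * (i%:R / n%:R).
have n0 : 0 < n%:R :> R by rewrite ltr0n expn_gt0.
have pn : p n = x by rewrite /p divff ?mulr1// gt_eqF.
have p0 : p 0%N = 0 by rewrite /p mul0r mulr0.
have pS i : p i.+1 - p i = x / n%:R by rewrite /p -natr1; field; rewrite gt_eqF.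
have pI i : (i <= n)%N -> I (p i).
  move=> le; rewrite /= in_itv /= mulr_ge0 ?divr_ge0 ?ler0n//= (le_trans _ xL)//.
  by rewrite ler_piMr// ler_pdivrMr// mul1r ler_nat.
have -> : D x - D 0 = \sum_(0 <= i < n) (D (p i.+1) - D (p i)).
  by rewrite (telescope_sumr (fun i => D (p i)) (leq0n n)) pn p0.
apply: le_trans (ler_norm_sum _ _ _) _.
apply: (@le_trans _ _ (\sum_(0 <= i < n) K * (x / n%:R) * (W (p i.+1) - W (p i)))).
  rewrite !big_mkord; apply: ler_sum => i _; rewrite -(pS i); apply: h.
  - by apply: pI; exact: ltnW.
  - exact: pI.
  - by rewrite -subr_ge0 pS divr_ge0.
rewrite -mulr_sumr (telescope_sumr (fun i => W (p i)) (leq0n n)) pn p0 /n natrX exprVn.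
by apply: eqle; field; rewrite expf_neq0.
Qed.

(** The l1 norm, adapted to estimates entry by entry. *)
Definition nv (m : nat) (a : 'cV[R]_m) : R := \sum_(l < m) `|a l 0|.

Lemma nv_ge0 m (a : 'cV[R]_m) : 0 <= nv a. Proof. exact: sumr_ge0. Qed.

Lemma le_nv m (a : 'cV[R]_m) l : `|a l 0| <= nv a.
Proof. by rewrite /nv (bigD1 l)//= lerDl sumr_ge0. Qed.

Lemma cts_nv m (u : R -> 'cV[R]_m) (Phi : R -> R) (M : R) :
  (forall l, cts (L := L) (fun x => u x l 0)) -> 0 <= M ->
  (forall x y, `|Phi x - Phi y| <= M * nv (u x - u y)) -> cts (L := L) Phi.
Proof.
move=> cu M0 h x; apply/(@cvgrPdist_le _ _ _ (nbhs (x : subspace I))) => e e0.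
have c : cts (L := L) (fun y => M * \sum_(l < m) `|u x l 0 - u y l 0|).
  apply: cts_scale; apply: cts_sum => l; apply: cts_abs; apply: cts_sub => //.
  exact: cts_cst.
have := @cvgr_dist_le _ _ _ (nbhs (x : subspace I)) (nbhs_filter (x : subspace I)) _ _ (c x) e e0.
apply: filterS => y; rewrite /from_subspace big1 => [|l _]; last by rewrite subrr normr0.
rewrite mulr0 sub0r normrN => hy; apply: le_trans (h x y) _; apply: le_trans hy.
apply: le_trans (ler_norm _); rewrite ler_wpM2l// /nv ler_sum// => l _.
by rewrite !mxE.
Qed.

Lemma L2_abs f : L2fun L f -> L2fun L (fun x => `|f x|).
Proof.
move=> hf; apply: L2funP; first by apply: measurableT_comp => //; exact: L2fun_meas.
by apply: intg_eq (L2_sqr hf) => [|x _]; [exact: mI|rewrite real_normK ?num_real].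
Qed.

Lemma int_sqr_le f x y : L2fun L f -> I x -> I y -> x <= y ->
  (\int[mu]_(t in `[x, y]) f t) ^+ 2 <= (y - x) * \int[mu]_(t in `[x, y]) (f t ^+ 2).
Proof.
move=> hf Ix Iy xy; have h1 := L2_cts (cts_cst (L := L) 1).
have m1 : \int[mu]_(t in `[x, y]) (1 ^+ 2) = y - x.
  rewrite expr1n Rintegral_cst// mul1r [X in fine X](lebesgue_measure_itv `[x, y]) /= lte_fin.
  by case: ltP => //= yx; apply/eqP; rewrite eq_sym subr_eq0 eq_le yx.
rewrite -m1; have -> : \int[mu]_(t in `[x, y]) f t = \int[mu]_(t in `[x, y]) (1 * f t).
  by apply: int_eq => t _; rewrite mul1r.
apply: int_CS => //; apply: intg_sub => //.
- exact: L2_sqr h1.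
- exact: L2_sqr hf.
- exact: L2_intg h1 hf.
Qed.

(** With V the sum of the [|w_l|], the Taylor remainder over [x, y] and the variation of [dPhi]
    there are both at most M times the square of the integral of V, hence at most [M * (y - x)]
    times that of V ^ 2. By [superadditive_const] the two sides differ by a constant. *)
Lemma hd_chain m (Phi : 'cV[R]_m -> R) (dPhi : 'I_m -> 'cV[R]_m -> R) (M : R)
    (u w : R -> 'cV[R]_m) : 0 <= M ->
  (forall a b : 'cV[R]_m, `|Phi b - Phi a - \sum_l dPhi l a * (b - a) l 0| <= M * nv (b - a) ^+ 2) ->
  (forall l (a b : 'cV[R]_m), `|dPhi l b - dPhi l a| <= M * nv (b - a)) ->
  weak_deriv L u w ->
  hd (fun x => Phi (u x)) (fun x => \sum_l dPhi l (u x) * w x l 0).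
Proof.
move=> M0 tay lip hu.
have cu l : cts (L := L) (fun x => u x l 0) by exact: hd_cts (hu l).
have hw l : L2fun L (fun x => w x l 0) by case: (hu l).
have cd l : cts (L := L) (fun x => dPhi l (u x)).
  by apply: (cts_nv cu M0) => x y; apply: lip.
pose G x := \sum_l dPhi l (u x) * w x l 0.
have hG : L2fun L G by apply: L2_sum => l; exact: L2_mul.
pose V x := \sum_l `|w x l 0|.
have hV : L2fun L V by apply: L2_sum => l; exact: L2_abs.
have V0 x : 0 <= V x by exact: sumr_ge0.
have iV x y : I x -> I y -> intg `[x, y] V by move=> Ix Iy; apply: intg_sub => //; exact: L2_intg1.
have du x y : I x -> I y -> x <= y -> nv (u y - u x) <= \int[mu]_(t in `[x, y]) V t.
  move=> Ix Iy xy; rewrite int_sum//; last first.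
    by move=> l; apply: intg_sub => //; apply: intg_abs; [exact: mI|exact: L2_intg1].
  apply: ler_sum => l _; rewrite !mxE (hd_diff (hu l) Ix Iy xy).
  by apply: int_abs => //; apply: intg_sub => //; [exact: L2_intg1|exact/L2_intg1/L2_abs].
pose iVV x y := \int[mu]_(t in `[x, y]) (V t ^+ 2).
have key x y : I x -> I y -> x <= y ->
    `|(Phi (u y) - \int[mu]_(t in `[0, y]) G t) - (Phi (u x) - \int[mu]_(t in `[0, x]) G t)|
    <= 2 * M * (y - x) * (iVV 0 y - iVV 0 x).
  move=> Ix Iy xy; have x0 : 0 <= x by move: Ix; rewrite /= in_itv /= => /andP[].
  pose J := \int[mu]_(t in `[x, y]) V t.
  have J0 : 0 <= J by apply: Rintegral_ge0.
  have iw l : intg `[x, y] (fun t => w t l 0) by apply: intg_sub => //; exact: L2_intg1.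
  have idw l : intg `[x, y] (fun t => dPhi l (u t) * w t l 0).
    by apply: intg_sub => //; apply: L2_intg1; exact: L2_mul.
  have sG : \int[mu]_(t in `[0, y]) G t = \int[mu]_(t in `[0, x]) G t + \int[mu]_(t in `[x, y]) G t.
    by apply: int_itv_split => //; apply: intg_sub => //; exact: L2_intg1.
  have sV : iVV 0 y = iVV 0 x + iVV x y.
    by apply: int_itv_split => //; apply: intg_sub => //; exact: L2_sqr.
  have -> : (Phi (u y) - \int[mu]_(t in `[0, y]) G t) - (Phi (u x) - \int[mu]_(t in `[0, x]) G t)
     = (Phi (u y) - Phi (u x) - \sum_l dPhi l (u x) * (u y - u x) l 0)
     - \int[mu]_(t in `[x, y]) \sum_l (dPhi l (u t) - dPhi l (u x)) * w t l 0.
    have -> : \int[mu]_(t in `[x, y]) \sum_l (dPhi l (u t) - dPhi l (u x)) * w t l 0 =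
        \int[mu]_(t in `[x, y]) G t - \sum_l dPhi l (u x) * (u y - u x) l 0.
      have -> : \sum_l dPhi l (u x) * (u y - u x) l 0 =
          \int[mu]_(t in `[x, y]) \sum_l dPhi l (u x) * w t l 0.
        rewrite int_sum//; last by move=> l; exact: intgZ.
        apply: eq_bigr => l _; rewrite int_scale// !mxE; congr (_ * _).
        exact: hd_diff (hu l) Ix Iy xy.
      rewrite -int_sub//; last 2 first.
      - exact: intg_sum.
      - by apply: intg_sum => // l; exact: intgZ.
      by apply: int_eq => t _; rewrite -sumrB; apply: eq_bigr => l _; rewrite mulrBl.
    by rewrite sG; ring.
  apply: (le_trans (ler_normB _ _)).
  have h1 : `|Phi (u y) - Phi (u x) - \sum_l dPhi l (u x) * (u y - u x) l 0| <= M * J ^+ 2.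
    apply: (le_trans (tay _ _)); rewrite ler_wpM2l// ler_pXn2r ?nnegrE ?nv_ge0//.
    exact: du.
  have h2 : `|\int[mu]_(t in `[x, y]) \sum_l (dPhi l (u t) - dPhi l (u x)) * w t l 0| <= M * J ^+ 2.
    apply: (@le_trans _ _ (\int[mu]_(t in `[x, y]) (M * J * V t))).
      apply: int_abs => //; last 2 first.
      - by apply: intgZ => //; exact: iV.
      - move=> t txy; apply: (le_trans (ler_norm_sum _ _ _)); rewrite /V mulr_sumr.
        have It : I t := subI Ix Iy txy.
        have /andP[xt ty] : x <= t <= y by move: txy; rewrite /= in_itv.
        apply: ler_sum => l _; rewrite normrM ler_wpM2r// (le_trans (lip _ _ _))//.
        rewrite ler_wpM2l// (le_trans (du x t Ix It xt))// /J (int_itv_split xt ty) ?lerDl.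
          by apply: Rintegral_ge0.
        exact: iV.
      apply: intg_sum => // l.
      apply: (@intg_eq _ _ (fun t => dPhi l (u t) * w t l 0 - dPhi l (u x) * w t l 0)) => //.
        by move=> t _; rewrite mulrBl.
      by apply: intgB => //; exact: intgZ.
    by rewrite int_scale//; [rewrite -/J expr2 mulrA|exact: iV].
  apply: (le_trans (lerD h1 h2)).
  have -> : 2 * M * (y - x) * (iVV 0 y - iVV 0 x) = 2 * M * ((y - x) * iVV x y).
    by rewrite sV; ring.
  have := int_sqr_le hV Ix Iy xy; rewrite -/J -/(iVV x y) => h.
  have h3 := ler_wpM2l (mulr_ge0 (ler0n R 2) M0) h.
  by apply: le_trans h3; apply: eqle; ring.
split => // x Ix; have := superadditive_const key Ix.
by rewrite set_itv1 Rintegral_set1 subr0 => <-; rewrite subrK.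
Qed.

(** The chain rule for the product map on R^2, whose Taylor remainder is the product of the two
    increments. *)
Lemma hd_mul f g u v : hd f u -> hd g v -> hd (fun x => f x * g x) (fun x => f x * v x + g x * u x).
Proof.
move=> hf hg.
pose c (a b : R) : 'cV[R]_2 := \col_i (if i == 0 then a else b).
apply: (hd_eq _ _ (@hd_chain 2 (fun a : 'cV[R]_2 => a 0 0 * a 1 0) (fun l (a : 'cV[R]_2) => if l == 0 then a 1 0 else a 0 0) 1
  (fun x => c (f x) (g x)) (fun x => c (u x) (v x)) ler01 _ _ _)).
- by move=> x _; rewrite !mxE.
- by move=> x _; rewrite !big_ord_recl big_ord0 /= !mxE /=; ring.
- move=> a b; rewrite !big_ord_recl big_ord0 /= !mxE mul1r.
  have -> : lift ord0 ord0 = 1 :> 'I_2 by apply: val_inj.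
  have -> : b 0 0 * b 1 0 - a 0 0 * a 1 0 - (a 1 0 * (b 0 0 - a 0 0) + (a 0 0 * (b 1 0 - a 1 0) + 0))
    = (b - a) 0 0 * (b - a) 1 0 by rewrite !mxE; ring.
  by rewrite normrM expr2 ler_pM// le_nv.
- move=> l a b; rewrite mul1r; case: ifP => _.
    by have := le_nv (b - a) 1; rewrite !mxE.
  by have := le_nv (b - a) 0; rewrite !mxE.
- move=> l; case: (altP (l =P 0)) => [->|l0].
    by apply: hd_eq hf => x _; rewrite mxE.
  by apply: hd_eq hg => x _; rewrite mxE (negbTE l0).
Qed.

Lemma ibp f g u v : hd f u -> hd g v ->
  ip (L := L) f v = f L%:num * g L%:num - f 0 * g 0 - ip (L := L) u g.
Proof.
move=> hf hg; have := hd_int (hd_mul hf hg).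
have iu : L2fun L u by case: hf.
have iv : L2fun L v by case: hg.
have cf := L2_cts (hd_cts hf); have cg := L2_cts (hd_cts hg).
rewrite int_add; [|exact: mI|exact: L2_intg|exact: L2_intg] => <-.
rewrite /ip [X in _ = _ - X](int_eq (g := fun x => g x * u x)) ?addrK//.
by move=> x _; rewrite mulrC.
Qed.

Lemma hd_tail g : L2fun L g -> hd (fun x => \int[mu]_(t in `[x, L%:num]) g t) (fun x => - g x).
Proof.
move=> hg; have := hd_sub (hd_cst (\int[mu]_(t in I) g t)) (hd_prim hg).
apply: hd_eq => x Ix; last by rewrite sub0r.
have /andP[x0 xL] : 0 <= x <= L%:num by move: Ix; rewrite /= in_itv.
by rewrite (int_itv_split x0 xL (L2_intg1 hg)) addrC addKr.
Qed.

End WeakDerivatives.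

(** * The sine and cosine systems *)

Section Trigonometric.
Context {R : realType} {L : {posnum R}}.
Local Notation I := `[0, L%:num]%classic.
Local Notation hd := (has_L2deriv L).
Local Notation ipI := (ip (L := L)).
Local Notation cts := (cts (L := L)).
Implicit Types (f g h : R -> R) (j k n : nat) (x : R).

Definition om k : R := k%:R * pi / L%:num.
Definition sn k x : R := Num.sqrt (2 / L%:num) * sin (om k * x).
Definition cn k x : R :=
  (if k == 0%N then (Num.sqrt L%:num)^-1 else Num.sqrt (2 / L%:num)) * cos (om k * x).

Lemma om0 : om 0 = 0. Proof. by rewrite /om !mul0r. Qed.

Lemma om_ge0 k : 0 <= om k.
Proof. by rewrite divr_ge0// mulr_ge0// pi_ge0. Qed.

Lemma om_inj : injective om.
Proof.
move=> j k; rewrite /om => /divIf-/(_ (lt0r_neq0 (gt0 L))) /mulIf.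
by move=> /(_ (lt0r_neq0 (pi_gt0 R))) /eqP; rewrite eqr_nat => /eqP.
Qed.

Lemma is_derive_lin (c x : R) : is_derive x 1 (fun y => c * y) c.
Proof. by rewrite -[X in is_derive _ _ _ X]mulr1; exact: is_derive_scale. Qed.

Lemma is_derive_sn k x : is_derive x 1 (sn k) (om k * cn k x).
Proof.
have := is_derive_scale (Num.sqrt (2 / L%:num))
  (@is_derive1_comp _ sin (fun y => om k * y) x _ _ (is_derive_sin _) (is_derive_lin _ _)).
move=> /is_derive_eq; apply; rewrite /cn; case: eqP => [->|_]; first by rewrite om0; ring.
by ring.
Qed.

Lemma is_derive_cn k x : is_derive x 1 (cn k) (- om k * sn k x).
Proof.
have := is_derive_scale (if k == 0%N then (Num.sqrt L%:num)^-1 else Num.sqrt (2 / L%:num))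
  (@is_derive1_comp _ cos (fun y => om k * y) x _ _ (is_derive_cos _) (is_derive_lin _ _)).
move=> /is_derive_eq; apply; rewrite /sn; case: eqP => [->|_]; first by rewrite om0; ring.
by ring.
Qed.

Lemma continuous_sn k : continuous (sn k).
Proof. by move=> x; exact: is_derive_continuous (is_derive_sn k x). Qed.

Lemma continuous_cn k : continuous (cn k).
Proof. by move=> x; exact: is_derive_continuous (is_derive_cn k x). Qed.

Lemma hd_sn k : hd (sn k) (fun x => om k * cn k x).
Proof.
apply: hd_C1 => [x|x]; first exact: is_derive_sn.
by apply: cvgM; [exact: cvg_cst|exact: continuous_cn].
Qed.

Lemma hd_cn k : hd (cn k) (fun x => - om k * sn k x).
Proof.
apply: hd_C1 => [x|x]; first exact: is_derive_cn.
by apply: cvgM; [exact: cvg_cst|exact: continuous_sn].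
Qed.

Lemma cts_sn k : cts (sn k). Proof. exact: cts_continuous (@continuous_sn k). Qed.
Lemma cts_cn k : cts (cn k). Proof. exact: cts_continuous (@continuous_cn k). Qed.
Lemma L2_sn k : L2fun L (sn k). Proof. exact: L2_cts (@cts_sn k). Qed.
Lemma L2_cn k : L2fun L (cn k). Proof. exact: L2_cts (@cts_cn k). Qed.
Hint Resolve L2_sn L2_cn cts_sn cts_cn : core.

Lemma sn00 k : sn k 0 = 0. Proof. by rewrite /sn mulr0 sin0 mulr0. Qed.

Lemma sn0 x : sn 0 x = 0. Proof. by rewrite /sn om0 mul0r sin0 mulr0. Qed.

Lemma snL k : sn k L%:num = 0.
Proof.
rewrite /sn /om divfK ?gt_eqF//; suff -> : sin (k%:R * pi) = 0 :> R by rewrite mulr0.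
by elim: k => [|k IH]; rewrite ?mul0r ?sin0// -natr1 mulrDl mul1r sinDpi IH oppr0.
Qed.

Definition tb : R := Num.sqrt (2 / L%:num).

Lemma tb_ge0 : 0 <= tb. Proof. exact: sqrtr_ge0. Qed.

Lemma sn_le k x : `|sn k x| <= tb.
Proof. by rewrite normrM ger0_norm ?sqrtr_ge0// ler_piMr ?sqrtr_ge0// sin_max. Qed.

Lemma cn_le k x : `|cn k x| <= tb.
Proof.
rewrite normrM; apply: (@le_trans _ _ (`|if k == 0%N then (Num.sqrt L%:num)^-1 else tb| * 1)).
  by rewrite ler_wpM2l// cos_max.
rewrite mulr1; case: ifP => _; last by rewrite ger0_norm// tb_ge0.
rewrite ger0_norm ?invr_ge0 ?sqrtr_ge0// /tb -(sqrtrV (ltW (gt0 L))) ler_wsqrtr//.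
by rewrite ler_peMl ?invr_ge0// ler1n.
Qed.

(** Integration by parts, [sn] vanishing at both ends. The identities for (j, k) and for (k, j) form
    a linear system of determinant [om j ^+ 2 - om k ^+ 2], whence orthogonality; for j = k > 0 they
    show that both norms agree. *)
Lemma green_cs j k : om k * ipI (cn j) (cn k) = om j * ipI (sn j) (sn k).
Proof.
have := ibp (hd_cn j) (hd_sn k); rewrite !sn00 !snL !mulr0 subrr sub0r.
rewrite ipC ip_scalel// => e; rewrite ipC e ip_scalel//; ring.
Qed.

Lemma orth_cs j k : j != k -> ipI (cn j) (cn k) = 0 /\ ipI (sn j) (sn k) = 0.
Proof.
move=> jk; have e1 := green_cs j k; have := green_cs k j.
rewrite (ipC (cn k)) (ipC (sn k)) => e2.
have d : om j ^+ 2 - om k ^+ 2 != 0.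
  rewrite subr_sqr mulf_neq0//; first by rewrite subr_eq0; apply: contra_neq jk => /om_inj.
  rewrite paddr_eq0 ?om_ge0//; apply: contra_neqN jk => /andP[/eqP a /eqP b].
  by apply: om_inj; rewrite a b.
have e (a b : R) : om k * a = om j * b -> om j * a = om k * b -> a = 0.
  move=> h1 h2; apply/eqP; rewrite -(mulrI_eq0 _ (mulfI d)); apply/eqP.
  transitivity (om j * (om j * a) - om k * (om k * a)); first by ring.
  by rewrite h1 h2; ring.
by split; [exact: e e1 e2|apply: (e _ _ (esym e2) (esym e1))].
Qed.

Lemma norm_c0 : ipI (cn 0) (cn 0) = 1.
Proof.
rewrite /ip; under eq_Rintegral do rewrite /cn eqxx om0 mul0r cos0 mulr1.
by rewrite Rintegral_cst// muI -invfM -expr2 sqr_sqrtr// mulVf// gt_eqF.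
Qed.

Lemma norm_cs k : (0 < k)%N -> ipI (cn k) (cn k) = 1 /\ ipI (sn k) (sn k) = 1.
Proof.
move=> k0; have ok : om k != 0 by rewrite -om0 (inj_eq om_inj) -lt0n.
have e : ipI (cn k) (cn k) = ipI (sn k) (sn k) by apply: (mulfI ok); exact: green_cs.
have s : ipI (cn k) (cn k) + ipI (sn k) (sn k) = 2.
  rewrite /ip -int_add//; [|exact: L2_intg|exact: L2_intg].
  rewrite (int_eq (g := cst (2 / L%:num))) ?Rintegral_cst// ?muI ?divfK ?gt_eqF//.
  move=> x _; rewrite /cn /sn gtn_eqF//=; set b := Num.sqrt _.
  have -> (c d : R) : b * c * (b * c) + b * d * (b * d) = b ^+ 2 * (c ^+ 2 + d ^+ 2) by ring.
  by rewrite cos2Dsin2 mulr1 sqr_sqrtr// divr_ge0.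
by split; move: s; rewrite -?e; lra.
Qed.

Lemma orthonormal_cn j k : ipI (cn j) (cn k) = (j == k)%:R.
Proof.
case: eqVneq => [->|/orth_cs[]//]; case: (posnP k) => [->|/norm_cs[]//].
exact: norm_c0.
Qed.

Lemma orthonormal_sn j k : ipI (sn j) (sn k) = ((j == k) && (0 < k)%N)%:R.
Proof.
case: eqVneq => [->|/orth_cs[]//]; case: (posnP k) => [->|/norm_cs[]//].
rewrite /ip; under eq_Rintegral do rewrite sn0 mul0r.
by rewrite Rintegral_cst// mul0r.
Qed.

Lemma cts_eps f x (e : R) : cts f -> I x -> 0 < e ->
  exists2 d : R, 0 < d & forall y, I y -> `|x - y| < d -> `|f x - f y| <= e.
Proof.
move=> cf Ix e0.
have := @cvgr_dist_le _ _ _ (nbhs (x : subspace I)) (nbhs_filter (x : subspace I)) f (f x) (cf x) e e0.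
rewrite -[nbhs _]/(nbhs_subspace _) -(nbhs_subspace_in Ix) near_withinE => /nbhs_ballP[d /= d0 hd].
by exists d => // y Iy xy; apply: hd => //; rewrite -ball_normE.
Qed.

(* Korovkin's trick: |h - h x0| <= e + K (1 - q) pointwise, so the masses of q ^ n
   decay geometrically when h is orthogonal to all of them. *)
Lemma peak h q (x0 : R) : cts h -> cts q -> I x0 ->
  (forall x, I x -> 0 <= q x <= 1) -> q x0 = 1 -> (forall x, I x -> q x = 1 -> x = x0) ->
  (forall n, \int[mu]_(x in I) (h x * q x ^+ n) = 0) -> h x0 = 0.
Proof.
move=> ch cq Ix0 q01 q1 qx hq; apply/eqP; apply/negPn/negP => h0.
pose e := `|h x0| / 2; have e0 : 0 < e by rewrite divr_gt0// normr_gt0.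
have [d d0 hd] := cts_eps ch Ix0 e0.
have [M M0 hM] := cts_bounded ch.
have eta a b : 0 <= a -> b <= L%:num -> (forall x, a <= x <= b -> x != x0) ->
    exists2 s : R, 0 < s & forall x, a <= x <= b -> s <= 1 - q x.
  move=> a0 bL nx; have [ab|ba] := leP a b; last first.
    by exists 1 => // x /andP[ax xb]; move: (lt_le_trans ba (le_trans ax xb)); rewrite ltxx.
  have cq' : {within `[a, b], continuous (fun x => 1 - q x)}.
    apply: (continuous_subspaceW (B := I)); last by apply: cts_sub => //; exact: cts_cst.
    move=> x /=; rewrite !in_itv /= => /andP[ax xb].
    by rewrite (le_trans a0 ax) (le_trans xb bL).
  have [c cI hc] := EVT_min ab cq'.
  have /andP[ac cb] : a <= c <= b by move: cI; rewrite in_itv.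
  have Ic : I c by rewrite /= in_itv /= (le_trans a0 ac) (le_trans cb bL).
  exists (1 - q c); last by move=> x xab; apply: hc; rewrite in_itv.
  have /andP[_ qc] := q01 c Ic; rewrite subr_gt0 lt_neqAle qc andbT.
  by apply: contraTneq (nx c _) => [/(qx c Ic) ->|]; rewrite ?eqxx ?ac.
have /andP[x00 x0L] : 0 <= x0 <= L%:num by move: Ix0; rewrite /= in_itv.
have [s1 s10 h1] : exists2 s : R, 0 < s & forall x, 0 <= x <= x0 - d -> s <= 1 - q x.
  apply: eta => //; first by rewrite (le_trans _ x0L)// gerBl ltW.
  by move=> x /andP[_ xd]; rewrite lt_eqF// (le_lt_trans xd)// gtrBl.
have [s2 s20 h2] : exists2 s : R, 0 < s & forall x, x0 + d <= x <= L%:num -> s <= 1 - q x.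
  apply: eta => //; first by rewrite addr_ge0// ltW.
  by move=> x /andP[xd _]; rewrite gt_eqF// (lt_le_trans _ xd)// ltrDl.
pose s := Num.min s1 s2; have s0 : 0 < s by rewrite lt_min s10.
pose K := 2 * M / s + e + 1.
have K0 : 0 < K by rewrite ltr_wpDl// addr_ge0 ?(ltW e0)// divr_ge0 ?mulr_ge0 ?(ltW s0).
have bd x : I x -> `|h x0 - h x| <= e + K * (1 - q x).
  move=> Ix; have /andP[xge xle] : 0 <= x <= L%:num by move: Ix; rewrite /= in_itv.
  have /andP[_ qle] := q01 x Ix; have p1 : 0 <= 1 - q x by rewrite subr_ge0.
  have [xd|xd] := ltP `|x0 - x| d.
    by apply: (le_trans (hd x Ix xd)); rewrite lerDl mulr_ge0// ltW.
  have sq : s <= 1 - q x.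
    move: xd; rewrite ler_normr => /orP[xd|xd].
      by apply: le_trans (h1 x _); rewrite ?ge_min ?lexx// xge /= lerBrDr -lerBrDl.
    by apply: le_trans (h2 x _); rewrite ?ge_min ?lexx ?orbT// xle andbT; lra.
  apply: (@le_trans _ _ (2 * M)).
    by rewrite (le_trans (ler_normB _ _))// mulr2n mulrDl mul1r lerD// hM.
  apply: (@le_trans _ _ (2 * M / s * (1 - q x))).
    rewrite -[leLHS](divfK (lt0r_neq0 s0)) ler_wpM2l// divr_ge0 ?mulr_ge0 ?(ltW s0)//.
  rewrite (le_trans _ (_ : K * (1 - q x) <= _)) ?lerDr ?(ltW e0)// ler_wpM2r//.
  by rewrite /K -addrA lerDl addr_ge0// ltW.
have cqn n : cts (fun x => q x ^+ n).
  elim: n => [|n IH]; first by apply: (cts_eq _ (cts_cst 1)) => x _; rewrite expr0.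
  by apply: (cts_eq _ (cts_mul cq IH)) => x _; rewrite exprS.
pose a n := \int[mu]_(x in I) (q x ^+ n).
have ia n : intg I (fun x => q x ^+ n) := cts_intg (cqn n).
have qn0 n x : I x -> 0 <= q x ^+ n by move=> /q01/andP[? _]; rewrite exprn_ge0.
have step n : `|h x0| * a n <= e * a n + K * (a n - a n.+1).
  have -> : `|h x0| * a n = `|\int[mu]_(x in I) ((h x0 - h x) * q x ^+ n)|.
    have -> : \int[mu]_(x in I) ((h x0 - h x) * q x ^+ n) =
        \int[mu]_(x in I) (h x0 * q x ^+ n) - \int[mu]_(x in I) (h x * q x ^+ n).
      rewrite -int_sub//; [|exact: intgZ|by apply: cts_intg; exact: cts_mul].
      by apply: int_eq => x _; rewrite mulrBl.
    rewrite hq subr0 int_scale// normrM [`|\int[mu]_(x in I) _|]ger0_norm//.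
    by apply: Rintegral_ge0 => x; exact: qn0.
  have -> : e * a n + K * (a n - a n.+1) = \int[mu]_(x in I) (e * q x ^+ n + K * (q x ^+ n - q x ^+ n.+1)).
    rewrite /a -int_sub// -!int_scale//; last exact: intgB.
    by rewrite -int_add//; apply: intgZ => //; exact: intgB.
  apply: int_abs => //.
  - by apply: cts_intg; apply: cts_mul => //; apply: cts_sub => //; exact: cts_cst.
  - by apply: intgD => //; apply: intgZ => //; exact: intgB.
  - move=> x Ix; rewrite normrM [`|q x ^+ n|]ger0_norm ?qn0//.
    have -> : e * q x ^+ n + K * (q x ^+ n - q x ^+ n.+1) = (e + K * (1 - q x)) * q x ^+ n.
      by rewrite exprS; ring.
    by rewrite ler_wpM2r ?qn0// bd.
(* Since [|h x0| = 2 * e], [step] says that e a_n <= K (a_n - a_(n+1)): the masses shrink by the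
   factor r. *)
pose r := 1 - e / K.
have eK : e / K < 1 by rewrite ltr_pdivrMr// mul1r /K ltr_pwDr// lerDr divr_ge0 ?mulr_ge0// ltW.
have r0 : 0 < r by rewrite subr_gt0.
have r1 : r < 1 by rewrite gtrBl divr_gt0.
have geo n : a n <= a 0%N * r ^+ n.
  elim: n => [|n IH]; first by rewrite expr0 mulr1.
  have : a n.+1 <= r * a n.
    have := step n; rewrite (_ : `|h x0| = 2 * e); last by rewrite /e mulrC divfK.
    move=> h3; rewrite -(ler_pM2l K0) mulrA /r mulrBr mulr1 [K * (e / K)]mulrC divfK ?gt_eqF//.
    lra.
  move=> /le_trans; apply; rewrite exprS mulrCA ler_wpM2l// ltW//.
(* Near x0 the function q is at least s' > r, so a_n is at least a positive multiple of s' ^ n,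
   which contradicts the decay in r ^ n. *)
pose s' := (1 + r) / 2.
have tau : 0 < 1 - s' by rewrite /s'; lra.
have [d' d'0 hd'] := cts_eps cq Ix0 tau.
pose c1 := Num.max 0 (x0 - d' / 2); pose c2 := Num.min L%:num (x0 + d' / 2).
have d2 : 0 < d' / 2 by rewrite divr_gt0.
have c12 : c1 < c2.
  rewrite gt_max !lt_min; apply/andP; split; apply/andP; split => //.
  - by rewrite ltr_wpDl.
  - by rewrite (lt_le_trans _ x0L)// gtrBl.
  - by rewrite (lt_trans (_ : _ < x0))// ?gtrBl// ltrDl.
have c1I : I c1.
  by rewrite /= in_itv /= le_max lexx /= ge_max ltW//= (le_trans _ x0L)// gerBl ltW.
have c2I : I c2.
  by rewrite /= in_itv /= ge_min lexx /= le_min ltW//= addr_ge0// ltW.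
have low n : (c2 - c1) * s' ^+ n <= a n.
  have -> : (c2 - c1) * s' ^+ n = \int[mu]_(x in `[c1, c2]) (s' ^+ n).
    rewrite Rintegral_cst; last exact: mitv.
    by rewrite [X in fine X](lebesgue_measure_itv `[c1, c2]) /= lte_fin c12 mulrC.
  apply: (@le_trans _ _ (\int[mu]_(x in `[c1, c2]) (q x ^+ n))).
    have i1 := intg_sub c1I c2I (cts_intg (cts_cst (L := L) (s' ^+ n))).
    have i2 := intg_sub c1I c2I (ia n).
    apply: (int_le (mitv c1 c2) i1 i2).
    move=> x xc; have Ix := subI c1I c2I xc; have /andP[xc1 xc2] : c1 <= x <= c2 by move: xc; rewrite /= in_itv.
    have s'0 : 0 <= s' by rewrite /s'; lra.
    have : `|q x0 - q x| <= 1 - s'.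
      apply: hd' => //; rewrite ltr_norml.
      move: xc1 xc2; rewrite ge_max le_min => /andP[_ ?] /andP[_ ?].
      by apply/andP; split; lra.
    rewrite q1 => /(le_trans (ler_norm _)) => h3.
    by apply: lerXn2r; rewrite ?nnegrE; lra.
  rewrite /a; have /andP[c10 _] : 0 <= c1 <= L%:num by move: c1I; rewrite /= in_itv.
  have /andP[_ c2L] : 0 <= c2 <= L%:num by move: c2I; rewrite /= in_itv.
  rewrite (int_itv_split c10 (le_trans (ltW c12) c2L) (ia n)).
  have i3 := intg_sub c1I (IL (L := L)) (ia n).
  rewrite (int_itv_split (ltW c12) c2L i3).
  rewrite [leRHS]addrCA lerDl addr_ge0//; apply: Rintegral_ge0 => x xI; apply: qn0.
    exact: (subI (I0 (L := L)) c1I xI).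
  exact: (subI c2I (IL (L := L)) xI).
have s'p : 0 < s' by rewrite /s'; lra.
have rs : 0 <= r / s' < 1.
  by rewrite divr_ge0 ?(ltW r0) ?(ltW s'p)//= ltr_pdivrMr// mul1r /s'; lra.
suff : c2 - c1 <= 0 by rewrite subr_le0 leNgt c12.
apply: (@le_geometric _ _ _ (a 0%N) _ rs) => n; rewrite add0r expr_div_n mulrA.
by rewrite ler_pdivlMr ?exprn_gt0// (le_trans (low n)).
Qed.

Lemma cosM k x : cos (om 1 * x) * cos (om k.+1 * x) =
  2^-1 * (cos (om k.+2 * x) + cos (om k * x)).
Proof.
have -> : om k.+2 * x = om k.+1 * x + om 1 * x by rewrite /om -!natr1; ring.
have -> : om k * x = om k.+1 * x - om 1 * x by rewrite /om -!natr1; ring.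
by rewrite cosD cosB; field.
Qed.

(** By [cosM] h is orthogonal to all powers of C = cos (om 1 y), hence to those of
    [q = 1 - (C - C x) ^ 2 / 8]. As cosine is injective on [0, pi], q attains 1 at x only; the
    factor 1/8 keeps q in [0, 1]. Then [peak] applies. *)
Lemma cos_unique h x : cts h -> (forall k, ipI h (cn k) = 0) -> I x -> h x = 0.
Proof.
move=> ch h0 Ix; pose C x := cos (om 1 * x).
have cC : cts C.
  apply: cts_continuous => y; apply: (@continuous_comp _ _ _ (fun y => om 1 * y) cos).
    by apply: cvgM; [exact: cvg_cst|exact: cvg_id].
  exact: continuous_cos.
have cP f n : cts f -> cts (fun x => f x ^+ n).
  move=> cf; elim: n => [|n IH]; first by apply: (cts_eq _ (cts_cst 1)) => y _; rewrite expr0.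
  by apply: (cts_eq _ (cts_mul cf IH)) => y _; rewrite exprS.
have ccos k : cts (fun x => cos (om k * x)).
  apply: cts_continuous => y; apply: (@continuous_comp _ _ _ (fun y => om k * y) cos).
    by apply: cvgM; [exact: cvg_cst|exact: cvg_id].
  exact: continuous_cos.
have hk k : ipI h (fun x => cos (om k * x)) = 0.
  have := h0 k; rewrite ipC /cn ip_scalel; [|exact: L2_cts|exact: L2_cts].
  rewrite ipC => /eqP; rewrite mulf_eq0 => /orP[|/eqP//].
  have n0 y : 0 < y -> Num.sqrt y != 0 :> R by move=> y0; rewrite gt_eqF// sqrtr_gt0.
  by case: ifP => _; rewrite ?invr_eq0 => /negPn; rewrite n0// divr_gt0.
have hCk n : forall k, ipI (fun x => h x * C x ^+ n) (fun x => cos (om k * x)) = 0.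
  elim: n => [|n IH] k.
    by rewrite -(hk k); apply: ip_eq => y _; rewrite expr0 mulr1.
  have cn' : L2fun L (fun x => h x * C x ^+ n) by apply: L2_cts; apply: cts_mul => //; exact: cP.
  case: k => [|k].
    rewrite -(IH 1%N); apply: ip_eq => y _.
    by rewrite om0 mul0r cos0 mulr1 exprS /C; ring.
  have : ipI (fun x => 2^-1 * (cos (om k.+2 * x) + cos (om k * x))) (fun x => h x * C x ^+ n) = 0.
    rewrite ip_scalel//; last by apply: L2_cts; exact: cts_add.
    by rewrite ip_addl//; [rewrite !(ipC _ (fun x => h x * _)) !IH addr0 mulr0|exact: L2_cts|exact: L2_cts].
  move=> <-; apply: ip_eq => y _; rewrite -cosM exprS /C; ring.
have hC n : \int[mu]_(x in I) (h x * C x ^+ n) = 0.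
  apply: etrans (hCk n 0%N); apply: int_eq => y _; by rewrite om0 mul0r cos0 mulr1.
pose q y := 1 - 8^-1 * (C y - C x) ^+ 2.
have cq : cts q.
  apply: cts_sub; first exact: cts_cst.
  by apply: cts_scale; apply: cP; apply: cts_sub => //; exact: cts_cst.
have hq n : forall k, \int[mu]_(y in I) (h y * q y ^+ n * C y ^+ k) = 0.
  elim: n => [|n IH] k.
    by apply: etrans (hC k); apply: int_eq => y _; rewrite expr0 mulr1.
  have i j : intg I (fun y => h y * q y ^+ n * C y ^+ j).
    by apply: cts_intg; apply: cts_mul; [apply: cts_mul => //|]; exact: cP.
  transitivity (\int[mu]_(y in I) ((1 - 8^-1 * C x ^+ 2) * (h y * q y ^+ n * C y ^+ k)
     + (4^-1 * C x * (h y * q y ^+ n * C y ^+ k.+1) + - 8^-1 * (h y * q y ^+ n * C y ^+ k.+2)))).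
    by apply: int_eq => y _; rewrite [q y ^+ n.+1]exprS {1}/q !exprS; field.
  rewrite !int_add//; try (do ?[apply: intgD => //|exact: intgZ]).
  by rewrite !int_scale// !IH !mulr0 !addr0.
apply: (peak ch cq Ix).
- move=> y Iy; have := cos_le1 (om 1 * y); have := cos_geN1 (om 1 * y).
  have := cos_le1 (om 1 * x); have := cos_geN1 (om 1 * x); rewrite /q /C.
  move=> *; rewrite gerBl mulr_ge0 ?sqr_ge0 ?invr_ge0// andbT subr_ge0.
  by rewrite -[leRHS](mulVf (lt0r_neq0 (ltr0n R 8))) ler_wpM2l ?invr_ge0//; nra.
- by rewrite /q subrr expr0n mulr0 subr0.
- move=> y Iy /eqP; rewrite /q subr_eq addrC -subr_eq subrr eq_sym mulf_eq0 invr_eq0.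
  rewrite pnatr_eq0 /= sqrf_eq0 subr_eq0 /C => /eqP /cos_inj.
  have R0 z : I z -> om 1 * z \in `[0, pi].
    rewrite /= !in_itv /= => /andP[z0 zL]; rewrite mulr_ge0 ?om_ge0//=.
    by rewrite /om mul1r mulrAC ler_pdivrMr// ler_wpM2l// pi_ge0.
  move=> /(_ (R0 _ Iy) (R0 _ Ix)); apply: mulfI.
  by rewrite -om0 (inj_eq om_inj).
- by move=> n; apply: etrans (hq n 0%N); apply: int_eq => y _; rewrite expr0 mulr1.
Qed.

End Trigonometric.
#[global] Hint Resolve L2_sn L2_cn : core.

(** * The Riesz-Fischer theorem and completeness of the sines *)

Section RieszFischer.
Context {R : realType} {L : {posnum R}}.
Local Notation I := `[0, L%:num]%classic.
Local Notation hd := (has_L2deriv L).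
Local Notation ipI := (ip (L := L)).
Local Notation nrmI := (nrm (L := L)).
Local Notation sn := (sn (L := L)).
Local Notation cn := (cn (L := L)).
Local Notation om := (om (L := L)).
Implicit Types (f : nat -> R -> R) (g h : R -> R) (c : nat -> R) (j k n p : nat) (x : R).

Let mI' : measurable (I : set (measurableTypeR R)) := mI (L := L).
Hint Resolve mI' : core.

Lemma limn_einf_le (u : (\bar R)^nat) (B : \bar R) : (forall k, u k <= B)%E -> (limn_einf u <= B)%E.
Proof.
move=> h; rewrite limn_einf_lim; apply: lime_le; first exact: is_cvg_einfs.
by apply: nearW => k; apply: le_trans (h k); apply: ereal_inf_lbound; exists k => /=.
Qed.

Lemma ipE_ereal h : L2fun L h -> (\int[mu]_(x in I) (h x ^+ 2)%:E = (ipI h h)%:E)%E.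
Proof. by move=> hh; rewrite ipE2 fineK// integrable_fin_num//; exact: L2_sqr. Qed.

Lemma cvg_summable_differences (u : nat -> R) (l : R) :
  (\sum_(0 <= j <oo) `|u j.+1 - u j|%:E < l%:E)%E -> cvgn u.
Proof.
move=> hl; have c1 := nnseries_is_cvg (fun j => normr_ge0 (u j.+1 - u j)) (lt_le_trans hl (leey _)).
have c2 : cvgn (series (telescope u)) by apply: normed_cvg; exact: c1.
have -> : u = (fun n => series (telescope u) n + u 0%N).
  by apply/funext => n; rewrite telescopeK /= subrK.
by apply: is_cvgD => //; exact: is_cvg_cst.
Qed.

(** The sum G of the absolute increments is integrable, so almost every sequence [f j x] converges.
    Fatou's lemma carries the bounds on [f (p + n) - f n] over to [g - f n]. *)
Lemma L2_complete f (C : R) : (forall j, L2fun L (f j)) ->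
  (forall j, nrmI (fun x => f j.+1 x - f j x) <= C * 2^-1 ^+ j) ->
  exists2 g, L2fun L g & forall n, nrmI (fun x => g x - f n x) <= 2 * C * 2^-1 ^+ n.
Proof.
move=> hf hC; have C0 : 0 <= C by have := le_trans (nrm_ge0 _) (hC 0%N); rewrite expr0 mulr1.
have mf j : measurable_fun I (f j) := L2fun_meas (hf j).
have hd j : L2fun L (fun x => f j.+1 x - f j x) := L2_sub (hf j.+1) (hf j).
pose G x := (\sum_(0 <= j <oo) `|f j.+1 x - f j x|%:E)%E.
have mG j : measurable_fun I (fun x => `|f j.+1 x - f j x|%:E).
  by apply/measurable_EFinP; apply: measurableT_comp => //; exact: L2fun_meas (hd j).
have intG : (\int[mu]_(x in I) G x <= (Num.sqrt L%:num * (2 * C))%:E)%E.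
  rewrite (integral_nneseries mu mI' mG); last by move=> j x _; rewrite lee_fin.
  apply: lime_le.
    by apply: is_cvg_nneseries => j _ _; apply: integral_ge0 => x _; rewrite lee_fin.
  apply: nearW => n; apply: (@le_trans _ _ (\sum_(0 <= j < n) (Num.sqrt L%:num * (C * 2^-1 ^+ j))%:E)%E).
    apply: lee_sum => j _; rewrite -[leLHS]fineK; last first.
      by rewrite integrable_fin_num//; apply: (L2fun_int (L2_abs (hd j))).
    rewrite lee_fin; have := int_le_nrm (L2_abs (hd j)); move/(le_trans (ler_norm _)) => /le_trans; apply.
    rewrite ler_wpM2l ?sqrtr_ge0// (le_trans _ (hC j))// /nrm ler_wsqrtr//.
    by rewrite !ipE2; apply: eqle; apply: int_eq => x _; rewrite real_normK ?num_real.
  rewrite sumEFin lee_fin -!mulr_sumr ler_wpM2l ?sqrtr_ge0// mulrC ler_wpM2r//.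
  have -> : \sum_(0 <= j < n) (2^-1 : R) ^+ j = 2 * (1 - 2^-1 ^+ n).
    elim: n => [|n IH]; first by rewrite big_nil expr0 subrr mulr0.
    by rewrite big_nat_recr//= IH exprS; field.
  by rewrite ler_piMr// gerBl exprn_ge0// invr_ge0.
have G0 x : (0 <= G x)%E by apply: nneseries_ge0 => j _ _; rewrite lee_fin.
have mG' : measurable_fun I G by apply: ge0_emeasurable_sum => // j x _ _; rewrite lee_fin.
have iG : mu.-integrable I G.
  apply/integrableP; split => //; apply: (@le_lt_trans _ _ (Num.sqrt L%:num * (2 * C))%:E); last exact: ltry.
  by apply: le_trans intG; apply: eqle; apply: eq_integral => x _; rewrite gee0_abs.
have aeG := integrable_ae mI' iG.
(* An upper limit is measurable without any convergence; it equals the limit wherever G is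
   finite. *)
pose g x := fine (limn_esup (fun j => (f j x)%:E)).
have mg : measurable_fun I g.
  apply: (measurableT_comp (@fine_measurable R setT measurableT)) => //.
  by apply: measurable_fun_limn_esup => j; apply/measurable_EFinP.
have aec : {ae mu, forall x, I x -> f ^~ x @ \oo --> g x}.
  apply: filterS aeG => x hx Ix; have /fineK hG := hx Ix.
  have /cvg_ex[l hl] : cvgn (f ^~ x).
    apply: (@cvg_summable_differences _ (fine (G x) + 1)); rewrite -[X in (X < _)%E]/(G x) -hG.
    by rewrite lte_fin ltrDl.
  suff -> : g x = l by [].
  have /cvg_limn_einf_sup[_] : EFin (f j x) @[j --> \oo] --> l%:E by apply: cvg_EFin; [exact: nearW|exact: hl].
  by rewrite /g => ->.
have mgf k : measurable_fun I (fun x => (g x - f k x) ^+ 2).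
  by apply: (@measurable_funX _ _ _ _ (fun x => g x - f k x)); apply: measurable_funB.
have key n : (\int[mu]_(x in I) ((g x - f n x) ^+ 2)%:E <= ((2 * C * 2^-1 ^+ n) ^+ 2)%:E)%E.
  have hn p : nrmI (fun x => f (p + n)%N x - f n x) <= C * (2 * (1 - 2^-1 ^+ p)) * 2^-1 ^+ n.
    elim: p => [|p IH].
      rewrite expr0 subrr !mulr0 mul0r; apply: nrm_le => //; rewrite expr0n/=.
      by rewrite ipE2 (int_eq (g := cst 0)) ?Rintegral_cst ?mul0r// => x _; rewrite add0n subrr expr0n.
    rewrite (nrm_eq (g := fun x => (f (p + n).+1 x - f (p + n)%N x) + (f (p + n)%N x - f n x))); last first.
      by move=> x _; rewrite addrA subrK.
    apply: le_trans (nrmD (hd _) (L2_sub (hf _) (hf _))) _.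
    apply: le_trans (lerD (hC _) IH) _; rewrite exprD exprS.
    by apply: eqle; field.
  pose phi p x := ((f (p + n)%N x - f n x) ^+ 2)%:E.
  have mphi p : measurable_fun I (phi p).
    apply/measurable_EFinP; apply: measurable_funX; exact: measurable_funB.
  have := fatou mu mI' mphi (fun p x _ => sqr_ge0 (f (p + n)%N x - f n x)).
  have -> : (\int[mu]_(x in I) limn_einf (phi ^~ x) = \int[mu]_(x in I) ((g x - f n x) ^+ 2)%:E)%E; last first.
    move/le_trans; apply; apply: limn_einf_le => p.
    rewrite (ipE_ereal (L2_sub (hf _) (hf _))) lee_fin -sqr_nrm ler_pXn2r// ?nnegrE ?nrm_ge0 ?mulr_ge0 ?exprn_ge0 ?invr_ge0//.
    apply: le_trans (hn p) _; rewrite ler_wpM2r ?exprn_ge0 ?invr_ge0// mulrC ler_wpM2r//.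
    by rewrite ler_piMr// gerBl exprn_ge0// invr_ge0.
  apply: ae_eq_integral => //.
  - have -> : (fun x => limn_einf (phi ^~ x)) = (fun x => (- limn_esup (fun p => - phi p x))%E).
      by apply/funext => x; rewrite /limn_einf.
    apply: measurableT_comp => //; apply: measurable_fun_limn_esup => p.
      have -> : (fun x => (- phi p x)%E) = EFin \o (fun x => - (f (p + n)%N x - f n x) ^+ 2) by [].
    apply/measurable_EFinP; apply: (@measurable_funN _ _ _ _ (fun x => (f (p + n)%N x - f n x) ^+ 2)).
    by apply: measurable_funX; exact: measurable_funB.
  - by apply/measurable_EFinP; exact: mgf.
  apply: filterS aec => x hx Ix; have {}hx := hx Ix.
  apply: (cvg_limn_einf_sup _).1; apply: cvg_EFin; first exact: nearW.
  have h1 : f (p + n)%N x - f n x @[p --> \oo] --> g x - f n x.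
    by apply: cvgB; [move: hx; rewrite -(cvg_shiftn n)|exact: cvg_cst].
  exact: (cvgM h1 h1).
have L2g n : L2fun L (fun x => g x - f n x).
  apply: L2funP; first exact: measurable_funB.
  apply/integrableP; split; first by apply/measurable_EFinP; exact: mgf.
  apply: le_lt_trans (ltry ((2 * C * 2^-1 ^+ n) ^+ 2)); apply: le_trans (key n).
  by apply: eqle; apply: eq_integral => x _; rewrite gee0_abs// lee_fin sqr_ge0.
exists g => [|n].
  by apply: L2_eq (L2_add (L2g 0%N) (hf 0%N)) => x _; rewrite subrK.
apply: nrm_le; first by rewrite !mulr_ge0// exprn_ge0// invr_ge0.
by rewrite -lee_fin -ipE_ereal.
Qed.

Definition ssum c n x := \sum_(k < n) c k * sn k x.

Lemma L2_ssum c n : L2fun L (ssum c n).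
Proof. by apply: L2_sum => k; exact: L2_scale. Qed.
Hint Resolve L2_ssum : core.

Lemma ip_ssum c n h : L2fun L h -> ipI (ssum c n) h = \sum_(k < n) c k * ipI (sn k) h.
Proof.
move=> hh; rewrite /ssum ip_suml//; last by move=> k; exact: L2_scale.
by apply: eq_bigr => k _; rewrite ip_scalel.
Qed.

Lemma ip_ssum_sn c n k : ipI (ssum c n) (sn k) = c k * ((k < n) && (0 < k))%N%:R.
Proof.
rewrite ip_ssum//; have [kn|kn] /= := ltnP k n.
  rewrite (bigD1 (Ordinal kn))//= orthonormal_sn eqxx/= big1 ?addr0// => j /negPf jk.
  by rewrite orthonormal_sn (_ : (_ == k) = false) ?mulr0.
rewrite mulr0 big1// => j _; rewrite orthonormal_sn ltn_eqF ?mulr0//.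
exact: leq_trans kn.
Qed.

Lemma nrm_ssum c n : nrmI (ssum c n) ^+ 2 <= \sum_(k < n) c k ^+ 2.
Proof.
rewrite sqr_nrm ip_ssum//; apply: ler_sum => k _; rewrite ipC ip_ssum_sn ltn_ord /=.
by rewrite mulrA -expr2 ler_piMr ?sqr_ge0// lern1 leq_b1.
Qed.

(** Cauchy-Schwarz for h and its partial sum: their product is s and the partial sum has squared
    norm at most s, so [s ^ 2 <= s |h| ^ 2]. *)
Lemma bessel h n : L2fun L h -> \sum_(k < n) ipI h (sn k) ^+ 2 <= nrmI h ^+ 2.
Proof.
move=> hh; pose c k := ipI h (sn k); set s := (X in X <= _).
have e1 : ipI (ssum c n) h = s.
  by rewrite ip_ssum//; apply: eq_bigr => k _; rewrite ipC expr2.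
have s0 : 0 <= s by apply: sumr_ge0 => k _; exact: sqr_ge0.
have := le_ip (L2_ssum c n) hh; rewrite e1 ger0_norm// => h1.
have h2 : s ^+ 2 <= s * nrmI h ^+ 2.
  apply: (@le_trans _ _ ((nrmI (ssum c n) * nrmI h) ^+ 2)); first by rewrite ler_pXn2r ?nnegrE ?mulr_ge0 ?nrm_ge0.
  by rewrite exprMn ler_wpM2r ?sqr_ge0//; exact: nrm_ssum.
have [->|sn0] := eqVneq s 0; first exact: sqr_ge0.
by rewrite -(ler_pM2l (_ : 0 < s)) ?lt0r ?sn0// -expr2.
Qed.

Lemma riesz_fischer c M : 0 <= M -> (forall n, \sum_(k < n) c k ^+ 2 <= M ^+ 2) ->
  exists2 g, L2fun L g & nrmI g <= M /\ forall k, (0 < k)%N -> ipI g (sn k) = c k.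
Proof.
move=> M0 hM; pose Q n := \sum_(k < n) c k ^+ 2.
have Qm n p : (n <= p)%N -> Q n <= Q p.
  elim: p => [|p IH]; first by rewrite leqn0 => /eqP ->.
  rewrite leq_eqVlt => /predU1P[->//|/IH h]; apply: le_trans h _.
  by rewrite /Q big_ord_recr/= lerDl sqr_ge0.
have dQ n p : (n <= p)%N -> nrmI (fun x => ssum c p x - ssum c n x) ^+ 2 <= Q p - Q n.
  move=> np; pose c' k := if (n <= k)%N then c k else 0.
  rewrite (nrm_eq (g := ssum c' p)); last first.
    move=> x _; rewrite /ssum -(subnKC np) !big_split_ord/= -addrAC addrC addrA.
    rewrite [X in _ = X + _]big1; last by move=> k _; rewrite /c' leqNgt ltn_ord mul0r.
    by rewrite addrK add0r; apply: eq_bigr => k _; rewrite /c' leq_addr.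
  apply: le_trans (nrm_ssum c' p) _.
  rewrite /Q -(subnKC np) !big_split_ord/= addrAC subrr add0r.
  rewrite big1 ?add0r; last by move=> k _; rewrite /c' leqNgt ltn_ord expr0n.
  by apply: ler_sum => k _; rewrite /c' leq_addr.
pose s := sup (range Q).
have hs : has_sup (range Q) by split; [exists (Q 0%N), 0%N|exists (M ^+ 2) => _ [n _ <-]; exact: hM].
have Qs n : Q n <= s by apply: ub_le_sup; [case: hs|exists n].
(* Squared distances of partial sums are differences of Q: along indices where Q is within 4 ^ -j of
   its supremum the partial sums are within 2 ^ -j. *)
have sub j : exists n, s - 4^-1 ^+ j <= Q n.
  have p0 : 0 < (4^-1 : R) ^+ j by rewrite exprn_gt0// invr_gt0.
  have [_ [n _ <-] h] := sup_adherent p0 hs.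
  by exists n; exact: ltW.
have [nu hnu] := choice sub.
have near n p j : s - 4^-1 ^+ j <= Q n -> s - 4^-1 ^+ j <= Q p ->
    nrmI (fun x => ssum c p x - ssum c n x) <= 2^-1 ^+ j.
  move=> hn hp; rewrite -(ler_pXn2r (ltn0Sn 1)) ?nnegrE ?nrm_ge0 ?exprn_ge0 ?invr_ge0//.
  have -> : ((2^-1 : R) ^+ j) ^+ 2 = 4^-1 ^+ j.
    by rewrite -exprM mulnC exprM expr2 -invfM -natrM.
  wlog np : n p hn hp / (n <= p)%N.
    move=> H; have [np|/ltnW pn] := leqP n p; first exact: H.
    rewrite (_ : nrmI _ = nrmI (fun x => ssum c n x - ssum c p x)); first exact: H.
    by rewrite /nrm; congr (Num.sqrt _); apply: ip_eq => x _; rewrite -!expr2 -sqrrN opprB.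
  by apply: le_trans (dQ _ _ np) _; have := Qs p; lra.
have dif j : nrmI (fun x => ssum c (nu j.+1) x - ssum c (nu j) x) <= 1 * 2^-1 ^+ j.
  rewrite mul1r; apply: near => //; apply: le_trans (hnu j.+1); rewrite lerD2l lerN2.
  by rewrite exprS ler_piMl ?exprn_ge0 ?invr_ge0// invf_le1// ler1n.
have [g hg hgn] := L2_complete (f := fun j => ssum c (nu j)) (fun j => L2_ssum _ _) dif.
exists g => //.
  have lim k : (0 < k)%N -> ipI g (sn k) = c k.
    move=> k0; apply/eqP; rewrite -subr_eq0 -normr_le0.
    apply: (@le_geometric _ _ _ (2 * nrmI (sn k) + nrmI (sn k)) 2^-1); first by rewrite invr_ge0 ler0n invf_lt1// ltr1n.
    move=> j; rewrite add0r.
    (* Late enough for mode k to be present in the partial sum, and still within 2 ^ -j of the one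
       at [nu j]. *)
    pose p := maxn (nu j) k.+1.
    have hp : s - 4^-1 ^+ j <= Q p by apply: le_trans (hnu j) (Qm _ _ _); exact: leq_maxl.
    have -> : ipI g (sn k) - c k = ipI (fun x => g x - ssum c (nu j) x) (sn k) +
        ipI (fun x => ssum c (nu j) x - ssum c p x) (sn k).
      rewrite !ip_subl// [ipI (ssum c p) _]ip_ssum_sn (_ : (k < p)%N) ?k0 /= ?mulr1 ?leq_maxr//.
      by rewrite addrA subrK.
    apply: le_trans (ler_normD _ _) _; rewrite mulrDl; apply: lerD.
      apply: le_trans (le_ip (L2_sub hg (L2_ssum _ _)) (L2_sn _)) _.
      by rewrite mulrAC ler_wpM2r ?nrm_ge0//; have := hgn j; rewrite mulr1.
    apply: le_trans (le_ip (L2_sub (L2_ssum _ _) (L2_ssum _ _)) (L2_sn _)) _.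
    by rewrite [leRHS]mulrC ler_wpM2r ?nrm_ge0//; exact: near.
  split => //; apply: (@le_geometric _ _ _ 2 2^-1); first by rewrite invr_ge0 ler0n invf_lt1// ltr1n.
  move=> j; rewrite (nrm_eq (g := fun x => ssum c (nu j) x + (g x - ssum c (nu j) x))); last first.
    by move=> x _; rewrite addrC subrK.
  apply: le_trans (nrmD (L2_ssum _ _) (L2_sub hg (L2_ssum _ _))) _; apply: lerD; last first.
    by have := hgn j; rewrite mulr1.
  rewrite -(ler_pXn2r (ltn0Sn 1)) ?nnegrE ?nrm_ge0//.
  exact: le_trans (nrm_ssum _ _) (hM _).
Qed.

(** The primitive G of h has vanishing cosine coefficients for k > 0, by integration by parts.
    Completeness of the cosines among continuous functions makes G constant, so its derivative h is
    null. *)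
Lemma sine_complete h : L2fun L h -> (forall k, ipI h (sn k) = 0) -> nrmI h = 0.
Proof.
move=> hh h0; pose G x := \int[mu]_(t in `[0, x]) h t.
have hG : hd G h := hd_prim hh.
have cG := hd_cts hG.
have Gk k : (0 < k)%N -> ipI G (cn k) = 0.
  move=> k0; have := ibp hG (hd_sn k); rewrite h0 subr0 snL sn00 !mulr0 subrr ipC ip_scalel//; last exact: L2_cts.
  have ok : om k != 0 by rewrite -(om0 (L := L)) (inj_eq om_inj) -lt0n.
  by move/eqP; rewrite mulf_eq0 (negPf ok) /= ipC => /eqP.
pose a := ipI G (cn 0); pose b := a * cn 0 0.
have GE x : I x -> G x - b = 0.
  have c0 y : cn 0 y = cn 0 0 by rewrite /cn om0 !mul0r.
  apply: (@cos_unique _ _ (fun x => G x - b)) => [|k]; first by apply: cts_sub => //; exact: cts_cst.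
  rewrite ip_subl//; [|exact: L2_cts|exact: L2_cts (cts_cst _)].
  have -> : ipI (fun=> b) (cn k) = a * ipI (cn 0) (cn k).
    by rewrite -ip_scalel//; apply: ip_eq => y _; rewrite c0.
  rewrite orthonormal_cn; case: (posnP k) => [->|k0]; first by rewrite mulr1 subrr.
  by rewrite Gk// eq_sym gtn_eqF// mulr0 subrr.
have G0 : G 0 = 0 by rewrite /G set_itv1 Rintegral_set1.
have G00 x : I x -> G x = 0.
  move=> Ix; have /eqP := GE x Ix; rewrite subr_eq0 => /eqP ->.
  by have /eqP := GE 0 (I0 (L := L)); rewrite G0 sub0r oppr_eq0 => /eqP.
have := has_L2deriv_unique hG (hd_eq (fun x Ix => esym (G00 x Ix)) (fun x _ => erefl) (hd_cst 0)).
move=> hae; rewrite /nrm /ip; have -> : \int[mu]_(x in I) (h x * h x) = \int[mu]_(x in I) (0 : R).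
  congr fine; apply: ae_eq_integral => //.
  - by have /integrableP[] := L2fun_intM hh hh.
  by apply: filterS hae => x hx Ix; rewrite hx// mul0r.
by rewrite Rintegral_cst// mul0r sqrtr0.
Qed.

Lemma ip_nrm0 g h v : L2fun L g -> L2fun L h -> L2fun L v ->
  nrmI (fun x => g x - h x) = 0 -> ipI g v = ipI h v.
Proof.
move=> hg hh hk e; apply/eqP; rewrite -subr_eq0 -ip_subl// -normr_le0.
by apply: le_trans (le_ip (L2_sub hg hh) hk) _; rewrite e mul0r.
Qed.

(** The converse of Bessel's inequality: the Riesz-Fischer function with the coefficients of h has
    norm at most M, and its difference with h is null by completeness. *)
Lemma parseval_le h M : 0 <= M -> L2fun L h ->
  (forall n, \sum_(k < n) ipI h (sn k) ^+ 2 <= M ^+ 2) -> nrmI h <= M.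
Proof.
move=> M0 hh hM; have [g hg [gM gk]] := @riesz_fischer (fun k => ipI h (sn k)) M M0 hM.
have e : nrmI (fun x => h x - g x) = 0.
  apply: sine_complete => [|k]; first exact: L2_sub.
  case: (posnP k) => [->|k0]; last by rewrite ip_subl// gk// subrr.
  by rewrite /ip (int_eq (g := cst 0)) ?Rintegral_cst ?mul0r// => x _; rewrite sn0 mulr0.
rewrite (nrm_eq (g := fun x => (h x - g x) + g x)); last by move=> x _; rewrite subrK.
by apply: le_trans (nrmD (L2_sub hh hg) hg) _; rewrite e add0r.
Qed.

End RieszFischer.

(** * Nonlinearities and their partial derivatives *)

Section SmoothNonlinearities.
Context {R : realType} {m : nat}.
Implicit Types (a b v : 'cV[R]_m) (s : seq 'I_m).

(** All later estimates use f and g only through these global bounds: each derivative [D s] is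
    bounded, Lipschitz, and has first-order Taylor expansion with the derivatives [D (l :: s)]. *)
Definition tame (D : jet R m) := forall s, exists2 M : R, 0 <= M &
  forall a b, [/\ `|D s a| <= M, `|D s b - D s a| <= M * nv (b - a) &
    `|D s b - D s a - \sum_l D (l :: s) a * (b - a) l 0| <= M * nv (b - a) ^+ 2].

Section Derivatives.
Context {p q : nat}.
Variable F : 'cV[R]_m -> 'M[R]_(p, q).

Definition pdiff (G : 'cV[R]_m -> 'M[R]_(p, q)) (l : 'I_m) : 'cV[R]_m -> 'M[R]_(p, q) :=
  fun x => 'd G x (delta_mx l 0).

Definition partials s := foldr (fun l G => pdiff G l) F s.

Lemma Ck_partials : (forall k, Ck k F) -> forall s k, Ck k (partials s).
Proof.
move=> hF; elim=> [|l s IH] k; first exact: hF.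
by have [_ h] := IH k.+1; exact: h.
Qed.

Lemma partials_eq0 (K : set 'cV[R]_m) : closed K -> (forall k, Ck k F) ->
  (forall x, ~ K x -> F x = 0) -> forall s x, ~ K x -> partials s x = 0.
Proof.
move=> cK hF F0; elim=> [|l s IH] x nK; first exact: F0.
have [d _] := Ck_partials hF s 1.
rewrite /= /pdiff -(deriveE (delta_mx l 0) (d x)); suff -> : 'D_(delta_mx l 0) (partials s) x = 'D_(delta_mx l 0) (cst (0 : 'M[R]_(p, q))) x by rewrite derive_cst.
apply: near_eq_derive.
have oK : open (~` K) by rewrite openC.
have : nbhs x (~` K) by apply: open_nbhs_nbhs; split.
by apply: filterS => y /IH.
Qed.

Lemma partials_bounded : Cinfty0 F -> forall s, exists2 M : R, 0 <= M & forall x, `|partials s x| <= M.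
Proof.
move=> [hF cK] s; set K := closure _ in cK.
have F0 x : ~ K x -> F x = 0.
  by move=> nK; apply/eqP/negPn/negP => h; apply: nK; exact: subset_closure.
have cs : continuous (partials s) := Ck_partials hF s 0.
have /continuous_compact/(_ cK)/compact_bounded[M [_ hM]] : {within K, continuous (partials s)}.
  by apply: continuous_subspaceT.
exists (`|M| + 1) => [|x]; first by rewrite addr_ge0.
have [Kx|nK] := pselect (K x); last first.
  by rewrite (partials_eq0 (@closed_closure _ _) hF F0)// normr0 addr_ge0.
by apply: (hM (`|M| + 1)); [rewrite (le_lt_trans (ler_norm M))// ltrDl|exists x].
Qed.

Lemma is_derive_line (h : 'cV[R]_m -> 'M[R]_(p, q)) a v (t : R) i j :
  (forall x, differentiable h x) ->
  is_derive t 1 (fun r => h (a + r *: v) i j) (\sum_l pdiff h l (a + t *: v) i j * v l 0).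
Proof.
move=> dh; pose c := a + t *: v.
have E : (fun e : R => e^-1 *: (((fun r : R => h (a + r *: v) i j) \o shift t) (e *: 1) - h (a + t *: v) i j)) =
    (fun e : R => e^-1 *: (((fun x => h x i j) \o shift c) (e *: v) - h c i j)).
  apply/funext => e; congr (_ *: (_ - _)); rewrite /c /=; congr (h _ i j).
  by rewrite [_ *: 1 : R]mulr1 scalerDl addrCA addrC addrC.
have db : derivable h c v by apply: diff_derivable.
have dbij : derivable (fun x => h x i j) c v by move/derivable_mxP: db; apply.
have dE : derivable (fun r : R => h (a + r *: v) i j) t 1.
  by rewrite /derivable E.
apply: DeriveDef => //.
have -> : 'D_1 (fun r : R => h (a + r *: v) i j) t = 'D_v (fun x => h x i j) c.
  by rewrite /derive E.
have -> : 'D_v (fun x => h x i j) c = ('D_v h c) i j by rewrite (derive_mx db) mxE.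
rewrite (deriveE v (dh c)).
have vE : v = \sum_l v l 0 *: delta_mx l 0.
  apply/matrixP => k k'; rewrite ord1 summxE (bigD1 k)//= !mxE !eqxx mulr1 big1 ?addr0// => l lk.
  by rewrite !mxE eq_sym (negPf lk) mulr0.
rewrite {1}vE linear_sum summxE; apply: eq_bigr => l _.
by rewrite linearZ mxE mulrC.
Qed.

End Derivatives.

(** The mean value theorem on segments. The last clause records what compact support gives beyond
    bounded derivatives, and serves the energy estimate. *)
Lemma Cinfty0_tame p q (F : 'cV[R]_m -> 'M[R]_(p, q)) : Cinfty0 F ->
  exists2 D : 'I_p -> 'I_q -> jet R m,
    forall i j, tame (D i j) /\ forall a, D i j [::] a = F a i j &
    exists B : R, forall i j a, `|F a i j| * nv a <= B.
Proof.
move=> hF; have [ck cK] := hF.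
have bd s : exists2 M : R, 0 <= M & forall i j x, `|partials F s x i j| <= M.
  have [M M0 hM] := partials_bounded hF s; exists M => // i j x.
  apply: le_trans (hM x); rewrite [leRHS]/Num.norm/= mx_normrE.
  exact: (le_bigmax _ (fun ij => `|partials F s x ij.1 ij.2|) (i, j)).
have line s i j a v t := is_derive_line (h := partials F s) a v t i j (fun x => (Ck_partials ck s 1).1 x).
have mvt s i j a b : exists2 t : R, 0 <= t <= 1 & partials F s b i j - partials F s a i j =
    \sum_l partials F (l :: s) (a + t *: (b - a)) i j * (b - a) l 0.
  have dl t := line s i j a (b - a) t.
  have := @MVT_segment _ (fun r => partials F s (a + r *: (b - a)) i j) _ 0 1 ler01 (fun t _ => dl t).
  case=> [|t]; first by apply: continuous_subspaceT => t; exact: is_derive_continuous (dl t).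
  rewrite in_itv /= => t01; rewrite scale1r scale0r addr0 subr0 mulr1 addrCA subrr addr0 => e.
  by exists t.
have lip s : exists2 M : R, 0 <= M & forall i j a b, `|partials F s b i j - partials F s a i j| <= M * nv (b - a).
  have [N hN] := choice (fun l => let: ex_intro2 M M0 h := bd (l :: s) in ex_intro (fun M => 0 <= M /\ forall i j x, `|partials F (l :: s) x i j| <= M) M (conj M0 h)).
  exists (\sum_l N l) => [|i j a b]; first by apply: sumr_ge0 => l _; have [] := hN l.
  have [t _ ->] := mvt s i j a b; apply: le_trans (ler_norm_sum _ _ _) _.
  rewrite mulr_suml; apply: ler_sum => l _; have [Nl hl] := hN l.
  by rewrite normrM ler_pM// le_nv.
exists (fun i j s x => partials F s x i j).
  move=> i j; split => // s; have [M0 M00 h0] := bd s; have [M1 M10 h1] := lip s.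
  have [N hN] := choice (fun l => let: ex_intro2 M M0 h := lip (l :: s) in ex_intro (fun M => 0 <= M /\ forall i j a b, `|partials F (l :: s) b i j - partials F (l :: s) a i j| <= M * nv (b - a)) M (conj M0 h)).
  have N0 : 0 <= \sum_l N l by apply: sumr_ge0 => l _; have [] := hN l.
  exists (M0 + M1 + \sum_l N l) => [|a b]; first by rewrite !addr_ge0.
  have n0 := nv_ge0 (b - a).
  split.
  - by apply: le_trans (h0 i j a) _; rewrite -addrA lerDl addr_ge0.
  - by apply: le_trans (h1 i j a b) _; rewrite ler_wpM2r// addrAC lerDr addr_ge0.
  have [t /andP[t0 t1] ->] := mvt s i j a b; rewrite -sumrB.
  apply: le_trans (ler_norm_sum _ _ _) _; apply: (@le_trans _ _ ((\sum_l N l) * nv (b - a) ^+ 2)); last first.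
    by rewrite ler_wpM2r ?exprn_ge0// lerDr addr_ge0.
  rewrite mulr_suml; apply: ler_sum => l _; have [Nl hl] := hN l.
  rewrite -mulrBl normrM expr2 mulrA ler_pM ?le_nv//; apply: le_trans (hl _ _ _ _) _.
  rewrite ler_wpM2l// addrC addKr /nv; apply: ler_sum => k _.
  by rewrite mxE normrM ger0_norm// ler_piMl.
have [C [_ hC]] := compact_bounded cK.
have {}hC := hC (`|C| + 1) (le_lt_trans (ler_norm C) (ltr_pwDr ltr01 (lexx _))).
have [M M0 hM] := bd [::].
exists (M * (m%:R * (`|C| + 1))) => i j a.
have [->|Fa] := eqVneq (F a i j) 0; first by rewrite normr0 mul0r !mulr_ge0// addr_ge0.
have Ca : `|a| <= `|C| + 1.
  apply: hC; apply: subset_closure => /=; apply: contraNneq Fa => ->.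
  by rewrite mxE.
apply: ler_pM; [exact: normr_ge0|exact: nv_ge0|exact: (hM i j a)|].
apply: (@le_trans _ _ (\sum_(l < m) (`|C| + 1))); last by rewrite sumr_const card_ord mulr_natl.
apply: ler_sum => l _; apply: le_trans Ca; rewrite [leRHS]/Num.norm/= mx_normrE.
exact: (le_bigmax _ (fun ij => `|a ij.1 ij.2|) (l, 0)).
Qed.

End SmoothNonlinearities.

(** * Second differences of scalars *)

Section SecondDifferences.
Context {R : realType}.
Implicit Types (M N d x y : R).

(* Values at two points at distance d and at their midpoint. *)
Definition e3 M d (xa xb xm : R) := [/\ [/\ `|xa| <= M, `|xb| <= M & `|xm| <= M],
  `|xa - xm| <= M * d, `|xb - xm| <= M * d & `|(xa - xm) + (xb - xm)| <= M * d ^+ 2].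

Lemma e3_ge0 M d xa xb xm : e3 M d xa xb xm -> 0 <= M.
Proof. by move=> [[h _ _] _ _ _]; exact: le_trans h. Qed.

Lemma e3_mono M N d xa xb xm : 0 <= d -> M <= N -> e3 M d xa xb xm -> e3 N d xa xb xm.
Proof.
move=> d0 MN [[h1 h2 h3] h4 h5 h6]; split.
- by split; apply: le_trans MN.
- by apply: le_trans h4 _; rewrite ler_wpM2r.
- by apply: le_trans h5 _; rewrite ler_wpM2r.
- by apply: le_trans h6 _; rewrite ler_wpM2r// exprn_ge0.
Qed.

Lemma e3_cst M d x : 0 <= d -> `|x| <= M -> e3 M d x x x.
Proof.
move=> d0 xM; have M0 : 0 <= M by exact: le_trans xM.
by split => //; rewrite ?subrr ?addr0 normr0 mulr_ge0// exprn_ge0.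
Qed.

Lemma e3_add M N d xa xb xm ya yb ym : e3 M d xa xb xm -> e3 N d ya yb ym ->
  e3 (M + N) d (xa + ya) (xb + yb) (xm + ym).
Proof.
move=> [[h1 h2 h3] h4 h5 h6] [[g1 g2 g3] g4 g5 g6].
have D (a b s t : R) : `|a| <= s -> `|b| <= t -> `|a + b| <= s + t.
  by move=> ha hb; apply: le_trans (ler_normD _ _) (lerD ha hb).
rewrite /e3 !(mulrDl M N); split; first by split; apply: D.
- by rewrite opprD addrACA; apply: D.
- by rewrite opprD addrACA; apply: D.
- have -> : xa + ya - (xm + ym) + (xb + yb - (xm + ym)) =
    (xa - xm + (xb - xm)) + (ya - ym + (yb - ym)) by ring.
  exact: D.
Qed.

Lemma e3_opp M d xa xb xm : e3 M d xa xb xm -> e3 M d (- xa) (- xb) (- xm).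
Proof.
move=> [[h1 h2 h3] h4 h5 h6]; split; first by split; rewrite normrN.
- by rewrite -opprD normrN.
- by rewrite -opprD normrN.
- by rewrite -!opprD normrN.
Qed.

(** 4 counts the products in the expansion of the second difference of a product: two with a second
    difference, two with a pair of first differences. *)
Lemma e3_mul M N d xa xb xm ya yb ym : 0 <= d -> e3 M d xa xb xm -> e3 N d ya yb ym ->
  e3 (4 * (M * N)) d (xa * ya) (xb * yb) (xm * ym).
Proof.
move=> d0 ha hb; have M0 := e3_ge0 ha; have N0 := e3_ge0 hb.
move: ha hb => [[h1 h2 h3] h4 h5 h6] [[g1 g2 g3] g4 g5 g6].
have MN0 : 0 <= M * N by rewrite mulr_ge0.
have P (a b s t : R) : `|a| <= s -> `|b| <= t -> `|a * b| <= s * t.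
  by move=> h g; rewrite normrM ler_pM.
have T (a b s t : R) : `|a| <= s -> `|b| <= t -> `|a + b| <= s + t.
  by move=> h g; apply: le_trans (ler_normD _ _) (lerD h g).
have b1 a b : `|a| <= M -> `|b| <= N -> `|a * b| <= 4 * (M * N).
  by move=> h g; apply: le_trans (P _ _ _ _ h g) _; lra.
have b2 a b : `|a| <= M -> `|b| <= N -> `|a - xm| <= M * d -> `|b - ym| <= N * d ->
    `|a * b - xm * ym| <= 4 * (M * N) * d.
  move=> h g h' g'; have -> : a * b - xm * ym = (a - xm) * b + xm * (b - ym) by ring.
  apply: le_trans (T _ _ _ _ (P _ _ _ _ h' g) (P _ _ _ _ h3 g')) _.
  have -> : M * d * N + M * (N * d) = 2 * (M * N) * d by ring.
  by rewrite ler_wpM2r// ler_wpM2r// ler_nat.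
split; first by split; exact: b1.
- exact: b2.
- exact: b2.
have -> : xa * ya - xm * ym + (xb * yb - xm * ym) =
   (xa - xm + (xb - xm)) * ym + (xm * (ya - ym + (yb - ym)) +
   ((xa - xm) * (ya - ym) + (xb - xm) * (yb - ym))) by ring.
have := T _ _ _ _ (P _ _ _ _ h6 g3) (T _ _ _ _ (P _ _ _ _ h3 g6)
   (T _ _ _ _ (P _ _ _ _ h4 g4) (P _ _ _ _ h5 g5))).
by move/le_trans; apply; apply: eqle; ring.
Qed.

(** In the Taylor expansion at the middle point the linear part sees the second difference of the
    arguments, and each of the two remainders is quadratic in d. *)
Lemma e3_tame m (D : jet R m) s N : 0 <= N -> tame D -> exists2 M, 0 <= M &
  forall d (ra rb rm : 'cV[R]_m), 0 <= d -> (forall l, e3 N d (ra l 0) (rb l 0) (rm l 0)) ->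
  e3 M d (D s ra) (D s rb) (D s rm).
Proof.
move=> N0 tD; have [M M0 hM] := tD s.
have [K hK] := choice (fun l => let: ex_intro2 M M0 h := tD (l :: s) in
  ex_intro (fun M => 0 <= M /\ forall a, `|D (l :: s) a| <= M) M (conj M0 (fun a => let: And3 h1 _ _ := h a a in h1))).
have sK : 0 <= \sum_l K l by apply: sumr_ge0 => l _; have [] := hK l.
have mN : 0 <= m%:R * N by rewrite mulr_ge0.
exists (M + M * (m%:R * N) + ((\sum_l K l) * N + 2 * (M * (m%:R * N) ^+ 2))).
  by rewrite !addr_ge0// !mulr_ge0// exprn_ge0.
move=> d ra rb rm d0 h.
have nvd (r : 'cV[R]_m) : (forall l, `|r l 0 - rm l 0| <= N * d) -> nv (r - rm) <= m%:R * N * d.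
  move=> hr; apply: (@le_trans _ _ (\sum_(l < m) N * d)); last by rewrite sumr_const card_ord -mulrA mulr_natl.
  by apply: ler_sum => l _; rewrite !mxE.
have na := nvd ra (fun l => let: And4 _ h _ _ := h l in h).
have nb := nvd rb (fun l => let: And4 _ _ h _ := h l in h).
have c0 : 0 <= (\sum_l K l) * N + 2 * (M * (m%:R * N) ^+ 2) by rewrite addr_ge0 ?mulr_ge0// exprn_ge0.
have c1 : 0 <= M * (m%:R * N) by rewrite mulr_ge0.
have b1 r : `|D s r| <= M + M * (m%:R * N) + ((\sum_l K l) * N + 2 * (M * (m%:R * N) ^+ 2)).
  by have [h1 _ _] := hM r r; apply: le_trans h1 _; rewrite -addrA lerDl addr_ge0.
have b2 r : nv (r - rm) <= m%:R * N * d -> `|D s r - D s rm| <=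
    (M + M * (m%:R * N) + ((\sum_l K l) * N + 2 * (M * (m%:R * N) ^+ 2))) * d.
  move=> hr; have [_ h2 _] := hM rm r; apply: le_trans h2 _.
  apply: (@le_trans _ _ (M * (m%:R * N * d))); first by rewrite ler_wpM2l.
  by rewrite mulrA ler_wpM2r// -addrA addrCA lerDl addr_ge0.
split; [by split|exact: b2|exact: b2|].
have [_ _ ta] := hM rm ra; have [_ _ tb] := hM rm rb.
have -> : D s ra - D s rm + (D s rb - D s rm) =
   (\sum_l D (l :: s) rm * ((ra - rm) l 0 + (rb - rm) l 0)) +
   ((D s ra - D s rm - \sum_l D (l :: s) rm * (ra - rm) l 0) +
    (D s rb - D s rm - \sum_l D (l :: s) rm * (rb - rm) l 0)).
  rewrite (eq_bigr (fun l => D (l :: s) rm * (ra - rm) l 0 + D (l :: s) rm * (rb - rm) l 0)); last by move=> l _; rewrite mulrDr.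
  by rewrite big_split /=; ring.
have sq (r : 'cV[R]_m) : nv (r - rm) <= m%:R * N * d -> M * nv (r - rm) ^+ 2 <= M * (m%:R * N) ^+ 2 * d ^+ 2.
  by move=> hr; rewrite -mulrA -exprMn ler_wpM2l// ler_pXn2r ?nnegrE ?mulr_ge0 ?nv_ge0.
apply: (@le_trans _ _ (((\sum_l K l) * N + 2 * (M * (m%:R * N) ^+ 2)) * d ^+ 2)); last first.
  by rewrite ler_wpM2r ?exprn_ge0// lerDr addr_ge0.
apply: le_trans (ler_normD _ _) _; rewrite mulrDl; apply: lerD.
  apply: le_trans (ler_norm_sum _ _ _) _; rewrite -mulrA mulr_suml; apply: ler_sum => l _.
  have [_ hl] := hK l; have [_ _ _ h4] := h l.
  by rewrite normrM ler_pM//; rewrite !mxE.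
apply: le_trans (ler_normD _ _) _; rewrite mulr2n mulrDl mul1r mulrDl; apply: lerD.
  exact: le_trans ta (sq _ na).
exact: le_trans tb (sq _ nb).
Qed.

End SecondDifferences.

(** * Families with uniform bounds on second differences *)

Section Families.
Context {R : realType} {L : {posnum R}} {V : normedModType R} {T : Type}.
Local Notation ip := (ip (L := L)).
Variable B : R.
Local Notation I := `[0, L%:num]%classic.
Local Notation nrmI := (nrm (L := L)).
Implicit Types (a b v : V) (t : T).

Definition mid a b : V := 2^-1 *: (a + b).

(** Boundedness, Lipschitz continuity and quadratic second differences on the ball of radius B,
    uniformly in the parameter t, which will be the mode. The class is stable under the operations
    that build the vector field, so that the field is handled by following its syntax. *)
Definition unif (G : V -> T -> R) := exists2 M : R, 0 <= M & forall a b t,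
  `|a| <= B -> `|b| <= B -> e3 M `|a - b| (G a t) (G b t) (G (mid a b) t).

(** The same for functions of x in the supremum norm; [unifL] below is the L2 version. A product
    needs one factor of the first kind ([unifSL_mul]), whereas [unif_ip] takes two of the second. *)
Definition unifS (G : V -> T -> R -> R) := (forall v t, cts (L := L) (G v t)) /\
  exists2 M : R, 0 <= M & forall a b t x, `|a| <= B -> `|b| <= B -> I x ->
    e3 M `|a - b| (G a t x) (G b t x) (G (mid a b) t x).

Definition l3 (M d : R) (p q r : R -> R) := [/\ [/\ nrmI p <= M, nrmI q <= M & nrmI r <= M],
  nrmI (fun x => p x - r x) <= M * d, nrmI (fun x => q x - r x) <= M * d &
  nrmI (fun x => (p x - r x) + (q x - r x)) <= M * d ^+ 2].

Definition unifL (G : V -> T -> R -> R) := (forall v t, L2fun L (G v t)) /\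
  exists2 M : R, 0 <= M & forall a b t, `|a| <= B -> `|b| <= B ->
    l3 M `|a - b| (G a t) (G b t) (G (mid a b) t).

Lemma mid_ball a b : `|a| <= B -> `|b| <= B -> `|mid a b| <= B.
Proof.
move=> ha hb; rewrite normrZ ger0_norm ?invr_ge0// ler_pdivrMl//.
by apply: le_trans (ler_normD _ _) _; lra.
Qed.

Lemma unif_eq G H : (forall v t, G v t = H v t) -> unif G -> unif H.
Proof. by move=> e; rewrite (_ : G = H)//; apply/funext => v; apply/funext => t. Qed.

Lemma unif_cst (c : T -> R) M : (forall t, `|c t| <= M) -> unif (fun _ t => c t).
Proof.
move=> h; exists `|M| => // a b t _ _; apply: e3_cst => //.
exact: le_trans (h t) (ler_norm _).
Qed.

Lemma unif_add G H : unif G -> unif H -> unif (fun v t => G v t + H v t).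
Proof.
move=> [M M0 hM] [N N0 hN]; exists (M + N) => [|a b t ha hb]; first exact: addr_ge0.
by apply: e3_add; [exact: hM|exact: hN].
Qed.

Lemma unif_opp G : unif G -> unif (fun v t => - G v t).
Proof. by move=> [M M0 hM]; exists M => // a b t ha hb; apply: e3_opp; exact: hM. Qed.

Lemma unif_mul G H : unif G -> unif H -> unif (fun v t => G v t * H v t).
Proof.
move=> [M M0 hM] [N N0 hN]; exists (4 * (M * N)) => [|a b t ha hb]; first by rewrite !mulr_ge0.
by apply: e3_mul => //; [exact: hM|exact: hN].
Qed.

Lemma unif_scale (c : R) G : unif G -> unif (fun v t => c * G v t).
Proof. by move=> hG; apply: unif_mul => //; exact: (@unif_cst (fun=> c) `|c|). Qed.

Lemma unif_sum (J : Type) (s : seq J) (G : J -> V -> T -> R) : (forall j, unif (G j)) ->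
  unif (fun v t => \sum_(j <- s) G j v t).
Proof.
move=> h; elim: s => [|j s IH].
  apply: (unif_eq (G := fun _ _ => 0)) => [v t|]; first by rewrite big_nil.
  by apply: (@unif_cst (fun=> 0) 0) => t; rewrite normr0.
by apply: unif_eq (unif_add (h j) IH) => v t; rewrite big_cons.
Qed.

Lemma unifS_eq G H : (forall v t x, G v t x = H v t x) -> unifS G -> unifS H.
Proof.
move=> e; rewrite (_ : G = H)//; apply/funext => v; apply/funext => t; apply/funext => x; exact: e.
Qed.

Lemma unifS_cst (c : T -> R -> R) M : (forall t, cts (L := L) (c t)) ->
  (forall t x, I x -> `|c t x| <= M) -> unifS (fun _ => c).
Proof.
move=> cc h; split => //; exists `|M| => // a b t x _ _ Ix; apply: e3_cst => //.
exact: le_trans (h t x Ix) (ler_norm _).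
Qed.

Lemma unifS_const (c : R) : unifS (fun _ _ _ => c).
Proof. by apply: (@unifS_cst (fun _ _ => c) `|c|) => // t; exact: cts_cst. Qed.

Lemma unifS_add G H : unifS G -> unifS H -> unifS (fun v t x => G v t x + H v t x).
Proof.
move=> [cG [M M0 hM]] [cH [N N0 hN]]; split; first by move=> v t; exact: cts_add.
exists (M + N) => [|a b t x ha hb Ix]; first exact: addr_ge0.
by apply: e3_add; [exact: hM|exact: hN].
Qed.

Lemma unifS_mul G H : unifS G -> unifS H -> unifS (fun v t x => G v t x * H v t x).
Proof.
move=> [cG [M M0 hM]] [cH [N N0 hN]]; split; first by move=> v t; exact: cts_mul.
exists (4 * (M * N)) => [|a b t x ha hb Ix]; first by rewrite !mulr_ge0.
by apply: e3_mul => //; [exact: hM|exact: hN].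
Qed.

Lemma unifS_scale (c : R) G : unifS G -> unifS (fun v t x => c * G v t x).
Proof. by move=> hG; apply: unifS_mul => //; exact: unifS_const. Qed.

Lemma unifS_opp G : unifS G -> unifS (fun v t x => - G v t x).
Proof. by move=> /(unifS_scale (-1)); apply: unifS_eq => v t x; rewrite mulN1r. Qed.

Lemma unifS_sum (J : Type) (s : seq J) (G : J -> V -> T -> R -> R) : (forall j, unifS (G j)) ->
  unifS (fun v t x => \sum_(j <- s) G j v t x).
Proof.
move=> h; elim: s => [|j s IH].
  by apply: unifS_eq (unifS_const 0) => v t x; rewrite big_nil.
by apply: unifS_eq (unifS_add (h j) IH) => v t x; rewrite big_cons.
Qed.

Lemma finite_bound (n : nat) (P : 'I_n -> R -> Prop) :
  (forall i (M N : R), M <= N -> P i M -> P i N) ->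
  (forall i, exists2 M : R, 0 <= M & P i M) -> exists2 M : R, 0 <= M & forall i, P i M.
Proof.
move=> mono h; have [K hK] := choice (fun i => let: ex_intro2 M M0 hM := h i in
   ex_intro (fun M => 0 <= M /\ P i M) M (conj M0 hM)).
exists (\sum_i K i) => [|i]; first by apply: sumr_ge0 => i _; have [] := hK i.
have [_ hi] := hK i; apply: mono hi; rewrite (bigD1 i)//= lerDl sumr_ge0// => j _.
by have [] := hK j.
Qed.

Lemma unifS_tame m (D : jet R m) s (r : V -> T -> R -> 'cV[R]_m) :
  tame D -> (forall l, unifS (fun v t x => r v t x l 0)) -> unifS (fun v t x => D s (r v t x)).
Proof.
move=> tD hr; split => [v t|].
  have [M M0 hM] := tD s.
  apply: (@cts_nv _ _ _ (r v t) (fun x => D s (r v t x)) M) => // [l|x y]; first by have [] := hr l.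
  by have [_ h _] := hM (r v t y) (r v t x).
have [N N0 hN] : exists2 N : R, 0 <= N & forall l a b t x, `|a| <= B -> `|b| <= B -> I x ->
    e3 N `|a - b| (r a t x l 0) (r b t x l 0) (r (mid a b) t x l 0).
  apply: finite_bound => [l M N MN h a b t x ha hb Ix|l]; last by have [_ h] := hr l.
  by apply: e3_mono (h a b t x ha hb Ix).
have [M M0 hM] := e3_tame s N0 tD.
by exists M => // a b t x ha hb Ix; apply: hM => // l; exact: hN.
Qed.

Lemma unifL_eq G H : (forall v t x, G v t x = H v t x) -> unifL G -> unifL H.
Proof.
move=> e; rewrite (_ : G = H)//; apply/funext => v; apply/funext => t; apply/funext => x; exact: e.
Qed.

Lemma unifL_add G H : unifL G -> unifL H -> unifL (fun v t x => G v t x + H v t x).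
Proof.
move=> [cG [M M0 hM]] [cH [N N0 hN]]; split; first by move=> v t; exact: L2_add.
exists (M + N) => [|a b t ha hb]; first exact: addr_ge0.
have [[h1 h2 h3] h4 h5 h6] := hM a b t ha hb; have [[g1 g2 g3] g4 g5 g6] := hN a b t ha hb.
rewrite /l3 !(mulrDl M N).
have D p q s u : L2fun L p -> L2fun L q -> nrmI p <= s -> nrmI q <= u -> nrmI (fun x => p x + q x) <= s + u.
  by move=> lp lq hp hq; apply: le_trans (nrmD lp lq) (lerD hp hq).
split; first by split; apply: D.
- rewrite (nrm_eq (g := fun x => (G a t x - G (mid a b) t x) + (H a t x - H (mid a b) t x))); last by move=> x _; ring.
  by apply: D => //; exact: L2_sub.
- rewrite (nrm_eq (g := fun x => (G b t x - G (mid a b) t x) + (H b t x - H (mid a b) t x))); last by move=> x _; ring.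
  by apply: D => //; exact: L2_sub.
- rewrite (nrm_eq (g := fun x => ((G a t x - G (mid a b) t x) + (G b t x - G (mid a b) t x)) + ((H a t x - H (mid a b) t x) + (H b t x - H (mid a b) t x)))); last by move=> x _; ring.
  by apply: D => //; apply: L2_add; exact: L2_sub.
Qed.

Lemma unifSL_mul G H : unifS G -> unifL H -> unifL (fun v t x => G v t x * H v t x).
Proof.
move=> [cG [M M0 hM]] [cH [N N0 hN]]; split; first by move=> v t; exact: L2_mul.
exists (4 * (M * N)) => [|a b t ha hb]; first by rewrite !mulr_ge0.
have [[g1 g2 g3] g4 g5 g6] := hN a b t ha hb; have hG x := hM a b t x ha hb.
pose d := `|a - b|; have d0 : 0 <= d by exact: normr_ge0.
set m := mid a b in g3 g4 g5 g6 hG *.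
have MN0 : 0 <= M * N by rewrite mulr_ge0.
have P (p q : R -> R) s u : cts (L := L) p -> L2fun L q -> 0 <= s -> (forall x, I x -> `|p x| <= s) -> nrmI q <= u ->
    nrmI (fun x => p x * q x) <= s * u.
  move=> cp lq s0 hp hq; apply: le_trans (ler_wpM2l s0 hq); apply: nrm_dom => //; first exact: L2_mul.
  by move=> x Ix; rewrite normrM ler_wpM2r// hp.
have D p q s u : L2fun L p -> L2fun L q -> nrmI p <= s -> nrmI q <= u -> nrmI (fun x => p x + q x) <= s + u.
  by move=> lp lq hp hq; apply: le_trans (nrmD lp lq) (lerD hp hq).
have b1 c : (forall x, I x -> `|G c t x| <= M) -> nrmI (H c t) <= N -> nrmI (fun x => G c t x * H c t x) <= 4 * (M * N).
  by move=> hg hh; apply: le_trans (P _ _ _ _ (cG c t) (cH c t) M0 hg hh) _; lra.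
have cD c : cts (L := L) (fun x => G c t x - G m t x) by apply: cts_sub.
have lD c : L2fun L (fun x => H c t x - H m t x) by apply: L2_sub.
have Gm x : I x -> `|G m t x| <= M by move=> /hG [[]].
have b2 c : (forall x, I x -> `|G c t x - G m t x| <= M * d) -> nrmI (H c t) <= N ->
    nrmI (fun x => H c t x - H m t x) <= N * d -> nrmI (fun x => G c t x * H c t x - G m t x * H m t x) <= 4 * (M * N) * d.
  move=> hg hh hd.
  rewrite (nrm_eq (g := fun x => (G c t x - G m t x) * H c t x + G m t x * (H c t x - H m t x))); last by move=> x _; ring.
  apply: le_trans (D _ _ (M * d * N) (M * (N * d)) _ _ _ _) _.
  - exact: L2_mul.
  - exact: L2_mul.
  - by apply: P => //; rewrite mulr_ge0.
  - exact: P.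
  have -> : M * d * N + M * (N * d) = 2 * (M * N) * d by ring.
  by rewrite ler_wpM2r// ler_wpM2r// ler_nat.
split.
- by split; apply: b1 => // x /hG [[]].
- by apply: b2 => // x /hG [].
- by apply: b2 => // x /hG [].
rewrite (nrm_eq (g := fun x => (G a t x - G m t x + (G b t x - G m t x)) * H m t x +
   (G m t x * (H a t x - H m t x + (H b t x - H m t x)) +
   ((G a t x - G m t x) * (H a t x - H m t x) + (G b t x - G m t x) * (H b t x - H m t x)))));
  last by move=> x _; ring.
apply: le_trans (D _ _ (M * d ^+ 2 * N) (M * (N * d ^+ 2) + (M * d * (N * d) + M * d * (N * d))) _ _ _ _) _.
- by apply: L2_mul => //; exact: cts_add.
- by apply: L2_add; [apply: L2_mul => //; exact: L2_add|apply: L2_add; exact: L2_mul].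
- by apply: P => //; [exact: cts_add|rewrite mulr_ge0 ?exprn_ge0|move=> x /hG []].
- apply: (D); [by apply: L2_mul => //; exact: L2_add|by apply: L2_add; exact: L2_mul|..].
    by apply: P => //; exact: L2_add.
  apply: (D); [exact: L2_mul|exact: L2_mul|..].
    by apply: P => //; [rewrite mulr_ge0|move=> x /hG []].
  by apply: P => //; [rewrite mulr_ge0|move=> x /hG []].
by apply: eqle; rewrite /d; ring.
Qed.

Lemma unifSL G : unifS G -> unifL G.
Proof.
move=> hG; have h1 : unifL (fun _ _ _ => 1).
  split; first by move=> v t; exact: L2_cts (cts_cst 1).
  exists (Num.sqrt L%:num) => [|a b t ha hb]; first exact: sqrtr_ge0.
  have l0 : nrmI (fun=> 0) <= 0.
    rewrite -[leRHS](mul0r (Num.sqrt L%:num)); apply: nrm_bounded => // [|x _]; [exact: L2_cts (cts_cst 0)|by rewrite normr0].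
  have l1 : nrmI (fun=> 1) <= Num.sqrt L%:num.
    by rewrite -[leRHS]mul1r; apply: nrm_bounded => // [|x _]; [exact: L2_cts (cts_cst 1)|rewrite normr1].
  have p0 : 0 <= Num.sqrt L%:num * `|a - b| ^+ 2 by rewrite mulr_ge0 ?sqrtr_ge0 ?exprn_ge0.
  have p1 : 0 <= Num.sqrt L%:num * `|a - b| by rewrite mulr_ge0 ?sqrtr_ge0.
  split => //; rewrite (nrm_eq (g := fun=> 0)) ?(le_trans l0)// => x _; by rewrite ?subrr ?addr0.
by apply: unifL_eq (unifSL_mul hG h1) => v t x; rewrite mulr1.
Qed.

Lemma unifL_scale (c : R) G : unifL G -> unifL (fun v t x => c * G v t x).
Proof. by move=> hG; apply: unifSL_mul => //; exact: unifS_const. Qed.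

Lemma unifL_sum (J : Type) (s : seq J) (G : J -> V -> T -> R -> R) : (forall j, unifL (G j)) ->
  unifL (fun v t x => \sum_(j <- s) G j v t x).
Proof.
move=> h; elim: s => [|j s IH].
  by apply: unifL_eq (unifSL (unifS_const 0)) => v t x; rewrite big_nil.
by apply: unifL_eq (unifL_add (h j) IH) => v t x; rewrite big_cons.
Qed.

Lemma ip_subr p q r : L2fun L p -> L2fun L q -> L2fun L r ->
  ip p (fun x => q x - r x) = ip p q - ip p r.
Proof. by move=> hp hq hr; rewrite ipC ip_subl// ipC [X in _ - X]ipC. Qed.

Lemma ip_addr p q r : L2fun L p -> L2fun L q -> L2fun L r ->
  ip p (fun x => q x + r x) = ip p q + ip p r.
Proof. by move=> hp hq hr; rewrite ipC ip_addl// ipC [X in _ + X]ipC. Qed.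

Lemma unif_ip G H : unifL G -> unifL H -> unif (fun v t => ip (G v t) (H v t)).
Proof.
move=> [cG [M M0 hM]] [cH [N N0 hN]]; exists (4 * (M * N)) => [|a b t ha hb]; first by rewrite !mulr_ge0.
have [[h1 h2 h3] h4 h5 h6] := hM a b t ha hb; have [[g1 g2 g3] g4 g5 g6] := hN a b t ha hb.
pose d := `|a - b|; have d0 : 0 <= d by exact: normr_ge0.
set m := mid a b in h3 h4 h5 h6 g3 g4 g5 g6 *.
have MN0 : 0 <= M * N by rewrite mulr_ge0.
have P p q s u : L2fun L p -> L2fun L q -> nrmI p <= s -> nrmI q <= u -> `|ip p q| <= s * u.
  by move=> lp lq hp hq; apply: le_trans (le_ip lp lq) _; apply: ler_pM => //; exact: nrm_ge0.
have lG c := cG c t; have lH c := cH c t.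
have dG c : L2fun L (fun x => G c t x - G m t x) by apply: L2_sub.
have dH c : L2fun L (fun x => H c t x - H m t x) by apply: L2_sub.
have Tr (x y s u : R) : `|x| <= s -> `|y| <= u -> `|x + y| <= s + u.
  by move=> h g; apply: le_trans (ler_normD _ _) (lerD h g).
have b1 c : nrmI (G c t) <= M -> nrmI (H c t) <= N -> `|ip (G c t) (H c t)| <= 4 * (M * N).
  by move=> hg hh; apply: le_trans (P _ _ _ _ (lG c) (lH c) hg hh) _; lra.
have b2 c : nrmI (H c t) <= N -> nrmI (fun x => G c t x - G m t x) <= M * d -> nrmI (fun x => H c t x - H m t x) <= N * d ->
   `|ip (G c t) (H c t) - ip (G m t) (H m t)| <= 4 * (M * N) * d.
  move=> hh hg hd.
  have -> : ip (G c t) (H c t) - ip (G m t) (H m t) =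
      ip (fun x => G c t x - G m t x) (H c t) + ip (G m t) (fun x => H c t x - H m t x).
    by rewrite ip_subl// ip_subr//; ring.
  apply: le_trans (Tr _ _ _ _ (P _ _ _ _ (dG c) (lH c) hg hh) (P _ _ _ _ (lG m) (dH c) h3 hd)) _.
  have -> : M * d * N + M * (N * d) = 2 * (M * N) * d by ring.
  by rewrite ler_wpM2r// ler_wpM2r// ler_nat.
split; [by split; exact: b1|exact: b2|exact: b2|].
have -> : ip (G a t) (H a t) - ip (G m t) (H m t) + (ip (G b t) (H b t) - ip (G m t) (H m t)) =
   ip (fun x => G a t x - G m t x + (G b t x - G m t x)) (H m t) +
   (ip (G m t) (fun x => H a t x - H m t x + (H b t x - H m t x)) +
   (ip (fun x => G a t x - G m t x) (fun x => H a t x - H m t x) +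
    ip (fun x => G b t x - G m t x) (fun x => H b t x - H m t x))).
  rewrite ip_addl// ip_addr// !ip_subl// !ip_subr//; ring.
have := Tr _ _ _ _ (P _ _ _ _ (L2_add (dG a) (dG b)) (lH m) h6 g3) (Tr _ _ _ _ (P _ _ _ _ (lG m) (L2_add (dH a) (dH b)) h3 g6)
   (Tr _ _ _ _ (P _ _ _ _ (dG a) (dH a) h4 g4) (P _ _ _ _ (dG b) (dH b) h5 g5))).
by move/le_trans; apply; apply: eqle; rewrite /d; ring.
Qed.

Lemma int_sub_le p x y : L2fun L p -> I x -> I y -> x <= y ->
  `|\int[mu]_(t in `[x, y]) p t| <= Num.sqrt L%:num * nrmI p.
Proof.
move=> hp Ix Iy xy; have h := int_sqr_le hp Ix Iy xy.
rewrite -(ler_pXn2r (ltn0Sn 1)) ?nnegrE ?mulr_ge0 ?sqrtr_ge0 ?nrm_ge0//.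
rewrite real_normK ?num_real// exprMn sqr_sqrtr// sqr_nrm; apply: le_trans h _.
have [x0 _] : 0 <= x /\ x <= L%:num by move: Ix; rewrite /= in_itv /= => /andP.
have [_ yL] : 0 <= y /\ y <= L%:num by move: Iy; rewrite /= in_itv /= => /andP.
have ge0 z w : 0 <= \int[mu]_(t in `[z, w]) (p t ^+ 2) by apply: Rintegral_ge0 => ? _; exact: sqr_ge0.
apply: ler_pM => //; [by rewrite subr_ge0|lra|].
have i := L2_sqr hp.
rewrite ipE2 (int_itv_split x0 (le_trans xy yL) i).
rewrite (int_itv_split xy yL (intg_sub Ix (IL (L := L)) i)).
by rewrite addrCA lerDl addr_ge0.
Qed.

(** Integration gains regularity: L2 bounds on a family become supremum bounds on its tails, by
    Cauchy-Schwarz. *)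
Lemma unifS_tail G : unifL G -> unifS (fun v t x => \int[mu]_(y in `[x, L%:num]) G v t y).
Proof.
move=> [cG [M M0 hM]]; split; first by move=> v t; exact: hd_cts (hd_tail (cG v t)).
have sL := sqrtr_ge0 (L%:num).
exists (Num.sqrt L%:num * M) => [|a b t x ha hb Ix]; first by rewrite mulr_ge0.
have [[h1 h2 h3] h4 h5 h6] := hM a b t ha hb; set m := mid a b in h3 h4 h5 h6 *.
have /andP[x0 xL] : 0 <= x <= L%:num by move: Ix; rewrite /= in_itv.
have P p s : L2fun L p -> nrmI p <= s -> `|\int[mu]_(y in `[x, L%:num]) p y| <= Num.sqrt L%:num * s.
  by move=> lp hp; apply: le_trans (int_sub_le lp Ix (IL (L := L)) xL) _; rewrite ler_wpM2l.
have i p : L2fun L p -> intg `[x, L%:num] p by move=> lp; exact: intg_sub Ix (IL (L := L)) (L2fun_int lp).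
have dG c : L2fun L (fun x => G c t x - G m t x) by apply: L2_sub.
have D c : \int[mu]_(y in `[x, L%:num]) G c t y - \int[mu]_(y in `[x, L%:num]) G m t y =
   \int[mu]_(y in `[x, L%:num]) (G c t y - G m t y).
  by rewrite (int_sub (mitv _ _) (i _ (cG c t)) (i _ (cG m t))).
rewrite /e3 -!mulrA !D; split; [by split; exact: P|exact: P|exact: P|].
by rewrite -(int_add (mitv _ _) (i _ (dG a)) (i _ (dG b))); apply: P => //; exact: L2_add.
Qed.

End Families.

(** * Linear systems on [0, L] and the matrix gauge *)

Section LinearOde.
Context {R : realType} {L : {posnum R}} {m : nat}.
Local Notation I := `[0, L%:num]%classic.
Local Notation hd := (has_L2deriv L).
Local Notation I0 := (I0 (L := L)).
Local Notation cts := (cts (L := L)).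
Implicit Types (A X Y : R -> 'M[R]_m) (x t : R).

(** Projection onto [0, L]; it extends curves to the whole line, where [fixed_curve] is stated. *)
Definition clamp t : R := Num.max 0 (Num.min t L%:num).

Lemma clampI t : I (clamp t).
Proof. by rewrite /= in_itv /= /clamp le_max lexx /= ge_max ltW//= ge_min lexx orbT. Qed.

Lemma clampE t : I t -> clamp t = t.
Proof. by rewrite /= in_itv /= /clamp => /andP[t0 tL]; rewrite min_l// max_r. Qed.

Lemma cts_clamp (h : R -> R) : cts h -> continuous (h \o clamp).
Proof.
move=> ch t; apply/(@cvgrPdist_le _ _ _ (nbhs t)) => e e0.
have [d d0 hd] := cts_eps ch (clampI t) e0.
apply/nbhs_ballP; exists d => //= s; rewrite -ball_normE /= => st.
apply: hd; first exact: clampI.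
apply: le_lt_trans st; rewrite /clamp.
have [h1 h2] : t - s <= `|t - s| /\ - (t - s) <= `|t - s|.
  by split; rewrite ?ler_norm// -normrN ler_norm.
have L0 := gt0 L; set r := `|t - s| in h1 h2 *.
have lipmax (x y z : R) : `|x - y| <= r -> `|Num.max z x - Num.max z y| <= r.
  by rewrite !ler_norml => /andP[? ?]; case: (leP z x) => ?; case: (leP z y) => ?; apply/andP; split; lra.
have lipmin (x y z : R) : `|x - y| <= r -> `|Num.min x z - Num.min y z| <= r.
  by rewrite !ler_norml => /andP[? ?]; case: (leP x z) => ?; case: (leP y z) => ?; apply/andP; split; lra.
by apply: lipmax; apply: lipmin.

Qed.

Lemma expR_int (k : R) x : I x -> \int[mu]_(t in `[0, x]) (k * expR (k * t)) = expR (k * x) - 1.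
Proof.
move=> Ix; have : hd (fun t => expR (k * t)) (fun t => k * expR (k * t)).
  apply: hd_C1 => t; first exact: is_derive_expM.
  by apply: cvgM; [exact: cvg_cst|exact: is_derive_continuous (is_derive_expM _ _)].
by move=> [_ /(_ x Ix) ->]; rewrite mulr0 expR0 addrAC subrr add0r.
Qed.

(** Picard iteration with an exponential weight, which makes the integral operator a contraction on
    all of [0, L]. Columns are embedded by e into [l2] as sequences supported at entry 0, to obtain
    a complete normed space to which [fixed_curve] applies. *)
Lemma linear_ode A (b0 : 'cV[R]_m) : (forall i j, cts (fun x => A x i j)) ->
  exists b : R -> 'cV[R]_m, b 0 = b0 /\
    forall i, hd (fun x => b x i 0) (fun x => \sum_j A x i j * b x j 0).
Proof.
move=> cA.
have [M M0 hM] : exists2 M : R, 0 <= M & forall i j x, I x -> `|A x i j| <= M.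
  apply: finite_bound => [i M N MN h j x Ix|i]; first exact: le_trans (h j x Ix) MN.
  apply: finite_bound => [j M N MN h x Ix|j]; first exact: le_trans (h x Ix) MN.
  exact: cts_bounded.
have sq0 (u : nat -> 'cV[R]_m) K n : 0 <= K -> (forall i, `|u 0%N i 0| <= K) ->
    (forall k i, u k.+1 i 0 = 0) -> sqs n u <= (m%:R * K) ^+ 2.
  move=> K0 hK u0; case: n => [|n]; first by rewrite /sqs big_ord0 exprn_ge0// mulr_ge0.
  rewrite /sqs big_ord_recl /= [X in _ + X]big1 ?addr0; last first.
    by move=> k _; rewrite big1// => i _; rewrite /bump add1n u0 expr0n.
  apply: (@le_trans _ _ (\sum_(i < m) K ^+ 2)).
    by apply: ler_sum => i _; rewrite -[leLHS]real_normK ?num_real// ler_pXn2r ?nnegrE.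
  rewrite sumr_const card_ord -[K ^+ 2 *+ m]mulr_natl exprMn ler_wpM2r ?exprn_ge0//.
  by rewrite -natrX ler_nat; case: (m) => // p; rewrite expnS leq_pmulr// expn_gt0.
have [e he] : exists e : 'cV[R]_m -> l2 R m, forall b, l2val (e b) = (fun k => if k == 0%N then b else 0).
  suff /choice[e he] : forall b : 'cV[R]_m, exists v : l2 R m, l2val v = (fun k => if k == 0%N then b else 0) by exists e.
  move=> b; pose u k := if k == 0%N then b else 0.
  have M0' : 0 <= m%:R * nv b by rewrite mulr_ge0// nv_ge0.
  have hs n : sqs n u <= (m%:R * nv b) ^+ 2.
    by apply: sq0 => [|i|k i]; [exact: nv_ge0|exact: le_nv|rewrite mxE].
  have [v hv _] := l2_exist M0' hs.
  by exists v.
have e0 b i : e b 0%N i 0 = b i 0 by rewrite he.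
have eB (b c : 'cV[R]_m) K : 0 <= K -> (forall i, `|b i 0 - c i 0| <= K) -> `|e b - e c| <= m%:R * K.
  move=> K0 h; apply: l2_norm_le => [|n]; first by rewrite mulr_ge0.
  by apply: sq0 => // [i|k i]; rewrite l2BE ?e0// !he !mxE subrr.
pose g (y : R -> l2 R m) i x := \sum_j A x i j * y x 0%N j 0.
pose G (y : R -> l2 R m) t : 'cV[R]_m := \col_i (b0 i 0 + \int[mu]_(x in `[0, clamp t]) g y i x).
(* Integration divides the weight by k; one factor m comes from the matrix product, the other from
   the norm of e, so this k yields the contraction constant 1/2. *)
pose k : R := 2 * m%:R * (m%:R * M) + 1.
have k0 : 0 < k by rewrite ltr_wpDl// !mulr_ge0.
pose w t := expR (k * clamp t).
have cclamp : continuous clamp := cts_clamp (cts_continuous (fun x => cvg_id)).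
have cw : continuous w.
  move=> t; apply: (@continuous_comp _ _ _ (fun t => k * clamp t) expR); last exact: continuous_expR.
  by apply: cvgM; [exact: cvg_cst|exact: cclamp].
have w0 t : 0 < w t by exact: expR_gt0.
have cy (y : R -> l2 R m) i : continuous y -> continuous (fun x => y x 0%N i 0).
  by move=> c x; apply: (@continuous_comp _ _ _ y (fun v : l2 R m => v 0%N i 0)); [exact: c|exact: l2_continuous_entry].
have cg y i : continuous y -> cts (g y i).
  by move=> c; apply: cts_sum => j; apply: cts_mul => //; apply: cts_continuous; exact: cy.
have hdg y i : continuous y -> hd (fun t => b0 i 0 + \int[mu]_(x in `[0, t]) g y i x) (g y i).
  move=> c; have := hd_add (hd_cst (L := L) (b0 i 0)) (hd_prim (L2_cts (cg y i c))).
  by apply: hd_eq => // x _; rewrite add0r.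
have Gest (x y : R -> l2 R m) K t i : cgrow w x -> cgrow w y -> 0 <= K -> (forall t, `|x t - y t| <= K * w t) ->
    `|G x t i 0 - G y t i 0| <= m%:R * M * K * (w t / k).
  move=> [cx _] [cyy _] K0 h.
  have It := clampI t; have ix := intg_sub (I0) It (cts_intg (cg x i cx)).
  have iy := intg_sub (I0) It (cts_intg (cg y i cyy)).
  rewrite /G !mxE opprD addrACA subrr add0r -(int_sub (mitv _ _) ix iy).
  pose ce := m%:R * M * K / k.
  have i1 : intg `[0, clamp t] (fun s => k * expR (k * s)).
    apply: intg_sub (I0) It _; apply: cts_intg; apply: cts_continuous => s.
    by apply: cvgM; [exact: cvg_cst|exact: is_derive_continuous (is_derive_expM _ _)].
  have ce0 : 0 <= ce by rewrite divr_ge0 ?mulr_ge0// ltW.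
  apply: (@le_trans _ _ (ce * (expR (k * clamp t) - 1))).
    rewrite -(expR_int _ It) -(int_scale ce (mitv _ _) i1).
    apply: (int_abs (mitv _ _)); [exact: intgB (mitv _ _) ix iy|exact: intgZ (mitv _ _) i1|].
    move=> s sI; have Is := subI (I0) It sI.
    have -> : ce * (k * expR (k * s)) = \sum_(j < m) (M * (K * w s)).
      rewrite sumr_const card_ord -[RHS]mulr_natl /w (clampE Is) /ce mulrA divfK ?gt_eqF//; ring.
    rewrite /g -sumrB; apply: le_trans (ler_norm_sum _ _ _) _; apply: ler_sum => j _.
    rewrite -mulrBr normrM ler_pM// ?hM//; apply: le_trans (h s); rewrite -l2BE; exact: l2_entry.
  have -> : m%:R * M * K * (w t / k) = ce * w t by rewrite /ce; ring.
  by rewrite ler_wpM2l// gerBl.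
have cG y : continuous y -> forall i, continuous (fun t => G y t i 0).
  move=> c i; have := cts_clamp (hd_cts (hdg y i c)).
  by rewrite (_ : _ \o clamp = (fun t => G y t i 0))//; apply/funext => t; rewrite mxE.
have ceG y : continuous y -> continuous (fun t => e (G y t)).
  move=> c t; apply/(@cvgrPdist_le _ _ _ (nbhs t)) => eps eps0.
  have p0 : 0 < eps / (m%:R + 1) by rewrite divr_gt0// ltr_wpDl.
  have : \forall s \near t, forall i, `|G y t i 0 - G y s i 0| <= eps / (m%:R + 1).
    apply: (@filter_forall _ _ (fun i s => `|G y t i 0 - G y s i 0| <= eps / (m%:R + 1)) _ (nbhs_filter t)) => i.
    exact: (@cvgr_dist_le _ _ _ (nbhs t) (nbhs_filter t) _ _ (cG y c i t) _ p0).
  apply: filterS => s hs; apply: le_trans (eB _ _ _ (ltW p0) hs) _.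
  by rewrite mulrCA ger_pMr// ler_pdivrMr ?mul1r ?lerDl// ltr_wpDl.
have w1 t : 1 <= w t.
  have /andP[c0 _] : 0 <= clamp t <= L%:num by have := clampI t; rewrite /= in_itv.
  by rewrite /w -expR0 ler_expR mulr_ge0// ltW.
have q01 : 0 <= (2^-1 : R) < 1 by rewrite invr_ge0 ler0n invf_lt1// ltr1n.
have mMk : m%:R * (m%:R * M) / k <= 2^-1.
  by rewrite ler_pdivrMr// /k mulrDr mulr1 !mulrA mulVf ?pnatr_eq0// mul1r lerDl invr_ge0.
have Tc (x y : R -> l2 R m) K : cgrow w x -> cgrow w y -> (forall t, `|x t - y t| <= K * w t) ->
    forall t, `|e (G x t) - e (G y t)| <= 2^-1 * K * w t.
  move=> gx gy h t; have K0 : 0 <= K by rewrite -(pmulr_lge0 _ (w0 0)); exact: le_trans (h 0).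
  have h1 i := Gest x y K t i gx gy K0 h.
  apply: le_trans (eB _ _ _ _ h1) _; first by rewrite mulr_ge0 ?divr_ge0 ?mulr_ge0// ltW.
  have -> : m%:R * (m%:R * M * K * (w t / k)) = (m%:R * (m%:R * M) / k) * (K * w t) by ring.
  by rewrite -[leRHS]mulrA ler_wpM2r// mulr_ge0// ltW.
have g0 : cgrow w (fun=> 0 : l2 R m).
  by split; [exact: cst_continuous|exists 0 => t; rewrite normr0 mul0r].
have Tg (x : R -> l2 R m) : cgrow w x -> cgrow w (fun t => e (G x t)).
  move=> gx; split; first exact: ceG gx.1.
  have [K hK] := gx.2.
  have h t : `|x t - 0| <= K * w t by rewrite subr0.
  have [N hN] : exists N, forall t, `|e (G (fun=> 0) t)| <= N.
    exists (m%:R * nv b0) => t; apply: l2_norm_le => [|n]; first by rewrite mulr_ge0// nv_ge0.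
    apply: sq0 => [|i|k' i]; [exact: nv_ge0| |by rewrite he mxE].
    rewrite e0 mxE (int_eq (g := cst 0)) ?Rintegral_cst ?mul0r ?addr0; [exact: le_nv|exact: mitv|].
    by move=> x' _; rewrite /g big1// => j _; rewrite mxE mulr0.
  exists (2^-1 * K + N) => t; rewrite mulrDl.
  rewrite -[e (G x t)](subrK (e (G (fun=> 0) t))); apply: le_trans (ler_normD _ _) _; apply: lerD.
    exact: Tc gx g0 h t.
  by apply: le_trans (hN t) _; rewrite ler_peMr// (le_trans _ (hN t)).
have [y gy yE] := fixed_curve w0 cw q01 Tg Tc.
have [cy' _] := gy.
have yG x i : I x -> y x 0%N i 0 = b0 i 0 + \int[mu]_(x in `[0, x]) g y i x.
  by move=> Ix; rewrite -{1}yE e0 mxE clampE.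
exists (fun x => \col_i y x 0%N i 0); split.
  apply/matrixP => i j; rewrite ord1 mxE yG; last exact: I0.
  by rewrite set_itv1 Rintegral_set1 addr0.
move=> i; apply: hd_eq (hdg y i cy') => x Ix; first by rewrite mxE yG.
by apply: eq_bigr => j _; rewrite mxE.
Qed.

Lemma hd_zero_const f : hd f (fun=> 0) -> forall x, I x -> f x = f 0.
Proof. by move=> [_ h] x Ix; rewrite h// Rintegral_cst ?mul0r ?addr0//; exact: mitv. Qed.

Lemma gronwall (N dN : R -> R) C : hd N dN -> (forall x, I x -> dN x <= C * N x) ->
  forall x, I x -> N x <= N 0 * expR (C * x).
Proof.
move=> hN h x Ix; have he : hd (fun x => expR (- C * x)) (fun x => - C * expR (- C * x)).
  apply: hd_C1 => t; first exact: is_derive_expM.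
  apply: cvgM; first exact: cvg_cst.
  apply: (@continuous_comp _ _ _ (fun t => - C * t) expR); last exact: continuous_expR.
  by apply: cvgM; [exact: cvg_cst|exact: cvg_id].
have [hL /(_ x Ix)] := hd_mul hN he; rewrite mulr0 expR0 mulr1 => e.
have : N x * expR (- C * x) <= N 0.
  rewrite e gerDl; have /andP[x0 _] : 0 <= x <= L%:num by move: Ix; rewrite /= in_itv.
  have i := intg_sub (I0) Ix (L2fun_int hL).
  have i0 := intg_sub (I0) Ix (cts_intg (cts_cst (L := L) 0)).
  apply: le_trans (int_le (mitv _ _) i i0 _) _; last by rewrite Rintegral_cst ?mul0r//; exact: mitv.
  move=> t /(subI (I0) Ix) It; have e0 := expR_gt0 (- C * t).
  have -> : N t * (- C * expR (- C * t)) + expR (- C * t) * dN t = expR (- C * t) * (dN t - C * N t) by ring.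
  by rewrite pmulr_rle0// subr_le0 h.
by rewrite -ler_pdivlMr ?expR_gt0// -expRN mulNr opprK.
Qed.

Lemma hd_mulmx X Y (dX dY : R -> 'M[R]_m) : (forall i j, hd (fun x => X x i j) (fun x => dX x i j)) ->
  (forall i j, hd (fun x => Y x i j) (fun x => dY x i j)) ->
  forall i j, hd (fun x => (X x *m Y x) i j) (fun x => (X x *m dY x + dX x *m Y x) i j).
Proof.
move=> hX hY i j; have := hd_sum (index_enum 'I_m) (fun k => hd_mul (hX i k) (hY k j)).
apply: hd_eq => x _; first by rewrite mxE.
by rewrite !mxE -big_split; apply: eq_bigr => k _ /=; rewrite [Y x k j * _]mulrC.
Qed.

Definition gauge A (be al : R -> 'M[R]_m) := [/\ be 0 = 1%:M, al 0 = 1%:M,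
  forall i j, hd (fun x => be x i j) (fun x => (- 2^-1 *: (be x *m A x)) i j) &
  forall i j, hd (fun x => al x i j) (fun x => (2^-1 *: (A x *m al x)) i j)].

Lemma gauge_exist A : (forall i j, cts (fun x => A x i j)) -> exists be al, gauge A be al.
Proof.
move=> cA.
have /choice[a ha] : forall j, exists b : R -> 'cV[R]_m, b 0 = col j 1%:M /\
    forall i, hd (fun x => b x i 0) (fun x => \sum_k (2^-1 *: A x) i k * b x k 0).
  move=> j; apply: (@linear_ode (fun x => 2^-1 *: A x)) => i k.
  by apply: (cts_eq _ (@cts_scale _ L 2^-1 _ (cA i k))) => x _; rewrite mxE.
have /choice[b hb] : forall i, exists b : R -> 'cV[R]_m, b 0 = col i 1%:M /\
    forall j, hd (fun x => b x j 0) (fun x => \sum_k (- 2^-1 *: (A x)^T) j k * b x k 0).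
  move=> i; apply: (@linear_ode (fun x => - 2^-1 *: (A x)^T)) => j k.
  by apply: (cts_eq _ (@cts_scale _ L (- 2^-1) _ (cA k j))) => x _; rewrite !mxE.
exists (fun x => \matrix_(i, j) b i x j 0), (fun x => \matrix_(i, j) a j x i 0); split.
- by apply/matrixP => i j; rewrite mxE (hb i).1 !mxE eq_sym.
- by apply/matrixP => i j; rewrite mxE (ha j).1 !mxE.
- move=> i j; apply: hd_eq ((hb i).2 j) => x _; first by rewrite mxE.
  rewrite !mxE mulr_sumr; apply: eq_bigr => k _; rewrite !mxE; ring.
- move=> i j; apply: hd_eq ((ha j).2 i) => x _; first by rewrite mxE.
  rewrite !mxE mulr_sumr; apply: eq_bigr => k _; rewrite !mxE; ring.
Qed.

(** Transposition exchanges the roles of [be] and [al], with A replaced by - A^T, so that each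
    estimate of [be] is also one of [al]. *)
Lemma gauge_tr A be al : gauge A be al -> gauge (fun x => - (A x)^T) (fun x => (al x)^T) (fun x => (be x)^T).
Proof.
move=> [b0 a0 hb ha]; split; rewrite ?b0 ?a0 ?trmx1// => i j.
- apply: hd_eq (ha j i) => x _; first by rewrite mxE.
  by rewrite mulmxN -trmx_mul !mxE; ring.
- apply: hd_eq (hb j i) => x _; first by rewrite mxE.
  by rewrite mulNmx -trmx_mul !mxE; ring.
Qed.

Lemma gauge_mul A be al x : gauge A be al -> I x -> be x *m al x = 1%:M.
Proof.
move=> [b0 a0 hb ha] Ix; apply/matrixP => i j.
have h : hd (fun x => (be x *m al x) i j) (fun=> 0).
  apply: hd_eq (hd_mulmx hb ha i j) => // y _.
  by rewrite -scalemxAr -scalemxAl !mulmxA -scalerDl addrN scale0r mxE.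
by rewrite (hd_zero_const h Ix) b0 a0 mulmx1.
Qed.

Lemma gauge_mulC A be al x : gauge A be al -> I x -> al x *m be x = 1%:M.
Proof. by move=> h Ix; apply: mulmx1C; exact: gauge_mul h Ix. Qed.

Definition mb (K : R) (X : 'M[R]_m) := forall i j, `|X i j| <= K.

Lemma mb_mul K N (X Y : 'M[R]_m) : mb K X -> mb N Y -> mb (m%:R * (K * N)) (X *m Y).
Proof.
move=> hX hY i j; rewrite mxE; apply: le_trans (ler_norm_sum _ _ _) _.
apply: (@le_trans _ _ (\sum_(k < m) K * N)); last by rewrite sumr_const card_ord mulr_natl.
by apply: ler_sum => k _; rewrite normrM ler_pM.
Qed.

Lemma mb_add K N (X Y : 'M[R]_m) : mb K X -> mb N Y -> mb (K + N) (X + Y).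
Proof. by move=> hX hY i j; rewrite mxE; apply: le_trans (ler_normD _ _) (lerD _ _). Qed.

(** Gronwall's inequality for the sum of squares of one row of [be], which satisfies a linear
    equation of its own. *)
Lemma gauge_bound M : 0 <= M -> exists2 K, 0 <= K & forall A be al, gauge A be al ->
  (forall x, I x -> mb M (A x)) -> forall x, I x -> mb K (be x).
Proof.
move=> M0; pose C := m%:R * M; have C0 : 0 <= C by rewrite mulr_ge0.
exists (m%:R * expR (C * L%:num) + 1) => [|A be al [b0 _ hb _] hA x Ix i j].
  by rewrite addr_ge0// mulr_ge0// expR_ge0.
pose S x := \sum_(k < m) be x i k ^+ 2.
pose dS x := \sum_(k < m) 2 * (be x i k * (- 2^-1 *: (be x *m A x)) i k).
have hS : hd S dS.
  apply: hd_sum => k; have := hd_mul (hb i k) (hb i k); apply: hd_eq => y _; ring.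
have le2 y k : be y i k ^+ 2 <= S y.
  by rewrite /S (bigD1 k)//= lerDl sumr_ge0// => ? _; exact: sqr_ge0.
have dSC y : I y -> dS y <= C * S y.
  move=> Iy; apply: (@le_trans _ _ (\sum_(k < m) \sum_(l < m) M * (2^-1 * (be y i k ^+ 2 + be y i l ^+ 2)))).
    apply: ler_sum => k _; rewrite !mxE.
    have -> : 2 * (be y i k * (- 2^-1 * \sum_j0 be y i j0 * A y j0 k)) = \sum_l - (A y l k * (be y i k * be y i l)).
      set Z := \sum__ _; have -> : 2 * (be y i k * (- 2^-1 * Z)) = - (be y i k * Z) by field.
      by rewrite mulr_sumr -sumrN; apply: eq_bigr => l _; ring.
    apply: ler_sum => l _; apply: le_trans (ler_norm _) _; rewrite normrN normrM.
    apply: ler_pM => //; first exact: hA.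
    rewrite normrM ler_pdivlMl//; have := sqr_ge0 (`|be y i k| - `|be y i l|).
    by rewrite sqrrB !real_normK ?num_real//; lra.
  have -> : \sum_(k < m) \sum_(l < m) M * (2^-1 * (be y i k ^+ 2 + be y i l ^+ 2)) = C * S y; last by [].
  under eq_bigr => k _ do rewrite -mulr_sumr -mulr_sumr big_split /= sumr_const card_ord -/(S y).
  rewrite -mulr_sumr -mulr_sumr big_split /= sumr_const card_ord -sumrMnl.
  rewrite -/(S y) (_ : \sum_(k < m) _ = S y *+ m); last by rewrite /S -sumrMnl.
  rewrite -[S y *+ m]mulr_natl /C; move: (m%:R : R) (S y) => c z; by field.
have S0 : S 0 <= m%:R.
  rewrite /S b0; apply: (@le_trans _ _ (\sum_(k < m) 1)); last by rewrite sumr_const card_ord.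
  by apply: ler_sum => k _; rewrite mxE; case: (i == k); rewrite ?expr1n ?expr0n.
have Sx : S x <= m%:R * expR (C * L%:num).
  apply: le_trans (gronwall hS dSC Ix) _; have /andP[x0 xL] : 0 <= x <= L%:num by move: Ix; rewrite /= in_itv.
  apply: ler_pM => //; first by apply: sumr_ge0 => ? _; exact: sqr_ge0.
  by rewrite ler_expR ler_wpM2l.
have s1 : `|be x i j| ^+ 2 <= m%:R * expR (C * L%:num).
  by rewrite real_normK ?num_real//; exact: le_trans (le2 x j) Sx.
have [h1|/ltW h1] := leP `|be x i j| 1; first by apply: le_trans h1 _; rewrite lerDr mulr_ge0// expR_ge0.
apply: (@le_trans _ _ (`|be x i j| ^+ 2)); first by rewrite expr2 ler_peMl.
by apply: le_trans s1 _; rewrite lerDl.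
Qed.

Definition mint x (F : R -> 'M[R]_m) : 'M[R]_m := \matrix_(i, j) \int[mu]_(y in `[0, x]) F y i j.

Lemma cts_mulmx p q r (X : R -> 'M[R]_(p, q)) (Y : R -> 'M[R]_(q, r)) : (forall i j, cts (fun x => X x i j)) ->
  (forall i j, cts (fun x => Y x i j)) -> forall i j, cts (fun x => (X x *m Y x) i j).
Proof.
move=> cX cY i j; apply: (cts_eq _ (@cts_sum _ L _ (index_enum 'I_q) _ (fun k => cts_mul (cX i k) (cY k j)))) => x _.
by rewrite mxE.
Qed.

(** The product of [be1] and [al0] has derivative - be1 (A1 - A0) al0 / 2, the terms in A1 and A0
    alone cancelling. *)
Lemma duhamel A1 A0 be1 al1 be0 al0 x : gauge A1 be1 al1 -> gauge A0 be0 al0 -> I x ->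
  be1 x - be0 x = - 2^-1 *: (mint x (fun y => be1 y *m (A1 y - A0 y) *m al0 y) *m be0 x).
Proof.
move=> g1 g0 Ix; have [b1 _ hb1 _] := g1; have [_ a0 _ ha0] := g0.
have h i j : hd (fun x => (be1 x *m al0 x) i j) (fun y => - 2^-1 * (be1 y *m (A1 y - A0 y) *m al0 y) i j).
  apply: hd_eq (hd_mulmx hb1 ha0 i j) => // y _.
  by rewrite -scalemxAr -scalemxAl mulmxBr mulmxBl !mulmxA !mxE; ring.
suff e : be1 x *m al0 x = 1%:M - 2^-1 *: mint x (fun y => be1 y *m (A1 y - A0 y) *m al0 y).
  have := congr1 (mulmx^~ (be0 x)) e; rewrite /= -mulmxA (gauge_mulC g0 Ix) mulmx1 mulmxBl mul1mx => ->.
  by rewrite addrC addKr scaleNr -scalemxAl.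
apply/matrixP => i j; have [hL /(_ x Ix) ->] := h i j.
rewrite b1 a0 mulmx1 !mxE; congr (_ + _).
have hL' : L2fun L (fun y => (be1 y *m (A1 y - A0 y) *m al0 y) i j).
  by apply: L2_eq (L2_scale (- 2) hL) => y _; field.
by rewrite (int_scale _ (mitv _ _) (intg_sub (I0) Ix (L2fun_int hL'))) mulNr.
Qed.

Lemma mint_bound x (F : R -> 'M[R]_m) K : 0 <= K -> I x -> (forall i j, cts (fun y => F y i j)) ->
  (forall y, I y -> mb K (F y)) -> mb (L%:num * K) (mint x F).
Proof.
move=> K0 Ix cF hF i j; rewrite mxE; have /andP[x0 xL] : 0 <= x <= L%:num by move: Ix; rewrite /= in_itv.
have i1 := intg_sub (I0) Ix (cts_intg (cF i j)).
have i2 := intg_sub (I0) Ix (cts_intg (cts_cst (L := L) K)).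
apply: le_trans (int_abs (mitv _ _) i1 i2 _) _ => [y /(subI (I0) Ix) Iy|]; first exact: hF.
rewrite Rintegral_cst; last exact: mitv.
rewrite mulrC ler_wpM2r// [X in fine X](lebesgue_measure_itv `[0, x]) /=.
by case: ifP => _ /=; rewrite ?subr0.
Qed.

End LinearOde.

(** * Dependence of the gauge on its coefficient *)

Section GaugeFamilies.
Context {R : realType} {L : {posnum R}} {m : nat} {V : normedModType R} {T : Type}.
Local Notation cts := (cts (L := L)).
Variable B : R.
Local Notation I := `[0, L%:num]%classic.
Implicit Types (A be al : V -> T -> R -> 'M[R]_m).

(** Duhamel's formula relative to the midpoint gives the Lipschitz bound [C1]. In its second
    difference [be] is replaced by its value at the midpoint: this leaves the second difference of
    A, and products of two first differences, whence [C2]. *)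
Lemma gauge_unifS A be al (M : R) : 0 <= M ->
  (forall v t, gauge (L := L) (A v t) (be v t) (al v t)) ->
  (forall v t x, I x -> mb M (A v t x)) ->
  (forall i j, unifS (L := L) B (fun v t x => A v t x i j)) ->
  forall i j, unifS (L := L) B (fun v t x => be v t x i j).
Proof.
move=> M0 hg hA uA.
have [K K0 hK] := @gauge_bound R L m M M0.
have hb v t x : I x -> mb K (be v t x) by exact: hK (hg v t) (hA v t) x.
have ha v t x : I x -> mb K (al v t x).
  move=> Ix; have := hK _ _ _ (gauge_tr (hg v t)) _ x Ix.
  have h y : I y -> mb M (- (A v t y)^T) by move=> Iy i j; rewrite !mxE normrN; exact: hA.
  by move=> /(_ h) h' i j; have := h' j i; rewrite mxE.
have [N N0 hN] : exists2 N : R, 0 <= N & forall i j a b t x, `|a| <= B -> `|b| <= B -> I x ->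
    e3 N `|a - b| (A a t x i j) (A b t x i j) (A (mid a b) t x i j).
  apply: finite_bound => [i K1 K2 K12 h j a b t x hha hhb Ix|i].
    exact: e3_mono (h j a b t x hha hhb Ix).
  apply: finite_bound => [j K1 K2 K12 h a b t x hha hhb Ix|j].
    exact: e3_mono (h a b t x hha hhb Ix).
  by have [] := uA i j.
have cA v t i j : cts (fun x => A v t x i j) by have [] := uA i j.
have cb v t i j : cts (fun x => be v t x i j) by have [_ _ h _] := hg v t; exact: hd_cts (h i j).
have ca v t i j : cts (fun x => al v t x i j) by have [_ _ _ h] := hg v t; exact: hd_cts (h i j).
pose c : R := m%:R; have c0 : 0 <= c by [].
pose C1 := 2^-1 * (c * (L%:num * (c * (c * (K * N) * K)) * K)).
have C10 : 0 <= C1 by rewrite !mulr_ge0 ?invr_ge0.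
pose C2 := 2^-1 * (c * (L%:num * (c * (c * (K * N) * K) + (c * (c * (C1 * N) * K) + c * (c * (C1 * N) * K))) * K)).
have C20 : 0 <= C2 by rewrite !mulr_ge0 ?invr_ge0 ?addr_ge0 ?mulr_ge0.
have cAB a b t i j : cts (fun x => (A a t x - A b t x) i j).
  by apply: (cts_eq _ (cts_sub (cA a t i j) (cA b t i j))) => x _; rewrite !mxE.
have cT a b w t : forall i j, cts (fun y => (be a t y *m (A a t y - A b t y) *m al w t y) i j).
  by apply: cts_mulmx => //; apply: cts_mulmx.
move=> i j; split => // ; exists (K + C1 + C2) => [|a b t x hha hhb Ix]; first by rewrite !addr_ge0.
set p := mid a b; pose d := `|a - b|; have d0 : 0 <= d by exact: normr_ge0.
have lip v y : (forall y i j, I y -> `|A v t y i j - A p t y i j| <= N * d) -> I y -> mb (C1 * d) (be v t y - be p t y).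
  move=> hv Iy; rewrite (duhamel (hg v t) (hg p t) Iy) => k l; rewrite mxE normrM normrN [`|2^-1|]ger0_norm ?invr_ge0//.
  have -> : C1 * d = 2^-1 * (c * (L%:num * (c * (c * (K * (N * d)) * K)) * K)) by rewrite /C1; ring.
  rewrite ler_wpM2l ?invr_ge0//; apply: mb_mul; last exact: hb.
  apply: mint_bound => //; first by rewrite !mulr_ge0.
  move=> z Iz; apply: mb_mul; last exact: ha.
  by apply: mb_mul; [exact: hb|move=> k' l'; rewrite !mxE; exact: hv].
have La y k l : I y -> `|A a t y k l - A p t y k l| <= N * d by move=> Iy; have [] := hN k l a b t y hha hhb Iy.
have Lb y k l : I y -> `|A b t y k l - A p t y k l| <= N * d by move=> Iy; have [] := hN k l a b t y hha hhb Iy.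
have sd : mb (C2 * d ^+ 2) ((be a t x - be p t x) + (be b t x - be p t x)).
  rewrite (duhamel (hg a t) (hg p t) Ix) (duhamel (hg b t) (hg p t) Ix) -scalerDr -mulmxDl.
  have -> : mint x (fun y => be a t y *m (A a t y - A p t y) *m al p t y) + mint x (fun y => be b t y *m (A b t y - A p t y) *m al p t y) =
     mint x (fun y => be p t y *m ((A a t y - A p t y) + (A b t y - A p t y)) *m al p t y +
       ((be a t y - be p t y) *m (A a t y - A p t y) *m al p t y + (be b t y - be p t y) *m (A b t y - A p t y) *m al p t y)).
    apply/matrixP => k l; rewrite !mxE.
    have i1 v := intg_sub (I0 (L := L)) Ix (cts_intg (cT v p p t k l)).
    rewrite -(int_add (mitv _ _) (i1 a) (i1 b)); apply: int_eq => y _.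
    have E (X1 X2 X0 D1 D2 Y : 'M[R]_m) : X1 *m D1 *m Y + X2 *m D2 *m Y =
        X0 *m (D1 + D2) *m Y + ((X1 - X0) *m D1 *m Y + (X2 - X0) *m D2 *m Y).
      by rewrite !mulmxBl mulmxDr mulmxDl addrACA !subrKC.
    by rewrite -(E (be a t y) (be b t y)) [RHS]mxE.
  move=> k l; rewrite mxE normrM normrN [`|2^-1|]ger0_norm ?invr_ge0//.
  have -> : C2 * d ^+ 2 = 2^-1 * (c * (L%:num * (c * (c * (K * (N * d ^+ 2)) * K) +
     (c * (c * (C1 * d * (N * d)) * K) + c * (c * (C1 * d * (N * d)) * K))) * K)) by rewrite /C2; ring.
  rewrite ler_wpM2l ?invr_ge0//; apply: mb_mul; last exact: hb.
  have cD v i' j' : cts (fun y => (be v t y - be p t y) i' j').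
    by apply: (cts_eq _ (cts_sub (cb v t i' j') (cb p t i' j'))) => y _; rewrite !mxE.
  apply: mint_bound => //.
  - by rewrite !addr_ge0// !mulr_ge0// exprn_ge0.
  - move=> k' l'.
    have cm (X Y Z : R -> 'M[R]_m) : (forall i j, cts (fun y => X y i j)) -> (forall i j, cts (fun y => Y y i j)) ->
        (forall i j, cts (fun y => Z y i j)) -> cts (fun y => (X y *m Y y *m Z y) k' l').
      by move=> cX cY cZ; apply: cts_mulmx => // ? ?; exact: cts_mulmx.
    have c1 := cm (be p t) (fun y => (A a t y - A p t y) + (A b t y - A p t y)) (al p t) (cb p t) _ (ca p t).
    have c2 v := cm (fun y => be v t y - be p t y) (fun y => A v t y - A p t y) (al p t) (cD v) (cAB v p t) (ca p t).
    apply: (cts_eq _ (cts_add (c1 _) (cts_add (c2 a) (c2 b)))) => [y _|i' j']; first by rewrite !mxE.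
    by apply: (cts_eq _ (cts_add (cAB a p t i' j') (cAB b p t i' j'))) => y _; rewrite !mxE.
  move=> y Iy; apply: mb_add.
    apply: mb_mul; last exact: ha.
    by apply: mb_mul => [|k' l']; [exact: hb|rewrite !mxE; have [] := hN k' l' a b t y hha hhb Iy].
  by apply: mb_add; (apply: mb_mul; last exact: ha); (apply: mb_mul => [|k' l']; [exact: lip|rewrite !mxE]); [exact: La|exact: Lb].
have E : K + C1 + C2 = C1 + (K + C2) /\ K + C1 + C2 = C2 + (K + C1) by split; ring.
split.
- by split; apply: le_trans (hb _ _ _ Ix i j) _; rewrite -addrA lerDl addr_ge0.
- have := lip a x La Ix i j; rewrite !mxE => /le_trans; apply; rewrite ler_wpM2r// E.1 lerDl addr_ge0//.
- have := lip b x Lb Ix i j; rewrite !mxE => /le_trans; apply; rewrite ler_wpM2r// E.1 lerDl addr_ge0//.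
- have := sd i j; rewrite !mxE => /le_trans; apply; rewrite ler_wpM2r ?exprn_ge0// E.2 lerDl addr_ge0//.
Qed.

Lemma gauge_unifS_tr A be al (M : R) : 0 <= M ->
  (forall v t, gauge (L := L) (A v t) (be v t) (al v t)) ->
  (forall v t x, I x -> mb M (A v t x)) ->
  (forall i j, unifS (L := L) B (fun v t x => A v t x i j)) ->
  forall i j, unifS (L := L) B (fun v t x => al v t x i j).
Proof.
move=> M0 hg hA uA i j.
have := @gauge_unifS (fun v t x => - (A v t x)^T) (fun v t x => (al v t x)^T) (fun v t x => (be v t x)^T) M M0
  (fun v t => gauge_tr (hg v t)) _ _ j i.
move=> h; apply: unifS_eq (h _ _) => [v t x|v t x Ix k l|k l]; first by rewrite mxE.
- by rewrite !mxE normrN; exact: hA.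
- by apply: unifS_eq (unifS_opp (uA l k)) => v t x; rewrite !mxE.
Qed.

End GaugeFamilies.

(** * Uniformly convergent cosine series *)

Section CosineSeries.
Context {R : realType} {L : {posnum R}}.
Local Notation I := `[0, L%:num]%classic.
Local Notation cn := (cn (L := L)).
Local Notation tb := (tb (L := L)).
Implicit Types (c : nat -> R) (k n p : nat) (x M : R).

(* The weight (k + 1)^(3/4): large enough for sum_k ow_k^-2 to converge, and
   small enough for ow_k to be negligible against the gaps of k^2. *)
Definition ow k : R := Num.sqrt (k.+1%:R * Num.sqrt k.+1%:R).

Lemma ow_gt0 k : 0 < ow k.
Proof. by rewrite sqrtr_gt0 mulr_gt0 ?sqrtr_gt0. Qed.

Lemma sqr_ow k : ow k ^+ 2 = k.+1%:R * Num.sqrt k.+1%:R.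
Proof. by rewrite sqr_sqrtr// mulr_ge0// sqrtr_ge0. Qed.

(** Comparison with a telescoping sum: (n + 2) ^ (-3/2) is at most the decrease of 2 / sqrt from n +
    1 to n + 2, which also explains the strengthened bound in the induction. *)
Lemma sum_ow n : \sum_(k < n) (ow k ^+ 2)^-1 <= 3.
Proof.
case: n => [|n]; first by rewrite big_ord0.
suff h : \sum_(k < n.+1) (ow k ^+ 2)^-1 <= 3 - 2 / Num.sqrt n.+1%:R.
  by apply: le_trans h _; rewrite gerBl divr_ge0// sqrtr_ge0.
elim: n => [|n IH].
  by rewrite big_ord_recr big_ord0 /= sqr_ow sqrtr1 !mulr1 invr1; lra.
rewrite big_ord_recr /=; apply: le_trans (lerD IH (lexx _)) _; rewrite sqr_ow.
have s0 : 0 < Num.sqrt n.+1%:R :> R by rewrite sqrtr_gt0.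
have t0 : 0 < Num.sqrt n.+2%:R :> R by rewrite sqrtr_gt0.
have s2 : Num.sqrt n.+1%:R ^+ 2 = n.+1%:R :> R by rewrite sqr_sqrtr.
have t2 : Num.sqrt n.+2%:R ^+ 2 = n.+2%:R :> R by rewrite sqr_sqrtr.
have st : Num.sqrt n.+1%:R <= Num.sqrt n.+2%:R :> R by rewrite ler_wsqrtr// ler_nat.
have e : Num.sqrt n.+2%:R ^+ 2 = Num.sqrt n.+1%:R ^+ 2 + 1 :> R by rewrite s2 t2 natr1.
rewrite -{1}t2; move: s0 t0 st e; move: (Num.sqrt _) (Num.sqrt _) => t s s0 t0 st e.
rewrite -subr_ge0.
have -> : 3 - 2 / t - (3 - 2 / s + (t ^+ 2 * t)^-1) = (2 * t ^+ 3 - 2 * s * t ^+ 2 - s) / (s * t ^+ 3).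
  by field; rewrite !gt_eqF.
rewrite divr_ge0//; last by rewrite mulr_ge0 ?exprn_ge0 ?(ltW s0) ?(ltW t0).
have : 0 <= t - s by rewrite subr_ge0.
have -> : 2 * t ^+ 3 - 2 * s * t ^+ 2 - s = (t - s) * (2 * t ^+ 2) - s * (t ^+ 2 - s ^+ 2).
  have e1 : t ^+ 2 - s ^+ 2 = 1 by rewrite e; ring.
  by rewrite e1; ring.
move=> ts; have -> : (t - s) * (2 * t ^+ 2) - s * (t ^+ 2 - s ^+ 2) = (t - s) * (2 * t ^+ 2 - s * (t + s)) by ring.
by apply: mulr_ge0 => //; nra.
Qed.

Definition cpsum c n x := \sum_(k < n) c k / ow k * cn k x.
Definition csum c x := limn (fun n => cpsum c n x).
Definition sqbounded c M := forall n, \sum_(k < n) c k ^+ 2 <= M ^+ 2.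

(** Young's inequality [2 N |c_k| / ow_k <= c_k ^ 2 + N ^ 2 / ow_k ^ 2] sums to N ^ 2 + 3 N ^ 2. It
    requires N > 0, hence the approximation of M from above. *)
Lemma sum_abs_ow c M n : 0 <= M -> sqbounded c M -> \sum_(k < n) `|c k / ow k| <= 2 * M.
Proof.
move=> M0 h.
have key (N : R) : 0 < N -> M <= N -> \sum_(k < n) `|c k / ow k| <= 2 * N.
  move=> N0 MN; rewrite -(ler_pM2l (mulr_gt0 (ltr0n R 2) N0)).
  apply: (@le_trans _ _ (\sum_(k < n) (c k ^+ 2 + N ^+ 2 * (ow k ^+ 2)^-1))).
    rewrite mulr_sumr; apply: ler_sum => k _; rewrite normrM [`|(ow k)^-1|]gtr0_norm ?invr_gt0 ?ow_gt0//.
    have := sqr_ge0 (`|c k| - N * (ow k)^-1); rewrite -exprVn sqrrB real_normK ?num_real//.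
    by rewrite exprMn; lra.
  rewrite big_split /= -mulr_sumr.
  apply: (@le_trans _ _ (N ^+ 2 + N ^+ 2 * 3)); last by apply: eqle; ring.
  apply: lerD; last by rewrite ler_wpM2l ?sqr_ge0// sum_ow.
  by apply: le_trans (h n) _; rewrite ler_pXn2r ?nnegrE// ltW.
apply/ler_addgt0Pr => e e0; have h2 : 0 < e / 2 by rewrite divr_gt0.
have := key (M + e / 2) (ltr_wpDl M0 h2); rewrite lerDl (ltW h2) => /(_ isT) /le_trans; apply.
by rewrite mulrDr lerD2l; lra.
Qed.

Lemma cpsum_cvg c M : 0 <= M -> sqbounded c M ->
  (forall x, cvgn (fun n => cpsum c n x)) /\
  forall e : R, 0 < e -> exists n, forall q x, (n <= q)%N -> `|csum c x - cpsum c q x| <= e.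
Proof.
move=> M0 h; pose A n := \sum_(k < n) `|c k / ow k|.
have Ab n : A n <= 2 * M := sum_abs_ow n M0 h.
have t0 : 0 <= tb := tb_ge0.
have dA n p x : (n <= p)%N -> `|cpsum c p x - cpsum c n x| <= tb * (A p - A n).
  move=> /subnKC <-; rewrite /cpsum /A !big_split_ord /= addrAC subrr add0r addrAC subrr add0r mulr_sumr.
  apply: le_trans (ler_norm_sum _ _ _) _; apply: ler_sum => k _.
  by rewrite normrM mulrC ler_wpM2r// cn_le.
have cv x : cvgn (fun n => cpsum c n x).
  have -> : (fun n => cpsum c n x) = series (fun k => c k / ow k * cn k x).
    by apply/funext => n; rewrite seriesEord.
  apply: normed_cvg; apply: nondecreasing_is_cvgn.
    by apply: nondecreasing_series => k _ _; exact: normr_ge0.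
  exists (tb * (2 * M)) => _ [n _ <-]; rewrite -[X in X <= _]/(\sum_(0 <= k < n) `|c k / ow k * cn k x|) big_mkord.
  apply: (@le_trans _ _ (tb * A n)); last by rewrite ler_wpM2l.
  by rewrite /A mulr_sumr; apply: ler_sum => k _; rewrite normrM mulrC ler_wpM2r// cn_le.
split => // e e0.
have hs : has_sup (range A) by split; [exists (A 0%N), 0%N|exists (2 * M) => _ [n _ <-]].
have d0 : 0 < e / (tb + 1) by rewrite divr_gt0// ltr_wpDl.
have [_ [n _ <-] hn] := sup_adherent d0 hs; exists n => q x nq.
have Am : A n <= A q by rewrite /A -(subnKC nq) big_split_ord /= lerDl sumr_ge0.
have bd p : (q <= p)%N -> `|cpsum c p x - cpsum c q x| <= e.
  move=> np; apply: le_trans (dA q p x np) _.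
  have Ap : A p <= sup (range A) by apply: ub_le_sup; [case: hs|exists p].
  apply: (@le_trans _ _ (tb * (e / (tb + 1)))); first by rewrite ler_wpM2l//; lra.
  by rewrite mulrCA ger_pMr// ler_pdivrMr ?mul1r ?lerDl// ltr_wpDl.
apply/ler_addgt0Pr => d dd0.
have /cvgrPdist_le/(_ d dd0)[r _ hr] := cv x.
have hr' := hr (maxn q r) (leq_maxr _ _).
rewrite -[csum c x](subrK (cpsum c (maxn q r) x)) -addrA addrC.
by apply: le_trans (ler_normD _ _) (lerD _ _) => //; exact/bd/leq_maxl.
Qed.

Lemma csum_lin (a : R) c c' M M' x : 0 <= M -> 0 <= M' -> sqbounded c M -> sqbounded c' M' ->
  csum (fun k => a * c k + c' k) x = a * csum c x + csum c' x.
Proof.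
move=> M0 M0' h h'; have [c1 _] := cpsum_cvg M0 h; have [c2 _] := cpsum_cvg M0' h'.
rewrite {1}/csum; apply: cvg_lim => //.
have -> : (fun n => cpsum (fun k => a * c k + c' k) n x) = (fun n => a * cpsum c n x + cpsum c' n x).
  apply/funext => n; rewrite /cpsum /= mulr_sumr -big_split /=.
  by apply: eq_bigr => k _; ring.
by apply: cvgD; [apply: cvgM; [exact: cvg_cst|exact: c1]|exact: c2].
Qed.

Lemma csum_bound c M x : 0 <= M -> sqbounded c M -> `|csum c x| <= tb * (2 * M).
Proof.
move=> M0 h; have [_ ap] := cpsum_cvg M0 h.
apply/ler_addgt0Pr => e e0; have [n hn] := ap e e0.
rewrite -[csum c x](subrK (cpsum c n x)) addrC; apply: le_trans (ler_normD _ _) (lerD _ (hn n x _)) => //.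
apply: (@le_trans _ _ (tb * \sum_(k < n) `|c k / ow k|)); last by rewrite ler_wpM2l ?tb_ge0// sum_abs_ow.
rewrite mulr_sumr; apply: le_trans (ler_norm_sum _ _ _) _; apply: ler_sum => k _.
by rewrite normrM mulrC ler_wpM2r// cn_le.
Qed.

Lemma cts_cpsum c n : cts (L := L) (cpsum c n).
Proof. by apply: cts_sum => k; apply: cts_scale; exact: cts_cn. Qed.

Lemma cts_csum c M : 0 <= M -> sqbounded c M -> cts (L := L) (csum c).
Proof.
move=> M0 h; have [_ ap] := cpsum_cvg M0 h.
move=> x; apply/(@cvgrPdist_le _ _ _ (nbhs (x : subspace I))) => e e0.
have e3 : 0 < e / 3 by rewrite divr_gt0.
have [n hn] := ap _ e3.
have := @cvgr_dist_le _ _ _ (nbhs (x : subspace I)) (nbhs_filter (x : subspace I)) _ _ (@cts_cpsum c n x) _ e3.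
apply: filterS => y hy; have h1 := hn n x (leqnn _); have h2 := hn n y (leqnn _).
have -> : csum c x - csum c y = (csum c x - cpsum c n x) + ((cpsum c n x - cpsum c n y) - (csum c y - cpsum c n y)) by ring.
apply: le_trans (ler_normD _ _) _; apply: le_trans (lerD (lexx _) (ler_normB _ _)) _.
by rewrite (le_trans (lerD h1 (lerD hy h2)))//; lra.
Qed.

Lemma ip_csum c M k : 0 <= M -> sqbounded c M -> ip (L := L) (csum c) (cn k) = c k / ow k.
Proof.
move=> M0 h; have [_ ap] := cpsum_cvg M0 h.
have L2p n : L2fun L (cpsum c n) by apply: L2_cts; exact: cts_cpsum.
have L2c : L2fun L (csum c) by apply: L2_cts; exact: (cts_csum M0 h).
have ipp n : (k < n)%N -> ip (L := L) (cpsum c n) (cn k) = c k / ow k.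
  move=> kn; rewrite /cpsum ip_suml//; last by move=> j; exact: L2_scale.
  rewrite (bigD1 (Ordinal kn))//= ip_scalel// orthonormal_cn eqxx mulr1 big1 ?addr0// => j jk.
  rewrite ip_scalel// orthonormal_cn (_ : (_ == k) = false) ?mulr0//.
  by apply: contraNF jk => /eqP e; apply/eqP/val_inj.
apply/eqP; rewrite -subr_eq0 -normr_le0; apply/ler_addgt0Pr => e e0; rewrite add0r.
pose z := Num.sqrt L%:num * nrm (L := L) (cn k).
have s0 : 0 <= z by rewrite mulr_ge0 ?sqrtr_ge0 ?nrm_ge0.
have d0 : 0 < e / (z + 1) by rewrite divr_gt0// ltr_wpDl.
have [n hn] := ap _ d0; pose q := maxn n k.+1.
rewrite -(ipp q) ?leq_maxr// -ip_subl//; apply: le_trans (le_ip (L2_sub L2c (L2p q)) (L2_cn _)) _.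
apply: (@le_trans _ _ (e / (z + 1) * z)); last first.
  by rewrite mulrAC ler_pdivrMr ?ltr_wpDl// ler_wpM2l ?lerDl// ltW.
rewrite /z mulrA ler_wpM2r ?nrm_ge0//; apply: nrm_bounded => //; [exact: L2_sub|exact: ltW|].
by move=> x _; apply: hn; exact: leq_maxl.
Qed.

End CosineSeries.

(** * Families of matrices *)

Section MatrixFamilies.
Context {R : realType} {L : {posnum R}} {V : normedModType R} {T : Type}.
Variable B : R.

Definition SM p q (G : V -> T -> R -> 'M[R]_(p, q)) := forall i j, unifS (L := L) B (fun v t x => G v t x i j).
Definition LM p q (G : V -> T -> R -> 'M[R]_(p, q)) := forall i j, unifL (L := L) B (fun v t x => G v t x i j).

Lemma SM_mul p q s (G : V -> T -> R -> 'M[R]_(p, q)) (H : V -> T -> R -> 'M[R]_(q, s)) :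
  SM G -> SM H -> SM (fun v t x => G v t x *m H v t x).
Proof.
move=> hG hH i j; apply: unifS_eq (unifS_sum (index_enum 'I_q) (fun k => unifS_mul (hG i k) (hH k j))) => v t x.
by rewrite mxE.
Qed.

Lemma LM_mul p q s (G : V -> T -> R -> 'M[R]_(p, q)) (H : V -> T -> R -> 'M[R]_(q, s)) :
  SM G -> LM H -> LM (fun v t x => G v t x *m H v t x).
Proof.
move=> hG hH i j; apply: unifL_eq (unifL_sum (index_enum 'I_q) (fun k => unifSL_mul (hG i k) (hH k j))) => v t x.
by rewrite mxE.
Qed.

Lemma SM_add p q (G H : V -> T -> R -> 'M[R]_(p, q)) : SM G -> SM H -> SM (fun v t x => G v t x + H v t x).
Proof. by move=> hG hH i j; apply: unifS_eq (unifS_add (hG i j) (hH i j)) => v t x; rewrite mxE. Qed.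

Lemma LM_add p q (G H : V -> T -> R -> 'M[R]_(p, q)) : LM G -> LM H -> LM (fun v t x => G v t x + H v t x).
Proof. by move=> hG hH i j; apply: unifL_eq (unifL_add (hG i j) (hH i j)) => v t x; rewrite mxE. Qed.

Lemma SM_scale p q (c : R) (G : V -> T -> R -> 'M[R]_(p, q)) : SM G -> SM (fun v t x => c *: G v t x).
Proof. by move=> hG i j; apply: unifS_eq (unifS_scale c (hG i j)) => v t x; rewrite mxE. Qed.

Lemma LM_scale p q (c : R) (G : V -> T -> R -> 'M[R]_(p, q)) : LM G -> LM (fun v t x => c *: G v t x).
Proof. by move=> hG i j; apply: unifL_eq (unifL_scale c (hG i j)) => v t x; rewrite mxE. Qed.

Lemma SM_LM p q (G : V -> T -> R -> 'M[R]_(p, q)) : SM G -> LM G.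
Proof. by move=> hG i j; exact: unifSL. Qed.

End MatrixFamilies.

(** * The nonlinear terms in the new coordinates *)

Section Field.
Context {R : realType} {L : {posnum R}} {m : nat}.
Local Notation ipI := (ip (L := L)).
Local Notation nrmI := (nrm (L := L)).
Local Notation sn := (sn (L := L)).
Local Notation cn := (cn (L := L)).
Local Notation tb := (tb (L := L)).
Variables (Df : 'I_m -> 'I_m -> jet R m) (Dg : 'I_m -> jet R m).
Hypotheses (tDf : forall i j, tame (Df i j)) (tDg : forall i, tame (Dg i)).
Implicit Types (r W : R -> 'cV[R]_m) (k : nat) (x : R) (i j l : 'I_m).

Definition fmat s (a : 'cV[R]_m) : 'M[R]_m := \matrix_(i, j) Df i j s a.
Definition gvec (a : 'cV[R]_m) : 'cV[R]_m := \col_i Dg i [::] a.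
Definition gmat (a : 'cV[R]_m) : 'M[R]_m := \matrix_(i, l) Dg i [:: l] a.

(** A gauge exists for every continuous r, so the default of [xget] is met only for other r. *)
Definition gpair r : (R -> 'M[R]_m) * (R -> 'M[R]_m) :=
  xget (cst 0, cst 0) [set p | gauge (L := L) (fun x => fmat [::] (r x)) p.1 p.2].
Definition gbe r := (gpair r).1.
Definition gal r := (gpair r).2.

Lemma cts_tame (D : jet R m) s r : tame D -> (forall i, cts (L := L) (fun x => r x i 0)) ->
  cts (L := L) (fun x => D s (r x)).
Proof.
move=> tD cr; have [M M0 hM] := tD s.
apply: (@cts_nv _ _ _ r (fun x => D s (r x)) M) => // x y.
by have [_ h _] := hM (r y) (r x).
Qed.

Lemma gpairP r : (forall i, cts (L := L) (fun x => r x i 0)) ->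
  gauge (L := L) (fun x => fmat [::] (r x)) (gbe r) (gal r).
Proof.
move=> cr; have [i j|be [al h]] := @gauge_exist R L m (fun x => fmat [::] (r x)).
  by apply: (cts_eq _ (cts_tame (tDf i j) cr)) => x _; rewrite mxE.
by rewrite /gbe /gal /gpair; case: xgetP => [p _ //|/(_ (be, al))].
Qed.

(** This is u_x recovered from W, so that [flux] below is f(u) u_x + g(u). *)
Definition gvv r W x : 'cV[R]_m := gal r x *m W x.
(** The primitive of W sn_k that vanishes at L. It appears when the variation of [be] at x, an
    integral over (0, x), is tested against sn_k and the two integrations are exchanged. *)
Definition tails W k x : 'cV[R]_m := \col_i \int[mu]_(y in `[x, L%:num]) (W y i 0 * sn k y).
Definition gzz r W k x : 'cV[R]_m := gal r x *m tails W k x.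
Definition flux r W x : 'cV[R]_m := fmat [::] (r x) *m gvv r W x + gvec (r x).

Definition fieldA r W i k : R := ipI (fun x => flux r W x i 0) (cn k).

(* From the weak form of the equation with the test function whose entry l is
   (- sn_k' be + sn_k be f / 2)_il - (be f_l gzz)_i / 2, where f_l is the l-th partial derivative
   of f: the last term is the variation of be under a variation of u. *)
Definition fieldW r W i k : R :=
  ipI (fun x => (- 4^-1 *: (gbe r x *m (fmat [::] (r x) *m (fmat [::] (r x) *m gvv r W x))) +
    - 1 *: (gbe r x *m (gmat (r x) *m gvv r W x))) i 0) (sn k) +
  \sum_l (- ipI (fun x => sn k x * gvv r W x l 0) (fun x => (gbe r x *m (fmat [:: l] (r x) *m gvv r W x)) i 0) +
   2^-1 * (ipI (fun x => gvv r W x l 0)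
      (fun x => (- 2^-1 *: (gbe r x *m (fmat [::] (r x) *m (fmat [:: l] (r x) *m gzz r W k x))) +
         2^-1 *: (gbe r x *m (fmat [:: l] (r x) *m (fmat [::] (r x) *m gzz r W k x)))) i 0) +
    \sum_j ipI (fun x => (gbe r x *m (fmat [:: j; l] (r x) *m gzz r W k x)) i 0 * gvv r W x l 0) (fun x => gvv r W x j 0) +
    ipI (fun x => (flux r W x + r x) l 0) (fun x => (gbe r x *m (fmat [:: l] (r x) *m gzz r W k x)) i 0))).

Section Uniform.
Context {V : normedModType R}.
Variables (B : R) (r W : V -> R -> 'cV[R]_m).
Hypothesis hr : forall i, unifS (L := L) B (fun v (_ : nat) x => r v x i 0).
Hypothesis hW : forall i, unifL (L := L) B (fun v (_ : nat) x => W v x i 0).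
Local Notation SMB := (SM (L := L) (T := nat) B).
Local Notation LMB := (LM (L := L) (T := nat) B).

Let cr v i : cts (L := L) (fun x => r v x i 0). Proof. by have [h _] := hr i; exact: (h v 0%N). Qed.

Lemma SM_fmat s : SMB (fun v _ x => fmat s (r v x)).
Proof.
move=> i j; apply: unifS_eq (unifS_tame (r := fun v _ x => r v x) s (tDf i j) hr) => v t x.
by rewrite mxE.
Qed.

Lemma SM_gmat : SMB (fun v _ x => gmat (r v x)).
Proof.
move=> i l; apply: unifS_eq (unifS_tame (r := fun v _ x => r v x) [:: l] (tDg i) hr) => v t x.
by rewrite mxE.
Qed.

Lemma SM_gvec : SMB (fun v _ x => gvec (r v x)).
Proof.
move=> i j; apply: unifS_eq (unifS_tame (r := fun v _ x => r v x) [::] (tDg i) hr) => v t x.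
by rewrite mxE.
Qed.

Lemma SM_r : SMB (fun v _ x => r v x).
Proof. by move=> i j; rewrite ord1; exact: hr. Qed.

Lemma fmat_bound : exists2 M : R, 0 <= M & forall a, mb M (fmat [::] a).
Proof.
suff [M M0 hM] : exists2 M : R, 0 <= M & forall i j a, `|fmat [::] a i j| <= M by exists M => // a i j.
apply: finite_bound => [i K1 K2 K12 h j a|i]; first exact: le_trans (h j a) K12.
apply: finite_bound => [j K1 K2 K12 h a|j]; first exact: le_trans (h a) K12.
by have [M M0 hM] := tDf i j [::]; exists M => // a; rewrite mxE; have [] := hM a a.
Qed.

Lemma gvec_bound : exists2 N : R, 0 <= N & forall i a, `|Dg i [::] a| <= N.
Proof.
apply: finite_bound => [i K1 K2 K12 h a|i]; first exact: le_trans (h a) K12.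
by have [N N0 h] := tDg i [::]; exists N => // a; have [] := h a a.
Qed.

Lemma SM_gbe : SMB (fun v _ x => gbe (r v) x).
Proof.
have [M M0 hM] := fmat_bound.
have hgp v (_ : nat) : gauge (L := L) (fun x => fmat [::] (r v x)) (gbe (r v)) (gal (r v)) by apply: gpairP; exact: cr.
move=> i j; refine (@gauge_unifS _ _ _ _ nat B (fun v _ x => fmat [::] (r v x)) (fun v _ => gbe (r v)) (fun v _ => gal (r v)) M M0
  hgp (fun v _ x _ => hM (r v x)) (SM_fmat [::]) i j).
Qed.

Lemma SM_gal : SMB (fun v _ x => gal (r v) x).
Proof.
have [M M0 hM] := fmat_bound.
have hgp v (_ : nat) : gauge (L := L) (fun x => fmat [::] (r v x)) (gbe (r v)) (gal (r v)) by apply: gpairP; exact: cr.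
move=> i j; refine (@gauge_unifS_tr _ _ _ _ nat B (fun v _ x => fmat [::] (r v x)) (fun v _ => gbe (r v)) (fun v _ => gal (r v)) M M0
  hgp (fun v _ x _ => hM (r v x)) (SM_fmat [::]) i j).
Qed.

Lemma LM_W : LMB (fun v _ x => W v x).
Proof. by move=> i j; rewrite ord1; exact: hW. Qed.

Lemma LM_gvv : LMB (fun v _ x => gvv (r v) (W v) x).
Proof. by apply: LM_mul; [exact: SM_gal|exact: LM_W]. Qed.

Lemma unifS_sn : unifS (L := L) B (fun (_ : V) k x => sn k x).
Proof. by apply: (@unifS_cst _ _ _ _ B (fun k x => sn k x) tb) => [k|k x _]; [exact: cts_sn|exact: sn_le]. Qed.

Lemma unifS_cn : unifS (L := L) B (fun (_ : V) k x => cn k x).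
Proof. by apply: (@unifS_cst _ _ _ _ B (fun k x => cn k x) tb) => [k|k x _]; [exact: cts_cn|exact: cn_le]. Qed.

Lemma SM_gzz : SMB (fun v k x => gzz (r v) (W v) k x).
Proof.
apply: SM_mul; first exact: SM_gal.
move=> i j; have := unifS_tail (unifSL_mul unifS_sn (hW i)).
by apply: unifS_eq => v k x; rewrite mxE; apply: int_eq => y _; rewrite mulrC.
Qed.

Lemma LM_flux : LMB (fun v _ x => flux (r v) (W v) x).
Proof.
apply: LM_add; last exact: SM_LM SM_gvec.
by apply: LM_mul; [exact: SM_fmat|exact: LM_gvv].
Qed.

Lemma fieldA_unif i : unif B (fun v k => fieldA (r v) (W v) i k).
Proof. by apply: unif_ip; [exact: LM_flux|exact: unifSL unifS_cn]. Qed.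

(** Neither om_k nor a derivative of W occurs: each term pairs L2 families, or an L2 family with a
    bounded one, and k enters only through sn_k and [gzz], both bounded uniformly in k. *)
Lemma fieldW_unif i : unif B (fun v k => fieldW (r v) (W v) i k).
Proof.
have Sf := SM_fmat; have Sb := SM_gbe; have Lv := LM_gvv; have Sz := SM_gzz.
have Sbfz l s : SMB (fun v k x => gbe (r v) x *m (fmat (l :: s) (r v x) *m gzz (r v) (W v) k x)).
  by apply: SM_mul => //; exact: SM_mul.
have Lbfv s : LMB (fun v k x => gbe (r v) x *m (fmat s (r v x) *m gvv (r v) (W v) x)).
  by apply: LM_mul => //; exact: LM_mul.
have L1 : LMB (fun v k x => - 4^-1 *: (gbe (r v) x *m (fmat [::] (r v x) *m (fmat [::] (r v x) *m gvv (r v) (W v) x))) +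
    - 1 *: (gbe (r v) x *m (gmat (r v x) *m gvv (r v) (W v) x))).
  apply: LM_add; apply: LM_scale; apply: LM_mul => //; apply: LM_mul => //; [exact: LM_mul|exact: SM_gmat].
have S2 l : SMB (fun v k x => - 2^-1 *: (gbe (r v) x *m (fmat [::] (r v x) *m (fmat [:: l] (r v x) *m gzz (r v) (W v) k x))) +
   2^-1 *: (gbe (r v) x *m (fmat [:: l] (r v x) *m (fmat [::] (r v x) *m gzz (r v) (W v) k x)))).
  by apply: SM_add; apply: SM_scale; apply: SM_mul => //; apply: SM_mul => //; exact: SM_mul.
have L3 : LMB (fun v k x => flux (r v) (W v) x + r v x) by apply: LM_add; [exact: LM_flux|exact: SM_LM SM_r].
apply: unif_add; first exact: unif_ip (L1 i 0) (unifSL unifS_sn).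
apply: unif_sum => l; apply: unif_add.
  by apply: unif_opp; exact: unif_ip (unifSL_mul unifS_sn (Lv l 0)) (Lbfv [:: l] i 0).
apply: unif_scale; apply: unif_add; first apply: unif_add.
- exact: unif_ip (Lv l 0) (unifSL (S2 l i 0)).
- apply: unif_sum => j; exact: unif_ip (unifSL_mul (Sbfz j [:: l] i 0) (Lv l 0)) (Lv j 0).
- exact: unif_ip (L3 l 0) (unifSL (Sbfz l [::] i 0)).
Qed.

End Uniform.

(* The field only sees the class of W: a family equal to W at 0 and to W' elsewhere is uniform in L2,
   and its values at 0 and near 0 are close. *)
Lemma field_class r W W' : (forall i, cts (L := L) (fun x => r x i 0)) ->
  (forall i, L2fun L (fun x => W x i 0)) -> (forall i, L2fun L (fun x => W' x i 0)) ->
  (forall i, nrmI (fun x => W x i 0 - W' x i 0) = 0) ->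
  forall i k, fieldA r W i k = fieldA r W' i k /\ fieldW r W i k = fieldW r W' i k.
Proof.
move=> cr hW hW' e i k.
pose rr (v : R) := r; pose WW (v : R) := if v == 0 then W else W'.
have hr j : unifS (L := L) 1 (fun (v : R) (_ : nat) x => rr v x j 0).
  have [M _ hM] := cts_bounded (cr j).
  split => // ; exists `|M| => // a b t x _ _ Ix; apply: e3_cst => //.
  exact: le_trans (hM x Ix) (ler_norm _).
have hWW j : unifL (L := L) 1 (fun (v : R) (_ : nat) x => WW v x j 0).
  have l2 v : L2fun L (fun x => WW v x j 0) by rewrite /WW; case: ifP.
  have d0 v w : nrmI (fun x => WW v x j 0 - WW w x j 0) <= 0.
    have n0 f : nrmI (fun x => f x - f x) <= 0.
      rewrite -[leRHS](mul0r (Num.sqrt L%:num)); apply: nrm_bounded => // [|x _]; last by rewrite subrr normr0.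
      by apply: L2_eq (L2_cts (cts_cst 0)) => x _; rewrite subrr.
    rewrite /WW; case: ifP => _; case: ifP => _ //; first by rewrite e.
    rewrite (nrm_eq (g := fun x => -1 * (W x j 0 - W' x j 0))) ?nrmZ ?e ?mulr0//; last by move=> x _; ring.
    exact: L2_sub.
  split => //; pose M := nrmI (fun x => W x j 0) + nrmI (fun x => W' x j 0).
  have M0 : 0 <= M by rewrite addr_ge0 ?nrm_ge0.
  exists M => // a b t _ _; split.
  - have bd v : nrmI (fun x => WW v x j 0) <= M by rewrite /WW /M; case: ifP => _; rewrite ?lerDl ?lerDr nrm_ge0.
    by split.
  - by apply: le_trans (d0 _ _) _; rewrite mulr_ge0.
  - by apply: le_trans (d0 _ _) _; rewrite mulr_ge0.
  - apply: le_trans (nrmD (L2_sub (l2 _) (l2 _)) (L2_sub (l2 _) (l2 _))) _.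
    by apply: le_trans (lerD (d0 _ _) (d0 _ _)) _; rewrite addr0 mulr_ge0// exprn_ge0.
have key (F : R -> R) : (forall v, v != 0 -> F v = F 1) ->
    (exists2 M, 0 <= M & forall a b, `|a| <= 1 -> `|b| <= 1 -> `|F a - F (mid a b)| <= M * `|a - b|) -> F 0 = F 1.
  move=> F1 [M M0 h]; apply/eqP; rewrite -subr_eq0 -normr_le0.
  apply/ler_addgt0Pr => d d0; rewrite add0r.
  have t0 : 0 < Num.min 1 (d / (M + 1)) by rewrite lt_min ltr01 divr_gt0// ltr_wpDl.
  have := h 0 (Num.min 1 (d / (M + 1))); rewrite normr0 ler01 [`|Num.min _ _|]gtr0_norm// ge_min lexx => /(_ isT isT).
  rewrite (F1 (mid _ _)); last by rewrite /mid add0r gt_eqF// mulr_gt0.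
  rewrite sub0r normrN [`|Num.min _ _|]gtr0_norm// => /le_trans; apply.
  apply: (@le_trans _ _ (M * (d / (M + 1)))); first by rewrite ler_wpM2l// ge_min lexx orbT.
  by rewrite mulrCA ger_pMr// ler_pdivrMr ?mul1r ?lerDl// ltr_wpDl.
have e1 v : v != 0 -> WW v = WW 1 by move=> v0; rewrite /WW (negPf v0) oner_eq0.
split.
  have [M M0 h] := fieldA_unif hr hWW i.
  have := key (fun v => fieldA (rr v) (WW v) i k) _ _; rewrite /rr /WW eqxx oner_eq0; apply.
    by move=> v /negPf ->.
  by exists M => // a b ha hb; have [_ h1 _ _] := h a b k ha hb.
have [M M0 h] := fieldW_unif hr hWW i.
have := key (fun v => fieldW (rr v) (WW v) i k) _ _; rewrite /rr /WW eqxx oner_eq0; apply.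
  by move=> v /negPf ->.
by exists M => // a b ha hb; have [_ h1 _ _] := h a b k ha hb.
Qed.

End Field.

(** * A cut-off function on the phase space *)

Section SquaredNorm.
Context {R : realType} {N : nat}.
Implicit Types (y v : l2 R N) (n : nat).

Lemma sqs_approx v (e : R) : 0 < e -> exists n, forall p, (n <= p)%N -> `|v| ^+ 2 - e <= sqs p v.
Proof.
move=> e0; suff [n hn] : exists n, `|v| ^+ 2 - e <= sqs n v.
  by exists n => p np; apply: le_trans hn _; exact: sqs_homo.
apply: contrapT => /forallNP h.
have [v0|v0] := leP (`|v| ^+ 2 - e) 0; first by apply: (h 0%N); apply: le_trans v0 _; exact: sqs_ge0.
have : `|v| <= Num.sqrt (`|v| ^+ 2 - e).
  apply: l2_norm_le => [|n]; first exact: sqrtr_ge0.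
  by rewrite sqr_sqrtr ?(ltW v0)//; move/negP: (h n); rewrite -ltNge => /ltW.
rewrite -(ler_pXn2r (ltn0Sn 1)) ?nnegrE ?sqrtr_ge0// sqr_sqrtr ?(ltW v0)//.
by rewrite lerBrDl -lerBrDr subrr leNgt e0.
Qed.

Lemma midE y v j i : (mid y v : l2 R N) j i 0 = 2^-1 * (y j i 0 + v j i 0).
Proof. by rewrite -l2DE; exact: l2ZE. Qed.

Lemma sqs_parallelogram n y v :
  (sqs n y - sqs n (mid y v)) + (sqs n v - sqs n (mid y v)) = 2^-1 * sqs n (y - v).
Proof.
rewrite /sqs mulr_sumr -!sumrB -big_split; apply: eq_bigr => j _ /=.
rewrite mulr_sumr -!sumrB -big_split; apply: eq_bigr => i _ /=.
by rewrite !midE l2BE; field.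
Qed.

(** The summands of the constant serve the three clauses: size B ^ 2, Lipschitz constant B, and a
    second difference equal, by the parallelogram identity, to half of |y - v| ^ 2. The identity is
    used on partial sums and passes to the norm up to an arbitrary error. *)
Lemma e3_sqnorm (B : R) y v : 0 <= B -> `|y| <= B -> `|v| <= B ->
  e3 (B ^+ 2 + B + 1) `|y - v| (`|y| ^+ 2) (`|v| ^+ 2) (`|mid y v| ^+ 2).
Proof.
move=> B0 hy hv; have hm := mid_ball hy hv; have d0 : 0 <= `|y - v| by [].
have sq u : `|u : l2 R N| <= B -> `|(`|u| ^+ 2 : R)| <= B ^+ 2 + B + 1.
  move=> hu; rewrite ger0_norm ?sqr_ge0//; apply: (@le_trans _ _ (B ^+ 2)); last by rewrite -addrA lerDl addr_ge0.
  by rewrite ler_pXn2r ?nnegrE.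
have lip u : `|u : l2 R N| <= B -> `|u - mid y v| <= 2^-1 * `|y - v| ->
    `| `|u| ^+ 2 - `|mid y v| ^+ 2| <= (B ^+ 2 + B + 1) * `|y - v|.
  move=> hu hd; rewrite subr_sqr normrM.
  have h1 : `| `|u| - `|mid y v| | <= 2^-1 * `|y - v| := le_trans (ler_dist_dist _ _) hd.
  have h2 : `| `|u| + `|mid y v| | <= 2 * B by rewrite ger0_norm ?addr_ge0//; lra.
  apply: (@le_trans _ _ (2^-1 * `|y - v| * (2 * B))); first by rewrite ler_pM.
  have -> : 2^-1 * `|y - v| * (2 * B) = B * `|y - v| by field.
  by rewrite ler_wpM2r// addrAC -{1}[B]add0r lerD2r addr_ge0 ?sqr_ge0.
have half (u w : l2 R N) : u - 2^-1 *: (u + w) = 2^-1 *: (u - w) by lmod R.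
split; first by split; exact: sq.
- by apply: lip => //; rewrite half normrZ ger0_norm ?invr_ge0.
- by apply: lip => //; rewrite /mid (addrC y v) half normrZ ger0_norm ?invr_ge0// distrC.
apply/ler_addgt0Pr => e e0; have e4 : 0 < e / 2 by rewrite divr_gt0.
have [n1 h1] := sqs_approx y e4; have [n2 h2] := sqs_approx v e4; have [n3 h3] := sqs_approx (mid y v) e4.
pose n := maxn n1 (maxn n2 n3).
have := h1 n (leq_maxl _ _); have := h2 n (leq_trans (leq_maxl _ _) (leq_maxr _ _)).
have := h3 n (leq_trans (leq_maxr _ _) (leq_maxr _ _)).
have := sqs_parallelogram n y v; have := sqs_le n y; have := sqs_le n v; have := sqs_le n (mid y v).
have := sqs_le n (y - v); have := sqs_ge0 n (y - v).
have : 0 <= (B ^+ 2 + B) * `|y - v| ^+ 2 by rewrite mulr_ge0 ?addr_ge0 ?exprn_ge0.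
rewrite (mulrDl _ 1) mul1r ler_norml.
move: (sqs n (y - v)) (sqs n y) (sqs n v) (sqs n (mid y v)) (`|y - v| ^+ 2) ((B ^+ 2 + B) * `|y - v| ^+ 2) => s1 s2 s3 s4 d b.
by move=> *; apply/andP; split; lra.
Qed.

Lemma e3_c11 (phi dphi : R -> R) (K M d xa xb xm : R) : 0 <= d -> 0 <= K ->
  (forall a, `|a| <= M -> `|phi a| <= K) -> (forall a, `|a| <= M -> `|dphi a| <= K) ->
  (forall a b, `|phi b - phi a - dphi a * (b - a)| <= K * (b - a) ^+ 2) ->
  e3 M d xa xb xm -> e3 (K * (1 + 3 * M + 2 * M ^+ 2)) d (phi xa) (phi xb) (phi xm).
Proof.
move=> d0 K0 hp hd ht h; have M0 := e3_ge0 h; move: h => [[h1 h2 h3] h4 h5 h6].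
have P x : `|x| <= M -> `|phi x| <= K * (1 + 3 * M + 2 * M ^+ 2).
  move=> hx; apply: le_trans (hp x hx) _; rewrite ler_peMr// -addrA lerDl addr_ge0// ?mulr_ge0// exprn_ge0.
have Q x : `|x| <= M -> `|x - xm| <= M * d -> `|phi x - phi xm| <= K * (1 + 3 * M + 2 * M ^+ 2) * d.
  move=> hx hxd; have e := ht xm x; have := hd _ h3 => hdm.
  have h2M : `|x - xm| <= 2 * M by apply: le_trans (ler_normB _ _) _; lra.
  have -> : phi x - phi xm = dphi xm * (x - xm) + (phi x - phi xm - dphi xm * (x - xm)) by ring.
  apply: le_trans (ler_normD _ _) _; apply: le_trans (lerD (lexx _) e) _.
  have sqx : (x - xm) ^+ 2 <= 2 * M * (M * d).
    by rewrite -[leLHS]real_normK ?num_real// expr2 ler_pM.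
  rewrite normrM; apply: (@le_trans _ _ (K * (M * d) + K * (2 * M * (M * d)))).
    by apply: lerD; [apply: ler_pM|rewrite ler_wpM2l].
  have -> : K * (M * d) + K * (2 * M * (M * d)) = K * (M + 2 * M ^+ 2) * d by ring.
  by rewrite ler_wpM2r// ler_wpM2l//; lra.
split; [by split; exact: P|exact: Q|exact: Q|].
have ea := ht xm xa; have eb := ht xm xb.
have -> : phi xa - phi xm + (phi xb - phi xm) = dphi xm * (xa - xm + (xb - xm)) +
  ((phi xa - phi xm - dphi xm * (xa - xm)) + (phi xb - phi xm - dphi xm * (xb - xm))) by ring.
have sq x : `|x - xm| <= M * d -> K * (x - xm) ^+ 2 <= K * (M ^+ 2 * d ^+ 2).
  by move=> hx; rewrite ler_wpM2l// -[leLHS]real_normK ?num_real// -exprMn ler_pXn2r ?nnegrE ?mulr_ge0.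
apply: le_trans (ler_normD _ _) _; apply: le_trans (lerD (lexx _) (ler_normD _ _)) _.
apply: (@le_trans _ _ (K * (M * d ^+ 2) + (K * (M ^+ 2 * d ^+ 2) + K * (M ^+ 2 * d ^+ 2)))).
  apply: lerD; first by rewrite normrM ler_pM// hd.
  by apply: lerD; [exact: le_trans ea (sq _ h4)|exact: le_trans eb (sq _ h5)].
have -> : K * (M * d ^+ 2) + (K * (M ^+ 2 * d ^+ 2) + K * (M ^+ 2 * d ^+ 2)) = K * (M + 2 * M ^+ 2) * d ^+ 2 by ring.
by rewrite ler_wpM2r ?exprn_ge0// ler_wpM2l//; lra.
Qed.

(** The squared positive part has a Lipschitz derivative, which is what bounded second differences
    require. *)
Definition psq (t : R) : R := Num.max 0 t ^+ 2.

Lemma e3_psq (M d xa xb xm : R) : 0 <= d -> e3 M d xa xb xm ->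
  e3 ((M ^+ 2 + 2 * M + 1) * (1 + 3 * M + 2 * M ^+ 2)) d (psq xa) (psq xb) (psq xm).
Proof.
move=> d0 h; have M0 := e3_ge0 h.
have m1 (a : R) : 0 <= Num.max 0 a by rewrite le_max lexx.
have m2 (a : R) : `|a| <= M -> Num.max 0 a <= M.
  by move=> ha; rewrite ge_max M0 (le_trans (ler_norm _)).
apply: (e3_c11 (dphi := fun t => 2 * Num.max 0 t)) h => //.
- by rewrite !addr_ge0// ?mulr_ge0// exprn_ge0.
- move=> a /m2 ha; rewrite ger0_norm ?sqr_ge0// -addrA /psq.
  apply: (@le_trans _ _ (M ^+ 2)); first by rewrite ler_pXn2r ?nnegrE ?m1.
  by rewrite lerDl addr_ge0// mulr_ge0.
- move=> a /m2 ha; rewrite ger0_norm ?mulr_ge0 ?m1//; have := sqr_ge0 M; lra.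
- move=> a b; apply: (@le_trans _ _ (1 * (b - a) ^+ 2)); last first.
    by rewrite ler_wpM2r ?sqr_ge0// lerDr addr_ge0 ?mulr_ge0 ?exprn_ge0.
  rewrite mul1r /psq; have sa := sqr_ge0 a; have sb := sqr_ge0 b; have sab := sqr_ge0 (b - a).
  case: (leP 0 a) => a0; case: (leP 0 b) => b0; rewrite ler_norml ?expr0n /=.
  - by apply/andP; split; nra.
  - have ab : a * b <= 0 by rewrite mulr_ge0_le0// ltW.
    by apply/andP; split; nra.
  - have ab : a * b <= 0 by rewrite mulr_le0_ge0// ltW.
    by apply/andP; split; nra.
  - by apply/andP; split; nra.
Qed.

(** Equal to 1 for |y| <= R0 and to 0 for |y| >= 2 R0, since 3 R0 ^ 2 is the increase of |y| ^ 2
    between the two radii. The squared norm is used because the norm itself is not smooth at 0. *)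
Definition chi (R0 : R) (y : l2 R N) : R := psq (1 - psq ((`|y| ^+ 2 - R0 ^+ 2) / (3 * R0 ^+ 2))).

Lemma chi1 R0 y : 0 < R0 -> `|y| <= R0 -> chi R0 y = 1.
Proof.
move=> R00 hy; rewrite /chi /psq [Num.max 0 (_ / _)]max_l; last first.
  rewrite pmulr_lle0 ?invr_gt0 ?mulr_gt0 ?exprn_gt0// subr_le0 ler_pXn2r ?nnegrE//.
  exact: ltW.
by rewrite expr0n /= subr0 max_r// expr1n.
Qed.

Lemma chi0 R0 y : 0 < R0 -> 2 * R0 <= `|y| -> chi R0 y = 0.
Proof.
move=> R00 hy; have h : 1 <= (`|y| ^+ 2 - R0 ^+ 2) / (3 * R0 ^+ 2).
  rewrite ler_pdivlMr ?mulr_gt0 ?exprn_gt0// mul1r lerBrDr.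
  apply: (@le_trans _ _ ((2 * R0) ^+ 2)); first by apply: eqle; ring.
  by rewrite ler_pXn2r ?nnegrE ?mulr_ge0 ?(ltW R00).
rewrite /chi /psq [Num.max 0 (1 - _)]max_l ?expr0n// subr_le0 max_r; last exact: le_trans h.
exact: exprn_ege1.
Qed.

Lemma chi_unif R0 (B : R) (T : Type) : 0 < R0 -> 0 <= B -> unif B (fun y (_ : T) => chi R0 y).
Proof.
move=> R00 B0; pose M1 := B ^+ 2 + B + 1.
have M10 : 0 <= M1 by rewrite !addr_ge0// exprn_ge0.
pose c : R := (3 * R0 ^+ 2)^-1.
pose M2 := 4 * ((M1 + R0 ^+ 2) * c).
have c0 : 0 <= c by rewrite invr_ge0 mulr_ge0// exprn_ge0// ltW.
have M20 : 0 <= M2 by rewrite !mulr_ge0// addr_ge0// exprn_ge0// ltW.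
pose g (M : R) := (M ^+ 2 + 2 * M + 1) * (1 + 3 * M + 2 * M ^+ 2).
have g0 M : 0 <= M -> 0 <= g M by move=> M0; rewrite mulr_ge0 ?addr_ge0 ?mulr_ge0 ?exprn_ge0.
exists (g (1 + g M2)) => [|a b _ ha hb]; first by rewrite g0// addr_ge0// g0.
have d0 : 0 <= `|a - b| by [].
apply: e3_psq => //; apply: e3_add; first by apply: e3_cst => //; rewrite normr1.
apply: e3_opp; apply: e3_psq => //; apply: e3_mul => //; last first.
  by apply: e3_cst => //; rewrite ger0_norm.
apply: e3_add; first exact: e3_sqnorm.
by apply: e3_cst => //; rewrite normrN ger0_norm// exprn_ge0// ltW.
Qed.

End SquaredNorm.

(** * Cutting off a field outside a ball *)

Section CutField.
Context {R : realType} {N : nat} {J : Type}.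
Variables (F0 : l2 R N -> J -> R) (R0 : R).
Hypotheses (R00 : 0 < R0) (hF : unif (2 * R0 + 2) F0).

Definition cut (y : l2 R N) (j : J) : R := chi R0 y * F0 y j.

Lemma cut_id y j : `|y| <= R0 -> cut y j = F0 y j.
Proof. by move=> h; rewrite /cut chi1// mul1r. Qed.

(** When |a - b| >= 1 the bound on the values is enough. Otherwise, either the midpoint is within 2
    R0 + 1, and all three points lie in the ball where [F0] is controlled, or all three lie beyond 2
    R0, where the cut field is 0. *)
Lemma cut_e3 : exists2 M : R, 0 <= M & forall a b j, e3 M `|a - b| (cut a j) (cut b j) (cut (mid a b) j).
Proof.
have B0 : 0 <= 2 * R0 + 2 by rewrite addr_ge0// mulr_ge0// ltW.
have [M M0 hM] := unif_mul (chi_unif J R00 B0) hF.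
have bd y j : `|cut y j| <= M.
  have [h|h] := leP `|y| (2 * R0 + 2).
    by have [[h1 _ _] _ _ _] := hM y y j h h.
  by rewrite /cut chi0 ?mul0r ?normr0//; apply: le_trans (ltW h); rewrite lerDl.
exists (4 * M) => [|a b j]; first by rewrite mulr_ge0.
have d0 : 0 <= `|a - b| by [].
have M4 : M <= 4 * M by lra.
have [h1|h1] := ltP `|a - b| 1; last first.
  have d2 : 1 <= `|a - b| ^+ 2 by exact: exprn_ege1.
  have p1 : M <= M * `|a - b| by rewrite ler_peMr.
  have p2 : M <= M * `|a - b| ^+ 2 by rewrite ler_peMr.
  have := bd a j; have := bd b j; have := bd (mid a b) j.
  rewrite !ler_norml => /andP[? ?] /andP[? ?] /andP[? ?].
  by split; [split; rewrite ler_norml; apply/andP; split; lra|..]; rewrite ler_norml -mulrA; apply/andP; split; lra.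
have h12 : 2 * R0 + 1 + 2^-1 <= 2 * R0 + 2 by lra.
have h12' : 2 * R0 + 2^-1 <= 2 * R0 + 1 by lra.
have half (u w : l2 R N) : u - 2^-1 *: (u + w) = 2^-1 *: (u - w) by lmod R.
have am : `|a - mid a b| <= 2^-1 by rewrite half normrZ ger0_norm ?invr_ge0// ler_piMr ?invr_ge0// ltW.
have bm : `|b - mid a b| <= 2^-1.
  by rewrite /mid (addrC a b) half normrZ ger0_norm ?invr_ge0// distrC ler_piMr ?invr_ge0// ltW.
have tri (u w : l2 R N) : `|u| <= `|w| + `|u - w|.
  by rewrite -{1}[u](subrK w) addrC ler_normD.
have [hm|hm] := leP `|mid a b| (2 * R0 + 1).
  apply: e3_mono M4 _ => //; apply: hM.
    by apply: le_trans (tri a (mid a b)) _; exact: le_trans (lerD hm am) h12.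
  by apply: le_trans (tri b (mid a b)) _; exact: le_trans (lerD hm bm) h12.
have z u : `|u - mid a b| <= 2^-1 -> cut u j = 0.
  move=> hu; rewrite /cut chi0 ?mul0r// -(lerD2r 2^-1); apply: (le_trans h12'); apply: (le_trans (ltW hm)).
  by apply: le_trans (tri (mid a b) u) _; rewrite lerD2l distrC.
have zm : cut (mid a b) j = 0 by apply: (z); rewrite subrr normr0 invr_ge0.
rewrite (z a am) (z b bm) zm.
by apply: e3_cst => //; rewrite normr0 mulr_ge0.
Qed.

(** An exponent r between 1 and 2 is admissible because d ^ 2 <= d ^ r for d <= 1, while for d >= 1
    the bound on the values suffices. *)
Lemma cut_props : exists2 C : R, 0 <= C &
  [/\ forall y j, `|cut y j| <= C, forall y v j, `|cut y j - cut v j| <= C * `|y - v| &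
  forall (r : R) y v j, 1 <= r <= 2 ->
    `|cut y j + cut v j - 2 * cut (2^-1 *: (y + v)) j| <= C * `|y - v| `^ r].
Proof.
have [M M0 hM] := cut_e3; exists (4 * M) => [|]; first by rewrite mulr_ge0.
split=> [y j|y v j|r y v j /andP[r1 r2]].
- by have [[h _ _] _ _ _] := hM y y j; lra.
- have [_ h1 h2 _] := hM y v j.
  have -> : cut y j - cut v j = (cut y j - cut (mid y v) j) - (cut v j - cut (mid y v) j) by ring.
  apply: le_trans (ler_normB _ _) _; have := mulr_ge0 M0 (normr_ge0 (y - v)); lra.
have [[h1 h2 h3] _ _ h4] := hM y v j.
have -> : cut y j + cut v j - 2 * cut (2^-1 *: (y + v)) j =
  cut y j - cut (mid y v) j + (cut v j - cut (mid y v) j) by rewrite /mid; ring.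
have d0 : 0 <= `|y - v| by [].
have [d1|d1] := leP `|y - v| 1.
  apply: le_trans h4 _; apply: ler_pM; [exact: M0|exact: exprn_ge0|lra|].
  have [->|dn] := eqVneq `|y - v| 0; first by rewrite expr0n powR_ge0.
  by rewrite -powR_mulrn// ger_powR// lt0r dn d0 d1.
have : 1 <= `|y - v| `^ r.
  rewrite -(powRr0 `|y - v|); apply: ler_powR; [exact: ltW|exact: le_trans ler01 r1].
move=> p1; apply: (@le_trans _ _ (4 * M)); last by rewrite ler_peMr// mulr_ge0.
move: h1 h2 h3; rewrite !ler_norml => /andP[? ?] /andP[? ?] /andP[? ?].
by apply/andP; split; lra.
Qed.

End CutField.

(** * Families linear in the state *)

Section LinearFamilies.
Context {R : realType} {L : {posnum R}} {V : normedModType R} {T : Type}.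
Local Notation I := `[0, L%:num]%classic.
Local Notation nrmI := (nrm (L := L)).
Implicit Types (a b u w : V) (B C x : R).

Lemma half_sub u w : u - 2^-1 *: (u + w) = 2^-1 *: (u - w).
Proof. by lmod R. Qed.

Lemma dist_midl a b : `|a - mid a b| = 2^-1 * `|a - b|.
Proof. by rewrite half_sub normrZ ger0_norm ?invr_ge0. Qed.

Lemma dist_midr a b : `|b - mid a b| = 2^-1 * `|a - b|.
Proof. by rewrite /mid (addrC a b) half_sub normrZ ger0_norm ?invr_ge0// distrC. Qed.

Lemma half_bound B C (d : R) : 0 <= B -> 0 <= C -> 0 <= d -> C * (2^-1 * d) <= C * (B + 1) * d.
Proof. by move=> B0 C0 d0; rewrite -mulrA ler_wpM2l// ler_wpM2r//; lra. Qed.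

Lemma linear_unifS (G : V -> R -> R) B C : 0 <= B -> 0 <= C -> (forall v, cts (L := L) (G v)) ->
  (forall v x, I x -> `|G v x| <= C * `|v|) ->
  (forall a b x, I x -> `|G a x - G b x| <= C * `|a - b|) ->
  (forall a b x, I x -> G (mid a b) x = 2^-1 * (G a x + G b x)) ->
  unifS (L := L) B (fun v (_ : T) x => G v x).
Proof.
move=> B0 C0 cG bG lG mG; split; first by move=> v _; exact: cG.
exists (C * (B + 1)) => [|a b _ x ha hb Ix]; first by rewrite mulr_ge0 ?addr_ge0.
have hm := mid_ball ha hb; have d0 : 0 <= `|a - b| := normr_ge0 _.
have bd v : `|v| <= B -> `|G v x| <= C * (B + 1).
  by move=> hv; apply: le_trans (bG _ _ Ix) _; rewrite ler_wpM2l// (le_trans hv)// lerDl.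
split; first by split; apply: bd.
- by apply: le_trans (lG _ _ _ Ix) _; rewrite dist_midl half_bound.
- by apply: le_trans (lG _ _ _ Ix) _; rewrite dist_midr half_bound.
- rewrite (mG a b x Ix) (_ : _ + _ = 0); last by field.
  by rewrite normr0 !mulr_ge0 ?addr_ge0 ?exprn_ge0.
Qed.

Lemma linear_unifL (G : V -> R -> R) B C : 0 <= B -> 0 <= C -> (forall v, L2fun L (G v)) ->
  (forall v, nrmI (G v) <= C * `|v|) ->
  (forall a b, nrmI (fun x => G a x - G b x) <= C * `|a - b|) ->
  (forall a b, nrmI (fun x => (G a x - G (mid a b) x) + (G b x - G (mid a b) x)) = 0) ->
  unifL (L := L) B (fun v (_ : T) x => G v x).
Proof.
move=> B0 C0 cG bG lG mG; split; first by move=> v _; exact: cG.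
exists (C * (B + 1)) => [|a b _ ha hb]; first by rewrite mulr_ge0 ?addr_ge0.
have hm := mid_ball ha hb; have d0 : 0 <= `|a - b| := normr_ge0 _.
have bd v : `|v| <= B -> nrmI (G v) <= C * (B + 1).
  by move=> hv; apply: le_trans (bG _) _; rewrite ler_wpM2l// (le_trans hv)// lerDl.
split; first by split; apply: bd.
- by apply: le_trans (lG _ _) _; rewrite dist_midl half_bound.
- by apply: le_trans (lG _ _) _; rewrite dist_midr half_bound.
- by rewrite mG !mulr_ge0 ?addr_ge0 ?exprn_ge0.
Qed.

End LinearFamilies.

(** * From coefficients back to functions *)

Section PhaseSpace.
Context {R : realType} {L : {posnum R}} {m : nat}.
Local Notation I := `[0, L%:num]%classic.
Local Notation ipI := (ip (L := L)).
Local Notation nrmI := (nrm (L := L)).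
Local Notation sn := (sn (L := L)).
Local Notation cn := (cn (L := L)).
Local Notation tb := (tb (L := L)).
Local Notation l2mm := (l2 R (m + m)).
Implicit Types (y a b : l2mm) (c : nat -> R) (i : 'I_m) (k n : nat) (x M : R).

(** A representative with prescribed sine coefficients; by completeness of the sines they determine
    its class. The default is met only when no such function exists. *)
Definition synth c : R -> R := xget (cst 0) [set g | L2fun L g /\
  forall k, (0 < k)%N -> ipI g (sn k) = c k].

Lemma synthP c M : 0 <= M -> sqbounded c M ->
  L2fun L (synth c) /\ forall k, (0 < k)%N -> ipI (synth c) (sn k) = c k.
Proof.
move=> M0 h; have [g hg [_ gk]] := riesz_fischer (L := L) M0 h.
by rewrite /synth; case: xgetP => [p _ //|/(_ g) []].
Qed.

Lemma ip_sn0 g : ipI g (sn 0) = 0.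
Proof. by rewrite /ip (int_eq (g := cst 0)) ?Rintegral_cst ?mul0r// => x _; rewrite sn0 mulr0. Qed.

Lemma parseval_coef g c M : 0 <= M -> L2fun L g -> (forall k, (0 < k)%N -> ipI g (sn k) = c k) ->
  sqbounded c M -> nrmI g <= M.
Proof.
move=> M0 hg e hM; apply: parseval_le => // n; apply: le_trans (hM n).
apply: ler_sum => k _; case: (posnP k) => [->|k0]; last by rewrite e.
by rewrite ip_sn0 expr0n sqr_ge0.
Qed.

Definition aco y i k : R := y k (lshift m i) 0.
Definition wco y i k : R := y k (rshift m i) 0.

Lemma sqbounded_entry y (j : 'I_(m + m)) : sqbounded (fun k => y k j 0) `|y|.
Proof.
move=> n; apply: le_trans (sqs_le n y); apply: ler_sum => k _.
by rewrite (bigD1 j)//= lerDl sumr_ge0// => ? _; exact: sqr_ge0.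
Qed.

(** Set to 0 outside [0, L], as elements of [H1] are, so that [rhat_E] is a plain equality of
    functions. *)
Definition rhat y x : 'cV[R]_m := if x \in I then \col_i csum (L := L) (aco y i) x else 0.
Definition What y x : 'cV[R]_m := \col_i synth (wco y i) x.

Lemma rhatE y i x : I x -> rhat y x i 0 = csum (L := L) (aco y i) x.
Proof. by move=> Ix; rewrite /rhat mem_set// mxE. Qed.

Lemma rhat_lin (s : R) a b x i : rhat (s *: a + b) x i 0 = s * rhat a x i 0 + rhat b x i 0.
Proof.
have [Ix|nIx] := boolP (x \in I); last by rewrite /rhat (negPf nIx) !mxE mulr0 addr0.
have Ix' := set_mem Ix; rewrite !(rhatE _ _ Ix') -(csum_lin s x (normr_ge0 a) (normr_ge0 b) (sqbounded_entry a _) (sqbounded_entry b _)).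
by congr (csum _ x); apply/funext => k; rewrite /aco l2E.
Qed.

Lemma rhat_bound y x i : `|rhat y x i 0| <= tb * (2 * `|y|).
Proof.
have [Ix|nIx] := boolP (x \in I); last by rewrite /rhat (negPf nIx) mxE normr0 !mulr_ge0// tb_ge0.
by rewrite (rhatE _ _ (set_mem Ix)); exact: csum_bound (normr_ge0 y) (sqbounded_entry y _).
Qed.

Lemma cts_rhat y i : cts (L := L) (fun x => rhat y x i 0).
Proof. by apply: (cts_eq _ (cts_csum (normr_ge0 y) (sqbounded_entry y (lshift m i)))) => x Ix; rewrite rhatE. Qed.

Lemma ip_rhat y i k : ipI (fun x => rhat y x i 0) (cn k) = aco y i k / ow k.
Proof.
by rewrite -(ip_csum (L := L) k (normr_ge0 y) (sqbounded_entry y (lshift m i))); apply: ip_eq => x Ix; rewrite rhatE.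
Qed.

Lemma rhatB a b x i : rhat (a - b) x i 0 = rhat a x i 0 - rhat b x i 0.
Proof.
have -> : a - b = -1 *: b + a by lmod R.
by rewrite rhat_lin mulN1r addrC.
Qed.

Lemma unifS_rhat (T : Type) (B : R) i : 0 <= B -> unifS (L := L) B (fun y (_ : T) x => rhat y x i 0).
Proof.
move=> B0; apply: (linear_unifS (C := tb * 2)) => // [|y|y x _|a b x _|a b x _].
- by rewrite mulr_ge0// tb_ge0.
- exact: cts_rhat.
- by rewrite -mulrA; exact: rhat_bound.
- by rewrite -rhatB -mulrA; exact: rhat_bound.
have r0 : rhat 0 x i 0 = 0 by apply/eqP; rewrite -normr_le0; apply: le_trans (rhat_bound _ _ _) _; rewrite normr0 !mulr0.
have h := rhat_lin 1 a b x i; have := rhat_lin 2^-1 (a + b) 0 x i.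
by rewrite addr0 r0 addr0 /mid => ->; rewrite -{1}[a]scale1r h mul1r.
Qed.

Lemma WhatP y i : L2fun L (fun x => What y x i 0) /\
  forall k, (0 < k)%N -> ipI (fun x => What y x i 0) (sn k) = wco y i k.
Proof.
have -> : (fun x => What y x i 0) = synth (wco y i) by apply/funext => x; rewrite mxE.
exact: synthP (normr_ge0 y) (sqbounded_entry y _).
Qed.

Lemma nrm_What y i : nrmI (fun x => What y x i 0) <= `|y|.
Proof. by have [h1 h2] := WhatP y i; apply: (parseval_coef _ h1 h2) => //; exact: sqbounded_entry. Qed.

Lemma nrm_WhatB a b i : nrmI (fun x => What a x i 0 - What b x i 0) <= `|a - b|.
Proof.
have [h1 h2] := WhatP a i; have [g1 g2] := WhatP b i.
apply: (@parseval_coef _ (wco (a - b) i)) => //; [exact: L2_sub| |exact: sqbounded_entry].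
by move=> k k0; rewrite ip_subl// h2// g2// /wco l2BE.
Qed.

Lemma unifL_What (T : Type) (B : R) i : 0 <= B -> unifL (L := L) B (fun y (_ : T) x => What y x i 0).
Proof.
move=> B0; have l2 y : L2fun L (fun x => What y x i 0) by have [] := WhatP y i.
apply: (linear_unifL (C := 1)) => // [y|a b|a b]; rewrite ?mul1r; [exact: nrm_What|exact: nrm_WhatB|].
have e y k : (0 < k)%N -> ipI (fun x => What y x i 0) (sn k) = wco y i k by have [_] := WhatP y i; apply.
apply: sine_complete => [|k]; first by apply: L2_add; exact: L2_sub.
case: (posnP k) => [->|k0]; first exact: ip_sn0.
rewrite ip_addl//; [|exact: L2_sub|exact: L2_sub].
by rewrite !ip_subl// !e// /wco midE; field.
Qed.

Variables (Df : 'I_m -> 'I_m -> jet R m) (Dg : 'I_m -> jet R m).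
Hypotheses (tDf : forall i j, tame (Df i j)) (tDg : forall i, tame (Dg i)).

(** The nonlinear part divided by ow_k: the weighted coefficients of u are driven by - ow_k
    [fieldA], those of W by [fieldW]. After this division the family is bounded uniformly in k and
    can be cut off; the factor ow_k is restored afterwards. *)
Definition gfield y (p : nat * 'I_(m + m)) : R := match fintype.split p.2 with
  | inl i => - fieldA (L := L) Df Dg (rhat y) (What y) i p.1
  | inr i => (ow p.1)^-1 * fieldW (L := L) Df Dg (rhat y) (What y) i p.1 end.

Lemma gfield_unif B : 0 <= B -> unif B gfield.
Proof.
move=> B0.
have [M M0 hM] : exists2 M : R, 0 <= M & forall (i : 'I_(m + m)) a b k, `|a| <= B -> `|b| <= B ->
    e3 M `|a - b| (gfield a (k, i)) (gfield b (k, i)) (gfield (mid a b) (k, i)).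
  apply: finite_bound => [i K1 K2 K12 h a b k ha hb|i]; first exact: e3_mono (h a b k ha hb).
  rewrite /gfield /=; case: (fintype.split i) => i'.
    have := unif_opp (fieldA_unif tDf tDg (fun i => unifS_rhat nat i B0) (fun i => unifL_What nat i B0) i').
    by case=> M M0 h; exists M.
  have ow1 k : `|(ow k)^-1 : R| <= 1.
    have o0 := @ow_gt0 R k; rewrite gtr0_norm ?invr_gt0// invf_le1// -(ler_pXn2r (ltn0Sn 1)) ?nnegrE ?(ltW o0)//.
    have s1 : 1 <= Num.sqrt k.+1%:R :> R by rewrite -[leLHS]sqrtr1 ler_wsqrtr// ler1n.
    by rewrite expr1n sqr_ow -[leLHS]mulr1; apply: ler_pM => //; rewrite ler1n.
  have := unif_mul (unif_cst (V := l2mm) B ow1) (fieldW_unif tDf tDg (fun i => unifS_rhat nat i B0) (fun i => unifL_What nat i B0) i').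
  by case=> M M0 h; exists M.
by exists M => // a b [k i]; exact: hM.
Qed.

End PhaseSpace.

(** * Elements of H^1 and the supremum norm *)

Section SobolevFacts.
Context {R : realType} {L : {posnum R}} {m : nat}.
Local Notation I := `[0, L%:num]%classic.
Local Notation hd := (has_L2deriv L).
Local Notation ipI := (ip (L := L)).
Local Notation nrmI := (nrm (L := L)).
Implicit Types (u v : H1 L m) (f g h : R -> R) (i : 'I_m) (x y : R).

Lemma nrm_sub_swap f g : nrmI (fun x => f x - g x) = nrmI (fun x => g x - f x).
Proof. by rewrite /nrm; congr (Num.sqrt _); apply: ip_eq => x _; ring. Qed.

Lemma ae_nrm0 f g : L2fun L f -> L2fun L g -> f = g %[ae mu in I] -> nrmI (fun x => f x - g x) = 0.
Proof.
move=> hf hg ae; rewrite /nrm /ip.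
have -> : \int[mu]_(x in I) ((f x - g x) * (f x - g x)) = \int[mu]_(x in I) (0 : R).
  congr fine; apply: ae_eq_integral => //.
  - by have /integrableP[] := L2fun_intM (L2_sub hf hg) (L2_sub hf hg).
  by apply: filterS ae => x hx Ix; rewrite hx// subrr mul0r.
by rewrite Rintegral_cst ?mul0r ?sqrtr0//; exact: mI.
Qed.

Lemma hd_nrm_unique f g h : hd f g -> hd f h -> nrmI (fun x => g x - h x) = 0.
Proof. by move=> hg hh; have [Lg _] := hg; have [Lh _] := hh; exact: ae_nrm0 (has_L2deriv_unique hg hh). Qed.

Lemma nrm_H1 u i : nrmI (fun x => u x i 0) <= `|u| /\ nrmI (fun x => dx u x i 0) <= `|u|.
Proof.
have h1 : ipL2 L u u + ipL2 L (dx u) (dx u) = `|u| ^+ 2.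
  by rewrite sqr_sqrtr// addr_ge0 ?ipL2_ge0.
have le1 (w : R -> 'cV[R]_m) : ipI (fun x => w x i 0) (fun x => w x i 0) <= ipL2 L w w.
  rewrite /ipL2 (bigD1 i)//= lerDl; apply: sumr_ge0 => j _.
  by apply: Rintegral_ge0 => x _; rewrite -expr2 sqr_ge0.
have g1 := ipL2_ge0 L u; have g2 := ipL2_ge0 L (dx u).
by split; (apply: nrm_le => //; rewrite -h1; apply: le_trans (le1 _) _; rewrite ?lerDl ?lerDr).
Qed.

Lemma H1_le u (K : R) : 0 <= K -> (forall i, nrmI (fun x => u x i 0) <= K) ->
  (forall i, nrmI (fun x => dx u x i 0) <= K) -> `|u| <= 2 * m%:R * K.
Proof.
move=> K0 h1 h2; rewrite -(ler_pXn2r (ltn0Sn 1)) ?nnegrE ?mulr_ge0//.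
have -> : `|u| ^+ 2 = ipL2 L u u + ipL2 L (dx u) (dx u).
  by rewrite sqr_sqrtr// addr_ge0 ?ipL2_ge0.
have le1 (w : R -> 'cV[R]_m) : (forall i, nrmI (fun x => w x i 0) <= K) -> ipL2 L w w <= m%:R * K ^+ 2.
  move=> hw; rewrite mulr_natl -[X in _ *+ X]card_ord -sumr_const.
  apply: ler_sum => i _; rewrite -[leLHS]/(ipI (fun x => w x i 0) (fun x => w x i 0)) -sqr_nrm.
  by rewrite ler_pXn2r ?nnegrE ?nrm_ge0.
apply: le_trans (lerD (le1 _ h1) (le1 _ h2)) _.
have -> : (2 * m%:R * K) ^+ 2 = (4 * m%:R ^+ 2 * K ^+ 2) by ring.
rewrite -mulrDl ler_wpM2r ?exprn_ge0//.
rewrite -natrX -natrD -natrM ler_nat; case: (m) => [//|n].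
by rewrite addnn -mul2n expnS expn1; apply: leq_mul => //; exact: leq_pmulr.
Qed.

Lemma weak_dx u i : hd (fun x => u x i 0) (fun x => dx u x i 0).
Proof. exact: dxP. Qed.

Lemma cts_H1 u i : cts (L := L) (fun x => u x i 0).
Proof. exact: hd_cts (weak_dx u i). Qed.

Lemma H1_out u x : ~ I x -> u x = 0.
Proof. by have := H1valP u; rewrite inE => -[_]; apply. Qed.

Lemma H1_exists (p q : R -> 'cV[R]_m) : weak_deriv L p q -> exists u : H1 L m,
  (forall x, I x -> u x = p x) /\ forall i, nrmI (fun x => dx u x i 0 - q x i 0) = 0.
Proof.
move=> hpq; pose p' x := if x \in I then p x else 0.
have hp' : weak_deriv L p' q.
  by move=> i; apply: hd_eq (hpq i) => // x Ix; rewrite /p' mem_set.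
have pin : p' \in @H1set R L m.
  rewrite inE; split; first by exists q.
  by move=> x nI; rewrite /p'; case: ifPn => // /set_mem.
exists (MkH1 pin); split => [x Ix|i]; first by rewrite /= /p' mem_set.
exact: hd_nrm_unique (weak_dx (MkH1 pin) i) (hp' i).
Qed.

Definition cS : R := (Num.sqrt L%:num)^-1 + Num.sqrt L%:num.

Lemma cS_ge0 : 0 <= cS. Proof. by rewrite addr_ge0 ?invr_ge0 ?sqrtr_ge0. Qed.

Lemma hd_dist f g x y : hd f g -> I x -> I y -> `|f x - f y| <= Num.sqrt L%:num * nrmI g.
Proof.
move=> h; have hg : L2fun L g by case: h.
wlog xy : x y / x <= y.
  by move=> H Ix Iy; have [xy|/ltW yx] := leP x y; [exact: H|rewrite distrC; exact: H].
by move=> Ix Iy; rewrite distrC (hd_diff h Ix Iy xy); exact: int_sub_le.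
Qed.

(** |f x| is at most |f y| plus the oscillation bound of [hd_dist]; integrating over y gives the
    constant [cS]. *)
Lemma hd_sup f g x (K : R) : hd f g -> nrmI f <= K -> nrmI g <= K -> I x -> `|f x| <= cS * K.
Proof.
move=> h fK gK Ix; have hf := hd_cts h; have Lf := L2_cts hf.
have mI' := mI (L := L).
have s0 : 0 < Num.sqrt L%:num :> R by rewrite sqrtr_gt0.
have LL : L%:num = Num.sqrt L%:num * Num.sqrt L%:num :> R by rewrite -expr2 sqr_sqrtr.
pose D := Num.sqrt L%:num * nrmI g.
have e1 : \int[mu]_(y in I) `|f x| = L%:num * `|f x| by rewrite Rintegral_cst// muI mulrC.
have e2 : \int[mu]_(y in I) D = L%:num * D by rewrite Rintegral_cst// muI mulrC.
have ic c : intg I (fun=> c) := cts_intg (cts_cst (L := L) c).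
have ia := intg_abs mI' (cts_intg hf).
have : L%:num * `|f x| <= Num.sqrt L%:num * nrmI f + L%:num * D.
  rewrite -e1 -e2; apply: (@le_trans _ _ (\int[mu]_(y in I) (`|f y| + D))).
    apply: (int_le mI' (ic _)); first exact: intgD.
    move=> y Iy; have := hd_dist h Ix Iy; rewrite -/D => hxy.
    by have := ler_normD (f y) (f x - f y); rewrite addrCA subrr addr0 => /le_trans; apply; rewrite lerD2l.
  rewrite int_add// lerD2r; apply: le_trans (ler_norm _) _.
  apply: le_trans (int_le_nrm (L2_abs Lf)) _; rewrite ler_wpM2l ?(ltW s0)//.
  by rewrite /nrm ler_wsqrtr// /ip; apply: eqle; apply: int_eq => y _; rewrite -normrM ger0_norm// -expr2 sqr_ge0.
rewrite /D => h0.
have h1 : Num.sqrt L%:num * `|f x| <= nrmI f + Num.sqrt L%:num * (Num.sqrt L%:num * nrmI g).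
  rewrite -(ler_pM2l s0) mulrDr !mulrA -LL; move: h0; rewrite mulrA; by [].
rewrite /cS mulrDl -(ler_pM2l s0) mulrDr mulrA mulfV ?gt_eqF// mul1r.
apply: le_trans h1 _; apply: lerD => //; rewrite ler_wpM2l ?(ltW s0)// ler_wpM2l ?(ltW s0)//.
Qed.

Lemma H1_sup u i x : `|u x i 0| <= cS * `|u|.
Proof.
have [Ix|nI] := pselect (I x); last by rewrite H1_out// mxE normr0 mulr_ge0 ?cS_ge0.
by have [h1 h2] := nrm_H1 u i; exact: hd_sup (weak_dx u i) h1 h2 Ix.
Qed.

Lemma H1B u v x i : (u - v) x i 0 = u x i 0 - v x i 0.
Proof. by rewrite /= !mxE. Qed.

Lemma nrm_dxB u v i : nrmI (fun x => (dx u x i 0 - dx v x i 0) - dx (u - v) x i 0) = 0.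
Proof.
apply: hd_nrm_unique (weak_dx (u - v) i).
by apply: hd_eq (hd_sub (weak_dx u i) (weak_dx v i)) => // x _; rewrite H1B.
Qed.

Lemma L2_dx u i : L2fun L (fun x => dx u x i 0).
Proof. by case: (weak_dx u i). Qed.

Lemma nrm0_le f g : L2fun L f -> L2fun L g -> nrmI (fun x => f x - g x) = 0 -> nrmI f <= nrmI g.
Proof.
move=> hf hg e; rewrite (nrm_eq (g := fun x => (f x - g x) + g x)); last by move=> x _; rewrite subrK.
by apply: le_trans (nrmD (L2_sub hf hg) hg) _; rewrite e add0r.
Qed.

Lemma nrm_dxB_le u v i : nrmI (fun x => dx u x i 0 - dx v x i 0) <= `|u - v|.
Proof.
have [_ h] := nrm_H1 (u - v) i; apply: le_trans h.
apply: nrm0_le (nrm_dxB u v i); [by apply: L2_sub; exact: L2_dx|exact: L2_dx].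
Qed.

Lemma H1mid u v x i : (mid u v : H1 L m) x i 0 = 2^-1 * (u x i 0 + v x i 0).
Proof. by rewrite /= !mxE. Qed.

Lemma unifS_H1 (T : Type) (B : R) i : 0 <= B -> unifS (L := L) B (fun u (_ : T) x => (u : H1 L m) x i 0).
Proof.
move=> B0; apply: (linear_unifS (V := H1 L m) (G := fun u x => u x i 0) B0 cS_ge0) => [u|u x _|a b x _|a b x _].
- exact: cts_H1.
- exact: H1_sup.
- by rewrite -H1B; exact: H1_sup.
- exact: H1mid.
Qed.

Lemma unifL_dx (T : Type) (B : R) i : 0 <= B -> unifL (L := L) B (fun u (_ : T) x => dx (u : H1 L m) x i 0).
Proof.
move=> B0; apply: (linear_unifL (V := H1 L m) (G := fun u x => dx u x i 0) B0 ler01) => [u|u|a b|a b].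
- exact: L2_dx.
- by rewrite mul1r; have [] := nrm_H1 u i.
- by rewrite mul1r; exact: nrm_dxB_le.
rewrite (nrm_eq (g := fun x => (dx a x i 0 + dx b x i 0) - 2 * dx (mid a b) x i 0)); last by move=> x _; ring.
apply: (@hd_nrm_unique (fun x => a x i 0 + b x i 0)).
  exact: hd_add (weak_dx a i) (weak_dx b i).
by apply: hd_eq (hd_scale 2 (weak_dx (mid a b) i)) => // x _; rewrite H1mid; field.
Qed.

End SobolevFacts.

(** * The embedding into the phase space *)

Section Embedding.
Context {R : realType} {L : {posnum R}} {m : nat}.
Local Notation I := `[0, L%:num]%classic.
Local Notation hd := (has_L2deriv L).
Local Notation ipI := (ip (L := L)).
Local Notation nrmI := (nrm (L := L)).
Local Notation sn := (sn (L := L)).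
Local Notation cn := (cn (L := L)).
Local Notation om := (om (L := L)).
Local Notation l2mm := (l2 R (m + m)).
Variable (Df : 'I_m -> 'I_m -> jet R m).
Hypothesis (tDf : forall i j, tame (Df i j)).
Local Notation gbe := (gbe (L := L) Df).
Local Notation gal := (gal (L := L) Df).
Local Notation fmat := (fmat Df).
Implicit Types (u v : H1 L m) (i : 'I_m) (k n : nat) (x : R).

(** Integration by parts with no condition on f, the boundary terms vanishing with sn_k. *)
Lemma om_cn f g k : hd f g -> om k * ipI f (cn k) = - ipI g (sn k).
Proof.
move=> h; have Lf := L2_cts (hd_cts h); have Lg : L2fun L g by case: h.
have := ibp h (hd_sn k); rewrite snL sn00 !mulr0 subrr sub0r => <-.
by rewrite ipC [RHS]ipC ip_scalel.
Qed.

(** Per component, 1 for the mean of u, [3 * (L%:num / pi) ^+ 2] for its other weighted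
    coefficients, by [ow_le_om], and 1 for W. *)
Definition cE : R := Num.sqrt (m%:R * (2 + 3 * (L%:num / pi) ^+ 2)).

(** (k + 1) ^ (3/2) <= 3 k ^ 2, from k + 1 <= 2 k and sqrt (k + 1) <= 3 k / 2. Thus the weighted
    coefficients of u are square-summable as soon as u_x is in L2. *)
Lemma ow_le_om k : (0 < k)%N -> ow k ^+ 2 <= 3 * (L%:num / pi) ^+ 2 * om k ^+ 2.
Proof.
move=> k0; have p0 : pi != 0 :> R by rewrite gt_eqF// pi_gt0.
have -> : 3 * (L%:num / pi) ^+ 2 * om k ^+ 2 = 3 * k%:R ^+ 2.
  have e : L%:num / pi * om k = k%:R by rewrite mulrC /om mulrA divfK ?gt_eqF// mulfK.
  by rewrite -mulrA -exprMn e.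
rewrite sqr_ow; have s0 := sqrtr_ge0 (k.+1%:R : R).
have s2 : Num.sqrt k.+1%:R ^+ 2 = k%:R + 1 :> R by rewrite sqr_sqrtr// natr1.
have k1 : 1 <= k%:R :> R by rewrite ler1n.
have sk : Num.sqrt k.+1%:R <= 3 / 2 * k%:R :> R.
  rewrite -(ler_pXn2r (ltn0Sn 1)) ?nnegrE ?mulr_ge0// s2; nra.
apply: (@le_trans _ _ (2 * k%:R * (3 / 2 * k%:R))); last by apply: eqle; field.
by apply: ler_pM => //; rewrite -natr1; lra.
Qed.

Lemma emb_exists (p q w : R -> 'cV[R]_m) (K : R) : 0 <= K -> weak_deriv L p q -> L2vec L w ->
  (forall i, nrmI (fun x => p x i 0) <= K) -> (forall i, nrmI (fun x => q x i 0) <= K) ->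
  (forall i, nrmI (fun x => w x i 0) <= K) ->
  exists2 y : l2mm, `|y| <= cE * K & forall i k, aco y i k = ow k * ipI (fun x => p x i 0) (cn k) /\
    wco y i k = ipI (fun x => w x i 0) (sn k).
Proof.
move=> K0 hpq hw pK qK wK.
pose Y k : 'cV[R]_(m + m) := \col_j match fintype.split j with
  | inl i => ow k * ipI (fun x => p x i 0) (cn k) | inr i => ipI (fun x => w x i 0) (sn k) end.
have c0 : 0 <= m%:R * (2 + 3 * (L%:num / pi) ^+ 2) :> R by rewrite mulr_ge0// addr_ge0// mulr_ge0// sqr_ge0.
have Lp i : L2fun L (fun x => p x i 0) := L2_cts (hd_cts (hpq i)).
have Lq i : L2fun L (fun x => q x i 0) by case: (hpq i).
have sK (f : R -> R) : nrmI f <= K -> nrmI f ^+ 2 <= K ^+ 2 by move=> h; rewrite ler_pXn2r ?nnegrE ?nrm_ge0.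
have sY n : sqs n Y <= (cE * K) ^+ 2.
  rewrite /sqs exprMn /cE sqr_sqrtr//.
  have -> : m%:R * (2 + 3 * (L%:num / pi) ^+ 2) * K ^+ 2 =
     \sum_(i < m) ((K ^+ 2 + 3 * (L%:num / pi) ^+ 2 * K ^+ 2) + K ^+ 2).
    by rewrite sumr_const card_ord -[RHS]mulr_natl; ring.
  under eq_bigr => k _ do rewrite big_split_ord /=.
  rewrite big_split /= exchange_big /= [X in _ + X]exchange_big /= -big_split /=.
  apply: ler_sum => i _; apply: lerD; last first.
    apply: le_trans (sK _ (wK i)); apply: le_trans (bessel n (hw i)); apply: ler_sum => k _.
    by rewrite mxE; case: splitP => j' /= e; [have := ltn_ord j'; rewrite -e ltnNge leq_addr|move/addnI: e => /val_inj ->].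
  have YE (k : 'I_n) : Y k (lshift m i) 0 = ow k * ipI (fun x => p x i 0) (cn k).
    by rewrite mxE; case: splitP => j' /= e; [move/val_inj: e => ->|have := ltn_ord i; rewrite e ltnNge leq_addr].
  under eq_bigr => k _ do rewrite YE.
  case: n YE => [|n] YE; first by rewrite big_ord0 addr_ge0 ?sqr_ge0// mulr_ge0 ?sqr_ge0// mulr_ge0// sqr_ge0.
  rewrite big_ord_recl; apply: lerD.
    rewrite /ow sqrtr1 mulr1 sqrtr1 mul1r; apply: le_trans (sK _ (pK i)).
    have hb := le_ip (Lp i) (L2_cn 0).
    have n1 : nrmI (cn 0) = 1 by rewrite /nrm orthonormal_cn sqrtr1.
    by rewrite n1 mulr1 in hb; rewrite -[leLHS]real_normK ?num_real// ler_pXn2r ?nnegrE ?nrm_ge0.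
  apply: (@le_trans _ _ (3 * (L%:num / pi) ^+ 2 * nrmI (fun x => q x i 0) ^+ 2)); last first.
    by rewrite ler_wpM2l ?sK// mulr_ge0// sqr_ge0.
  apply: le_trans (ler_wpM2l _ (bessel n.+1 (Lq i))); last by rewrite mulr_ge0// sqr_ge0.
  apply: (@le_trans _ _ (3 * (L%:num / pi) ^+ 2 * \sum_(k < n) ipI (fun x => q x i 0) (sn (lift ord0 k)) ^+ 2)); last first.
    apply: ler_wpM2l; first by rewrite mulr_ge0 ?sqr_ge0.
    by rewrite [leRHS]big_ord_recl lerDr sqr_ge0.
  rewrite mulr_sumr.
  apply: ler_sum => k _; rewrite exprMn.
  have -> : ipI (fun x => q x i 0) (sn (lift ord0 k)) ^+ 2 = om (lift ord0 k) ^+ 2 * ipI (fun x => p x i 0) (cn (lift ord0 k)) ^+ 2.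
    by rewrite -exprMn (om_cn _ (hpq i)) sqrrN.
  by rewrite [leRHS]mulrA ler_wpM2r ?sqr_ge0// ow_le_om.
have cEK : 0 <= cE * K by rewrite mulr_ge0// sqrtr_ge0.
have [y hy ny] := l2_exist cEK sY; exists y => // i k.
rewrite /aco /wco hy !mxE; split.
  by case: splitP => j' /= e; [move/val_inj: e => ->|have := ltn_ord i; rewrite e ltnNge leq_addr].
by case: splitP => j' /= e; [have := ltn_ord j'; rewrite -e ltnNge leq_addr|move/addnI: e => /val_inj ->].
Qed.

Lemma l2mmP (y z : l2mm) : (forall i k, aco y i k = aco z i k /\ wco y i k = wco z i k) -> y = z.
Proof.
move=> h; apply: l2P => k j; rewrite -(splitK j); case: (fintype.split j) => i /=.
  by have [h1 _] := h i k; exact: h1.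
by have [_ h1] := h i k; exact: h1.
Qed.

Definition Wt u x : 'cV[R]_m := gbe u x *m dx u x.

Lemma gaugeP u : gauge (L := L) (fun x => fmat [::] (u x)) (gbe u) (gal u).
Proof. by apply: gpairP => // i; exact: cts_H1. Qed.

Lemma L2_Wt u : L2vec L (Wt u).
Proof.
move=> i; have [_ _ hb _] := gaugeP u.
apply: L2_eq (L2_sum (index_enum 'I_m) (fun j => L2_mul (hd_cts (hb i j)) (L2_dx u j))) => x _.
by rewrite mxE.
Qed.

Definition emap (E : H1 L m -> l2mm) := forall u i k,
  aco (E u) i k = ow k * ipI (fun x => u x i 0) (cn k) /\ wco (E u) i k = ipI (fun x => Wt u x i 0) (sn k).

Lemma emap_exists : exists E, emap E.
Proof.
suff h u : exists y : l2mm, forall i k,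
    aco y i k = ow k * ipI (fun x => u x i 0) (cn k) /\ wco y i k = ipI (fun x => Wt u x i 0) (sn k).
  by have [E hE] := choice h; exists E.
pose K := `|u| + \sum_(i < m) nrmI (fun x => Wt u x i 0).
have s0 : 0 <= \sum_(i < m) nrmI (fun x => Wt u x i 0) by apply: sumr_ge0 => i _; exact: nrm_ge0.
have K0 : 0 <= K by rewrite addr_ge0.
have [||i|y _ h] := emb_exists K0 (dxP u) (L2_Wt u).
- by move=> i; have [h1 _] := nrm_H1 u i; apply: le_trans h1 _; rewrite lerDl.
- by move=> i; have [_ h1] := nrm_H1 u i; apply: le_trans h1 _; rewrite lerDl.
- apply: (@le_trans _ _ (\sum_(i < m) nrmI (fun x => Wt u x i 0))); last by rewrite lerDr.
  by rewrite (bigD1 i)//= lerDl sumr_ge0// => j _; exact: nrm_ge0.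
by exists y.
Qed.

Variable E : H1 L m -> l2mm.
Hypothesis hE : emap E.

Lemma rhat_E u : rhat (L := L) (E u) = u.
Proof.
apply/funext => x; have [Ix|nI] := pselect (I x); last first.
  by rewrite H1_out// /rhat ifN//; apply/negP => /set_mem.
apply/matrixP => i j; rewrite ord1; apply/eqP; rewrite -subr_eq0; apply/eqP.
apply: (@cos_unique _ _ (fun x => rhat (E u) x i 0 - u x i 0)) Ix.
  by apply: cts_sub; [exact: cts_rhat|exact: cts_H1].
move=> k; rewrite ip_subl; [|by apply: L2_cts; exact: cts_rhat|by apply: L2_cts; exact: cts_H1|exact: L2_cn].
have [h _] := hE u i k; rewrite ip_rhat h mulrC mulKf ?subrr//.
by rewrite gt_eqF// ow_gt0.
Qed.

Lemma nrm_What_E u i : nrmI (fun x => What (L := L) (E u) x i 0 - Wt u x i 0) = 0.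
Proof.
have [h1 h2] := WhatP (L := L) (E u) i; apply: sine_complete => [|k]; first exact: L2_sub (L2_Wt u i).
case: (posnP k) => [->|k0]; first exact: ip_sn0.
have LW := L2_Wt u i; rewrite (ip_subl h1 LW (L2_sn _)) (h2 k k0).
by have [_ ->] := hE u i k; rewrite subrr.
Qed.

Lemma LM_Wt (B : R) : 0 <= B -> LM (L := L) (T := nat) B (fun u (_ : nat) x => Wt u x).
Proof.
move=> B0; apply: LM_mul; last by move=> i j; rewrite ord1; exact: unifL_dx.
by apply: (SM_gbe (r := fun u : H1 L m => (u : R -> 'cV[R]_m)) tDf) => i; exact: unifS_H1.
Qed.

Lemma aco_add (y z : l2mm) i k : aco (y + z) i k = aco y i k + aco z i k /\ wco (y + z) i k = wco y i k + wco z i k.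
Proof. by rewrite /aco /wco !l2DE. Qed.

Lemma aco_scale (c : R) (y : l2mm) i k : aco (c *: y) i k = c * aco y i k /\ wco (c *: y) i k = c * wco y i k.
Proof. by rewrite /aco /wco !l2ZE. Qed.

(* A combination of values of E is the element of the phase space with the combined data. *)
Lemma E_comb (J : Type) (s : seq J) (c : J -> R) (U : J -> H1 L m) (K : R) : 0 <= K ->
  (forall i, nrmI (fun x => \sum_(j <- s) c j * U j x i 0) <= K) ->
  (forall i, nrmI (fun x => \sum_(j <- s) c j * dx (U j) x i 0) <= K) ->
  (forall i, nrmI (fun x => \sum_(j <- s) c j * Wt (U j) x i 0) <= K) ->
  `|\sum_(j <- s) c j *: E (U j)| <= cE * K.
Proof.
move=> K0 h1 h2 h3.
pose p x : 'cV[R]_m := \sum_(j <- s) c j *: U j x.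
pose q x : 'cV[R]_m := \sum_(j <- s) c j *: dx (U j) x.
pose w x : 'cV[R]_m := \sum_(j <- s) c j *: Wt (U j) x.
have sE (F : J -> R -> 'cV[R]_m) x i : (\sum_(j <- s) c j *: F j x) i 0 = \sum_(j <- s) c j * F j x i 0.
  by rewrite summxE; apply: eq_bigr => j _; rewrite mxE.
have fE (F : J -> R -> 'cV[R]_m) i : (fun x => (\sum_(j <- s) c j *: F j x) i 0) = (fun x => \sum_(j <- s) c j * F j x i 0).
  by apply/funext => x; exact: sE.
have hp : weak_deriv L p q.
  move=> i; rewrite /p /q !fE; apply: hd_sum => j; apply: hd_scale; exact: weak_dx.
have hw : L2vec L w.
  by move=> i; rewrite /w fE; apply: L2_sum => j; apply: L2_scale; exact: L2_Wt.
have [i|i|i|y hy ye] := emb_exists K0 hp hw; rewrite ?/p ?/q ?/w ?fE//.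
suff -> : \sum_(j <- s) c j *: E (U j) = y by [].
apply: l2mmP => i k; have [-> ->] := ye i k.
have aS : aco (\sum_(j <- s) c j *: E (U j)) i k = \sum_(j <- s) c j * aco (E (U j)) i k /\
    wco (\sum_(j <- s) c j *: E (U j)) i k = \sum_(j <- s) c j * wco (E (U j)) i k.
  elim: (s) => [|j r [IH1 IH2]]; first by rewrite !big_nil /aco /wco !l20E.
  have [e1 e2] := aco_add (c j *: E (U j)) (\sum_(j <- r) c j *: E (U j)) i k.
  have [e3 e4] := aco_scale (c j) (E (U j)) i k.
  by rewrite !big_cons e1 e2 e3 e4 IH1 IH2.
have [-> ->] := aS; rewrite /p /w !fE; split.
  rewrite ip_suml; [|by move=> j; apply: L2_scale; apply: L2_cts; exact: cts_H1|exact: L2_cn].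
  rewrite mulr_sumr; apply: eq_bigr => j _; rewrite ip_scalel; [|by apply: L2_cts; exact: cts_H1|exact: L2_cn].
  by have [-> _] := hE (U j) i k; ring.
rewrite ip_suml; [|by move=> j; apply: L2_scale; exact: L2_Wt|exact: L2_sn].
apply: eq_bigr => j _; rewrite ip_scalel; [|exact: L2_Wt|exact: L2_sn].
by have [_ ->] := hE (U j) i k.
Qed.

End Embedding.

(** * Consequences of bounds on triples *)

Section TripleEstimates.
Context {R : realType} {L : {posnum R}}.
Implicit Types (M N d x y z : R) (p q r : R -> R).

Lemma e3_dist M d x y z : e3 M d x y z -> `|x - y| <= 2 * M * d.
Proof.
move=> [_ h4 h5 _]; have -> : x - y = (x - z) - (y - z) by ring.
by apply: le_trans (ler_normB _ _) _; apply: le_trans (lerD h4 h5) _; lra.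
Qed.

Lemma mulBB (x y z w : R) : x * y - z * w = x * (y - w) + (x - z) * w.
Proof. by ring. Qed.

Lemma l3_mono M N d p q r : 0 <= d -> M <= N -> l3 (L := L) M d p q r -> l3 (L := L) N d p q r.
Proof.
move=> d0 MN [[h1 h2 h3] h4 h5 h6]; split.
- by split; apply: le_trans MN.
- by apply: le_trans h4 _; rewrite ler_wpM2r.
- by apply: le_trans h5 _; rewrite ler_wpM2r.
- by apply: le_trans h6 _; rewrite ler_wpM2r// exprn_ge0.
Qed.

Lemma l3_dist M d p q r : L2fun L p -> L2fun L q -> L2fun L r -> l3 (L := L) M d p q r ->
  nrm (L := L) (fun x => p x - q x) <= 2 * M * d.
Proof.
move=> lp lq lr [_ h4 h5 _].
rewrite (nrm_eq (g := fun x => (p x - r x) - (q x - r x))); last by move=> x _; ring.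
apply: le_trans (nrmB (L2_sub lp lr) (L2_sub lq lr)) _.
by apply: le_trans (lerD h4 h5) _; lra.
Qed.

End TripleEstimates.

(** * The embedding is bi-Lipschitz with small second differences *)

Section BiLipschitz.
Context {R : realType} {L : {posnum R}} {m : nat}.
Local Notation I := `[0, L%:num]%classic.
Local Notation hd := (has_L2deriv L).
Local Notation ipI := (ip (L := L)).
Local Notation nrmI := (nrm (L := L)).
Local Notation sn := (sn (L := L)).
Local Notation cn := (cn (L := L)).
Local Notation tb := (tb (L := L)).
Local Notation l2mm := (l2 R (m + m)).
Variable (Df : 'I_m -> 'I_m -> jet R m).
Hypothesis (tDf : forall i j, tame (Df i j)).
Local Notation gal := (gal (L := L) Df).
Local Notation Wt := (Wt (L := L) Df).
Variable E : H1 L m -> l2mm.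
Hypothesis hE : emap (L := L) Df E.
Implicit Types (a b u v : H1 L m) (i j : 'I_m) (x : R).

Lemma Wt_uniform (B : R) : 0 <= B -> exists2 M : R, 0 <= M & forall i a b, `|a| <= B -> `|b| <= B ->
  l3 (L := L) M `|a - b| (fun x => Wt a x i 0) (fun x => Wt b x i 0) (fun x => Wt (mid a b) x i 0).
Proof.
move=> B0; apply: finite_bound => [i K1 K2 K12 h a b ha hb|i].
  exact: l3_mono (normr_ge0 _) K12 (h a b ha hb).
by have [_ [M M0 h]] := LM_Wt (L := L) tDf B0 i 0; exists M => // a b ha hb; exact (h a b 0%N ha hb).
Qed.

(** E is linear in u apart from its W part. In the second difference the contributions of u and u_x
    vanish, and only that of [Wt] remains. *)
Lemma E_lip_mid (B : R) : 0 <= B -> exists2 C : R, 0 <= C & forall a b, `|a| <= B -> `|b| <= B ->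
  `|E a - E b| <= C * `|a - b| /\ `|E a + E b - 2 *: E (mid a b)| <= C * `|a - b| ^+ 2.
Proof.
move=> B0; have [M M0 hM] := Wt_uniform B0.
have cE0 : 0 <= @cE R L m by exact: sqrtr_ge0.
have M1 : M <= 1 + 2 * M by lra.
pose C := cE (L := L) (m := m) * (1 + 2 * M); exists C => [|a b ha hb].
  by rewrite mulr_ge0// addr_ge0// mulr_ge0.
have LW u i : L2fun L (fun x => Wt u x i 0) by exact: L2_Wt.
have d0 : 0 <= `|a - b| := normr_ge0 _.
have hp i := (nrm_H1 (a - b) i).1; have hq i := nrm_dxB_le a b i.
have hl i := hM i a b ha hb.
move: d0 hp hq hl; rewrite /C; move: (`|a - b|) => d d0 hp hq hl; split.
  have := @E_comb R L m Df tDf E hE (R * H1 L m) [:: (1, a); (-1, b)] fst snd ((1 + 2 * M) * d).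
  rewrite !big_cons big_nil /= scale1r scaleN1r addr0 mulrA; apply.
  - by rewrite mulr_ge0// addr_ge0// mulr_ge0.
  - move=> i; rewrite (nrm_eq (g := fun x => (a - b) x i 0)).
      by apply: le_trans (hp i) _; rewrite ler_peMl// lerDl mulr_ge0.
    by move=> x _; rewrite !big_cons big_nil H1B /=; ring.
  - move=> i; rewrite (nrm_eq (g := fun x => dx a x i 0 - dx b x i 0)).
      by apply: le_trans (hq i) _; rewrite ler_peMl// lerDl mulr_ge0.
    by move=> x _; rewrite !big_cons big_nil /=; ring.
  - move=> i; rewrite (nrm_eq (g := fun x => Wt a x i 0 - Wt b x i 0)); last first.
      by move=> x _; rewrite !big_cons big_nil /=; ring.
    apply: le_trans (l3_dist (LW _ _) (LW _ _) (LW _ _) (hl i)) _.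
    by rewrite ler_wpM2r// lerDr.
have := @E_comb R L m Df tDf E hE (R * H1 L m) [:: (1, a); (1, b); (-2, mid a b)] fst snd ((1 + 2 * M) * d ^+ 2).
rewrite !big_cons big_nil /= !scale1r scaleNr addr0 [X in `|X|]addrA mulrA; apply.
- by rewrite mulr_ge0 ?exprn_ge0// addr_ge0// mulr_ge0.
- move=> i; apply: nrm_le; first by rewrite mulr_ge0 ?exprn_ge0// addr_ge0// mulr_ge0.
  rewrite /ip (int_eq (g := cst 0)); first by rewrite Rintegral_cst ?mul0r ?sqr_ge0//; exact: mI.
  by move=> x _; rewrite !big_cons big_nil H1mid /=; field.
- move=> i; apply: (@le_trans _ _ 0); last by rewrite mulr_ge0 ?exprn_ge0// addr_ge0// mulr_ge0.
  rewrite (nrm_eq (g := fun x => (dx a x i 0 + dx b x i 0) - 2 * dx (mid a b) x i 0)); last first.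
    by move=> x _; rewrite !big_cons big_nil /=; ring.
  rewrite (@hd_nrm_unique _ _ (fun x => a x i 0 + b x i 0)) //.
    exact: hd_add (weak_dx a i) (weak_dx b i).
  by apply: hd_eq (hd_scale 2 (weak_dx (mid a b) i)) => // x _; rewrite H1mid; field.
- move=> i; have [_ _ _ h6] := hl i.
  rewrite (nrm_eq (g := fun x => (Wt a x i 0 - Wt (mid a b) x i 0) + (Wt b x i 0 - Wt (mid a b) x i 0))).
    apply: le_trans h6 _; apply: ler_wpM2r; [exact: exprn_ge0|exact: M1].
  by move=> x _; rewrite !big_cons big_nil /=; ring.
Qed.

Lemma dx_Wt u x i : I x -> dx u x i 0 = \sum_j gal u x i j * Wt u x j 0.
Proof.
move=> Ix; have g := gaugeP tDf u.
by rewrite -{1}[dx u x]mul1mx -(gauge_mulC g Ix) -mulmxA mxE.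
Qed.

(** u is recovered from E u by the linear map [rhat], bounded in the supremum norm, and u_x is [al]
    times W, where [al] is a Lipschitz function of E u through [rhat]. *)
Lemma E_low (B : R) : 0 <= B -> exists2 C : R, 0 <= C & forall a b, `|a| <= B -> `|b| <= B ->
  `|a - b| <= C * `|E a - E b|.
Proof.
move=> B0; have [C1 C10 hC1] := E_lip_mid B0; have [M M0 hM] := Wt_uniform B0.
pose B' := `|E 0| + C1 * B.
have EB u : `|u| <= B -> `|E u| <= B'.
  move=> hu; rewrite -[E u](subrK (E 0)); apply: le_trans (ler_normD _ _) _; rewrite addrC lerD2l.
  have n0 : `|0 : H1 L m| <= B by rewrite normr0.
  have [h _] := hC1 u 0 hu n0; apply: le_trans h _; rewrite (subr0 u); exact: ler_wpM2l C10 _ _ hu.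
have [N N0 hN] : exists2 N : R, 0 <= N & forall i j (y z : l2mm) (t : nat) x, `|y| <= B' -> `|z| <= B' -> I x ->
    e3 N `|y - z| (gal (rhat (L := L) y) x i j) (gal (rhat (L := L) z) x i j) (gal (rhat (L := L) (mid y z)) x i j).
  have B'0 : 0 <= B' by rewrite addr_ge0// mulr_ge0.
  apply: finite_bound => [i K1 K2 K12 h j y z t x hy hz Ix|i]; first exact: e3_mono (h j y z t x hy hz Ix).
  apply: finite_bound => [j K1 K2 K12 h y z t x hy hz Ix|j]; first exact: e3_mono (h y z t x hy hz Ix).
  have [_ [N N0 h]] := SM_gal (r := @rhat R L m) tDf (fun i => unifS_rhat nat i B'0) i j.
  by exists N => // y z t x; exact: h.
have t0 := @tb_ge0 R L.
pose C2 := tb * 2 * Num.sqrt L%:num.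
have C20 : 0 <= C2 by rewrite !mulr_ge0// sqrtr_ge0.
pose C3 : R := m%:R * (N + 2 * N * M).
have C30 : 0 <= C3 by rewrite mulr_ge0// addr_ge0// !mulr_ge0.
exists (2 * m%:R * (C2 + C3)) => [|a b ha hb]; first by rewrite mulr_ge0 ?mulr_ge0// addr_ge0.
have LW u i : L2fun L (fun x => Wt u x i 0) by exact: L2_Wt.
have d0 : 0 <= `|E a - E b| := normr_ge0 _.
have hp i x : I x -> `|a x i 0 - b x i 0| <= tb * 2 * `|E a - E b|.
  by move=> Ix; rewrite -{1}(rhat_E hE a) -{1}(rhat_E hE b) -rhatB -mulrA; exact: rhat_bound.
have hw i : nrmI (fun x => Wt a x i 0 - Wt b x i 0) <= `|E a - E b|.
  apply: (@parseval_coef _ _ _ (wco (E a - E b) i)) => //; [exact: L2_sub| |exact: sqbounded_entry].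
  move=> k k0; rewrite (ip_subl (LW _ _) (LW _ _) (L2_sn _)) /wco l2BE.
  by have [_ <-] := hE a i k; have [_ <-] := hE b i k.
have hg i j x : I x -> `|gal a x i j| <= N /\ `|gal a x i j - gal b x i j| <= 2 * N * `|E a - E b|.
  move=> Ix; have := hN i j (E a) (E b) 0%N x (EB a ha) (EB b hb) Ix.
  move=> h; have hd := e3_dist h; have [[h1 _ _] _ _ _] := h.
  by move: hd h1; rewrite !(rhat_E hE).
have hb1 i : nrmI (fun x => Wt b x i 0) <= M by have [[_ h _] _ _ _] := hM i a b ha hb.
have cgal u i j : cts (L := L) (fun x => gal u x i j) by have [_ _ _ h] := gaugeP tDf u; exact: hd_cts (h i j).
have hp' i : nrmI (fun x => (a - b) x i 0) <= C2 * `|E a - E b|.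
  rewrite (nrm_eq (g := fun x => a x i 0 - b x i 0)); last by move=> x _; rewrite H1B.
  have -> : C2 * `|E a - E b| = tb * 2 * `|E a - E b| * Num.sqrt L%:num by rewrite /C2; ring.
  apply: nrm_bounded (hp i); last by rewrite mulr_ge0// mulr_ge0.
  by apply: L2_cts; apply: cts_sub; exact: cts_H1.
have hq' i : nrmI (fun x => dx (a - b) x i 0) <= C3 * `|E a - E b|.
  apply: le_trans (nrm0_le (L2_dx (a - b) i) (L2_sub (L2_dx a i) (L2_dx b i)) _) _.
    by rewrite nrm_sub_swap; exact: nrm_dxB.
  rewrite (nrm_eq (g := fun x => \sum_j (gal a x i j * (Wt a x j 0 - Wt b x j 0) + (gal a x i j - gal b x i j) * Wt b x j 0))); last first.
    by move=> x Ix; rewrite (dx_Wt a i Ix) (dx_Wt b i Ix) -sumrB; apply: eq_bigr => j _; exact: mulBB.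
  have cD j : cts (L := L) (fun x => gal a x i j - gal b x i j) by exact: cts_sub.
  have l1 j : L2fun L (fun x => gal a x i j * (Wt a x j 0 - Wt b x j 0)) by apply: L2_mul => //; exact: L2_sub.
  have l2 j : L2fun L (fun x => (gal a x i j - gal b x i j) * Wt b x j 0) by exact: L2_mul.
  apply: le_trans (nrm_sum _ _) _; first by move=> j; exact: L2_add.
  have -> : C3 * `|E a - E b| = \sum_(j < m) ((N + 2 * N * M) * `|E a - E b|).
    by rewrite sumr_const card_ord -[RHS]mulr_natl /C3 mulrA.
  apply: ler_sum => j _; apply: le_trans (nrmD (l1 j) (l2 j)) _; rewrite mulrDl; apply: lerD.
    apply: le_trans (nrm_dom N0 (l1 j) (L2_sub (LW a j) (LW b j)) _) (ler_wpM2l N0 (hw j)) => x Ix.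
    by rewrite normrM ler_wpM2r//; have [] := hg i j x Ix.
  have c0 : 0 <= 2 * N * `|E a - E b| by rewrite !mulr_ge0.
  have -> : 2 * N * M * `|E a - E b| = 2 * N * `|E a - E b| * M by ring.
  apply: le_trans (nrm_dom c0 (l2 j) (LW b j) _) (ler_wpM2l c0 (hb1 j)) => x Ix.
  by rewrite normrM ler_wpM2r//; have [] := hg i j x Ix.
have -> : 2 * m%:R * (C2 + C3) * `|E a - E b| = 2 * m%:R * ((C2 + C3) * `|E a - E b|) by ring.
apply: H1_le => [|i|i]; first by rewrite mulr_ge0// addr_ge0.
- by apply: le_trans (hp' i) _; rewrite ler_wpM2r// lerDl.
- by apply: le_trans (hq' i) _; rewrite ler_wpM2r// lerDr.
Qed.

End BiLipschitz.

(** * Weak derivatives of matrices and sums of integrals *)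

Section WeakMatrixDerivatives.
Context {R : realType} {L : {posnum R}}.
Local Notation I := `[0, L%:num]%classic.
Local Notation hd := (has_L2deriv L).

Definition hdM p q (X dX : R -> 'M[R]_(p, q)) := forall i j, hd (fun x => X x i j) (fun x => dX x i j).

Lemma hdM_eq p q (X dX dY : R -> 'M[R]_(p, q)) : (forall x, I x -> dX x = dY x) -> hdM X dX -> hdM X dY.
Proof. by move=> e h i j; apply: hd_eq (h i j) => // x Ix; rewrite e. Qed.

Lemma hdM_mul p q s (X dX : R -> 'M[R]_(p, q)) (Y dY : R -> 'M[R]_(q, s)) : hdM X dX -> hdM Y dY ->
  hdM (fun x => X x *m Y x) (fun x => dX x *m Y x + X x *m dY x).
Proof.
move=> hX hY i j; have := hd_sum (index_enum 'I_q) (fun k => hd_mul (hX i k) (hY k j)).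
apply: hd_eq => x _; first by rewrite mxE.
by rewrite !mxE -big_split; apply: eq_bigr => k _ /=; rewrite addrC [Y x k j * _]mulrC.
Qed.

Lemma hdM_add p q (X dX Y dY : R -> 'M[R]_(p, q)) : hdM X dX -> hdM Y dY ->
  hdM (fun x => X x + Y x) (fun x => dX x + dY x).
Proof. by move=> hX hY i j; apply: hd_eq (hd_add (hX i j) (hY i j)) => x _; rewrite mxE. Qed.

Lemma hdM_scalar p q (c dc : R -> R) (X dX : R -> 'M[R]_(p, q)) : hd c dc -> hdM X dX ->
  hdM (fun x => c x *: X x) (fun x => dc x *: X x + c x *: dX x).
Proof.
move=> hc hX i j; apply: hd_eq (hd_mul hc (hX i j)) => x _; first by rewrite mxE.
by rewrite !mxE; ring.
Qed.

Lemma hdM_scale p q (a : R) (X dX : R -> 'M[R]_(p, q)) : hdM X dX ->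
  hdM (fun x => a *: X x) (fun x => a *: dX x).
Proof. by move=> hX i j; apply: hd_eq (hd_scale a (hX i j)) => x _; rewrite mxE. Qed.

Lemma hdM_tame m p q (D : 'I_p -> 'I_q -> jet R m) (s : seq 'I_m) (u w : R -> 'cV[R]_m) :
  (forall i j, tame (D i j)) -> weak_deriv L u w ->
  hdM (fun x => \matrix_(i, j) D i j s (u x)) (fun x => \sum_l w x l 0 *: (\matrix_(i, j) D i j (l :: s) (u x))).
Proof.
move=> tD hu i j; have [M M0 hM] := tD i j s.
have [N N0 hN] : exists2 N : R, 0 <= N & forall l a b, `|D i j (l :: s) b - D i j (l :: s) a| <= N * nv (b - a).
  apply: finite_bound => [l K1 K2 K12 h a b|l].
    by apply: le_trans (h a b) _; rewrite ler_wpM2r// nv_ge0.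
  by have [N N0 h] := tD i j (l :: s); exists N => // a b; have [] := h a b.
have := @hd_chain R L m (D i j s) (fun l => D i j (l :: s)) (M + N) u w (addr_ge0 M0 N0) _ _ hu.
move=> h; apply: hd_eq (h _ _) => [x _|x _|a b|l a b].
- by rewrite mxE.
- by rewrite summxE; apply: eq_bigr => l _; rewrite !mxE mulrC.
- have [_ _ h3] := hM a b; apply: le_trans h3 _; rewrite ler_wpM2r ?exprn_ge0 ?nv_ge0// lerDl//.
- by apply: le_trans (hN l a b) _; rewrite ler_wpM2r ?nv_ge0// lerDr.
Qed.

Lemma L2_mulmx p q r (X : R -> 'M[R]_(p, q)) (Y : R -> 'M[R]_(q, r)) : (forall i j, cts (L := L) (fun x => X x i j)) ->
  (forall i j, L2fun L (fun x => Y x i j)) -> forall i j, L2fun L (fun x => (X x *m Y x) i j).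
Proof.
move=> cX LY a b; apply: (L2_eq _ (L2_sum (index_enum 'I_q) (fun c => L2_mul (cX a c) (LY c b)))) => x _.
by rewrite mxE.
Qed.

Lemma L2_ctsmx p q (X : R -> 'M[R]_(p, q)) : (forall i j, cts (L := L) (fun x => X x i j)) ->
  forall i j, L2fun L (fun x => X x i j).
Proof. by move=> cX a b; exact: L2_cts (cX a b). Qed.

(** Integrability and value travel together, so that a long identity between integrals is assembled
    term by term and then checked pointwise under a single integral. *)
Definition hasint (F : R -> R) c := intg I F /\ \int[mu]_(x in I) F x = c.

Lemma hasint_ip (F G : R -> R) : L2fun L F -> L2fun L G -> hasint (fun x => F x * G x) (ip (L := L) F G).
Proof. by move=> hF hG; split => //; exact: L2_intg. Qed.

Lemma hasint_add F c G d : hasint F c -> hasint G d -> hasint (fun x => F x + G x) (c + d).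
Proof. by move=> [iF <-] [iG <-]; split; [exact: intgD|rewrite int_add]. Qed.

Lemma hasint_scale a F c : hasint F c -> hasint (fun x => a * F x) (a * c).
Proof. by move=> [iF <-]; split; [exact: intgZ|rewrite int_scale]. Qed.

Lemma hasint_opp F c : hasint F c -> hasint (fun x => - F x) (- c).
Proof.
move=> /(hasint_scale (-1)) [h1 h2]; rewrite mulN1r in h2; split; last first.
  by rewrite -h2; apply: int_eq => x _; rewrite mulN1r.
by apply: (intg_eq _ _ h1) => // x _; rewrite mulN1r.
Qed.

Lemma hasint_sum (J : finType) (F : J -> R -> R) c : (forall j, hasint (F j) (c j)) ->
  hasint (fun x => \sum_j F j x) (\sum_j c j).
Proof.
move=> h; split; first by apply: intg_sum => // j; have [] := h j.
by rewrite int_sum//; [apply: eq_bigr => j _; have [] := h j|move=> j; have [] := h j].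
Qed.

Lemma hasint_eq F c G d : hasint F c -> hasint G d -> (forall x, I x -> F x = G x) -> c = d.
Proof. by move=> [_ <-] [_ <-] e; exact: int_eq. Qed.

End WeakMatrixDerivatives.

(** * The test function that represents the W coefficients *)

Section TestFunction.
Context {R : realType} {L : {posnum R}} {m : nat}.
Local Notation I := `[0, L%:num]%classic.
Local Notation hd := (has_L2deriv L).
Local Notation hdM := (hdM (L := L)).
Local Notation ipI := (ip (L := L)).
Local Notation sn := (sn (L := L)).
Local Notation cn := (cn (L := L)).
Local Notation om := (om (L := L)).
Variables (Df : 'I_m -> 'I_m -> jet R m) (Dg : 'I_m -> jet R m).
Hypotheses (tDf : forall i j, tame (Df i j)) (tDg : forall i, tame (Dg i)).
Local Notation gbe := (gbe (L := L) Df).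
Local Notation gal := (gal (L := L) Df).
Local Notation fmat := (fmat Df).
Local Notation gvec := (gvec Dg).
Local Notation gmat := (gmat Dg).
Local Notation Wt := (Wt (L := L) Df).
Variables (u : H1 L m) (i : 'I_m) (k : nat).
Implicit Types (x : R) (l j : 'I_m).

Let f x := fmat [::] (u x).
Let fl l x := fmat [:: l] (u x).
Let v x := dx u x.
Let be x := gbe u x.
Let z x := gzz (L := L) Df u (Wt u) k x.
Definition rhs_vec (w : H1 L m) x : 'cV[R]_m := fmat [::] (w x) *m dx w x + gvec (w x) + w x.
Let h := rhs_vec u.
Let bt x (a : 'cV[R]_m) : R := (be x *m a) i 0.

Let btD x a b : bt x (a + b) = bt x a + bt x b. Proof. by rewrite /bt mulmxDr mxE. Qed.
Let btZ x (c : R) a : bt x (c *: a) = c * bt x a. Proof. by rewrite /bt -scalemxAr mxE. Qed.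
Let btN x a : bt x (- a) = - bt x a. Proof. by rewrite /bt mulmxN mxE. Qed.
Let bt_sum x (J : finType) (F : J -> 'cV[R]_m) : bt x (\sum_j F j) = \sum_j bt x (F j).
Proof. by rewrite /bt mulmx_sumr summxE. Qed.

(** The derivative of u |-> <W, sn_k> in a direction is the L2 product of that direction with
    [test_fun]. The variation of u_x gives [test_phi], after an integration by parts without
    boundary terms; that of [be] gives [test_psi]. *)
Definition test_phi x : 'rV[R]_m :=
  (- om k * cn k x) *: row i (be x) + (2^-1 * sn k x) *: row i (be x *m f x).
Definition test_psi x : 'rV[R]_m := \row_l (- 2^-1 * bt x (fl l x *m z x)).
Definition test_fun x : 'cV[R]_m := (test_phi x + test_psi x)^T.

Definition test_dphi x : 'rV[R]_m := (om k ^+ 2 * sn k x) *: row i (be x) + (om k * cn k x) *: row i (be x *m f x) +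
  (2^-1 * sn k x) *: (- 2^-1 *: row i (be x *m (f x *m f x)) + \sum_j v x j 0 *: row i (be x *m fl j x)).
Definition test_dpsi x : 'rV[R]_m := \row_l (- 2^-1 * (- 2^-1 * bt x (f x *m (fl l x *m z x)) +
  \sum_j v x j 0 * bt x (fmat [:: j; l] (u x) *m z x) + 2^-1 * bt x (fl l x *m (f x *m z x)) - sn k x * bt x (fl l x *m v x))).
Definition test_dfun x : 'cV[R]_m := (test_dphi x + test_dpsi x)^T.

Let gP : gauge (L := L) f be (gal u). Proof. exact: gaugeP tDf u. Qed.

Let vW x : I x -> gal u x *m Wt u x = v x.
Proof. by move=> Ix; rewrite /Wt mulmxA (gauge_mulC gP Ix) mul1mx. Qed.

Let hd_be : hdM be (fun x => - 2^-1 *: (be x *m f x)).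
Proof. by have [_ _ hb _] := gP. Qed.

Let hd_f s : hdM (fun x => fmat s (u x)) (fun x => \sum_j v x j 0 *: fmat (j :: s) (u x)).
Proof. exact: hdM_tame tDf (dxP u). Qed.

Let hd_tails : hdM (tails (L := L) (Wt u) k) (fun x => - (sn k x *: Wt u x)).
Proof.
move=> a j; have hL : L2fun L (fun y => Wt u y a 0 * sn k y).
  by apply: (L2_eq _ (L2_mul (@cts_sn R L k) (L2_Wt tDf u a))) => y _; rewrite mulrC.
apply: hd_eq (hd_tail hL) => x _; first by rewrite mxE.
by rewrite ord1 !mxE mulrC.
Qed.

Let hd_z : hdM z (fun x => 2^-1 *: (f x *m z x) - sn k x *: v x).
Proof.
have [_ _ _ ha] := gP; have := hdM_mul ha hd_tails; apply: hdM_eq => x Ix.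
rewrite /z /gzz -scalemxAl -mulmxA; congr (_ + _).
by rewrite mulmxN -scalemxAr vW.
Qed.

Lemma test_weak : weak_deriv L test_fun test_dfun.
Proof.
move=> l.
have hphi : hdM (fun x => test_phi x) (fun x => test_dphi x).
  have hrow (X dX : R -> 'M[R]_m) : hdM X dX -> hdM (fun x => row i (X x)) (fun x => row i (dX x)).
    by move=> hX a j; apply: hd_eq (hX i j) => x _; rewrite mxE.
  have h1 := hdM_scalar (hd_scale (- om k) (hd_cn k)) (hrow _ _ hd_be).
  have h2 := hdM_scalar (hd_scale 2^-1 (hd_sn k)) (hrow _ _ (hdM_mul hd_be (hd_f [::]))).
  apply: hdM_eq (hdM_add h1 h2) => x _; rewrite /test_dphi.
  have e1 : - 2^-1 *: (be x *m f x) *m f x + be x *m (\sum_j v x j 0 *: fl j x) =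
      - 2^-1 *: (be x *m (f x *m f x)) + \sum_j v x j 0 *: (be x *m fl j x).
    rewrite -scalemxAl -mulmxA mulmx_sumr; congr (_ + _); apply: eq_bigr => j _.
    by rewrite -scalemxAr.
  rewrite -[fmat [::] (u x)]/(f x) -[\sum_j _]/(\sum_j v x j 0 *: fl j x) e1.
  pose Bf j := be x *m fl j x; rewrite -[\sum_j v x j 0 *: (be x *m fl j x)]/(\sum_j v x j 0 *: Bf j).
  rewrite -[\sum_j v x j 0 *: row i (be x *m fl j x)]/(\sum_j v x j 0 *: row i (Bf j)).
  move: Bf (be x *m (f x *m f x)) (be x *m f x) (be x) => Bf B3 B2 B1.
  apply/matrixP => a b; rewrite !mxE !summxE.
  have -> : \sum_j (v x j 0 *: Bf j) i b = \sum_j v x j 0 * Bf j i b by apply: eq_bigr => j _; rewrite mxE.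
  have -> : \sum_j (v x j 0 *: row i (Bf j)) a b = \sum_j v x j 0 * Bf j i b by apply: eq_bigr => j _; rewrite !mxE.
  by field.
have hpsi : hdM (fun x => test_psi x) (fun x => test_dpsi x).
  move=> a l'; have := hdM_mul hd_be (hdM_mul (hd_f [:: l']) hd_z).
  move=> h0; have := @hdM_scale R L _ _ (- 2^-1) _ _ h0 i 0.
  apply: hd_eq => x _; first by rewrite /test_psi /bt !mxE.
  rewrite /test_dpsi [LHS]mxE [RHS]mxE; congr (_ * _).
  have e0 (A B : 'cV[R]_m) : (A + B) i 0 = A i 0 + B i 0 by rewrite mxE.
  have e1 (c : R) (A : 'cV[R]_m) : (c *: A) i 0 = c * A i 0 by rewrite mxE.
  rewrite e0 -[fmat [:: l'] (u x)]/(fl l' x).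
  rewrite -[X in _ + X = _]/(bt x ((\sum_j v x j 0 *: fmat [:: j; l'] (u x)) *m z x +
            fl l' x *m (2^-1 *: (f x *m z x) - sn k x *: v x))).
  rewrite -scalemxAl -mulmxA e1 -[X in - 2^-1 * X + _ = _]/(bt x (f x *m (fl l' x *m z x))).
  rewrite btD mulmx_suml bt_sum mulmxDr btD mulmxN btN -!scalemxAr !btZ -!addrA.
  congr (_ + (_ + _)).
  by apply: eq_bigr => j _; rewrite -scalemxAl btZ.
by apply: hd_eq (hdM_add hphi hpsi 0 l) => x _; rewrite [RHS]mxE.
Qed.

Definition weak_form (w : H1 L m) (p q : R -> 'cV[R]_m) : R :=
  - (\sum_l ipI (fun x => dx w x l 0) (fun x => q x l 0)) - \sum_l ipI (fun x => rhs_vec w x l 0) (fun x => p x l 0).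

Let hz a b : cts (L := L) (fun x => z x a b). Proof. exact: hd_cts (hd_z a b). Qed.
Let cbe a b : cts (L := L) (fun x => be x a b). Proof. exact: hd_cts (hd_be a b). Qed.
Let cf s a b : cts (L := L) (fun x => fmat s (u x) a b). Proof. exact: hd_cts (hd_f s a b). Qed.
Let Lv a b : L2fun L (fun x => v x a b). Proof. by rewrite [b]ord1; exact: L2_dx. Qed.

Let hd_g : hdM (fun x => gvec (u x)) (fun x => gmat (u x) *m v x).
Proof.
move=> a b; have := hdM_tame [::] (fun i (_ : 'I_1) => tDg i) (dxP u) => h1.
apply: hd_eq (h1 a b) => x _; first by rewrite !mxE.
by rewrite summxE mxE; apply: eq_bigr => l _; rewrite !mxE ord1 mulrC.
Qed.

Let Lh a b : L2fun L (fun x => h x a b).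
Proof.
have h1 := L2_mulmx (fun a b => @cf [::] a b) Lv a b.
have h2 := L2_cts (hd_cts (hd_g a b)).
have h3 : L2fun L (fun x => u x a b) by rewrite [b]ord1; apply: L2_cts; exact: cts_H1.
by apply: (L2_eq _ (L2_add (L2_add h1 h2) h3)) => x _; rewrite !mxE.
Qed.

Lemma rhs_vec_L2 (a : 'I_m) : L2fun L (fun x => rhs_vec u x a 0). Proof. exact: Lh. Qed.

(** A derivative with zero integral, its primitive vanishing with sn_k at both ends. It trades om_k
    cn_k be (g(u) + u) for terms without the factor om_k; among these, sn_k be u_x accounts for the
    1 in om_k ^ 2 + 1. *)
Let hd_boundary : hd (fun x => sn k x * bt x (gvec (u x) + u x))
  (fun x => om k * cn k x * bt x (gvec (u x) + u x) +
    sn k x * (- 2^-1 * bt x (f x *m (gvec (u x) + u x)) + bt x (gmat (u x) *m v x + v x))).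
Proof.
have hu : hdM (fun x => u x) v by move=> a b; rewrite [b]ord1; exact: dxP.
have := hd_mul (hd_sn k) (hdM_mul hd_be (hdM_add hd_g hu) i 0).
apply: hd_eq => x _ //; rewrite -scalemxAl -mulmxA addrC; congr (_ + _).
  by rewrite mulrC.
by congr (_ * _); rewrite [LHS]mxE; congr (_ + _); rewrite mxE.
Qed.

Let row_dot (X : 'M[R]_m) (a : 'cV[R]_m) : \sum_l a l 0 * row i X 0 l = (X *m a) i 0.
Proof. by rewrite mxE; apply: eq_bigr => l _; rewrite mxE mulrC. Qed.

Let dot_dfun x : \sum_l v x l 0 * test_dfun x l 0 = om k ^+ 2 * sn k x * bt x (v x) + om k * cn k x * bt x (f x *m v x) +
  2^-1 * sn k x * (- 2^-1 * bt x (f x *m (f x *m v x)) + \sum_j v x j 0 * bt x (fl j x *m v x)) +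
  \sum_l v x l 0 * test_dpsi x 0 l.
Proof.
transitivity (\sum_l (v x l 0 * test_dphi x 0 l + v x l 0 * test_dpsi x 0 l)).
  by apply: eq_bigr => l _; rewrite mxE [X in _ * X]mxE mulrDr.
rewrite big_split /=; congr (_ + _).
transitivity (\sum_l (om k ^+ 2 * sn k x * (v x l 0 * row i (be x) 0 l) + om k * cn k x * (v x l 0 * row i (be x *m f x) 0 l) +
  2^-1 * sn k x * (- 2^-1 * (v x l 0 * row i (be x *m (f x *m f x)) 0 l) + \sum_j v x j 0 * (v x l 0 * row i (be x *m fl j x) 0 l)))).
  apply: eq_bigr => l _; rewrite /test_dphi; set X1 := row i (be x); set X2 := row i _; set X3 := row i _.
  set S := \sum_j _; set S' := \sum_j _.
  have -> : S' = v x l 0 * S 0 l.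
    by rewrite /S summxE mulr_sumr; apply: eq_bigr => j _; rewrite [in RHS]mxE mulrCA.
  have e (a b c d : R) (A B C D : 'rV[R]_m) : (a *: A + b *: B + c *: (d *: C + D)) 0 l = a * A 0 l + b * B 0 l + c * (d * C 0 l + D 0 l).
    by rewrite !mxE.
  by rewrite e; ring.
rewrite !big_split -!mulr_sumr /= !big_split -!mulr_sumr !row_dot /bt -!mulmxA; congr (_ + _ * (_ + _)).
rewrite exchange_big; apply: eq_bigr => j _; rewrite -mulr_sumr row_dot -mulmxA //.
Qed.

Let dot_fun x (a : 'cV[R]_m) : \sum_l a l 0 * test_fun x l 0 = - om k * cn k x * bt x a + 2^-1 * sn k x * bt x (f x *m a) +
  \sum_l a l 0 * test_psi x 0 l.
Proof.
transitivity (\sum_l (- om k * cn k x * (a l 0 * row i (be x) 0 l) + 2^-1 * sn k x * (a l 0 * row i (be x *m f x) 0 l) + a l 0 * test_psi x 0 l)).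
  apply: eq_bigr => l _; rewrite mxE [X in _ * X]mxE mulrDr /test_phi; set X1 := row i _; set X2 := row i _.
  have e (b c : R) (A B : 'rV[R]_m) : (b *: A + c *: B) 0 l = b * A 0 l + c * B 0 l by rewrite !mxE.
  by rewrite e; ring.
by rewrite !big_split -!mulr_sumr /= !row_dot /bt -!mulmxA.
Qed.

Lemma test_fun_L2 l : L2fun L (fun x => test_fun x l 0). Proof. by have := hd_cts (test_weak l) => /L2_cts. Qed.
Lemma test_dfun_L2 l : L2fun L (fun x => test_dfun x l 0). Proof. by have [] := test_weak l. Qed.

(** The terms om_k cn_k be f u_x coming from the diffusion and from the drift cancel; this is the
    purpose of the factor 1/2 in [gauge]. Once the null integral of [hd_boundary] is taken into
    account, the identity holds pointwise. *)
Lemma test_identity : weak_form u test_fun test_dfun =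
  - (om k ^+ 2 + 1) * ipI (fun x => Wt u x i 0) (sn k) + fieldW (L := L) Df Dg u (Wt u) i k.
Proof.
have hT : hasint (L := L) (fun x => - (\sum_l v x l 0 * test_dfun x l 0) - \sum_l h x l 0 * test_fun x l 0)
    (weak_form u test_fun test_dfun).
  apply: hasint_add; apply: hasint_opp; apply: hasint_sum => l; apply: hasint_ip.
  - exact: Lv.
  - exact: test_dfun_L2.
  - exact: Lh.
  - exact: test_fun_L2.
have eD (A B : 'cV[R]_m) (a b : R) : (a *: A + b *: B) i 0 = a * A i 0 + b * B i 0 by rewrite !mxE.
have hV := hasint_ip (L2_Wt tDf u i) (@L2_sn R L k).
have hB : hasint (L := L) (fun x => om k * cn k x * bt x (gvec (u x) + u x) +
    sn k x * (- 2^-1 * bt x (f x *m (gvec (u x) + u x)) + bt x (gmat (u x) *m v x + v x))) 0.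
  split; first by apply: L2_intg1; have [] := hd_boundary.
  by rewrite (hd_int hd_boundary) snL sn00 !mul0r subr0.
have cg a b : cts (L := L) (fun x => gmat (u x) a b).
  apply: (cts_eq _ (@cts_tame R L m (Dg a) [:: b] u (tDg a) _)) => [x _|c]; first by rewrite mxE.
  exact: cts_H1.
have Lb (X : R -> 'cV[R]_m) (LX : forall a b, L2fun L (fun x => X x a b)) :
    L2fun L (fun x => bt x (X x)) by exact: (L2_mulmx cbe LX).
have Lf s (X : R -> 'cV[R]_m) (LX : forall a b, L2fun L (fun x => X x a b)) a b :
    L2fun L (fun x => (fmat s (u x) *m X x : 'cV[R]_m) a b).
  exact: (L2_mulmx (fun a b => @cf s a b) LX).
have cbf s (X : R -> 'cV[R]_m) (cX : forall a b, cts (L := L) (fun x => X x a b)) :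
    cts (L := L) (fun x => bt x (fmat s (u x) *m X x)).
  by apply: (cts_mulmx cbe) => a b; exact: (cts_mulmx (fun a b => @cf s a b) cX).
have Lz := L2_ctsmx hz.
have L2l s l : L2fun L (fun x => bt x (fmat s (u x) *m z x)) by apply: L2_cts; apply: (cbf); exact: hz.
have hW : hasint (L := L) (fun x => (- 4^-1 * bt x (f x *m (f x *m v x)) - bt x (gmat (u x) *m v x)) * sn k x +
    \sum_l (- (sn k x * v x l 0 * bt x (fl l x *m v x)) +
     2^-1 * (v x l 0 * (- 2^-1 * bt x (f x *m (fl l x *m z x)) + 2^-1 * bt x (fl l x *m (f x *m z x))) +
    \sum_j bt x (fmat [:: j; l] (u x) *m z x) * v x l 0 * v x j 0 +
    h x l 0 * bt x (fl l x *m z x)))) (fieldW (L := L) Df Dg u (Wt u) i k).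
  rewrite /fieldW; have eI F G F' G' : (forall x, I x -> F x * G x = F' x * G' x) -> ipI F G = ipI F' G' by exact: ip_eq.
  apply: hasint_add.
    have -> := eI _ _ (fun x => - 4^-1 * bt x (f x *m (f x *m v x)) - bt x (gmat (u x) *m v x)) (sn k).
      have hs : L2fun L (sn k) by exact: L2_sn.
      apply: hasint_ip hs; apply: L2_add; [apply: L2_scale|apply: L2_opp]; apply: (Lb); first by do 2!apply: (Lf).
      exact: (L2_mulmx cg Lv).
    by move=> x Ix; rewrite /gvv (vW Ix) eD mulN1r.
  apply: hasint_sum => l; apply: hasint_add.
    apply: hasint_opp.
    have -> := eI _ _ (fun x => sn k x * v x l 0) (fun x => bt x (fl l x *m v x)).
      by apply: hasint_ip; [by apply: L2_mul => //; exact: cts_sn|by apply: (Lb); apply: (Lf)].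
    by move=> x Ix; rewrite /gvv vW.
  apply: hasint_scale; apply: hasint_add; first apply: hasint_add.
  - have -> := eI _ _ (fun x => v x l 0) (fun x => - 2^-1 * bt x (f x *m (fl l x *m z x)) + 2^-1 * bt x (fl l x *m (f x *m z x))).
      apply: hasint_ip => //; apply: L2_add; apply: L2_scale; apply: L2_cts; apply: (cbf) => a b; exact: (cts_mulmx (fun a b => @cf _ a b) hz).
    by move=> x Ix; rewrite /gvv (vW Ix) eD.
  - apply: hasint_sum => j.
    have -> := eI _ _ (fun x => bt x (fmat [:: j; l] (u x) *m z x) * v x l 0) (fun x => v x j 0).
      by apply: hasint_ip => //; apply: L2_mul => //; apply: (cbf).
    by move=> x Ix; rewrite /gvv vW.
  - have -> := eI _ _ (fun x => h x l 0) (fun x => bt x (fl l x *m z x)).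
      by apply: hasint_ip => //; exact: L2l.
    by move=> x Ix; rewrite /flux /gvv vW.
apply/eqP; rewrite -subr_eq0; apply/eqP.
have := hasint_add hT (hasint_opp (hasint_add (hasint_scale (- (om k ^+ 2 + 1)) hV) hW)).
move/hasint_eq => /(_ _ _ hB); apply => x Ix.
rewrite dot_dfun dot_fun -[Wt u x i 0]/(bt x (v x)) /h /rhs_vec -!addrA mulmxDr !btD.
rewrite -[fmat [::] (u x)]/(f x) -[dx u x]/(v x).
set hh := f x *m v x + (gvec (u x) + u x).
pose S1 := \sum_l v x l 0 * bt x (fl l x *m v x).
pose c2 l := - 2^-1 * bt x (f x *m (fl l x *m z x)) + 2^-1 * bt x (fl l x *m (f x *m z x)).
pose c3 l := \sum_j bt x (fmat [:: j; l] (u x) *m z x) * v x l 0 * v x j 0.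
pose S2 := \sum_l v x l 0 * c2 l; pose S3 := \sum_l c3 l; pose S4 := \sum_l hh l 0 * bt x (fl l x *m z x).
have -> : \sum_l v x l 0 * test_dpsi x 0 l = - 2^-1 * S2 - 2^-1 * S3 + 2^-1 * sn k x * S1.
  rewrite /S1 /S2 /S3 !mulr_sumr -sumrN -!big_split; apply: eq_bigr => l _; rewrite [test_dpsi x 0 l]mxE /= /c2.
  have -> : c3 l = v x l 0 * \sum_j v x j 0 * bt x (fmat [:: j; l] (u x) *m z x).
    by rewrite mulr_sumr; apply: eq_bigr => j _; ring.
  by ring.
have -> : \sum_l hh l 0 * test_psi x 0 l = - 2^-1 * S4.
  by rewrite /S4 mulr_sumr; apply: eq_bigr => l _; rewrite [test_psi x 0 l]mxE; ring.
set S5 := \sum_l (_ + _); have -> : S5 = - sn k x * S1 + 2^-1 * (S2 + S3 + S4).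
  rewrite /S1 /S2 /S3 /S4 mulr_sumr -!big_split mulr_sumr -big_split; apply: eq_bigr => l _ /=.
  by rewrite /c2 /c3; ring.
rewrite -/S1; move: S1 S2 S3 S4 (bt x (f x *m v x)) (bt x (f x *m (f x *m v x))) => S1 S2 S3 S4 b1 b2.
by field.
Qed.

Lemma test_fun_dot x (a : 'cV[R]_m) : \sum_l a l 0 * test_fun x l 0 =
  - om k * cn k x * (gbe u x *m a) i 0 + 2^-1 * sn k x * (gbe u x *m (fmat [::] (u x) *m a)) i 0 -
  2^-1 * (gbe u x *m ((\sum_l a l 0 *: fmat [:: l] (u x)) *m gzz (L := L) Df u (Wt u) k x)) i 0.
Proof.
rewrite dot_fun; congr (_ + _); rewrite mulmx_suml -[(gbe u x *m _) i 0]/(bt x _) bt_sum -mulNr mulr_sumr.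
by apply: eq_bigr => l _; rewrite [test_psi x 0 l]mxE -scalemxAl btZ mulrCA.
Qed.

End TestFunction.

(** * Quadratic remainder of the W coefficients *)

Section GaugeTaylor.
Context {R : realType} {L : {posnum R}} {m : nat}.
Local Notation I := `[0, L%:num]%classic.
Local Notation hd := (has_L2deriv L).
Local Notation hdM := (hdM (L := L)).
Local Notation ipI := (ip (L := L)).
Local Notation nrmI := (nrm (L := L)).
Local Notation sn := (sn (L := L)).
Local Notation cn := (cn (L := L)).
Local Notation om := (om (L := L)).
Local Notation tb := (tb (L := L)).
Local Notation cts := (cts (L := L)).
Variables (Df : 'I_m -> 'I_m -> jet R m) (Dg : 'I_m -> jet R m).
Hypotheses (tDf : forall i j, tame (Df i j)) (tDg : forall i, tame (Dg i)).
Local Notation gbe := (gbe (L := L) Df).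
Local Notation gal := (gal (L := L) Df).
Local Notation fmat := (fmat Df).
Local Notation Wt := (Wt (L := L) Df).
Implicit Types (u w : H1 L m) (i : 'I_m) (k : nat) (x : R).

Definition vb (K : R) (a : 'cV[R]_m) := forall l, `|a l 0| <= K.

Lemma vb_mul K N (X : 'M[R]_m) a : mb K X -> vb N a -> vb (m%:R * (K * N)) (X *m a).
Proof.
move=> hX ha i; rewrite mxE; apply: le_trans (ler_norm_sum _ _ _) _.
apply: (@le_trans _ _ (\sum_(j < m) K * N)); last by rewrite sumr_const card_ord mulr_natl.
by apply: ler_sum => j _; rewrite normrM; apply: ler_pM.
Qed.

Lemma mul_diff3 (B1 B0 X F : 'M[R]_m) (y y0 : 'cV[R]_m) i : - 2^-1 * (B1 *m (X *m y)) i 0 +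
  2^-1 * (B0 *m (F *m y0)) i 0 =
  - 2^-1 * (((B1 - B0) *m (X *m y)) i 0 + (B0 *m ((X - F) *m y)) i 0 + (B0 *m (F *m (y - y0))) i 0).
Proof.
rewrite !mulmxBr !mulmxBl !mulmxBr.
move: (B1 *m _) (B0 *m (X *m y)) (B0 *m (F *m y)) (B0 *m (F *m y0)) => A1 A2 A3 A4.
by rewrite !mxE; ring.
Qed.

Lemma vb_nv (a : 'cV[R]_m) : vb (nv a) a. Proof. exact: le_nv. Qed.

Lemma gauge_uniform : exists2 K : R, 0 <= K & forall u x, I x -> [/\ mb K (gbe u x), mb K (gal u x) & mb K (fmat [::] (u x))].
Proof.
have [M M0 hM] := fmat_bound tDf; have [K K0 hK] := gauge_bound (L := L) (m := m) M0.
exists (K + M) => [|u x Ix]; first exact: addr_ge0.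
have g := gaugeP tDf u; split => a b.
- by apply: le_trans (hK _ _ _ g _ x Ix a b) _; rewrite ?lerDl// => y _; exact: hM.
- have := hK _ _ _ (gauge_tr g) _ x Ix b a; rewrite mxE => h; apply: le_trans (h _) _; rewrite ?lerDl// => y _ c d.
  by rewrite !mxE normrN; have := hM (u y) d c; rewrite mxE.
- by apply: le_trans (hM (u x) a b) _; rewrite lerDr.
Qed.

Lemma fmat_taylor : exists2 K : R, 0 <= K & forall a b, mb (K * nv (b - a)) (fmat [::] b - fmat [::] a) /\
  mb (K * nv (b - a) ^+ 2) (fmat [::] b - fmat [::] a - \sum_l (b - a) l 0 *: fmat [:: l] a).
Proof.
suff [K K0 h] : exists2 K : R, 0 <= K & forall i j a b, `|Df i j [::] b - Df i j [::] a| <= K * nv (b - a) /\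
    `|Df i j [::] b - Df i j [::] a - \sum_l Df i j [:: l] a * (b - a) l 0| <= K * nv (b - a) ^+ 2.
  exists K => // a b; split => i j; have [h1 h2] := h i j a b; first by rewrite !mxE.
  rewrite !mxE summxE; congr (`|_ - _| <= _) : h2; apply: eq_bigr => l _.
  by rewrite !mxE mulrC.
apply: finite_bound => [i K N KN h j a b|i].
  by have [h1 h2] := h j a b; split; [apply: le_trans h1 _|apply: le_trans h2 _]; rewrite ler_wpM2r ?exprn_ge0 ?nv_ge0.
apply: finite_bound => [j K N KN h a b|j].
  by have [h1 h2] := h a b; split; [apply: le_trans h1 _|apply: le_trans h2 _]; rewrite ler_wpM2r ?exprn_ge0 ?nv_ge0.
by have [M M0 h] := tDf i j [::]; exists M => // a b; have [_ h1 h2] := h a b.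
Qed.

Section Increment.
Variables (u w : H1 L m) (i : 'I_m) (k : nat) (K : R).
Hypotheses (K0 : 0 <= K) (Kg : forall (v : H1 L m) x, I x -> [/\ mb K (gbe v x), mb K (gal v x) & mb K (fmat [::] (v x))])
  (Kf : forall a b, mb (K * nv (b - a)) (fmat [::] b - fmat [::] a) /\
  mb (K * nv (b - a) ^+ 2) (fmat [::] b - fmat [::] a - \sum_l (b - a) l 0 *: fmat [:: l] a)).
Let dl x : 'cV[R]_m := w x - u x.
Let N := nrmI (fun x => nv (dl x)).
Let b0 := gbe u.
Let b1 := gbe w.
Let a0 := gal u.
Let df x := fmat [::] (w x) - fmat [::] (u x).
Let G x := b1 x *m df x *m a0 x.
Let V x : 'cV[R]_m := sn k x *: (b0 x *m dx w x).
Let Ga := tails (L := L) (fun x => b0 x *m dx w x) k.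
Let Ga0 := tails (L := L) (Wt u) k.

Let cdl a b : cts (fun x => dl x a b).
Proof.
rewrite [b]ord1; apply: (cts_eq _ (cts_sub (@cts_H1 R L m w a) (@cts_H1 R L m u a))) => x _.
by rewrite !mxE.
Qed.

Let cnv : cts (fun x => nv (dl x)).
Proof. by apply: (@cts_sum _ L) => l; apply: cts_abs; exact: cdl. Qed.

Let Lnv : L2fun L (fun x => nv (dl x)). Proof. exact: L2_cts. Qed.

Let N0 : 0 <= N. Proof. exact: nrm_ge0. Qed.

Let cb (v : H1 L m) a b : cts (fun x => gbe v x a b).
Proof. by have [_ _ h _] := gaugeP tDf v; exact: hd_cts (h a b). Qed.

Let ca (v : H1 L m) a b : cts (fun x => gal v x a b).
Proof. by have [_ _ _ h] := gaugeP tDf v; exact: hd_cts (h a b). Qed.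

Let cf (v : H1 L m) a b : cts (fun x => fmat [::] (v x) a b).
Proof. exact: hd_cts (hdM_tame [::] tDf (dxP v) a b). Qed.

Let cdf a b : cts (fun x => df x a b).
Proof. by apply: (cts_eq _ (cts_sub (@cf w a b) (@cf u a b))) => x _; rewrite /df !mxE. Qed.

Let cG a b : cts (fun x => G x a b).
Proof. by apply: (cts_mulmx _ (@ca u)) => ? ?; exact: (cts_mulmx (@cb w) cdf). Qed.

Let Lbw a b : L2fun L (fun x => (b0 x *m dx w x) a b).
Proof. by apply: (L2_mulmx (@cb u)) => c d; rewrite [d]ord1; exact: L2_dx. Qed.

Let hd_Ga : hdM Ga (fun x => - V x).
Proof.
move=> a j; have hL : L2fun L (fun y => (b0 y *m dx w y) a 0 * sn k y).
  by apply: (L2_eq _ (L2_mul (@cts_sn R L k) (Lbw a 0))) => y _; rewrite mulrC.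
apply: hd_eq (hd_tail hL) => x _; first by rewrite mxE.
by rewrite ord1 [in RHS]mxE [in RHS]mxE mulrC.
Qed.

Let GaL : Ga L%:num = 0.
Proof. by apply/matrixP => a b; rewrite !mxE set_itv1 Rintegral_set1. Qed.

Let D x := mint x G.

Let hd_D : hdM D G.
Proof. by move=> a b; apply: hd_eq (hd_prim (L2_cts (@cG a b))) => x _; rewrite ?mxE. Qed.

Let D0 : D 0 = 0.
Proof. by apply/matrixP => a b; rewrite !mxE set_itv1 Rintegral_set1. Qed.

Let G_bound x : I x -> mb (m%:R * (m%:R * (K * (K * nv (dl x))) * K)) (G x).
Proof.
move=> Ix; have [h1 _ _] := Kg w Ix; have [_ h2 _] := Kg u Ix.
by apply: mb_mul => //; apply: mb_mul => //; have [h _] := Kf (u x) (w x).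
Qed.

Let D_bound x : I x -> mb (Num.sqrt L%:num * (m%:R * (m%:R * (K * K) * K) * N)) (D x).
Proof.
move=> Ix a b; have := hd_dist (hd_D a b) Ix (I0 (L := L)); rewrite D0 [X in _ - X]mxE subr0 => h.
apply: le_trans h _; rewrite ler_wpM2l ?sqrtr_ge0//; apply: nrm_dom.
- by rewrite !mulr_ge0.
- exact: L2_cts.
- exact: Lnv.
- move=> y Iy; rewrite (ger0_norm (nv_ge0 _)); apply: le_trans (G_bound Iy a b) _.
  by apply: eqle; ring.
Qed.

Let be_diff x : I x -> b1 x - b0 x = - 2^-1 *: (D x *m b0 x).
Proof. by move=> Ix; rewrite (duhamel (gaugeP tDf w) (gaugeP tDf u) Ix). Qed.

Let hd_dl : hdM dl (fun x => dx w x - dx u x).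
Proof.
move=> a b; rewrite [b]ord1; apply: hd_eq (hd_sub (weak_dx w a) (weak_dx u a)) => x _; by rewrite !mxE.
Qed.

Let hd_sb : hdM (fun x => sn k x *: (b0 x *m dl x)) (fun x => om k * cn k x *: (b0 x *m dl x) -
  2^-1 * sn k x *: (b0 x *m (fmat [::] (u x) *m dl x)) + sn k x *: (b0 x *m (dx w x - dx u x))).
Proof.
have hb : hdM b0 (fun x => - 2^-1 *: (b0 x *m fmat [::] (u x))) by have [_ _ h _] := gaugeP tDf u.
apply: hdM_eq (hdM_scalar (hd_sn k) (hdM_mul hb hd_dl)) => x _.
by rewrite -scalemxAl -mulmxA scalerDr addrA scalerA mulrN scaleNr [sn k x * _]mulrC.
Qed.

(** The difference of the tails contains w_x - u_x; integrated by parts, it leaves only w - u, at x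
    and in L2. This costs the factor om_k, harmless as k is fixed here. *)
Let Ga_diff x : I x -> vb (tb * (m%:R * (K * nv (dl x))) +
  Num.sqrt L%:num * (((om k * tb) * (m%:R * K) + 2^-1 * tb * (m%:R * (K * (m%:R * K)))) * N)) (Ga x - Ga0 x).
Proof.
move=> Ix l; pose P y := (Ga y - Ga0 y + sn k y *: (b0 y *m dl y)) l 0.
pose Q y := (om k * cn k y *: (b0 y *m dl y) - 2^-1 * sn k y *: (b0 y *m (fmat [::] (u y) *m dl y))) l 0.
have hP : hd P Q.
  have h0 : hdM Ga0 (fun y => - (sn k y *: Wt u y)).
    move=> a b; have hL : L2fun L (fun y => Wt u y a 0 * sn k y).
      by apply: (L2_eq _ (L2_mul (@cts_sn R L k) (L2_Wt tDf u a))) => y _; rewrite mulrC.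
    apply: hd_eq (hd_tail hL) => y _; first by rewrite mxE.
    by rewrite ord1 [in RHS]mxE [in RHS]mxE mulrC.
  have := hdM_add (hdM_add hd_Ga (hdM_scale (-1) h0)) hd_sb => /(_ l 0).
  apply: hd_eq => y _; first by rewrite /P scaleN1r.
  rewrite /Q /V /Wt [b0 y *m (dx w y - _)]mulmxBr [sn k y *: (_ - _)]scalerBr -[gbe u y]/(b0 y); set A := b0 y *m dx w y; set A' := b0 y *m dx u y.
  by move: A A' (b0 y *m dl y) (b0 y *m (_ *m _)) => A1 A2 A3 A4; rewrite !mxE; ring.
have PL : P L%:num = 0.
  rewrite /P GaL snL scale0r addr0 sub0r; apply/eqP; rewrite mxE oppr_eq0; apply/eqP.
  by rewrite !mxE set_itv1 Rintegral_set1.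
have hPx : `|P x| <= Num.sqrt L%:num * (((om k * tb) * (m%:R * K) + 2^-1 * tb * (m%:R * (K * (m%:R * K)))) * N).
  have := hd_dist hP Ix (IL (L := L)); rewrite PL subr0 => h; apply: le_trans h _.
  rewrite ler_wpM2l ?sqrtr_ge0//; apply: nrm_dom => //.
  - apply: addr_ge0; rewrite !mulr_ge0 ?tb_ge0 ?om_ge0 ?invr_ge0 ?pi_ge0//.
  - by case: hP.
  - move=> y Iy; rewrite (ger0_norm (nv_ge0 _)) mulrDl; have [h1 _ h2] := Kg u Iy.
    have v1 := vb_mul h1 (vb_nv (dl y)); have v2 := vb_mul h1 (vb_mul h2 (vb_nv (dl y))).
    rewrite /Q [X in `|X|]mxE [X in `|X + _|]mxE [X in `|_ + X|]mxE [X in `|_ - X|]mxE.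
    apply: le_trans (ler_normB _ _) _; apply: lerD.
      have -> : om k * tb * (m%:R * K) * nv (dl y) = om k * (tb * (m%:R * (K * nv (dl y)))) by ring.
      rewrite -mulrA normrM [`|cn k y * _|]normrM (ger0_norm (@om_ge0 R L k)); apply: ler_wpM2l; first exact: om_ge0.
      by apply: ler_pM => //; exact: cn_le.
    rewrite normrM normrM gtr0_norm ?invr_gt0// -!mulrA ler_wpM2l ?invr_ge0//.
    by apply: ler_pM => //; exact: sn_le.
have -> : (Ga x - Ga0 x) l 0 = P x - sn k x * (b0 x *m dl x) l 0.
  by rewrite /P; move: (Ga x - Ga0 x) (b0 x *m dl x) => A1 A2; rewrite !mxE; ring.
apply: le_trans (ler_normB _ _) _; rewrite addrC; apply: lerD => //.
rewrite normrM; apply: ler_pM => //; first exact: sn_le.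
have [h1 _ _] := Kg u Ix; exact: vb_mul h1 (vb_nv (dl x)) l.
Qed.

Let Err x := - 2^-1 * (G x *m Ga x) i 0 +
  2^-1 * (b0 x *m ((\sum_l dl x l 0 *: fmat [:: l] (u x)) *m (a0 x *m Ga0 x))) i 0.

(** Two derivatives of zero integral are subtracted: that of sn_k be (w - u), which moves the
    derivative off w - u, and that of D Ga, which exchanges the integrations in Duhamel's formula.
    What is left is [Err]. *)
Let hasint_Err : hasint (L := L) Err (ipI (fun x => Wt w x i 0) (sn k) - ipI (fun x => Wt u x i 0) (sn k) -
  \sum_l ipI (fun x => w x l 0 - u x l 0) (fun x => test_fun Df u i k x l 0)).
Proof.
have h1 := hasint_ip (L2_Wt tDf w i) (@L2_sn R L k).
have h2 := hasint_ip (L2_Wt tDf u i) (@L2_sn R L k).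
have h3 : hasint (L := L) (fun x => \sum_l (w x l 0 - u x l 0) * test_fun Df u i k x l 0)
    (\sum_l ipI (fun x => w x l 0 - u x l 0) (fun x => test_fun Df u i k x l 0)).
  apply: hasint_sum => l; apply: hasint_ip; last exact: test_fun_L2.
  by apply: L2_sub; apply: L2_cts; exact: cts_H1.
have hz f g : hd f g -> f L%:num = 0 -> f 0 = 0 -> hasint (L := L) g 0.
  by move=> h fL f0; split; [case: h => /L2_intg1|rewrite (hd_int h) fL f0 subr0].
have h4 := hz _ _ (hd_sb i 0) _ _; have h5 := hz _ _ (hdM_mul hd_D hd_Ga i 0) _ _.
rewrite !snL !sn00 !scale0r mxE in h4; have {}h4 := h4 erefl erefl.
rewrite GaL D0 mulmx0 mul0mx mxE in h5; have {}h5 := h5 erefl erefl.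
have := hasint_add (hasint_add (hasint_add h1 (hasint_opp h2)) (hasint_opp h3))
  (hasint_opp (hasint_add h4 (hasint_scale 2^-1 h5))).
rewrite mulr0 addr0 oppr0 addr0; set c := (X in hasint _ X) => -[iF eF].
suff e x : I x -> Err x = (Wt w x i 0 * sn k x + - (Wt u x i 0 * sn k x) +
    - (\sum_l (w x l 0 - u x l 0) * test_fun Df u i k x l 0)) +
    - ((om k * cn k x *: (b0 x *m dl x) - 2^-1 * sn k x *: (b0 x *m (fmat [::] (u x) *m dl x)) +
       sn k x *: (b0 x *m (dx w x - dx u x))) i 0 + 2^-1 * (G x *m Ga x + D x *m - V x) i 0).
  split; last exact: etrans (int_eq e) eF.
  by apply: (intg_eq _ _ iF) => // x /e ->.
move=> Ix; have -> : \sum_l (w x l 0 - u x l 0) * test_fun Df u i k x l 0 = \sum_l dl x l 0 * test_fun Df u i k x l 0.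
  by apply: eq_bigr => l _; congr (_ * _); rewrite !mxE.
rewrite test_fun_dot // /gzz -[gal u x]/(a0 x) -[tails _ _ x]/(Ga0 x) -[gbe u x]/(b0 x).
have -> : Wt w x = b0 x *m dx w x - 2^-1 *: (D x *m (b0 x *m dx w x)).
  rewrite /Wt; have -> : gbe w x = b0 x - 2^-1 *: (D x *m b0 x) by rewrite -scaleNr -be_diff// addrC subrK.
  by rewrite mulmxBl -scalemxAl mulmxA.
rewrite -[Wt u x]/(b0 x *m dx u x) [b0 x *m (dx w x - _)]mulmxBr mulmxN /V -scalemxAr /Err.
set A1 := b0 x *m dx w x; set A2 := b0 x *m dx u x; set A3 := G x *m Ga x.
move: A1 A2 A3 (D x *m A1) (b0 x *m dl x) (b0 x *m (fmat [::] (u x) *m dl x)) (b0 x *m (_ *m _)) => A1 A2 A3 A4 A5 A6 A7.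
by rewrite !mxE; ring.
Qed.


Variables (B Z : R).
Hypotheses (hB : `|w| <= B) (hZ : forall x, I x -> nv (dl x) <= Z) (Z0 : 0 <= Z).
Let KG : R := Num.sqrt L%:num * (m%:R * (tb * K * B)).
Let c1 : R := tb * (m%:R * K).
Let c2 : R := Num.sqrt L%:num * (om k * tb * (m%:R * K) + 2^-1 * tb * (m%:R * (K * (m%:R * K)))).
Let P : R := m%:R * (2^-1 * (m%:R * (Num.sqrt L%:num * (m%:R * (m%:R * (K * K) * K)) * K)) * (m%:R * (K * (m%:R * (K * KG))))).
Let Q : R := m%:R * (K * (m%:R * (K * (m%:R * (K * KG))))).
Let S : R := m%:R * (K * (m%:R * ((K + K * Z) * (m%:R * K)))).

Let B0 : 0 <= B. Proof. exact: le_trans (normr_ge0 _) hB. Qed.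
Let tb0 : 0 <= tb. Proof. exact: tb_ge0. Qed.

Let Ga_bound x : I x -> vb KG (Ga x).
Proof.
move=> Ix l; have := hd_dist (hd_Ga l 0) Ix (IL (L := L)); rewrite GaL [X in _ - X]mxE subr0 => h.
apply: le_trans h _; rewrite ler_wpM2l ?sqrtr_ge0//.
rewrite (nrm_eq (g := fun y => \sum_j - (sn k y * b0 y l j) * dx w y j 0)); last first.
  by move=> y _; rewrite !mxE mulr_sumr -sumrN; apply: eq_bigr => j _; rewrite mulrA mulNr.
have Lj j : L2fun L (fun y => - (sn k y * b0 y l j) * dx w y j 0).
  by apply: L2_mul (L2_dx w j); apply: cts_opp; apply: cts_mul (@cb u l j); exact: cts_sn.
apply: le_trans (nrm_sum _ Lj) _; apply: (@le_trans _ _ (\sum_(j < m) tb * K * B)).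
  apply: ler_sum => j _; apply: (@le_trans _ _ (tb * K * nrmI (fun y => dx w y j 0))).
    apply: nrm_dom => [||//|y Iy]; rewrite ?mulr_ge0//; first exact: L2_dx.
    rewrite normrM normrN normrM ler_wpM2r//; apply: ler_pM => //; first exact: sn_le.
    by have [h1 _ _] := Kg u Iy; exact: h1.
  by rewrite ler_wpM2l ?mulr_ge0//; have [_ h2] := nrm_H1 w j; exact: le_trans h2 hB.
by rewrite sumr_const card_ord mulr_natl.
Qed.

(** Up to the factor - 1/2, [Err] is the sum of three quadratic terms: the difference of the gauges
    times that of f, the Taylor remainder of f, and the linear part of f times the difference of the
    tails. *)
Let Err_bound x : I x -> `|Err x| <= 2^-1 * ((P + S * c2) * (N * nv (dl x)) + (Q + S * c1) * nv (dl x) ^+ 2).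
Proof.
move=> Ix; have [h1 h2 h3] := Kg u Ix; have [d1 d2] := Kf (u x) (w x).
rewrite -[w x - u x]/(dl x) in d1 d2; set n := nv (dl x) in d1 d2 *; have n0 : 0 <= n by exact: nv_ge0.
pose F := \sum_l dl x l 0 *: fmat [:: l] (u x).
rewrite -[\sum_l _]/F -[fmat [::] (w x) - _]/(df x) in d1 d2.
have dF : mb ((K + K * Z) * n) F.
  move=> a b; have -> : F a b = df x a b - (df x - F) a b by rewrite -{1}[F](subKr (df x)) [LHS]mxE [X in _ + X = _]mxE.
  apply: le_trans (ler_normB _ _) _; rewrite mulrDl; apply: lerD => //.
  by apply: le_trans (d2 a b) _; rewrite expr2 !mulrA ler_wpM2r// ler_wpM2l// hZ.
have z1 := vb_mul h2 (Ga_bound Ix).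
have b10 : mb (2^-1 * (m%:R * (Num.sqrt L%:num * (m%:R * (m%:R * (K * K) * K) * N) * K))) (b1 x - b0 x).
  move=> a b; rewrite (be_diff Ix) mxE normrM normrN [`|2^-1|]gtr0_norm ?invr_gt0//; apply: ler_wpM2l; first by rewrite invr_ge0.
  exact: mb_mul (D_bound Ix) h1 a b.
have t1 := vb_mul b10 (vb_mul d1 z1); have t2 := vb_mul h1 (vb_mul d2 z1).
have t3 := vb_mul h1 (vb_mul dF (vb_mul h2 (Ga_diff Ix))).
have -> : Err x = - 2^-1 * (((b1 x - b0 x) *m (df x *m (a0 x *m Ga x))) i 0 +
    (b0 x *m ((df x - F) *m (a0 x *m Ga x))) i 0 + (b0 x *m (F *m (a0 x *m (Ga x - Ga0 x)))) i 0).
  rewrite /Err; have -> : G x *m Ga x = b1 x *m (df x *m (a0 x *m Ga x)) by rewrite /G !mulmxA.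
  by rewrite (mulmxBr (a0 x) (Ga x) (Ga0 x)); exact: mul_diff3.
rewrite normrM normrN [`|2^-1|]gtr0_norm ?invr_gt0//; apply: ler_wpM2l; first by rewrite invr_ge0.
apply: le_trans (ler_normD _ _) _; apply: le_trans (lerD (ler_normD _ _) (lexx _)) _.
apply: le_trans (lerD (lerD (t1 i) (t2 i)) (t3 i)) _; apply: eqle.
rewrite -/n /P /S /Q /c1 /c2 /KG; ring.
Qed.

Definition increment_const : R := 2^-1 * ((P + S * c2) * Num.sqrt L%:num + (Q + S * c1)).

Lemma increment_bound : `|ipI (fun x => Wt w x i 0) (sn k) - ipI (fun x => Wt u x i 0) (sn k) -
  \sum_l ipI (fun x => w x l 0 - u x l 0) (fun x => test_fun Df u i k x l 0)| <= increment_const * N ^+ 2.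
Proof.
have P0 : 0 <= P + S * c2.
  by apply: addr_ge0; rewrite !mulr_ge0 ?addr_ge0 ?mulr_ge0 ?invr_ge0 ?sqrtr_ge0 ?om_ge0 ?pi_ge0.
rewrite /increment_const.
have [iE <-] := hasint_Err.
have h1 : hasint (L := L) (fun x => nv (dl x)) (\int[mu]_(x in I) nv (dl x)) by split => //; exact: L2_intg1.
have h2 : hasint (L := L) (fun x => nv (dl x) ^+ 2) (N ^+ 2).
  by split; [exact: L2_sqr|rewrite sqr_nrm ipE2].
have [iB eB] := hasint_scale 2^-1 (hasint_add (hasint_scale (P + S * c2) (hasint_scale N h1)) (hasint_scale (Q + S * c1) h2)).
apply: le_trans (int_abs (mI (L := L)) iE iB Err_bound) _; rewrite eB -[X in _ <= X]mulrA; apply: ler_wpM2l; first by rewrite invr_ge0.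
rewrite [X in _ <= X]mulrDl; apply: lerD => //; rewrite -[X in _ <= X]mulrA; apply: ler_wpM2l => //.
rewrite expr2 mulrCA; apply: ler_wpM2l => //.
exact: le_trans (ler_norm _) (int_le_nrm Lnv).
Qed.

End Increment.

Lemma nv_H1 u w x : nv (w x - u x) <= m%:R * (cS (R := R) (L := L) * `|w - u|).
Proof.
rewrite /nv; apply: (@le_trans _ _ (\sum_(l < m) cS (R := R) (L := L) * `|w - u|)).
  by apply: ler_sum => l _; have := H1_sup (w - u) l x; rewrite !mxE.
by rewrite sumr_const card_ord mulr_natl.
Qed.

(** The remainder involves the L2 norm of w - u only, not its H^1 norm: along a solution the square
    of the former is o(s - t), by [solution_increment], which nothing ensures for the latter. *)
Lemma Wt_taylor u i k B : exists2 C : R, 0 <= C & forall w, `|w| <= B ->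
  `|ipI (fun x => Wt w x i 0) (sn k) - ipI (fun x => Wt u x i 0) (sn k) -
    \sum_l ipI (fun x => w x l 0 - u x l 0) (fun x => test_fun Df u i k x l 0)| <= C * nrmI (fun x => nv (w x - u x)) ^+ 2.
Proof.
have [K1 K10 h1] := gauge_uniform; have [K2 K20 h2] := fmat_taylor.
have [B0|B0] := leP 0 B; last first.
  by exists 0 => // w wB; have := lt_le_trans B0 (normr_ge0 w); rewrite ltNge wB.
have mbW (M N : R) (X : 'M[R]_m) : M <= N -> mb M X -> mb N X by move=> MN h a b; exact: le_trans (h a b) MN.
pose Z := m%:R * (cS (R := R) (L := L) * (B + `|u|)).
have Z0 : 0 <= Z by rewrite !mulr_ge0 ?cS_ge0// addr_ge0.
exists `|increment_const k (K1 + K2) B Z| => // w wB.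
apply: le_trans (@increment_bound u w i k (K1 + K2) (addr_ge0 K10 K20) _ _ B Z wB _ Z0) _.
- move=> v x Ix; have [a1 a2 a3] := h1 v x Ix.
  by split; [apply: mbW a1|apply: mbW a2|apply: mbW a3]; rewrite lerDl.
- move=> a b; have [b1 b2] := h2 a b.
  by split; [apply: mbW b1|apply: mbW b2]; rewrite ler_wpM2r ?exprn_ge0 ?nv_ge0// lerDr.
- move=> x _; apply: le_trans (nv_H1 u w x) _; rewrite ler_wpM2l// ler_wpM2l ?cS_ge0//.
  by apply: le_trans (ler_normB _ _) _; rewrite lerD2r.
by rewrite ler_wpM2r ?exprn_ge0 ?nrm_ge0// ler_norm.
Qed.

End GaugeTaylor.

(** * Comparing derivatives *)

Section DerivativeComparison.
Context {R : realType}.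
Implicit Types (F G : R -> R) (t d : R).

(** Carries a derivative from G, linear in the solution, to a nonlinear functional F tangent to it:
    the difference quotient of F - G is bounded by e. *)
Lemma is_derive_compare F G (e : R -> R) t d : is_derive t 1 G d -> e s @[s --> t] --> 0 ->
  (\forall s \near t, `|F s - F t - (G s - G t)| <= e s * `|s - t|) -> is_derive t 1 F d.
Proof.
move=> dG e0 h; pose H s := F s - G s.
have lim : h0^-1 *: ((H \o shift t) (h0 *: 1) - H t) @[h0 --> 0^'] --> (0 : R).
  apply/cvgrPdist_lt => r r0; have e1 : \forall s \near t, `|e s| < r.
    by move/cvgrPdist_lt : e0 => /(_ _ r0); apply: filterS => s; rewrite sub0r normrN.
  have h2 : \forall z \near (0 : R), `|F (t + z) - F t - (G (t + z) - G t)| <= e (t + z) * `|t + z - t| /\ `|e (t + z)| < r.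
    apply: (proj1 (@nbhs0P _ _ (fun s => `|F s - F t - (G s - G t)| <= e s * `|s - t| /\ `|e s| < r) t)).
    exact: filterI h e1.
  near=> z.
  have z0 : z != 0 by near: z; exact: nbhs_dnbhs_neq.
  rewrite sub0r normrN /= /H [z *: 1]mulr1 normrM normfV mulrC ltr_pdivrMr ?normr_gt0//.
  have [hz1 hz2] : `|F (t + z) - F t - (G (t + z) - G t)| <= e (t + z) * `|t + z - t| /\ `|e (t + z)| < r.
    by near: z; exact: nbhs_dnbhs.
  have -> : F (z + t) - G (z + t) - (F t - G t) = F (t + z) - F t - (G (t + z) - G t) by rewrite [z + t]addrC; ring.
  apply: le_lt_trans hz1 _; rewrite [t + z]addrC addrK ltr_pM2r ?normr_gt0//.
  by rewrite [z + t]addrC; exact: le_lt_trans (ler_norm _) hz2.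
have dH : is_derive t 1 H 0.
  by apply: DeriveDef; [apply/cvg_ex; exists 0|exact/cvg_lim].
rewrite -[d]add0r; apply: is_derive_near (is_derive_add dH dG).
by near=> s; rewrite /H subrK.
Unshelve. all: by end_near. Qed.

Lemma derive_bound_le F (dF : R -> R) (a b K : R) : a <= b -> (forall t, a <= t <= b -> is_derive t 1 F (dF t)) ->
  (forall t, a <= t <= b -> `|dF t| <= K) -> `|F b - F a| <= K * (b - a).
Proof.
move=> ab h hK; have W t : a < t < b -> a <= t <= b by case/andP=> *; rewrite !ltW.
have cF c : {within `[a, b], continuous (fun s => K * s + c * F s)}.
  apply: continuous_in_subspaceT => t; rewrite inE /= in_itv /= => tab.
  by apply: cvgD; apply: cvgM; try exact: cvg_cst; [exact: cvg_id|exact: is_derive_continuous (h t tab)].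
have key c : `|c| = 1 -> K * a + c * F a <= K * b + c * F b.
  move=> c1; apply: (@derive_ge0_le _ (fun s => K * s + c * F s) (fun t => K * 1 + c * dF t)) => // t /W tab.
    by apply: is_derive_add; apply: is_derive_scale; exact: h.
  rewrite mulr1 -lerBlDr sub0r; have := hK t tab; apply: le_trans.
  by rewrite -[X in _ <= X]mul1r -c1 -normrM -normrN ler_norm.
have := key 1 (normr1 _); have := key (-1); rewrite normrN normr1 => /(_ erefl) h1 h2.
by rewrite ler_norml; apply/andP; split; lra.
Qed.

Lemma sum_le_const (n : nat) (F : 'I_n -> R) (K : R) : (forall l, F l <= K) -> \sum_l F l <= n%:R * K.
Proof.
move=> h; apply: (@le_trans _ _ (\sum_(l < n) K)); first exact: ler_sum.
by rewrite sumr_const card_ord mulr_natl.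
Qed.

Lemma sqr_sum_le (n : nat) (a : 'I_n -> R) : (\sum_l a l) ^+ 2 <= n%:R * \sum_l a l ^+ 2.
Proof.
rewrite expr2 mulr_suml; apply: (@le_trans _ _ (\sum_i \sum_j 2^-1 * (a i ^+ 2 + a j ^+ 2))).
  apply: ler_sum => i _; rewrite mulr_sumr; apply: ler_sum => j _.
  by have := sqr_ge0 (a i - a j); rewrite sqrrB mulr2n; lra.
apply: eqle; set T := \sum_l a l ^+ 2.
have -> : \sum_i \sum_j 2^-1 * (a i ^+ 2 + a j ^+ 2) = \sum_i (2^-1 * (n%:R * a i ^+ 2) + 2^-1 * T).
  by apply: eq_bigr => i _; rewrite -mulr_sumr big_split /= sumr_const card_ord mulr_natl mulrDr.
by rewrite big_split /= -!mulr_sumr sumr_const card_ord -/T -[_ *+ n]mulr_natl; field.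
Qed.

End DerivativeComparison.

(** * Time regularity from the weak form *)

Section SolutionDerivatives.
Context {R : realType} {L : {posnum R}} {m : nat}.
Local Notation ipI := (ip (L := L)).
Local Notation nrmI := (nrm (L := L)).
Variables (Df : 'I_m -> 'I_m -> jet R m) (Dg : 'I_m -> jet R m).
Hypotheses (tDf : forall i j, tame (Df i j)) (tDg : forall i, tame (Dg i)).
Local Notation fmat := (fmat Df).
Local Notation gvec := (gvec Dg).
Local Notation rhs_vec := (rhs_vec (L := L) Df Dg).
Local Notation weak_form := (weak_form (L := L) Df Dg).
Variable u : R -> H1 L m.
Hypothesis sol : is_solution (fmat [::]) gvec u.
Implicit Types (t s x : R) (i l : 'I_m).

Let Lu w i : L2fun L (fun x => (w : H1 L m) x i 0). Proof. exact: L2_cts (@cts_H1 R L m w i). Qed.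
Let Lr w i : L2fun L (fun x => rhs_vec w x i 0). Proof. exact: rhs_vec_L2. Qed.

(** The weak form is stated for elements of [H1]; a test function given by formulas p and q agrees
    on [0, L] with such an element, and q with its derivative up to a null set. *)
Lemma test_derive (p q : R -> 'cV[R]_m) t : weak_deriv L p q -> 0 < t ->
  is_derive t 1 (fun s => \sum_l ipI (fun x => u s x l 0) (fun x => p x l 0)) (weak_form (u t) p q).
Proof.
move=> hpq t0; have [phi [e1 e2]] := H1_exists hpq; have [_ /(_ phi t t0)] := sol.
have Lq l : L2fun L (fun x => q x l 0) by case: (hpq l).
have -> : - ipL2 L (dx (u t)) (dx phi) - ipL2 L (fun x => fmat [::] (u t x) *m dx (u t) x + gvec (u t x) + u t x) phi =
    weak_form (u t) p q.
  rewrite /weak_form; congr (- _ - _); apply: eq_bigr => l _.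
    rewrite -[LHS]/(ipI (fun x => dx (u t) x l 0) (fun x => dx phi x l 0)) ipC [RHS]ipC.
    exact: ip_nrm0 (L2_dx phi l) (Lq l) (L2_dx (u t) l) (e2 l).
  by apply: ip_eq => x Ix; rewrite e1.
by apply: is_derive_near; near=> s; apply: eq_bigr => l _; apply: ip_eq => x Ix; rewrite e1.
Unshelve. all: by end_near. Qed.

Lemma reaction_le : exists2 K : R, 0 <= K & forall w l,
  nrmI (fun x => rhs_vec w x l 0 - w x l 0) <= K * (\sum_j nrmI (fun x => dx w x j 0) + 1).
Proof.
have [M M0 hM] := fmat_bound tDf; have [N N0 hN] := gvec_bound tDg.
have q0 : 0 <= N * Num.sqrt L%:num by rewrite mulr_ge0// sqrtr_ge0.
exists (M + N * Num.sqrt L%:num) => [|w l]; first exact: addr_ge0.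
have cf j : cts (L := L) (fun x => fmat [::] (w x) l j) by exact: hd_cts (hdM_tame [::] tDf (dxP w) l j).
have cg : cts (L := L) (fun x => Dg l [::] (w x)) by apply: cts_tame (tDg l) _ => i; exact: cts_H1.
have Lj j : L2fun L (fun x => fmat [::] (w x) l j * dx w x j 0) by exact: L2_mul (@cf j) (L2_dx w j).
have LS : L2fun L (fun x => \sum_j fmat [::] (w x) l j * dx w x j 0) by exact: L2_sum.
rewrite (nrm_eq (g := fun x => \sum_j fmat [::] (w x) l j * dx w x j 0 + Dg l [::] (w x))); last first.
  by move=> x _; rewrite !mxE addrK.
have d0 : 0 <= \sum_j nrmI (fun x => dx w x j 0) by apply: sumr_ge0 => j _; exact: nrm_ge0.
rewrite mulrDr mulr1; apply: le_trans (nrmD LS (L2_cts cg)) _; apply: lerD; last first.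
  by apply: le_trans (nrm_bounded (L2_cts cg) N0 _) _ => //; rewrite lerDr.
apply: le_trans (nrm_sum _ Lj) _; apply: (@le_trans _ _ (M * \sum_j nrmI (fun x => dx w x j 0))).
  rewrite mulr_sumr; apply: ler_sum => j _.
  by apply: nrm_dom => // [|x Ix]; [exact: L2_dx|rewrite normrM ler_wpM2r// hM].
by rewrite ler_wpM2r// lerDl.
Qed.

Lemma weak_form_bound (B : R) : 0 <= B -> exists2 C : R, 0 <= C & forall w (phi : H1 L m), `|w| <= B ->
  `|weak_form w phi (dx phi)| <= C * `|phi|.
Proof.
move=> B0; have [K K0 hK] := reaction_le; pose C0 := K * (m%:R * B + 1) + B.
have C00 : 0 <= C0 by rewrite !addr_ge0 ?mulr_ge0 ?addr_ge0 ?mulr_ge0.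
have rb w l : `|w| <= B -> nrmI (fun x => rhs_vec w x l 0) <= C0.
  move=> wB; rewrite (nrm_eq (g := fun x => (rhs_vec w x l 0 - w x l 0) + w x l 0)) => [|x _]; last by rewrite subrK.
  apply: le_trans (nrmD (L2_sub (Lr w l) (Lu w l)) (Lu w l)) _; have [h1 _] := nrm_H1 w l.
  apply: lerD; last exact: le_trans h1 wB.
  apply: le_trans (hK w l) _; rewrite ler_wpM2l// lerD2r; apply: sum_le_const => j.
  by have [_ h2] := nrm_H1 w j; exact: le_trans h2 wB.
exists (m%:R * B + m%:R * C0) => [|w phi wB]; first by rewrite addr_ge0 ?mulr_ge0.
rewrite /weak_form; apply: le_trans (ler_normB _ _) _; rewrite normrN mulrDl.
have sB (F : 'I_m -> R) D : (forall l, `|F l| <= D * `|phi|) -> `|\sum_l F l| <= m%:R * D * `|phi|.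
  by move=> h; apply: le_trans (ler_norm_sum _ _ _) _; rewrite -mulrA; exact: sum_le_const.
apply: lerD; apply: sB => l; (apply: le_trans (le_ip _ _) _); try exact: L2_dx; try exact: Lr; try exact: Lu.
  apply: ler_pM; rewrite ?nrm_ge0//; last by have [] := nrm_H1 phi l.
  by have [_ h] := nrm_H1 w l; exact: le_trans h wB.
apply: ler_pM; rewrite ?nrm_ge0//; first exact: rb.
by have [] := nrm_H1 phi l.
Qed.

Lemma solution_local_bound t : 0 < t -> exists2 r : R, 0 < r & forall s, `|s - t| <= r -> 0 < s /\ `|u s| <= `|u t| + 1.
Proof.
move=> t0; have [/subspace_continuousP cu _] := sol.
have := cu t; rewrite /= in_itv /= andbT ltW// => /(_ isT) /cvgrPdist_lt /(_ 1 ltr01).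
rewrite near_withinE => h; have h2 : \forall s \near t, 0 < s by exact: lt_nbhsr.
have [r /= r0 hr] := (@nbhs_ballP _ _ t _).1 (filterI h h2).
exists (r / 2) => [|s hs]; first exact: divr_gt0.
have [|h3 h4] := hr s.
  by rewrite /ball /= distrC; apply: le_lt_trans hs _; rewrite ltr_pdivrMr// ltr_pMr// ltr1n.
split => //; have := h3 _; rewrite /= in_itv /= andbT ltW// => /(_ isT) h5.
have -> : u s = u t - (u t - u s) by rewrite subKr.
by apply: le_trans (ler_normB _ _) _; rewrite lerD2l ltW.
Qed.

Lemma solution_cvg t : 0 < t -> `|u s - u t| @[s --> t] --> 0.
Proof.
move=> t0; have [/subspace_continuousP cu _] := sol.
have := cu t; rewrite /= in_itv /= andbT ltW// => /(_ isT) ct.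
apply/cvgrPdist_lt => e e0; move/cvgrPdist_lt : ct => /(_ e e0); rewrite near_withinE => h.
near=> s; rewrite sub0r normrN normr_id distrC; have h3 : 0 < s by near: s; exact: lt_nbhsr.
suff : [set` `[0, +oo[] s -> `|u t - u s| < e by apply; rewrite /= in_itv /= andbT ltW.
by near: s.
Unshelve. all: by end_near. Qed.

Lemma solution_continuous : continuous (fun t => u (Num.max 0 t)).
Proof.
have [/subspace_continuousP cu _] := sol => t; have m0 : 0 <= Num.max 0 t by rewrite le_max lexx.
apply/(@cvgrPdist_lt _ _ _ (nbhs t)) => e e0.
have := cu (Num.max 0 t); rewrite /= in_itv /= andbT m0 => /(_ isT) /cvgrPdist_lt /(_ _ e0).
rewrite near_withinE => h.
have cm : Num.max 0 s @[s --> t] --> Num.max 0 t.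
  by apply: (@continuous_max _ _ (cst 0) id); [exact: cst_continuous|move=> ?].
have hs : \forall s \near t, [set` `[0, +oo[] (Num.max 0 s) -> `|u (Num.max 0 t) - u (Num.max 0 s)| < e := cm _ h.
by apply: filterS hs => s; apply; rewrite /= in_itv /= le_max lexx.
Qed.

(* The increment u s - u t is itself an admissible test function. *)
Lemma solution_increment t : 0 < t -> exists2 C : R, 0 <= C & \forall s \near t,
  nrmI (fun x => nv (u s x - u t x)) ^+ 2 <= C * `|u s - u t| * `|s - t|.
Proof.
move=> t0; have [r r0 hr] := solution_local_bound t0.
have B0 : 0 <= `|u t| + 1 by rewrite addr_ge0.
have [C C0 hC] := weak_form_bound B0; exists (m%:R * C); first by rewrite mulr_ge0.
near=> s; have hs : `|s - t| <= r.
  by near: s; apply/nbhs_ballP; exists r => //= s; rewrite /ball /= distrC => /ltW.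
pose phi := u s - u t; pose g y := \sum_l ipI (fun x => u y x l 0) (fun x => phi x l 0).
have gl : `|g s - g t| <= C * `|phi| * `|s - t|.
  have dg (y : R) : 0 < y -> is_derive y 1 g (weak_form (u y) phi (dx phi)) by apply: test_derive; exact: dxP.
  have [ts|/ltW st] := leP t s.
    rewrite [`|s - t|]ger0_norm ?subr_ge0//; apply: derive_bound_le => // y /andP[y1 y2].
      by apply: (dg); exact: lt_le_trans y1.
    have [|_ h] := hr y; last exact: hC.
    by apply: le_trans hs; rewrite !ger0_norm ?subr_ge0// lerD2r.
  rewrite distrC [`|s - t|]distrC [`|t - s|]ger0_norm ?subr_ge0//.
  have hy (y : R) : s <= y <= t -> `|y - t| <= r.
    move=> /andP[y1 y2]; apply: le_trans hs; rewrite distrC [`|s - t|]distrC ger0_norm ?subr_ge0// ger0_norm ?subr_ge0//.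
    by rewrite lerD2l lerN2.
  apply: derive_bound_le => // y /hy /hr[y0 yB]; [exact: dg|exact: hC].
have Ld l : L2fun L (fun x => u s x l 0 - u t x l 0) by exact: L2_sub.
apply: (@le_trans _ _ (m%:R * `|g s - g t|)); last by rewrite -!mulrA ler_wpM2l// !mulrA.
have -> : g s - g t = \sum_l nrmI (fun x => u s x l 0 - u t x l 0) ^+ 2.
  rewrite /g -sumrB; apply: eq_bigr => l _; rewrite -ip_subl// sqr_nrm; apply: ip_eq => x _.
  by rewrite /phi H1B.
rewrite ger0_norm ?sumr_ge0// => [|l _]; last exact: sqr_ge0.
have Lnv : nrmI (fun x => nv (u s x - u t x)) <= \sum_l nrmI (fun x => u s x l 0 - u t x l 0).
  have La l := L2_abs (Ld l); apply: le_trans (_ : _ <= \sum_l nrmI (fun x => `|u s x l 0 - u t x l 0|)) _.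
    rewrite (nrm_eq (g := fun x => \sum_l `|u s x l 0 - u t x l 0|)); first exact: nrm_sum.
    by move=> x _; apply: eq_bigr => l _; rewrite !mxE.
  apply: ler_sum => l _; rewrite -[X in _ <= X]mul1r; apply: nrm_dom => // x _.
  by rewrite mul1r normr_id.
apply: le_trans (sqr_sum_le _); rewrite ler_sqr ?nnegrE ?nrm_ge0//.
by apply: sumr_ge0 => l _; exact: nrm_ge0.
Unshelve. all: by end_near. Qed.

End SolutionDerivatives.

(** * Solutions become orbits of the reduced equation *)

Section Conjugacy.
Context {R : realType} {L : {posnum R}} {m : nat}.
Local Notation ipI := (ip (L := L)).
Local Notation sn := (sn (L := L)).
Local Notation cn := (cn (L := L)).
Local Notation om := (om (L := L)).
Variables (Df : 'I_m -> 'I_m -> jet R m) (Dg : 'I_m -> jet R m).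
Hypotheses (tDf : forall i j, tame (Df i j)) (tDg : forall i, tame (Dg i)).
Local Notation fmat := (fmat Df).
Local Notation gvec := (gvec Dg).
Local Notation Wt := (Wt (L := L) Df).
Variable u : R -> H1 L m.
Hypothesis sol : is_solution (fmat [::]) gvec u.
Implicit Types (t s x : R) (i l : 'I_m) (k : nat).

Let ow_neq0 k : ow k != 0 :> R. Proof. exact: lt0r_neq0 (ow_gt0 _). Qed.

(** [test_identity] evaluates the derivative of the linearized functional; by [Wt_taylor] and
    [solution_increment] the error is at most |u s - u t| |s - t| up to a constant, and the first
    factor tends to 0. *)
Lemma W_derive t i k : 0 < t -> is_derive t 1 (fun s => ipI (fun x => Wt (u s) x i 0) (sn k))
  (- (om k ^+ 2 + 1) * ipI (fun x => Wt (u t) x i 0) (sn k) + fieldW (L := L) Df Dg (u t) (Wt (u t)) i k).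
Proof.
move=> t0; rewrite -(test_identity tDf tDg).
have [C C0 hC] := Wt_taylor tDf (u t) i k (`|u t| + 1); have [C' C'0 hC'] := solution_increment tDf tDg sol t0.
apply: (is_derive_compare (e := fun s => C * C' * `|u s - u t|) (test_derive sol (test_weak tDf (u t) i k) t0)).
  have c0 := solution_cvg sol t0; have cc : (fun _ : R => C * C') s @[s --> t] --> C * C' by exact: cvg_cst.
  by have := cvgM cc c0; rewrite mulr0; exact.
have [r r0 hr] := solution_local_bound sol t0; near=> s.
have [|_ sB] := hr s; first by near: s; apply/nbhs_ballP; exists r => //= s; rewrite /ball /= distrC => /ltW.
have h := hC _ sB; rewrite -sumrB; rewrite (eq_bigr (fun l => ipI (fun x => u s x l 0 - u t x l 0) (fun x => test_fun Df (u t) i k x l 0))).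
  apply: le_trans h _; rewrite -!mulrA ler_wpM2l// mulrA.
  by near: s.
move=> l _; rewrite ip_subl//; try exact: (L2_cts (@cts_H1 R L m _ _)).
exact: test_fun_L2.
Unshelve. all: by end_near. Qed.

Lemma fieldA_rhs (w : H1 L m) i k : fieldA (L := L) Df Dg w (Wt w) i k =
  ipI (fun x => rhs_vec Df Dg w x i 0 - w x i 0) (cn k).
Proof.
apply: ip_eq => x Ix.
have gv : gvv (L := L) Df w (Wt w) x = dx w x.
  by rewrite /gvv /Wt mulmxA (gauge_mulC (gaugeP tDf w) Ix) mul1mx.
by rewrite /flux gv /rhs_vec [(_ + w x) i 0]mxE addrK.
Qed.

Lemma a_derive t i k : 0 < t -> is_derive t 1 (fun s => ipI (fun x => u s x i 0) (cn k))
  (- (om k ^+ 2 + 1) * ipI (fun x => u t x i 0) (cn k) - fieldA (L := L) Df Dg (u t) (Wt (u t)) i k).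
Proof.
move=> t0; pose p x : 'cV[R]_m := \col_l (if l == i then cn k x else 0).
pose q x : 'cV[R]_m := \col_l (if l == i then - (om k * sn k x) else 0).
have hpq : weak_deriv L p q.
  move=> l; case: (eqVneq l i) => [->|/negPf li].
    have := hd_cn (L := L) k; apply: hd_eq => x _; by rewrite mxE eqxx ?mulNr.
  by apply: hd_eq (hd_cst (L := L) 0) => x _; rewrite mxE li.
have one (F : 'I_m -> R -> R) (G : R -> R) : \sum_l ipI (F l) (fun x => if l == i then G x else 0) = ipI (F i) G.
  rewrite (bigD1 i)//= eqxx big1 ?addr0// => l /negPf li; rewrite li.
  rewrite /ip (int_eq (g := cst 0)); last by move=> x _; rewrite mulr0.
  by rewrite Rintegral_cst ?mul0r//; exact: mI.
have := test_derive sol hpq t0; rewrite /weak_form.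
rewrite (eq_bigr (fun l => ipI (fun x => dx (u t) x l 0) (fun x => if l == i then - (om k * sn k x) else 0))); last first.
  by move=> l _; apply: ip_eq => x _; rewrite [q x l 0]mxE.
rewrite [\sum_l ipI (fun x => rhs_vec Df Dg _ x l 0) _](eq_bigr (fun l => ipI (fun x => rhs_vec Df Dg (u t) x l 0) (fun x => if l == i then cn k x else 0))); last first.
  by move=> l _; apply: ip_eq => x _; rewrite [p x l 0]mxE.
rewrite (one (fun l x => dx (u t) x l 0) (fun x => - (om k * sn k x))) (one (fun l x => rhs_vec Df Dg (u t) x l 0) (cn k)).
have e1 : ipI (fun x => dx (u t) x i 0) (fun x => - (om k * sn k x)) = om k ^+ 2 * ipI (fun x => u t x i 0) (cn k).
  rewrite expr2 -mulrA (om_cn k (weak_dx (u t) i)) mulrN ipC -[X in _ = - (_ * X)]ipC.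
  rewrite -ip_scalel; [|exact: L2_sn|exact: L2_dx].
  by rewrite /ip -mulN1r -int_scale; [apply: int_eq => x _; ring|exact: mI|apply: L2_intg (L2_dx _ _); apply: L2_scale; exact: L2_sn].
have Lw : L2fun L (fun x => u t x i 0) by exact: L2_cts (@cts_H1 R L m (u t) i).
have Lr : L2fun L (fun x => rhs_vec Df Dg (u t) x i 0) by exact: rhs_vec_L2.
have e2 : ipI (fun x => rhs_vec Df Dg (u t) x i 0) (cn k) = fieldA (L := L) Df Dg (u t) (Wt (u t)) i k + ipI (fun x => u t x i 0) (cn k).
  rewrite fieldA_rhs.
  by rewrite (ip_subl Lr Lw (@L2_cn R L k)) subrK.
rewrite e1 e2 => h; have {}h : is_derive t 1 (fun s => ipI (fun x => u s x i 0) (cn k))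
    (- (om k ^+ 2 * ipI (fun x => u t x i 0) (cn k)) - (fieldA (L := L) Df Dg (u t) (Wt (u t)) i k + ipI (fun x => u t x i 0) (cn k))).
  apply: is_derive_near h; near=> s; rewrite -(one (fun l x => u s x l 0) (cn k)).
  by apply: eq_bigr => l _; apply: ip_eq => x _; rewrite [p x l 0]mxE.
by apply: is_derive_eq h _; ring.
Unshelve. all: by end_near. Qed.

Variable E : H1 L m -> l2 R (m + m).
Hypothesis hE : emap (L := L) Df E.
Variable R0 : R.
Hypothesis R00 : 0 < R0.
Hypothesis uR0 : forall t, 0 <= t -> `|E (u t)| <= R0.

Lemma E_continuous : continuous E.
Proof.
move=> v; have [C C0 hC] := E_lip_mid tDf hE (addr_ge0 (normr_ge0 v) ler01).
apply/(@cvgrPdist_le _ _ _ (nbhs v)) => e e0.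
have d0 : 0 < Num.min 1 (e / (C + 1)) by rewrite lt_min ltr01 divr_gt0// ltr_wpDl.
have hs : \forall w \near v, `|v - w| < Num.min 1 (e / (C + 1)) by apply/nbhs_ballP; exists (Num.min 1 (e / (C + 1))).
apply: filterS hs => w; rewrite lt_min => /andP[h1 h2].
have n0 : `|v| <= `|v| + 1 by rewrite lerDl.
have [|h3 _] := hC v w n0.
  have -> : w = v - (v - w) by rewrite subKr.
  by apply: le_trans (ler_normB _ _) _; rewrite lerD2l ltW.
apply: le_trans h3 _; apply: (@le_trans _ _ ((C + 1) * (e / (C + 1)))).
  by apply: ler_pM => //; [rewrite lerDl|exact: ltW].
by rewrite mulrC divfK// gt_eqF// ltr_wpDl.
Qed.

Let cE : continuous (fun t => E (u (Num.max 0 t))).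
Proof.
by move=> t; apply: (@continuous_comp _ _ _ (fun t => u (Num.max 0 t)) E); [exact: solution_continuous sol t|exact: E_continuous].
Qed.

(** The orbit stays in the ball where the cut-off is 1. The field is evaluated at the functions
    rebuilt from coefficients: [rhat_E] gives back u itself, and [field_class] replaces [What] by
    [Wt], which has the same class. *)
Lemma E_fwd T : fwd (fun k => om k ^+ 2 + 1) (fun y k j => ow k * cut (gfield (L := L) Df Dg) R0 y (k, j)) T
  (fun t => E (u (Num.max 0 t))).
Proof.
move=> k j; split.
  by move=> t; apply: (@continuous_comp _ _ _ (fun t => E (u (Num.max 0 t))) (fun y => y k j 0)); [exact: cE|exact: l2_continuous_entry].
move=> t t0 _; apply: (is_derive_pos (f := fun s => E (u s) k j 0)) => //.
rewrite max_r ?ltW// cut_id ?uR0 ?ltW//.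
have cr i : cts (L := L) (fun x => rhat (L := L) (E (u t)) x i 0) by exact: cts_rhat.
have hf := field_class tDf tDg cr (fun i => (WhatP (L := L) (E (u t)) i).1) (L2_Wt tDf (u t)) (nrm_What_E tDf hE (u t)).
rewrite /gfield /= -(splitK j); case: (fintype.split j) => i; rewrite ?unsplitK /=; have [hA hW] := hf i k.
  rewrite -[E (u t) k _ 0]/(aco (E (u t)) i k) hA (rhat_E hE); have [-> _] := hE (u t) i k.
  have := is_derive_scale (ow k) (a_derive i k t0) => h; have {}h := is_derive_eq h _ ; apply: is_derive_near (h _ _).
    by near=> s; have [h1 _] := hE (u s) i k; exact: h1.
  by ring.
rewrite -[E (u t) k _ 0]/(wco (E (u t)) i k) hW (rhat_E hE); have [_ ->] := hE (u t) i k.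
have h := W_derive i k t0; have {}h := is_derive_eq h _ ; apply: is_derive_near (h _ _).
  by near=> s; have [_ h1] := hE (u s) i k; exact: h1.
by move: (fieldW _ _ _ _ _ _) => c; rewrite (mulVKf (ow_neq0 k)).
Unshelve. all: by end_near. Qed.

End Conjugacy.

(** * The spectral gap condition *)

Section SpectralGap.
Context {R : realType} {L : {posnum R}}.
Local Notation om := (om (L := L)).
Implicit Types (n k p : nat) (s C kappa : R).

Let c : R := pi / L%:num.

Let c0 : 0 < c. Proof. by rewrite divr_gt0// pi_gt0. Qed.

Let omE k : om k = c * k%:R. Proof. by rewrite /om /c [RHS]mulrC mulrA. Qed.

(** |k - n|: with truncated subtraction one of the two terms is 0. *)
Let nd n k : nat := ((k - n) + (n - k))%N.

Let sum_dist n p : \sum_(k < p) (ow (nd n k) ^+ 2)^-1 <= 6 :> R.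
Proof.
have w0 k : 0 <= (ow k ^+ 2)^-1 :> R by rewrite invr_ge0 sqr_ge0.
apply: (@le_trans _ _ (\sum_(k < n + p) (ow (nd n k) ^+ 2)^-1)).
  by rewrite addnC big_split_ord /= lerDl; apply: sumr_ge0.
rewrite big_split_ord /=; have -> : 6 = 3 + 3 :> R by ring.
apply: lerD; last first.
  rewrite (eq_bigr (fun k : 'I_p => (ow k ^+ 2)^-1)) ?sum_ow// => k _.
  by rewrite /nd addKn subnDA subnn sub0n addn0.
rewrite (reindex_inj rev_ord_inj) /= (eq_bigr (fun k : 'I_n => (ow k.+1 ^+ 2)^-1)); last first.
  move=> k _; congr (ow _ ^+ 2)^-1; rewrite /nd subKn//.
  by rewrite (eqP (leq_subr _ _ : _ - _ == 0)%N).
by apply: le_trans (@sum_ow R n.+1); rewrite big_ord_recl lerDr.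
Qed.

(** The denominator is c ^ 2 (k - n + s) (k + n - s). For s in [1/4, 1/2] the first factor is at
    least a quarter of |k - n| + 1 in absolute value and absorbs the weight at distance |k - n|; the
    second absorbs ow_k and leaves 1 / sqrt n. *)
Let quotient_bound n k s : (1 < n)%N -> 4^-1 <= s <= 2^-1 ->
  (ow k / `|om k ^+ 2 + 1 - (1 + (c * (n%:R - s)) ^+ 2)|) ^+ 2 <=
  64 / (c ^+ 4 * Num.sqrt n%:R) * (ow (nd n k) ^+ 2)^-1.
Proof.
move=> n1 /andP[s1 s2]; set d := nd n k.
have q0 : 0 < Num.sqrt n%:R :> R by rewrite sqrtr_gt0 ltr0n ltnW.
have D0 : 0 < d.+1%:R :> R by rewrite ltr0n.
have nk : (d.+1%:R : R) <= 4 * `|k%:R - n%:R + s|.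
  rewrite /d /nd -natr1; have [kn|kn] := leqP n k.
    rewrite (eqP (kn : n - k == 0)%N) addn0 natrB// ger0_norm; last first.
      by rewrite addr_ge0// ?subr_ge0 ?ler_nat//; lra.
    have : (n%:R : R) <= k%:R by rewrite ler_nat.
    lra.
  rewrite (eqP (ltnW kn : k - n == 0)%N) add0n natrB 1?ltnW// ler0_norm.
    by have h : k%:R + 1 <= n%:R :> R by [rewrite natr1 ler_nat]; lra.
  by have h : k%:R + 1 <= n%:R :> R by [rewrite natr1 ler_nat]; lra.
have n2 : 2 <= n%:R :> R by rewrite ler_nat.
have k0 : 0 <= k%:R :> R by [].
pose m := k%:R + n%:R - s; have m0 : 0 < m by rewrite /m; lra.
have -> : om k ^+ 2 + 1 - (1 + (c * (n%:R - s)) ^+ 2) = c ^+ 2 * ((k%:R - n%:R + s) * m).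
  by rewrite omE /m; ring.
rewrite normrM [`|_ * m|]normrM (gtr0_norm (exprn_gt0 2 c0)) (gtr0_norm m0).
set a := `|_|; rewrite -/a in nk; have a0 : 0 < a by move: D0 nk; lra.
have hd : ow d ^+ 2 <= 16 * a ^+ 2.
  apply: (@le_trans _ _ (d.+1%:R ^+ 2)); last first.
    have -> : 16 * a ^+ 2 = (4 * a) ^+ 2 by ring.
    by rewrite ler_sqr ?nnegrE ?mulr_ge0// ltW.
  rewrite sqr_ow expr2 ler_wpM2l// -[leRHS](sqr_sqrtr (ltW D0)) expr2 -[leLHS]mul1r.
  by rewrite ler_wpM2r ?sqrtr_ge0// -[leLHS]sqrtr1 ler_wsqrtr// ler1n.
have hk : ow k ^+ 2 * Num.sqrt n%:R <= 4 * m ^+ 2.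
  rewrite sqr_ow -mulrA -sqrtrM//; apply: (@le_trans _ _ ((k%:R + n%:R) * (k%:R + n%:R))).
    apply: ler_pM; rewrite ?sqrtr_ge0//; first by rewrite -natr1; lra.
    have e : 0 <= k%:R + n%:R :> R by rewrite addr_ge0.
    rewrite -[leRHS](ger0_norm e) -sqrtr_sqr ler_wsqrtr// expr2.
    by apply: ler_pM => //; rewrite -?natr1; lra.
  have -> : 4 * m ^+ 2 = (2 * m) * (2 * m) by ring.
  by apply: ler_pM; rewrite /m; lra.
have o0 : 0 < ow d :> R := ow_gt0 d.
have am : 0 < c ^+ 2 * (a * m) := mulr_gt0 (exprn_gt0 2 c0) (mulr_gt0 a0 m0).
rewrite expr_div_n ler_pdivrMr ?exprn_gt0//.
have -> : 64 / (c ^+ 4 * Num.sqrt n%:R) / ow d ^+ 2 * (c ^+ 2 * (a * m)) ^+ 2 =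
  (4 * m ^+ 2) * ((16 * a ^+ 2) / ow d ^+ 2) / Num.sqrt n%:R.
  by field; rewrite ?gt_eqF.
rewrite ler_pdivlMr//; apply: le_trans hk _.
by apply: ler_peMr; [rewrite mulr_ge0 ?sqr_ge0|rewrite ler_pdivlMr ?exprn_gt0// mul1r].
Qed.

(** 384 is 64 from [quotient_bound] times 6 from [sum_dist]; the sum is of order 1 / sqrt n, so a
    large n makes it as small as desired. *)
Let gap_sum N n s C kappa : (1 < n)%N -> 4^-1 <= s <= 2^-1 ->
  N%:R * C ^+ 2 * 384 / (c ^+ 4 * kappa ^+ 2) <= Num.sqrt n%:R -> 0 < kappa ->
  wsum N (fun k => C * ow k / `|om k ^+ 2 + 1 - (1 + (c * (n%:R - s)) ^+ 2)|) kappa.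
Proof.
move=> n1 hs hn k0 p.
have q0 : 0 < Num.sqrt n%:R :> R by rewrite sqrtr_gt0 ltr0n ltnW.
pose K := N%:R * C ^+ 2 * (64 / (c ^+ 4 * Num.sqrt n%:R)).
have c4 : 0 < c ^+ 4 by exact: exprn_gt0.
have K0 : 0 <= K.
  exact: mulr_ge0 (mulr_ge0 (ler0n _ _) (sqr_ge0 C)) (divr_ge0 (ler0n _ 64) (ltW (mulr_gt0 c4 q0))).
apply: (@le_trans _ _ (\sum_(k < p) K * (ow (nd n k) ^+ 2)^-1)).
  apply: ler_sum => k _; rewrite -mulrA exprMn /K -[X in _ <= X]mulrA [X in X <= _]mulrA.
  by apply: ler_wpM2l; [rewrite mulr_ge0 ?sqr_ge0|exact: quotient_bound].
rewrite -mulr_sumr; apply: le_trans (ler_wpM2l K0 (sum_dist n p)) _.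
have kk : 0 < kappa ^+ 2 by exact: exprn_gt0.
move: hn; rewrite (ler_pdivrMr _ _ (mulr_gt0 c4 kk)) => hn.
have -> : K * 6 = N%:R * C ^+ 2 * 384 / (c ^+ 4 * Num.sqrt n%:R) by rewrite /K; field; do ?[apply/andP; split]; rewrite gt_eqF// pi_gt0.
rewrite (ler_pdivrMr _ _ (mulr_gt0 c4 q0)); apply: le_trans hn _.
by apply: eqle; ring.
Qed.

Lemma spectral_gap N C kappa : 0 < kappa -> exists n th th' r,
  [/\ (1 < n)%N, 1 < th, th <= th', 1 < r <= 2 & r * th = th'] /\
  [/\ forall k, (k < n)%N -> om k ^+ 2 + 1 < th, forall k, (n <= k)%N -> th' < om k ^+ 2 + 1,
    wsum N (fun k => C * ow k / `|om k ^+ 2 + 1 - th|) kappa &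
    wsum N (fun k => C * ow k / `|om k ^+ 2 + 1 - th'|) kappa].
Proof.
move=> k0; set K := N%:R * C ^+ 2 * 384 / (c ^+ 4 * kappa ^+ 2).
pose n := (Num.truncn (K ^+ 2)).+2; exists n.
have n1 : (1 < n)%N by [].
have n2 : 2 <= n%:R :> R by rewrite ler_nat.
have Kn : K <= Num.sqrt n%:R.
  apply: le_trans (ler_norm _) _; rewrite -sqrtr_sqr ler_wsqrtr// ltW//.
  apply: lt_le_trans (truncnS_gt _) _; by rewrite ler_nat.
(* s = 1/2 and s = 1/4 give two rates between the eigenvalues of modes n - 1 and n. *)
clearbody n; pose th (s : R) : R := 1 + (c * (n%:R - s)) ^+ 2.
have c2 : 0 < c ^+ 2 by exact: exprn_gt0.
have tp s : 0 <= s <= 2^-1 -> 1 < th s.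
  by move=> /andP[s0 s1]; rewrite ltrDl exprn_gt0// mulr_gt0//; lra.
have tpos s : 0 <= s <= 2^-1 -> th s != 0.
  by move=> /tp h; rewrite gt_eqF// (lt_trans ltr01).
have r2 : 0 <= (2^-1 : R) <= 2^-1 by apply/andP; split; lra.
have r4 : 0 <= (4^-1 : R) <= 2^-1 by apply/andP; split; lra.
have lt1 : th 2^-1 < th 4^-1.
  have h2 : 0 <= n%:R - 2^-1 :> R by lra.
  have h4 : 0 <= n%:R - 4^-1 :> R by lra.
  rewrite ltrD2l ltr_pXn2r ?nnegrE ?(mulr_ge0 (ltW c0))// ltr_pM2l//.
  by rewrite ltrD2l ltrN2; lra.
exists (th 2^-1), (th 4^-1), (th 4^-1 / th 2^-1); split; split => //.
- exact: tp.
- exact: ltW.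
(* The ratio exceeds 1 because 1/4 < 1/2, and it is at most 2 because n >= 2. *)
- have t0 := lt_trans ltr01 (tp _ r2); rewrite ltr_pdivlMr// ler_pdivrMr// mul1r lt1 /=.
  have h : (n%:R - 4^-1) ^+ 2 <= 2 * (n%:R - 2^-1) ^+ 2 :> R by nra.
  have := ler_wpM2l (ltW c2) h; rewrite /th !exprMn; nra.
- by rewrite divfK// tpos.
- move=> k kn; rewrite addrC ltrD2l omE ltr_pXn2r ?nnegrE ?(mulr_ge0 (ltW c0))//; last by lra.
  have h : k%:R + 1 <= n%:R :> R by rewrite natr1 ler_nat.
  by rewrite ltr_pM2l//; lra.
- move=> k kn; rewrite addrC ltrD2l omE ltr_pXn2r ?nnegrE ?(mulr_ge0 (ltW c0))//; last by lra.
  have h : n%:R <= k%:R :> R by rewrite ler_nat.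
  by rewrite ltr_pM2l//; lra.
- by apply: gap_sum => //; apply/andP; split; lra.
- by apply: gap_sum => //; apply/andP; split; lra.
Qed.

End SpectralGap.

(** * Exponential decay *)

Section ExponentialDecay.
Context {R : realType}.

Lemma decay_le (F dF : R -> R) (D t : R) : continuous F -> (forall s : R, 0 < s -> is_derive s 1 F (dF s)) ->
  (forall s : R, 0 < s -> dF s <= D - F s) -> 0 <= t -> F t <= D + expR (- t) * (F 0 - D).
Proof.
move=> cF dF1 hF t0; pose G s := expR (1 * s) * (D - F s).
have G0 : G 0 <= G t.
  apply: (@derive_ge0_le _ G (fun s => expR (1 * s) * (0 - dF s) + (D - F s) * (1 * expR (1 * s)))) => //.
  - apply: continuous_subspaceT => s; apply: cvgM; last by apply: cvgB; [exact: cvg_cst|exact: cF].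
    exact: is_derive_continuous (is_derive_expM 1 s).
  - move=> s /andP[s0 _]; apply: is_derive_eq (is_derive_mul (is_derive_expM 1 s)
      (is_derive_sub (is_derive_const D s) (dF1 s s0))) _; ring.
  - move=> s /andP[s0 _]; rewrite !mul1r [X in _ + X]mulrC -mulrDr mulr_ge0 ?expR_ge0//.
    by have := hF s s0; lra.
move: G0; rewrite /G mulr0 expR0 !mul1r => h.
rewrite -lerBlDl -(ler_pM2l (expR_gt0 t)) mulrA -expRD subrr expR0 mul1r.
lra.
Qed.

End ExponentialDecay.

(** * Energy estimates and the absorbing set *)

Section Dissipation.
Context {R : realType} {L : {posnum R}} {m : nat}.
Local Notation ipI := (ip (L := L)).
Local Notation nrmI := (nrm (L := L)).
Local Notation cn := (cn (L := L)).
Local Notation om := (om (L := L)).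
Implicit Types (w : H1 L m) (l j : 'I_m) (n k : nat) (t s K : R).

Lemma bessel_cn h n : L2fun L h -> \sum_(k < n) ipI h (cn k) ^+ 2 <= nrmI h ^+ 2.
Proof.
move=> hh; pose q x := \sum_(k < n) ipI h (cn k) * cn k x.
have Lk k : L2fun L (fun x => ipI h (cn k) * cn k x) by exact: L2_scale (L2_cn k).
have Lq : L2fun L q by apply: L2_sum => k; exact: Lk.
have ipq g : L2fun L g -> ipI q g = \sum_(k < n) ipI h (cn k) * ipI (cn k) g.
  move=> hg; rewrite /q ip_suml//.
  by apply: eq_bigr => k _; rewrite ip_scalel.
set s := \sum_(k < n) _.
have e1 : ipI q h = s by rewrite ipq//; apply: eq_bigr => k _; rewrite [ipI (cn k) h]ipC expr2.
have e2 : ipI q q = s.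
  rewrite {1}ipq//; apply: eq_bigr => k _; rewrite [ipI (cn k) q]ipC ipq// (bigD1 k)//= orthonormal_cn eqxx mulr1.
  by rewrite big1 ?addr0 ?expr2// => j /negPf jk; rewrite orthonormal_cn (_ : (_ == _) = false) ?mulr0.
have := ip_ge0 (L := L) (fun x => h x - q x).
have Lhq := L2_sub hh Lq.
rewrite (ip_subl hh Lq Lhq) ipC (ip_subl hh Lq hh) [ipI q (fun _ => _ - _)]ipC (ip_subl hh Lq Lq).
rewrite [ipI h q]ipC e1 e2 sqr_nrm; lra.
Qed.

Definition grad2 w : R := \sum_l nrmI (fun x => dx w x l 0) ^+ 2.
Definition mass w : R := \sum_l nrmI (fun x => w x l 0) ^+ 2.
Definition energy n w : R := \sum_l \sum_(k < n) om k ^+ 2 * ipI (fun x => w x l 0) (cn k) ^+ 2.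

Let Lu w l : L2fun L (fun x => w x l 0). Proof. exact: L2_cts (@cts_H1 R L m w l). Qed.

Lemma energy_le n w : energy n w <= grad2 w.
Proof.
apply: ler_sum => l _; apply: le_trans (bessel n (L2_dx w l)); apply: ler_sum => k _.
by rewrite -exprMn (om_cn k (weak_dx w l)) sqrrN.
Qed.

Lemma grad2_le w l K : 0 <= K -> (forall n, energy n w <= K ^+ 2) -> nrmI (fun x => dx w x l 0) <= K.
Proof.
move=> K0 hK; apply: parseval_le => // [|n]; first exact: L2_dx.
apply: le_trans (hK n); rewrite /energy (bigD1 l)//= -[X in X <= _]addr0; apply: lerD.
  by apply: ler_sum => k _; rewrite -exprMn (om_cn k (weak_dx w l)) sqrrN.
by apply: sumr_ge0 => j _; apply: sumr_ge0 => k _; rewrite mulr_ge0 ?sqr_ge0.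
Qed.

Lemma mass_le w : mass w <= m%:R * `|w| ^+ 2.
Proof.
apply: sum_le_const => l.
by have [h _] := nrm_H1 w l; rewrite ler_sqr ?nnegrE ?nrm_ge0.
Qed.

Lemma grad2_norm w : grad2 w <= m%:R * `|w| ^+ 2.
Proof.
apply: sum_le_const => l.
by have [_ h] := nrm_H1 w l; rewrite ler_sqr ?nnegrE ?nrm_ge0.
Qed.

Lemma lip_continuous (phi : H1 L m -> R) : (forall a b, `|phi a - phi b| <= `|a - b|) -> continuous phi.
Proof.
move=> h v; apply/(@cvgrPdist_le _ _ _ (nbhs v)) => e e0.
have := @cvgr_dist_le _ _ _ (nbhs v) (nbhs_filter v) id v (@cvg_id _ (nbhs v)) _ e0.
by apply: filterS => u; apply: le_trans.
Qed.

Let csum_H1 (J : finType) (phi : J -> H1 L m -> R) : (forall b, continuous (phi b)) ->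
  continuous (fun w => \sum_b phi b w).
Proof.
move=> h; elim: (index_enum J) => [|b r IH].
  by rewrite (_ : (fun w => \sum_(b <- [::]) phi b w) = cst 0); [exact: cst_continuous|apply/funext => w; rewrite big_nil].
rewrite (_ : (fun w => \sum_(b0 <- b :: r) phi b0 w) = (fun w => phi b w + \sum_(b <- r) phi b w)).
  by move=> v; apply: (@cvgD _ _ _ (nbhs v) _ _ _ _ _ (h b v) (IH v)).
by apply/funext => w; rewrite big_cons.
Qed.

Let nrmB_H1 (a b : H1 L m) l : nrmI (fun x => a x l 0 - b x l 0) <= `|a - b|.
Proof.
have [h _] := nrm_H1 (a - b) l; apply: le_trans h.
by rewrite (nrm_eq (g := fun x => (a - b) x l 0))// => x _; rewrite H1B.
Qed.

Let cmul_H1 (phi psi : H1 L m -> R) : continuous phi -> continuous psi -> continuous (fun w => phi w * psi w).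
Proof. by move=> h1 h2 v; apply: (@cvgM _ _ (nbhs v) _ _ _ _ _ (h1 v) (h2 v)). Qed.

Lemma energy_continuous n : continuous (energy n).
Proof.
apply: csum_H1 => l; apply: csum_H1 => k; apply: cmul_H1; first exact: cst_continuous.
suff c : continuous (fun w : H1 L m => ipI (fun x => w x l 0) (cn k)) by exact (cmul_H1 c c).
apply: lip_continuous => a b; rewrite -ip_subl//.
have n1 : nrmI (cn k) = 1 by rewrite /nrm orthonormal_cn eqxx sqrtr1.
by apply: le_trans (le_ip (L2_sub (Lu a l) (Lu b l)) (L2_cn k)) _; rewrite n1 mulr1.
Qed.

Lemma mass_continuous : continuous mass.
Proof.
apply: csum_H1 => l.
suff c : continuous (fun w : H1 L m => nrmI (fun x => w x l 0)) by exact (cmul_H1 c c).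
have h (a b : H1 L m) : nrmI (fun x => a x l 0) - nrmI (fun x => b x l 0) <= `|a - b|.
  rewrite lerBlDr; apply: (@le_trans _ _ (nrmI (fun x => (a x l 0 - b x l 0) + b x l 0))).
    by rewrite (nrm_eq (g := fun x => (a x l 0 - b x l 0) + b x l 0))// => x _; rewrite subrK.
  by apply: le_trans (nrmD (L2_sub (Lu a l) (Lu b l)) (Lu b l)) _; rewrite lerD2r.
apply: lip_continuous => a b; rewrite ler_norml h andbT.
by have := h b a; rewrite [`|b - a|]distrC; lra.
Qed.

Variables (Df : 'I_m -> 'I_m -> jet R m) (Dg : 'I_m -> jet R m).
Hypotheses (tDf : forall i j, tame (Df i j)) (tDg : forall i, tame (Dg i)).
Local Notation fmat := (fmat Df).
Local Notation gvec := (gvec Dg).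
Local Notation rhs_vec := (rhs_vec (L := L) Df Dg).
Local Notation weak_form := (weak_form (L := L) Df Dg).

Let Lr w l : L2fun L (fun x => rhs_vec w x l 0). Proof. exact: rhs_vec_L2. Qed.

Let sqr_split (x y : R) : 2 * (x * y) <= x ^+ 2 + y ^+ 2.
Proof. by have := sqr_ge0 (x - y); rewrite sqrrB mulr2n; lra. Qed.

Let reaction_bound : exists2 K : R, 0 <= K & forall w l,
  nrmI (fun x => rhs_vec w x l 0 - w x l 0) ^+ 2 <= K * (grad2 w + 1).
Proof.
have [K K0 hK] := reaction_le (L := L) tDf tDg.
exists (2 * K ^+ 2 * (m%:R + 1)) => [|w l]; first by rewrite !mulr_ge0 ?sqr_ge0.
set A := \sum_j nrmI (fun x => dx w x j 0); have A0 : 0 <= A by apply: sumr_ge0 => j _; exact: nrm_ge0.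
apply: (@le_trans _ _ ((K * (A + 1)) ^+ 2)).
  by rewrite ler_sqr ?nnegrE ?nrm_ge0 ?mulr_ge0 ?addr_ge0//; exact: hK.
have hA : A ^+ 2 <= m%:R * grad2 w by exact: sqr_sum_le.
have p0 : 0 <= grad2 w by apply: sumr_ge0 => j _; exact: sqr_ge0.
have m0 : 0 <= m%:R :> R by [].
have -> : 2 * K ^+ 2 * (m%:R + 1) * (grad2 w + 1) = K ^+ 2 * (2 * (m%:R + 1) * (grad2 w + 1)) by ring.
rewrite exprMn; apply: ler_wpM2l; first exact: sqr_ge0.
have := sqr_split A 1; move: hA m0 p0; move: (grad2 w) (m%:R : R) => a b; nra.
Qed.

(* Compact support of f is used here: f(u)^T u is bounded, so that the drift
   term can be absorbed by the dissipation alone. *)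
Let weak_form_energy (B : R) : (forall i j a, `|fmat [::] a i j| * nv a <= B) ->
  exists2 K : R, 0 <= K & forall w, 2 * weak_form w w (dx w) <= K - mass w - grad2 w.
Proof.
move=> hB0; have {hB0}[B0 hB] : 0 <= `|B| /\ forall i j a, `|fmat [::] a i j| * nv a <= `|B|.
  by split => // i j a; apply: le_trans (hB0 i j a) (ler_norm B).
move: (`|B|) B0 hB => {}B B0 hB.
have [N N0 hN] := gvec_bound tDg.
set q := Num.sqrt L%:num; have q0 : 0 <= q by exact: sqrtr_ge0.
exists (\sum_(l < m) ((m%:R * (B * q)) ^+ 2 + (N * q) ^+ 2)) => [|w].
  by apply: sumr_ge0 => l _; rewrite addr_ge0 ?sqr_ge0.
have cf l j : cts (L := L) (fun x => fmat [::] (w x) l j) by exact: hd_cts (hdM_tame [::] tDf (dxP w) l j).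
have cg l : cts (L := L) (fun x => Dg l [::] (w x)) by apply: cts_tame (tDg l) _ => i; exact: cts_H1.
have Lj l j : L2fun L (fun x => fmat [::] (w x) l j * w x l 0) by exact: L2_mul (@cf l j) (Lu w l).
have Lf l j : L2fun L (fun x => fmat [::] (w x) l j * dx w x j 0) by exact: L2_mul (@cf l j) (L2_dx w j).
have LS l : L2fun L (fun x => \sum_j fmat [::] (w x) l j * dx w x j 0) by exact: L2_sum.
have e l : ipI (fun x => rhs_vec w x l 0) (fun x => w x l 0) =
    \sum_j ipI (fun x => dx w x j 0) (fun x => fmat [::] (w x) l j * w x l 0) +
    ipI (fun x => Dg l [::] (w x)) (fun x => w x l 0) + nrmI (fun x => w x l 0) ^+ 2.
  rewrite sqr_nrm (ip_eq (u := fun x => (\sum_j fmat [::] (w x) l j * dx w x j 0 + Dg l [::] (w x)) + w x l 0)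
    (v := fun x => w x l 0)); last by move=> x _; rewrite !mxE.
  rewrite (ip_addl (L2_add (LS l) (L2_cts (cg l))) (Lu w l) (Lu w l)) (ip_addl (LS l) (L2_cts (cg l)) (Lu w l)).
  congr (_ + _ + _); rewrite (ip_suml _ (Lf l) (Lu w l)).
  by apply: eq_bigr => j _; apply: ip_eq => x _; ring.
have b1 l j : `|ipI (fun x => dx w x j 0) (fun x => fmat [::] (w x) l j * w x l 0)| <=
    nrmI (fun x => dx w x j 0) * (B * q).
  apply: le_trans (le_ip (L2_dx w j) (Lj l j)) _; apply: ler_wpM2l; first exact: nrm_ge0.
  apply: nrm_bounded (Lj l j) B0 _ => x _; rewrite normrM; apply: le_trans (hB l j (w x)).
  by rewrite ler_wpM2l// le_nv.
have b2 l : `|ipI (fun x => Dg l [::] (w x)) (fun x => w x l 0)| <= N * q * nrmI (fun x => w x l 0).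
  apply: le_trans (le_ip (L2_cts (cg l)) (Lu w l)) _; apply: ler_wpM2r; first exact: nrm_ge0.
  exact: nrm_bounded (L2_cts (cg l)) N0 _.
have b3 l : - 2 * ipI (fun x => Dg l [::] (w x)) (fun x => w x l 0) <= (N * q) ^+ 2 + nrmI (fun x => w x l 0) ^+ 2.
  have := b2 l; have := sqr_split (N * q) (nrmI (fun x => w x l 0)); rewrite ler_norml => ? /andP[? ?]; lra.
have b4 : - 2 * \sum_l \sum_j ipI (fun x => dx w x j 0) (fun x => fmat [::] (w x) l j * w x l 0) <=
    \sum_j (nrmI (fun x => dx w x j 0) ^+ 2 + (m%:R * (B * q)) ^+ 2).
  rewrite exchange_big mulr_sumr; apply: ler_sum => j _.
  apply: (@le_trans _ _ (2 * (nrmI (fun x => dx w x j 0) * (m%:R * (B * q))))); last exact: sqr_split.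
  rewrite mulNr -mulrN; apply: ler_wpM2l => //; rewrite -sumrN mulrCA.
  by apply: sum_le_const => l; apply: le_trans (b1 l j); rewrite -normrN ler_norm.
rewrite /weak_form (eq_bigr (fun l => nrmI (fun x => dx w x l 0) ^+ 2)); last by move=> l _; rewrite sqr_nrm.
rewrite [\sum_l ipI (fun x => rhs_vec w x l 0) _](eq_bigr _ (fun l _ => e l)) !big_split /=.
rewrite -/(grad2 w) -/(mass w).
have b5 : - 2 * \sum_l ipI (fun x => Dg l [::] (w x)) (fun x => w x l 0) <= \sum_(l < m) (N * q) ^+ 2 + mass w.
  by rewrite mulr_sumr -big_split /=; apply: ler_sum => l _; exact: b3.
move: b4 b5; rewrite [in X in X -> _]big_split /= -/(grad2 w).
set x1 := \sum_l \sum_j _; set x2 := \sum_l _; lra.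
Qed.

(** The squared norm differs from its linearization at u t by |u s - u t| ^ 2, which is o(s - t) by
    [solution_increment]. *)
Let mass_derive u t : is_solution (fmat [::]) gvec u -> 0 < t ->
  is_derive t 1 (fun s => mass (u s)) (2 * weak_form (u t) (u t) (dx (u t))).
Proof.
move=> sol t0; have [C C0 hC] := solution_increment tDf tDg sol t0.
apply: (is_derive_compare (e := fun s => m%:R * C * `|u s - u t|)
  (is_derive_scale 2 (test_derive sol (dxP (u t)) t0))).
  have c0 := solution_cvg sol t0; have cc : (fun _ : R => m%:R * C) s @[s --> t] --> m%:R * C by exact: cvg_cst.
  by have := cvgM cc c0; rewrite mulr0; exact.
near=> s.
have -> : mass (u s) - mass (u t) - (2 * (\sum_l ipI (fun x => u s x l 0) (fun x => u t x l 0)) -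
    2 * (\sum_l ipI (fun x => u t x l 0) (fun x => u t x l 0))) =
    \sum_l nrmI (fun x => u s x l 0 - u t x l 0) ^+ 2.
  rewrite -mulrBr /mass -!sumrB mulr_sumr -sumrB; apply: eq_bigr => l _; rewrite !sqr_nrm.
  have Ld := L2_sub (Lu (u s) l) (Lu (u t) l).
  rewrite [RHS](ip_subl (Lu (u s) l) (Lu (u t) l) Ld) [ipI (fun x => u s x l 0) (fun _ => _ - _)]ipC.
  rewrite [ipI (fun x => u t x l 0) (fun _ => _ - _)]ipC.
  rewrite (ip_subl (Lu (u s) l) (Lu (u t) l) (Lu (u s) l)) (ip_subl (Lu (u s) l) (Lu (u t) l) (Lu (u t) l)).
  by rewrite [ipI (fun x => u t x l 0) (fun x => u s x l 0)]ipC; ring.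
rewrite ger0_norm; last by apply: sumr_ge0 => l _; exact: sqr_ge0.
apply: (@le_trans _ _ (m%:R * nrmI (fun x => nv (u s x - u t x)) ^+ 2)); last first.
  by rewrite -!mulrA ler_wpM2l// !mulrA; near: s.
apply: sum_le_const => l.
have cd j : cts (L := L) (fun x => `|u s x j 0 - u t x j 0|).
  by apply: cts_abs; apply: cts_sub; exact: cts_H1.
have cnv : cts (L := L) (fun x => nv (u s x - u t x)).
  apply: (@cts_eq _ _ (fun x => \sum_j `|u s x j 0 - u t x j 0|)) => [x _|]; last by exact: cts_sum.
  by apply: eq_bigr => j _; rewrite !mxE.
rewrite ler_sqr ?nnegrE ?nrm_ge0// -[X in _ <= X]mul1r; apply: nrm_dom => //.
- exact: L2_sub.
- exact: L2_cts.
- move=> x _; rewrite mul1r [X in _ <= X]ger0_norm ?nv_ge0//.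
  by have := le_nv (u s x - u t x) l; rewrite !mxE.
Unshelve. all: by end_near. Qed.

(** Mode by mode, Young's inequality [- 2 om ^ 2 a h <= om ^ 4 a ^ 2 + h ^ 2] pays for the reaction
    with half of the dissipation; Bessel's inequality sums the terms h ^ 2. *)
Let energy_derive u t n : is_solution (fmat [::]) gvec u -> 0 < t ->
  exists2 d : R, is_derive t 1 (fun s => energy n (u s)) d &
    d <= - energy n (u t) + \sum_l nrmI (fun x => rhs_vec (u t) x l 0 - u t x l 0) ^+ 2.
Proof.
move=> sol t0.
pose a l k := ipI (fun x => u t x l 0) (cn k).
pose h l k := ipI (fun x => rhs_vec (u t) x l 0 - u t x l 0) (cn k).
pose d l k := om k ^+ 2 * (a l k * (- (om k ^+ 2 + 1) * a l k - h l k) + a l k * (- (om k ^+ 2 + 1) * a l k - h l k)).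
exists (\sum_l \sum_(k < n) d l k).
  apply: is_derive_sumR => l; apply: is_derive_sumR => k; apply: is_derive_scale.
  have := a_derive tDf tDg sol l k t0; rewrite (fieldA_rhs Dg tDf) => h1.
  by have := is_derive_mul h1 h1; apply: is_derive_near; near=> s; rewrite expr2.
rewrite -sumrN -big_split /=; apply: ler_sum => l _.
have Lh := L2_sub (Lr (u t) l) (Lu (u t) l).
apply: le_trans (_ : _ <= - (\sum_(k < n) om k ^+ 2 * a l k ^+ 2) + \sum_(k < n) h l k ^+ 2) _; last first.
  by rewrite lerD2l; exact: bessel_cn.
rewrite -sumrN -big_split /=; apply: ler_sum => k _; rewrite /d.
have := sqr_split (om k ^+ 2 * a l k) (- h l k); have := sqr_ge0 (om k ^+ 2 * a l k).
have := sqr_ge0 (om k * a l k); have := sqr_ge0 (h l k).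
move: (om k) (a l k) (h l k) => x y z; nra.
Unshelve. all: by end_near. Qed.

(** The reaction may feed the energy with up to m K |u_x| ^ 2. The mass dissipates |u_x| ^ 2 at unit
    rate, so the weight c = 1 + m K compensates for it. *)
Lemma lyapunov (B : R) : (forall i j a, `|fmat [::] a i j| * nv a <= B) ->
  exists c D : R, [/\ 1 <= c, 0 <= D & forall u n t, is_solution (fmat [::]) gvec u -> 0 <= t ->
    energy n (u t) + c * mass (u t) <= D + expR (- t) * (energy n (u 0) + c * mass (u 0) - D)].
Proof.
move=> hB; have [K K0 hK] := reaction_bound; have [K' K'0 hK'] := weak_form_energy hB.
pose c := 1 + m%:R * K; have c1 : 1 <= c by rewrite lerDl mulr_ge0.
exists c, (m%:R * K + c * K'); split => // [|u n t sol t0].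
  by rewrite addr_ge0 ?mulr_ge0// (le_trans ler01).
set D := m%:R * K + c * K'.
pose F s := energy n (u (Num.max 0 s)) + c * mass (u (Num.max 0 s)).
have cF : continuous F.
  move=> s; apply: cvgD; last apply: cvgM; first 1 last.
  - exact: cvg_cst.
  - by apply: (@continuous_comp _ _ _ (fun s => u (Num.max 0 s)) mass); [exact: solution_continuous sol s|exact: mass_continuous].
  - by apply: (@continuous_comp _ _ _ (fun s => u (Num.max 0 s)) (energy n)); [exact: solution_continuous sol s|exact: energy_continuous].
have /choice[dF hF] (s : R) : exists d : R, 0 < s -> is_derive s 1 F d /\ d <= D - F s.
  case: (ltP 0 s) => [s0|_]; last by exists 0.
  have [d1 h1 h2] := energy_derive n sol s0; exists (d1 + c * (2 * weak_form (u s) (u s) (dx (u s)))) => _; split.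
    apply: is_derive_add; first exact: is_derive_pos s0 h1.
    by apply: is_derive_scale; exact: is_derive_pos s0 (mass_derive sol s0).
  have c0 : 0 <= c by exact: le_trans c1.
  rewrite /F (max_r (ltW s0)); have := ler_wpM2l c0 (hK' (u s)).
  have h3 : \sum_l nrmI (fun x => rhs_vec (u s) x l 0 - u s x l 0) ^+ 2 <= m%:R * K * (grad2 (u s) + 1).
    rewrite -mulrA; apply: sum_le_const => l; exact: hK.
  have p0 : 0 <= grad2 (u s) by apply: sumr_ge0 => l _; exact: sqr_ge0.
  move: h2 h3 p0; rewrite /D /c; move: (grad2 _) (mass _) (energy _ _) (\sum_l _) (weak_form _ _ _) (m%:R * K) => *; nra.
have := @decay_le _ F dF D t cF (fun s hs => (hF s hs).1) (fun s hs => (hF s hs).2) t0.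
by rewrite /F maxxx (max_r t0).
Qed.

(** The level D + 1 is above the limit level D: the sublevel set is forward invariant by the decay
    estimate, and is entered from a bounded set once the exponential has brought the excess below
    1. *)
Lemma absorbing_exists (B : R) (S : R -> H1 L m -> H1 L m) : (forall i j a, `|fmat [::] a i j| * nv a <= B) ->
  (forall u0, is_solution (fmat [::]) gvec (S ^~ u0)) -> (forall u0, S 0 u0 = u0) ->
  exists2 A, bounded_absorbing S A & forall t, 0 <= t -> S t @` A `<=` A.
Proof.
move=> hB sol S0; have [c [D [c1 D0 hV]]] := lyapunov hB.
have c0 : 0 <= c by exact: le_trans c1.
have m0 w : 0 <= mass w by apply: sumr_ge0 => l _; exact: sqr_ge0.
have e0 n w : 0 <= energy n w.
  by apply: sumr_ge0 => l _; apply: sumr_ge0 => k _; rewrite mulr_ge0 ?sqr_ge0.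
exists [set w | forall n, energy n w + c * mass w <= D + 1]; last first.
  move=> t t0 _ [w hw <-] n; apply: le_trans (hV (S ^~ w) n t (sol w) t0) _; rewrite S0 lerD2l.
  have h1 : expR (- t) <= 1 by rewrite -expR0 ler_expR oppr_le0.
  apply: (@le_trans _ _ (expR (- t) * 1)); last by rewrite mulr1.
  by rewrite ler_wpM2l ?expR_ge0// lerBlDl.
split.
  pose K := Num.sqrt (D + 1); have K0 : 0 <= K by exact: sqrtr_ge0.
  have KE : K ^+ 2 = D + 1 by rewrite sqr_sqrtr// addr_ge0.
  exists (2 * m%:R * K); split => [|r hr w /= hw]; first exact: num_real.
  apply: le_trans (ltW hr); apply: H1_le => // l.
    rewrite -ler_sqr ?nnegrE ?nrm_ge0// KE; apply: le_trans (hw 0%N).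
    apply: (@le_trans _ _ (mass w)); last by rewrite -[X in X <= _]add0r; apply: lerD => //; rewrite ler_peMl.
    by rewrite /mass (bigD1 l)//= lerDl sumr_ge0// => j _; exact: sqr_ge0.
  apply: grad2_le => // n; rewrite KE; apply: le_trans (hw n); by rewrite lerDl mulr_ge0.
move=> A [K [_ hA]]; pose r := `|K| + 1.
have hA1 w : A w -> `|w| <= r by apply: hA; rewrite ltr_pwDr// ler_norm.
pose V0 := m%:R * r ^+ 2 + c * (m%:R * r ^+ 2) + 1.
have r2 : 0 <= m%:R * r ^+ 2 by rewrite mulr_ge0 ?sqr_ge0.
have V00 : 0 < V0 by rewrite ltr_wpDl// addr_ge0// mulr_ge0.
have [T T0 hT] := expR_decay (ltrN10 R) (divr_gt0 ltr01 V00).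
exists T => t t0 Tt _ [w Aw <-] n; apply: le_trans (hV (S ^~ w) n t (sol w) t0) _; rewrite S0 lerD2l.
have hr : `|w| ^+ 2 <= r ^+ 2 by rewrite ler_sqr ?nnegrE ?addr_ge0//; exact: hA1.
have mr : m%:R * `|w| ^+ 2 <= m%:R * r ^+ 2 by rewrite ler_wpM2l.
apply: (@le_trans _ _ (expR (- t) * V0)).
  rewrite ler_wpM2l ?expR_ge0// /V0 lerBlDr; apply: (@le_trans _ _ (m%:R * r ^+ 2 + c * (m%:R * r ^+ 2))).
    apply: lerD; first by apply: le_trans (energy_le n w) _; exact: le_trans (grad2_norm w) mr.
    by apply: ler_wpM2l => //; exact: le_trans (mass_le w) mr.
  by rewrite -addrA lerDl addr_ge0.
have := hT t Tt; rewrite mulN1r => h; apply: le_trans (ler_wpM2r (ltW V00) h) _.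
by rewrite divfK// gt_eqF.
Qed.

End Dissipation.

(** * The phase space as a space of functions with Dirichlet conditions *)

Section DirichletModes.
Context {R : realType} {L : {posnum R}} {m : nat}.
Local Notation I := `[0, L%:num]%classic.
Local Notation hd := (has_L2deriv L).
Local Notation ipI := (ip (L := L)).
Local Notation nrmI := (nrm (L := L)).
Local Notation sn := (sn (L := L)).
Local Notation cn := (cn (L := L)).
Local Notation om := (om (L := L)).
Local Notation l2mm := (l2 R (m + m)).
Local Notation bc := (fun _ : 'I_(m + m) => Dirichlet).
Local Notation eigen := (eigenfunction L bc).
Implicit Types (y v e p : l2mm) (j : 'I_(m + m)) (k n : nat) (x lam : R) (w : R -> 'cV[R]_(m + m)).

Lemma nrm0_ae f g : L2fun L f -> L2fun L g -> nrmI (fun x => f x - g x) = 0 -> f = g %[ae mu in I].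
Proof.
move=> hf hg h0; pose u x : 'cV[R]_1 := \col__ (f x - g x).
have uE i : (fun x => u x i 0) = (fun x => f x - g x) by apply/funext => x; rewrite mxE.
have Lu : L2vec L u by move=> i; rewrite uE; exact: L2_sub.
have i0 : ipL2 L u u = 0.
  rewrite /ipL2 big_ord1 -[LHS]/(ipI (fun x => u x ord0 0) (fun x => u x ord0 0)) uE -sqr_nrm h0.
  by rewrite expr0n.
apply: filterS (ipL2_eq0 Lu i0 ord0) => x hx Ix; have := hx Ix; rewrite mxE => /eqP.
by rewrite subr_eq0 => /eqP.
Qed.

Lemma ip_zero f g : (forall x, I x -> f x = 0) -> ipI f g = 0.
Proof.
move=> h; rewrite /ip (int_eq (g := cst 0)); last by move=> x Ix; rewrite h// mul0r.
by rewrite Rintegral_cst ?mul0r//; exact: mI.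
Qed.

Lemma col_ae N (u w : R -> 'cV[R]_N) :
  (forall i, (fun x => u x i 0) = (fun x => w x i 0) %[ae mu in I]) -> u = w %[ae mu in I].
Proof.
move=> h; apply: filterS (filter_forall _ h) => x hx Ix; apply/matrixP => i j.
by rewrite ord1; exact: hx.
Qed.

Lemma ae_col N (u w : R -> 'cV[R]_N) i : u = w %[ae mu in I] ->
  (fun x => u x i 0) = (fun x => w x i 0) %[ae mu in I].
Proof.
by apply: filterS => x hx Ix; rewrite hx.
Qed.

Lemma sine_unique f g : L2fun L f -> L2fun L g -> (forall k, ipI f (sn k.+1) = ipI g (sn k.+1)) ->
  nrmI (fun x => f x - g x) = 0.
Proof.
move=> hf hg h; apply: sine_complete => [|[|k]]; [exact: L2_sub|exact: ip_sn0|].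
by rewrite (ip_subl hf hg (L2_sn k.+1)) h subrr.
Qed.

(* The constant mode sn 0 = 0 is skipped: entry k of the sequence is the coefficient of sn k.+1. *)
Definition sine_coef y j k : R := if k is k'.+1 then y k' j 0 else 0.
Definition dirichlet_fun y x : 'cV[R]_(m + m) := \col_j synth (L := L) (sine_coef y j) x.

Let sq_coef y j : sqbounded (sine_coef y j) `|y|.
Proof.
case=> [|n]; first by rewrite big_ord0 sqr_ge0.
by rewrite big_ord_recl expr0n add0r; exact: sqbounded_entry y j n.
Qed.

Lemma dirichlet_L2 y j : L2fun L (fun x => dirichlet_fun y x j 0) /\
  forall k, ipI (fun x => dirichlet_fun y x j 0) (sn k.+1) = y k j 0.
Proof.
have -> : (fun x => dirichlet_fun y x j 0) = synth (L := L) (sine_coef y j) by apply/funext => x; rewrite mxE.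
have [h1 h2] := synthP (L := L) (normr_ge0 y) (sq_coef y j).
by split => // k; rewrite h2.
Qed.

Let Ld y j : L2fun L (fun x => dirichlet_fun y x j 0). Proof. by have [] := dirichlet_L2 y j. Qed.
Let dE y j k : ipI (fun x => dirichlet_fun y x j 0) (sn k.+1) = y k j 0.
Proof. by have [_] := dirichlet_L2 y j. Qed.

Let coef w y j k : L2vec L w -> dirichlet_fun y = w %[ae mu in I] -> y k j 0 = ipI (fun x => w x j 0) (sn k.+1).
Proof.
move=> Lw h; rewrite -dE; apply: ip_nrm0 => //; apply: ae_nrm0 => //; exact: ae_col.
Qed.

Lemma dirichlet_linear (a : R) u v : dirichlet_fun (a *: u + v) =
  (fun x => a *: dirichlet_fun u x + dirichlet_fun v x) %[ae mu in I].
Proof.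
apply: col_ae => j.
have La := L2_scale a (Ld u j); have Ls := L2_add La (Ld v j).
suff h : (fun x => dirichlet_fun (a *: u + v) x j 0) =
    (fun x => a * dirichlet_fun u x j 0 + dirichlet_fun v x j 0) %[ae mu in I].
  by apply: filterS h => x hx Ix; rewrite /= hx// !mxE.
apply: nrm0_ae => //; apply: sine_unique => // k.
by rewrite (ip_addl La (Ld v j) (@L2_sn _ _ k.+1)) (ip_scalel _ (Ld u j) (@L2_sn _ _ k.+1)) !dE l2E.
Qed.

Lemma dirichlet_inj v : dirichlet_fun v = cst 0 %[ae mu in I] -> v = 0.
Proof.
move=> h; apply: l2P => k j; have L0 : L2vec L (fun=> 0 : 'cV[R]_(m + m)).
  by move=> i; apply: (L2_eq (f := fun=> 0)) => [x _|]; [rewrite mxE|apply: L2_cts; exact: cts_cst].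
by rewrite (coef j k L0 h) l20E ip_zero// => x _; rewrite mxE.
Qed.

Lemma dirichlet_cont : exists C : R, forall v,
  Num.sqrt (ipL2 L (dirichlet_fun v) (dirichlet_fun v)) <= C * `|v|.
Proof.
exists (Num.sqrt (m + m)%:R) => v.
rewrite -[`|v|](ger0_norm (normr_ge0 v)) -sqrtr_sqr -sqrtrM// ler_wsqrtr//.
apply: sum_le_const => j; rewrite -[X in X <= _]/(ipI _ _) -sqr_nrm ler_sqr ?nnegrE ?nrm_ge0//.
by apply: (parseval_coef (c := sine_coef v j)) => // -[//|k] _; exact: dE.
Qed.

Let eigen_cts lam w j : eigen lam w -> continuous (fun x => w x j 0).
Proof.
move=> [h _] x; have [/(_ x) [d _ _] _] := h j.
exact: is_derive_continuous (derivableP d).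
Qed.

Let eigen_L2 lam w : eigen lam w -> L2vec L w.
Proof. by move=> h j; apply: L2_cts; apply: cts_continuous; exact: eigen_cts h. Qed.

Lemma dirichlet_eigen lam w : eigen lam w -> exists v, dirichlet_fun v = w %[ae mu in I].
Proof.
move=> /eigen_L2 Lw.
pose K := \sum_j nrmI (fun x => w x j 0) ^+ 2.
have K0 : 0 <= K by apply: sumr_ge0 => j _; exact: sqr_ge0.
have [|n|v hv _] := @l2_exist R _ (fun k => \col_j ipI (fun x => w x j 0) (sn k.+1)) (Num.sqrt K).
- exact: sqrtr_ge0.
- rewrite sqr_sqrtr// /sqs exchange_big; apply: ler_sum => j _.
  apply: le_trans (bessel n.+1 (Lw j)); rewrite big_ord_recl -[X in X <= _]add0r; apply: lerD; first exact: sqr_ge0.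
  by apply: eqle; apply: eq_bigr => k _; rewrite mxE.
exists v; apply: col_ae => j; apply: nrm0_ae => //; apply: sine_unique => // k.
by rewrite dE hv mxE.
Qed.

(** All 2 m components are read as sine series, also those that carry cosine coefficients of u. This
    only relabels the modes: entry k becomes the mode of eigenvalue om_(k+1) ^ 2, which preserves
    their order, and the spectral projectors become truncations. *)
Definition dirichlet_space : function_space L bc :=
  FunctionSpace (fs_sort := l2mm) (fs_fun := dirichlet_fun) Ld dirichlet_linear dirichlet_inj
    dirichlet_cont dirichlet_eigen.

Let is_derive_c (c d x : R) f : is_derive x 1 f d -> derivable (fun z => c * f z) x 1 /\
  derive1 (fun z => c * f z) x = c * d.
Proof.
by move=> h; have [h1 h2] := is_derive_scale c h; split => //; rewrite derive1E h2.
Qed.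

Let eigen_sn k (a : 'cV[R]_(m + m)) : a != 0 -> eigen (om k.+1 ^+ 2) (fun x => sn k.+1 x *: a).
Proof.
move=> a0; split => [j wi|]; last first.
  have [//|h] := pselect (exists x, x \in `[0, L%:num] /\ sn k.+1 x *: a != 0).
  have z x : I x -> sn k.+1 x = 0.
    move=> Ix; apply/eqP; apply: contra_notT h => s0; exists x; split; first by [].
    by rewrite scaler_eq0 negb_or s0.
  have [_] := norm_cs (L := L) (ltn0Sn k); rewrite ip_zero// => /eqP.
  by rewrite eq_sym oner_eq0.
have we : wi = (fun x => a j 0 * sn k.+1 x) by apply/funext => x; rewrite /wi mxE mulrC.
have d1 : derive1 wi = (fun x => a j 0 * om k.+1 * cn k.+1 x).
  by apply/funext => x; rewrite we; have [_ ->] := is_derive_c (a j 0) (is_derive_sn (L := L) k.+1 x); rewrite mulrA.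
have d2 x := is_derive_c (a j 0 * om k.+1) (is_derive_cn (L := L) k.+1 x).
split => [x|]; last by rewrite we sn00 snL mulr0.
split; first by rewrite we; have [] := is_derive_c (a j 0) (is_derive_sn (L := L) k.+1 x).
  by rewrite d1; have [] := d2 x.
by rewrite d1; have [_ ->] := d2 x; rewrite we; ring.
Qed.

Section Eigenfunction.
Variables (lam : R) (w : R -> 'cV[R]_(m + m)).
Hypothesis hw : eigen lam w.

Let wd j x : is_derive x 1 (fun x => w x j 0) (derive1 (fun x => w x j 0) x).
Proof. by have [/(_ j)[/(_ x)[d _ _] _] _] := hw; apply: DeriveDef => //; rewrite derive1E. Qed.

Let wdd j x : is_derive x 1 (derive1 (fun x => w x j 0)) (- lam * w x j 0).
Proof.
have [/(_ j)[/(_ x)[_ d e] _] _] := hw; apply: DeriveDef => //.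
by rewrite -derive1E mulNr -e opprK.
Qed.

Let hd_w j : hd (fun x => w x j 0) (derive1 (fun x => w x j 0)).
Proof. by apply: hd_C1 => [x|x]; [exact: wd|exact: is_derive_continuous (wdd j x)]. Qed.

Let hd_dw j : hd (derive1 (fun x => w x j 0)) (fun x => - lam * w x j 0).
Proof.
apply: hd_C1 => [x|x]; first exact: wdd.
by apply: (@cvgM _ _ (nbhs x) _ (fun=> - lam) (fun x => w x j 0)); [exact: cvg_cst|exact: is_derive_continuous (wd j x)].
Qed.

Let dw_cn j k : ipI (derive1 (fun x => w x j 0)) (cn k) = om k * ipI (fun x => w x j 0) (sn k).
Proof.
have [/(_ j)[_ [w0 wL]] _] := hw; have Lw := eigen_L2 hw j.
have bd : cn k L%:num * w L%:num j 0 - cn k 0 * w 0 j 0 = 0.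
  have w0' : w 0 j 0 = 0 := w0; have wL' : w L%:num j 0 = 0 := wL.
  by rewrite w0' wL' !mulr0 subrr.
have e := ibp (hd_cn (L := L) k) (hd_w j); rewrite ipC; apply: (etrans e).
rewrite -[X in X - _]/(cn k L%:num * w L%:num j 0 - cn k 0 * w 0 j 0) bd sub0r.
by rewrite (ip_scalel _ (@L2_sn _ _ k) Lw) mulNr opprK ipC.
Qed.

(** Two integrations by parts show that [om k.+1 ^+ 2] and [lam] multiply the coefficient to the
    same value. *)
Lemma eigen_coef j k : ipI (fun x => w x j 0) (sn k.+1) != 0 -> lam = om k.+1 ^+ 2.
Proof.
have Lw := eigen_L2 hw j; move=> h; apply: (mulIf h); rewrite expr2 -mulrA -dw_cn (om_cn k.+1 (hd_dw j)).
by rewrite (ip_scalel _ Lw (L2_sn _)); ring.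
Qed.

(** Some sine coefficient is nonzero: otherwise all cosine coefficients of w' vanish, w' is 0, and w
    is constant, hence 0 by the Dirichlet condition. *)
Lemma eigen_sqr : exists k, lam = om k.+1 ^+ 2.
Proof.
have [_ [x [Ix wx]]] := hw; have {wx}[j wj] : exists j, w x j 0 != 0.
  apply/existsP; apply: contraNT wx; rewrite negb_exists => /forallP h; apply/eqP/matrixP => i j.
  by rewrite ord1 [RHS]mxE; apply/eqP; have := h i; rewrite negbK.
have [[k h]|h] := pselect (exists k, ipI (fun x => w x j 0) (sn k.+1) != 0); first by exists k; exact: eigen_coef h.
have z k : ipI (derive1 (fun x => w x j 0)) (cn k) = 0.
  rewrite dw_cn; case: k => [|k]; first by rewrite om0 mul0r.
  have [->|n0] := eqVneq (ipI (fun x => w x j 0) (sn k.+1)) 0; first by rewrite mulr0.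
  by case: h; exists k.
have c0 : hd (fun x => w x j 0) (fun=> 0).
  by apply: hd_eq (hd_w j) => // z0 Iz; apply: cos_unique Iz => //; exact: hd_cts (hd_dw j).
have [/(_ j)[_ [w0 _]] _] := hw.
by move: wj; rewrite (hd_zero_const c0 Ix) w0 eqxx.
Qed.

End Eigenfunction.

Hypothesis m0 : (0 < m)%N.

Let ones_neq0 : const_mx 1 != 0 :> 'cV[R]_(m + m).
Proof.
have i0 : 'I_(m + m) by exists 0%N; rewrite addn_gt0 m0.
by apply/eqP => /matrixP/(_ i0 0); rewrite !mxE => /eqP; rewrite oner_eq0.
Qed.

Let om_sqr_lt i k : (om i.+1 ^+ 2 < om k.+1 ^+ 2) = (i < k)%N.
Proof.
rewrite ltr_pXn2r ?nnegrE ?om_ge0// /om ltr_pM2r ?invr_gt0// ltr_pM2r ?pi_gt0//.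
by rewrite ltr_nat.
Qed.

Let eigenvalueE lam : eigenvalue_lap L bc lam <-> exists k, lam = om k.+1 ^+ 2.
Proof.
split=> [[w hw]|[k ->]]; first exact: eigen_sqr hw.
by exists (fun x => sn k.+1 x *: const_mx 1); exact: eigen_sn ones_neq0.
Qed.

Let first_eigenvalueE n k : first_eigenvalue L bc n (om k.+1 ^+ 2) <-> (k < n)%N.
Proof.
have e : [set nu | eigenvalue_lap L bc nu /\ nu < om k.+1 ^+ 2] = (fun i => om i.+1 ^+ 2) @` `I_k.
  apply/seteqP; split => [nu [/eigenvalueE[i ->]]|_ [i ik <-]] /=.
    by rewrite om_sqr_lt => ik; exists i.
  by split; [apply/eigenvalueE; exists i|rewrite om_sqr_lt].
have ck : ((fun i => om i.+1 ^+ 2) @` `I_k #= `I_k)%card.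
  have inj : {in `I_k &, injective (fun i => om i.+1 ^+ 2)}.
    move=> i i' _ _ h; have [||//] := ltngtP i i'; rewrite -om_sqr_lt.
      by rewrite h ltxx.
    by rewrite h ltxx.
  exact: (inj_card_eq inj).
split=> [[_ [k' kn]]|kn].
  by rewrite e => h; have /card_eq_II -> := card_eq_trans (card_esym ck) h.
by split; [apply/eigenvalueE; exists k|exists k => //; rewrite e].
Qed.

Lemma low_modesP n v : low_modes (Psi := dirichlet_space) n v <-> forall k j, (n <= k)%N -> v k j 0 = 0.
Proof.
split=> [[r [c [e [he ->]]]] k j nk|h].
  have sE (s : seq 'I_r) : (\sum_(i <- s) c i *: (e i : l2mm)) k j 0 = \sum_(i <- s) c i * (e i : l2mm) k j 0.
    by elim: s => [|i s IH]; rewrite ?big_nil ?l20E// !big_cons l2DE l2ZE IH.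
  rewrite sE big1// => i _; have [lam [w [h1 h2 h3]]] := he i.
  rewrite (coef j k (eigen_L2 h2) h3); have [->|n0] := eqVneq (ipI (fun x => w x j 0) (sn k.+1)) 0.
    by rewrite mulr0.
  by move: h1; rewrite (eigen_coef h2 n0) => /first_eigenvalueE; rewrite ltnNge nk.
(* Eigenfunctions have to be nonzero: where the coefficient vector of mode k vanishes, it is
   replaced by the vector of ones and given weight 0. *)
pose b k : 'cV[R]_(m + m) := if v k == 0 then const_mx 1 else v k.
have b0 k : b k != 0.
  by rewrite /b; case: (eqVneq (v k) 0) => // _; exact: ones_neq0.
have /choice[e he] k := dirichlet_eigen (eigen_sn k (b0 k)).
exists n, (fun k => if v k == 0 then 0 else 1), (fun k => e k : dirichlet_space); split.
  move=> k; exists (om k.+1 ^+ 2), (fun x => sn k.+1 x *: b k); split; last exact: he.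
    exact/first_eigenvalueE.
  exact: eigen_sn.
have eE k i j : e k i j 0 = b k j 0 * (i == k)%:R.
  rewrite (coef j i (eigen_L2 (eigen_sn k (b0 k))) (he k)).
  rewrite (ip_eq (u := fun x => b k j 0 * sn k.+1 x) (v := sn i.+1)); last by move=> x _; congr (_ * _); rewrite mxE mulrC.
  by rewrite (ip_scalel _ (L2_sn _) (L2_sn _)) orthonormal_sn andbT eqSS [(k == i)]eq_sym.
apply: l2P => i j.
have sE (s : seq 'I_n) : (\sum_(k <- s) (if v k == 0 then 0 else 1) *: (e k : l2mm)) i j 0 =
    \sum_(k <- s) v k j 0 * (i == k)%:R.
  elim: s => [|k s IH]; rewrite ?big_nil ?l20E// !big_cons l2DE l2ZE IH eE /b.
  by case: eqP => [->|_]; rewrite ?mul0r ?mxE ?mul0r ?mul1r.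
rewrite sE; have [ni|ni] := leqP n i.
  rewrite h// big1// => k _; rewrite [(_ == _)](_ : _ = false) ?mulr0//.
  by apply/negbTE; rewrite gtn_eqF// (leq_trans (ltn_ord k)).
rewrite (bigD1 (Ordinal ni))//= eqxx mulr1 big1 ?addr0// => k kn.
rewrite [(_ == _)](_ : _ = false) ?mulr0//; apply: contraNF kn => /eqP ik.
by apply/eqP/val_inj.
Qed.

(** Uniqueness of the projection comes from testing against the eigenfunctions with a single nonzero
    component, which read off one entry each. It justifies evaluating the [get] in [Pn]. *)
Lemma PnE n v : Pn (Psi := dirichlet_space) n v = trunc n v.
Proof.
apply: get_subset1; first split.
- by apply/low_modesP => k j nk; rewrite truncE ltnNge nk.
- move=> e /low_modesP he; apply: big1 => j _; rewrite -[LHS]/(ipI _ _).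
  pose c := sine_coef e j.
  have h0 : nrmI (fun x => dirichlet_fun e x j 0 - ssum (L := L) c n.+1 x) = 0.
    apply: sine_unique => [|| k]; [exact: Ld|exact: L2_ssum|].
    rewrite dE ip_ssum_sn ltnS andbT /c; case: (ltnP k n) => kn; first by rewrite mulr1.
    by rewrite he// mulr0.
  rewrite ipC; have -> := ip_nrm0 (Ld e j) (L2_ssum c n.+1) (Ld (v - trunc n v) j) h0.
  rewrite (ip_ssum _ _ (Ld _ j)) big1// => -[[|k] /= kn] _; first exact: mul0r.
  by rewrite ipC dE l2BE truncE ifT ?subrr ?mulr0.
move=> p q [p1 p2] [q1 q2]; have key r : low_modes (Psi := dirichlet_space) n r ->
    (forall e, low_modes (Psi := dirichlet_space) n e -> ipL2 L (dirichlet_fun (v - r)) (dirichlet_fun e) = 0) ->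
    r = trunc n v.
  move=> /low_modesP r1 r2; apply: l2P => k j; rewrite truncE; case: (ltnP k n) => kn; last exact: r1.
  have d0 : delta_mx j 0 != 0 :> 'cV[R]_(m + m).
    by apply/eqP => /matrixP/(_ j 0); rewrite !mxE !eqxx => /eqP; rewrite oner_eq0.
  have [e he] := dirichlet_eigen (eigen_sn k d0).
  have Lw := eigen_L2 (eigen_sn k d0).
  have le : low_modes (Psi := dirichlet_space) n e.
    apply/low_modesP => i l ni; rewrite (coef l i Lw he).
    rewrite (ip_eq (u := fun x => (delta_mx j 0 : 'cV[R]_(m + m)) l 0 * sn k.+1 x) (v := sn i.+1)); last first.
      by move=> x _; congr (_ * _); rewrite mxE mulrC.
    rewrite ip_scalel; [|exact: L2_sn|exact: L2_sn].
    by rewrite orthonormal_sn eqSS ltn_eqF ?mulr0// (leq_trans kn).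
  have := r2 e le; rewrite /ipL2 (bigD1 j)//= big1 ?addr0 => [|l lj]; last first.
    rewrite -[LHS]/(ipI _ _) ipC (ip_nrm0 (Ld e l) (Lw l) (Ld _ l) (ae_nrm0 (Ld e l) (Lw l) (ae_col l he))).
    by rewrite ip_zero// => x _; rewrite !mxE (negPf lj) mulr0.
  rewrite -[X in X = 0]/(ipI _ _) ipC (ip_nrm0 (Ld e j) (Lw j) (Ld _ j) (ae_nrm0 (Ld e j) (Lw j) (ae_col j he))).
  rewrite (ip_eq (u := sn k.+1) (v := fun x => dirichlet_fun (v - r) x j 0)); last first.
    by move=> x _; rewrite !mxE !eqxx mulr1.
  by rewrite ipC dE l2BE => /eqP; rewrite subr_eq0 => /eqP.
by rewrite (key p p1 p2) (key q q1 q2).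
Qed.

End DirichletModes.

(** * The reduced semigroup and its manifold *)

Section ReducedDynamics.
Context {R : realType} {L : {posnum R}} {m : nat}.
Local Notation om := (om (L := L)).
Local Notation l2mm := (l2 R (m + m)).
Local Notation Psi := (dirichlet_space (L := L) (m := m)).
Implicit Types (u v p : l2mm) (i : 'I_(m + m)) (j k : nat) (r t T : R).

(* The same spectral gap serves all the weighted estimates, since |nu_k - th| is
   at most nu_k + th and at most (1 + th) nu_k. *)
Lemma inertial_exists (C : R) (F : l2mm -> nat -> 'I_(m + m) -> R) : (0 < m)%N -> 0 <= C ->
  (forall v j i, `|F v j i| <= C * ow j) ->
  (forall u v j i, `|F u j i - F v j i| <= C * ow j * `|u - v|) ->
  (forall r u v j i, 1 <= r <= 2 ->
    `|F u j i + F v j i - 2 * F (2^-1 *: (u + v)) j i| <= C * ow j * `|u - v| `^ r) ->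
  exists (S : R -> Psi -> Psi) n (M : Psi -> Psi) X r,
    [/\ semigroup S, dissipative S, (0 < n)%N, 1 < r <= 2 & inertial_manifold S n M X] /\
    C1holder (r - 1) setT (M \o Pn n) /\
    forall x, (forall T, fwd (fun k => om k ^+ 2 + 1) F T x) -> forall t, 0 <= t -> x t = S t (x 0).
Proof.
move=> m0 C0 F_bd F_lip F_mid; have k0 : 0 < 8^-1 :> R by rewrite invr_gt0.
have [n [th [th' [r [[n1 th1 th_le r12 rth] [lo hi hk hk']]]]]] := spectral_gap (L := L) (m + m) C k0.
pose nu k := om k ^+ 2 + 1; pose l k := C * ow k : R.
have th0 : 0 < th by exact: lt_trans th1.
have mu1 k : 1 <= nu k by rewrite /nu lerDr sqr_ge0.
have mp k : 0 < nu k by exact: lt_le_trans (mu1 k).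
have l0 k : 0 <= l k by rewrite mulr_ge0// ltW// ow_gt0.
have mu_th k : 0 < `|nu k - th|.
  rewrite normr_gt0 subr_eq0; have [kn|nk] := ltnP k n; first by rewrite lt_eqF// lo.
  by rewrite gt_eqF// (le_lt_trans th_le)// hi.
have wsum_le (b : nat -> R) K : (forall k, 0 <= b k <= K * (l k / `|nu k - th|)) -> wsum (m + m) b (K * 8^-1).
  move=> hb p; rewrite exprMn; apply: le_trans (ler_wpM2l (sqr_ge0 K) (hk p)); rewrite mulr_sumr.
  apply: ler_sum => k _; rewrite [X in _ <= X]mulrCA ler_wpM2l// -exprMn; have /andP[b0 bK] := hb k.
  by rewrite ler_sqr ?nnegrE// (le_trans b0).
have hk0 : wsum (m + m) (fun k => l k / `|- nu k - th|) 2^-1.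
  have -> : 2^-1 = 4 * 8^-1 :> R by field.
  apply: (wsum_le) => k; rewrite divr_ge0//=; have p0 : 0 <= l k / `|nu k - th| by rewrite divr_ge0.
  apply: (@le_trans _ _ (l k / `|nu k - th|)); last by rewrite ler_peMl// ler1n.
  rewrite -opprD normrN (gtr0_norm (addr_gt0 (mp k) th0)) ler_wpM2l// lef_pV2 ?posrE ?(addr_gt0 (mp k) th0)//.
  by apply: le_trans (ler_normB _ _) _; rewrite (gtr0_norm (mp k)) (gtr0_norm th0).
have hD : wsum (m + m) (fun k => l k / nu k) ((1 + th) * 8^-1).
  apply: (wsum_le _ (1 + th)) => i; rewrite divr_ge0 ?(ltW (mp i))//= mulrCA ler_wpM2l// ler_pdivlMr// ler_pdivrMl//.
  apply: le_trans (ler_normB _ _) _; rewrite (gtr0_norm (mp i)) (gtr0_norm th0) mulrC mulrDl mul1r lerD2l.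
  by rewrite ler_peMr// ltW.
have D0 : 0 <= (1 + th) * 8^-1 by rewrite mulr_ge0 ?addr_ge0 ?ltW.
have [S [Sc S0 Sf]] := flow_exist mu1 l0 F_bd F_lip th0 hk0.
have /choice[X hX] := bwd_exist l0 F_bd F_lip th0 th_le lo hi (ltW k0) (lexx _) hk.
have Xg p : bgrow th (X p) by have [] := hX p.
have Xb p T : bwd nu F T (X p) by have [_ + _] := hX p; exact.
have Xl p j i : (j < n)%N -> X p 0 j i 0 = p j i 0 by have [_ _] := hX p; exact.
have PE : Pn (Psi := Psi) n = trunc n by apply/funext => v; exact: PnE.
pose M := graph_map n X.
have inv t (t0 : 0 <= t) := bset_flow mu1 l0 F_bd F_lip th0 hk0 S0 Sf th0 th_le lo hi (ltW k0) (lexx _) hk Xg Xb Xl t0.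
exists S, n, M, (bset nu F th), r; split; last split.
- split => //.
  + exact (flow_semigroup mu1 l0 F_bd F_lip th0 hk0 Sc S0 Sf).
  + exact (flow_dissipative mu1 F_bd S0 Sf D0 hD).
  + exact: ltn_trans n1.
  split.
  + by move=> t t0; exact: inv.
  + move=> p _; exists (M p) => //; rewrite /Qn PE.
    by rewrite (graph_map_low Xl) subr0.
  + exists 4^-1; split => [|K hK [p q] _ /=]; first exact: num_real.
    apply: le_trans (graph_map_lip l0 F_lip th_le lo hi (ltW k0) (lexx _) hk Xg Xb Xl p q) _.
    by rewrite ler_wpM2r// ltW.
  + by rewrite PE; exact: (bsetE l0 F_lip th_le lo hi (ltW k0) (lexx _) hk Xg Xb Xl).
  + exists 2, th; split => // v.
    have [w [w1 w2]] := bset_tracking mu1 l0 F_bd F_lip th0 hk0 Sc S0 Sf th_le lo hi (ltW k0) (lexx _) hk Xg Xb Xl v.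
    exists w; split => // t t0.
    by rewrite -(inv t t0); exists w.
- have -> : M \o Pn (Psi := Psi) n = M.
    by apply/funext => v /=; rewrite PE; exact: (graph_map_trunc l0 F_lip th_le lo hi (ltW k0) (lexx _) hk Xg Xb Xl v).
  have /andP[r1 r2] := r12; pose K : R := (1 - 8^-1)^-1 `^ r.
  have K0 : 0 <= K := powR_ge0 _ _.
  apply: (@zygmund_C1holder R l2mm l2mm M r (fun=> 4^-1 + K)) => // [_|_ a b _ _|_ a b _ _].
  + by rewrite addr_ge0.
  + apply: le_trans (graph_map_lip l0 F_lip th_le lo hi (ltW k0) (lexx _) hk Xg Xb Xl a b) _.
    by rewrite ler_wpM2r// lerDl.
  + have r0 : 0 <= r by rewrite ltW// (lt_trans ltr01).
    have r12' : 1 <= r <= 2 by rewrite ltW.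
    have h := graph_map_mid l0 F_lip th_le lo hi (ltW k0) (lexx _) hk hk' Xg Xb Xl r0 rth
      (fun u v j i => F_mid r u v j i r12') a b.
    by apply: le_trans h _; rewrite ler_wpM2r ?powR_ge0// lerDr.
- by move=> x hx t t0; exact: (flow_unique mu1 l0 F_bd F_lip th0 hk0 S0 Sf (hx 0) t0).
Qed.

(** Constants are given ball by ball; summing those of integer radii yields a nondecreasing function
    of the radius. The factor [1 + 2 * Num.max 0 x] lowers the exponent from 2 to r, as |a - b| <= 2
    x on the ball of radius x. *)
Lemma locally_mid_C1holder (V : normedModType R) (W : completeNormedModType R) (E : V -> W) r A : 1 < r <= 2 ->
  (forall B, 0 <= B -> exists2 K : R, 0 <= K & forall a b, `|a| <= B -> `|b| <= B ->
    `|E a - E b| <= K * `|a - b| /\ `|E a + E b - 2 *: E (2^-1 *: (a + b))| <= K * `|a - b| ^+ 2) ->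
  C1holder (r - 1) A E.
Proof.
move=> /andP[r1 r2] hE; pose P K a b := `|E a - E b| <= K * `|a - b| /\ `|E a + E b - 2 *: E (2^-1 *: (a + b))| <= K * `|a - b| ^+ 2.
have /choice[c hc] (k : nat) : exists K : R, 0 <= K /\ forall a b, `|a| <= k%:R -> `|b| <= k%:R -> P K a b.
  by have [K K0 h] := hE k%:R (ler0n _ _); exists K.
have c0 k : 0 <= c k by have [] := hc k.
pose s (x : R) : R := \sum_(k < (Num.truncn x).+2) c k.
have s0 x : 0 <= s x by exact: sumr_ge0.
have s_mono x y : x <= y -> s x <= s y.
  move=> xy; rewrite /s -(subnKC (_ : (Num.truncn x).+2 <= (Num.truncn y).+2)%N); last by rewrite !ltnS le_truncn.
  by rewrite big_split_ord /= lerDl sumr_ge0.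
have m0 (x : R) : 0 <= Num.max 0 x by rewrite le_max lexx.
have key x a b : `|a| <= x -> `|b| <= x -> P (s x) a b.
  move=> ax bx; have xk : x <= (Num.truncn x).+1%:R by rewrite ltW// truncnS_gt.
  have [_ /(_ a b (le_trans ax xk) (le_trans bx xk)) [h1 h2]] := hc (Num.truncn x).+1.
  have cs : c (Num.truncn x).+1 <= s x by rewrite /s big_ord_recr /= lerDr sumr_ge0.
  split; first by apply: le_trans h1 _; rewrite ler_wpM2r.
  by apply: le_trans h2 _; rewrite ler_wpM2r// exprn_ge0.
apply: (@zygmund_C1holder R V W E r (fun x => s x * (1 + 2 * Num.max 0 x))) => // [x|x y xy|x a b ax bx|x a b ax bx].
- by rewrite mulr_ge0// addr_ge0// mulr_ge0.
- apply: ler_pM => //; [by rewrite addr_ge0// mulr_ge0|exact: s_mono|].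
  by rewrite lerD2l ler_wpM2l// le_max2.
- have [h _] := key x a b ax bx; apply: le_trans h _; rewrite ler_wpM2r//.
  by rewrite ler_peMr// lerDl mulr_ge0.
have [_ h] := key x a b ax bx; apply: le_trans h _; rewrite -mulrA ler_wpM2l//.
have x0 : 0 <= x := le_trans (normr_ge0 a) ax.
have d2 : `|a - b| <= 2 * x by apply: le_trans (ler_normB _ _) _; have := lerD ax bx; lra.
rewrite (max_r x0); have p0 := powR_ge0 `|a - b| r; have d0 := normr_ge0 (a - b).
have [d1|d1] := leP `|a - b| 1.
  apply: (@le_trans _ _ (`|a - b| `^ r)); last by rewrite ler_peMl// lerDl mulr_ge0.
  have [->|dn] := eqVneq `|a - b| 0; first by rewrite expr0n powR_ge0.
  by rewrite -powR_mulrn// ger_powR// lt0r dn d0 d1.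
rewrite expr2; apply: ler_pM => //; first by rewrite ler_wpDl.
by rewrite -[X in X <= _]powRr1// ler_powR// ltW.
Qed.

End ReducedDynamics.

(** * Assembly of the generalized inertial manifold *)

Theorem theorem5p2 (R : realType) (L : {posnum R}) (m : nat)
    (f : 'cV[R]_m -> 'M[R]_m) (g : 'cV[R]_m -> 'cV[R]_m)
    (S : R -> H1 L m -> H1 L m) :
  (0 < m)%N ->
  Cinfty0 f -> Cinfty0 g ->
  solution_semigroup f g S ->
  exists (G : gen_inertial_manifold S) (eps : R),
    0 < eps /\ C1holder_gim G eps.
Proof.
move=> m0 cf cg [[S0 _ _ _] sol].
have [Df hDf [B hB]] := Cinfty0_tame cf; have [Dg' hDg _] := Cinfty0_tame cg.
pose Dg (i : 'I_m) := Dg' i 0.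
have tDf i j : tame (Df i j) by have [] := hDf i j.
have tDg i : tame (Dg i) by have [] := hDg i 0.
have fE : f = fmat Df [::] by apply/funext => a; apply/matrixP => i j; rewrite mxE (hDf i j).2.
have gE : g = gvec Dg.
  by apply/funext => a; apply/matrixP => i j; rewrite ord1 mxE /Dg (hDg i 0).2.
rewrite fE gE in sol; rewrite fE in hB.
have Sid u : S 0 u = u by rewrite S0.
have [A absA invA] := absorbing_exists tDf tDg hB sol Sid.
have [E hE] := emap_exists (L := L) tDf.
have [B0 B00 hB0] : exists2 B0 : R, 0 <= B0 & forall u, A u -> `|u| <= B0.
  have [[K [_ hK]] _] := absA; exists (`|K| + 1) => // u; apply: hK.
  by rewrite ltr_pwDr// ler_norm.
have [C1 C10 hC1] := E_lip_mid tDf hE B00; have [C2 C20 hC2] := E_low tDf hE B00.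
(* Bounds E on the absorbing set by its Lipschitz constant on the ball of radius B0; the added 1
   makes R0 positive. *)
pose R0 := `|E 0| + C1 * B0 + 1; have R00 : 0 < R0 by rewrite ltr_wpDl// addr_ge0 ?mulr_ge0.
have ER0 u : A u -> `|E u| <= R0.
  move=> /hB0 uB; have [|h _] := hC1 u 0 uB; first by rewrite normr0.
  rewrite -(subrK (E 0) (E u)); apply: le_trans (ler_normD _ _) _.
  rewrite addrC /R0 -addrA lerD2l; apply: le_trans h _; rewrite subr0.
  by rewrite -[X in X <= _]addr0 lerD// ler_wpM2l.
have B20 : 0 <= 2 * R0 + 2 by rewrite addr_ge0// mulr_ge0// ltW.
have [C C0 [c1 c2 c3]] := cut_props R00 (gfield_unif (L := L) tDf tDg B20).
have ow0 k : 0 <= ow k :> R by rewrite ltW// ow_gt0.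
pose F (y : l2 R (m + m)) k j := ow k * cut (gfield (L := L) Df Dg) R0 y (k, j).
have F1 v j i : `|F v j i| <= C * ow j.
  by rewrite normrM (ger0_norm (ow0 j)) mulrC ler_wpM2r.
have F2 u v j i : `|F u j i - F v j i| <= C * ow j * `|u - v|.
  by rewrite -mulrBr normrM (ger0_norm (ow0 j)) mulrC mulrAC ler_wpM2r.
have F3 r u v j i : 1 <= r <= 2 ->
    `|F u j i + F v j i - 2 * F (2^-1 *: (u + v)) j i| <= C * ow j * `|u - v| `^ r.
  move=> r12; rewrite /F [2 * _]mulrCA -mulrDr -mulrBr normrM (ger0_norm (ow0 j)) mulrC mulrAC.
  by rewrite ler_wpM2r// c3.
have [S' [n [M [X [r [[sg ds n0 r12 im] [Mh un]]]]]]] := inertial_exists (L := L) m0 C0 F1 F2 F3.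
have bil : bilipschitz_on A E.
  exists (C2 + 1)^-1, (C1 + 1); have p2 : 0 < C2 + 1 by rewrite ltr_wpDl.
  split; [by rewrite invr_gt0|by rewrite ltr_wpDl|move=> x y /hB0 xB /hB0 yB].
  have [h1 _] := hC1 x y xB yB; have h2 := hC2 x y xB yB; apply/andP; split.
    by rewrite mulrC ler_pdivrMr// mulrC; apply: le_trans h2 _; rewrite ler_wpM2r// lerDl.
  by apply: le_trans h1 _; rewrite ler_wpM2r// lerDl.
(* Invariance of A keeps the whole orbit in the ball of radius R0, where the cut field is the true
   one; uniqueness of the reduced flow then identifies the two orbits. *)
have conj t u : 0 <= t -> A u -> S' t (E u) = E (S t u).
  move=> t0 Au; have uR t1 : 0 <= t1 -> `|E (S t1 u)| <= R0.
    by move=> t10; apply: ER0; apply: (invA t1 t10); exists u.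
  have := un _ (E_fwd tDf tDg (sol u) hE R00 uR) t t0.
  by rewrite maxxx (max_r t0) S0.
have mm0 : (0 < m + m)%N by rewrite addn_gt0 m0.
exists (GenInertialManifold absA invA mm0 sg ds bil conj n0 im), (r - 1); split.
  by rewrite subr_gt0; case/andP: r12.
split; first exact: Mh.
(* E is defined on all of [H1] and its estimates hold on every ball, so the open neighbourhood may
   be the whole space. *)
exists setT; split => //; first exact: openT.
by apply: locally_mid_C1holder r12 _ => B1 B10; exact (E_lip_mid tDf hE B10).
Qed.
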